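(* Let $c\in(0,1)$ and let $\bar P_c$, $\underline P_c$ be the two particular solutions of $( ** )$ described in the context. Assume that $u$ is a convex function satisfying $$\det D^2u=c\ \text{ in }Q,\qquad u(x)=\tfrac{|x|^2}{2}\ \text{ on }\partial Q\qquad ( ** )$$ (the condition $u\ge0$ is not assumed). Then either $u=P_c^+$, or $u=P_c^-$, or $$u(x)=\lambda^2\,\bar P_c\!\left(\frac x\lambda\right),\qquad\text{or}\qquad u(x)=\lambda^2\,\underline P_c\!\left(\frac x\lambda\right),$$ for some $\lambda\in(0,\infty)$.
   Context: $Q=\{x\in\mathbb{R}^2:x_1,x_2>0\}$. $P_c^{\pm}(x)=\frac12x_1^2+\frac12x_2^2\pm\sqrt{1-c}\,x_1x_2$. Solutions are convex functions continuous on $\overline Q$, with the equation understood in the Alexandrov sense. $\bar P_c$ and $\underline P_c$ are two convex solutions of $\det D^2 u=c$ in $Q$, $u=|x|^2/2$ on $\partial Q$, such that $\underline P_c<P_c^-<\bar P_c<P_c^+$ in $Q$, $\bar P_c(1,1)=1$, $\underline P_c(1,1)=0$; moreover $\bar P_c$ is pointwise $C^{2,\alpha}$ at the origin for some $\alpha=\alpha(c)\in(0,1)$ (i.e. $\bar P_c=P+O(|x|^{2+\alpha})$ near $0$ in $Q$ for some quadratic polynomial $P$), and $\underline P_c$ has a conical singularity at the origin (i.e. $\|D^2\underline P_c(x)\|\to\infty$ as $x\to0$). Such solutions exist for every $c\in(0,1)$. *)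

(* Defs.v *)
From HB Require Import structures.
From mathcomp Require Import all_boot all_order all_algebra.
From mathcomp Require Import all_classical all_reals all_analysis.

Set Implicit Arguments.
Unset Strict Implicit.
Unset Printing Implicit Defensive.

Import Order.TTheory GRing.Theory Num.Theory.
Import numFieldNormedType.Exports.

Local Open Scope classical_set_scope.
Local Open Scope ring_scope.

Section Defs.
Context {R : realType}.
Implicit Types (D E : set (R * R)) (u : R * R -> R) (x : R * R) (c : R).

Definition quadrant : set (R * R) := [set x | 0 < x.1 /\ 0 < x.2].

(* The norm of the normed module [R * R] is the maximum norm. *)
Definition euclid_norm x : R := Num.sqrt (x.1 ^+ 2 + x.2 ^+ 2).

Definition P_plus c x : R :=
  x.1 ^+ 2 / 2 + x.2 ^+ 2 / 2 + Num.sqrt (1 - c) * (x.1 * x.2).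

Definition P_minus c x : R :=
  x.1 ^+ 2 / 2 + x.2 ^+ 2 / 2 - Num.sqrt (1 - c) * (x.1 * x.2).

Definition subdifferential D u x : set (R * R) :=
  [set p | forall y, D y ->
     u x + p.1 * (y.1 - x.1) + p.2 * (y.2 - x.2) <= u y].

Definition normal_image D u E : set (R * R) :=
  \bigcup_(x in E) subdifferential D u x.

(* Lebesgue measure of the plane.  The product measure is only meaningful on
   Borel sets, whereas the normal image of a Borel set is merely Lebesgue
   measurable in general; the outer measure generated by the product measure
   coincides with the Lebesgue measure on all Lebesgue measurable sets. *)
Definition lebesgue2 :
    set (measurableTypeR R * measurableTypeR R) -> \bar R :=
  mu_ext (@lebesgue_measure R \x @lebesgue_measure R)%E.

Definition monge_ampere_alexandrov D c u : Prop :=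
  forall E : set (measurableTypeR R * measurableTypeR R),
    measurable E -> E `<=` D ->
    lebesgue2 (normal_image D u E) = (c%:E * lebesgue2 E)%E.

Record convex_solution c u : Prop := ConvexSolution {
  sol_convex : convex_function (closure quadrant) u ;
  sol_continuous : {within closure quadrant, continuous u} ;
  sol_equation : monge_ampere_alexandrov quadrant c u ;
  sol_boundary : forall x, (closure quadrant `\` interior quadrant) x ->
    u x = euclid_norm x ^+ 2 / 2
}.

Definition quadratic (a b1 b2 h11 h12 h22 : R) x : R :=
  a + b1 * x.1 + b2 * x.2
  + h11 * x.1 ^+ 2 + h12 * (x.1 * x.2) + h22 * x.2 ^+ 2.

Definition pointwise_C2_at_0 u (alpha : R) : Prop :=
  exists a b1 b2 h11 h12 h22 C r : R, 0 < r /\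
    forall x, quadrant x -> euclid_norm x < r ->
      `|u x - quadratic a b1 b2 h11 h12 h22 x|
        <= C * euclid_norm x `^ (2 + alpha).

Definition basis_vec (i : 'I_2) : R * R :=
  ((i == ord0)%:R, (i == ord_max)%:R).

Definition hessian u x : 'M[R]_2 :=
  \matrix_(i, j) 'D_(basis_vec i) ('D_(basis_vec j) u) x.

(* ['D_v f] is a total operator, so that [hessian u x] is only the second
   derivative of [u] at [x] under this condition. *)
Definition twice_differentiable u x : Prop :=
  (\forall y \near x, differentiable u y) /\
  forall j, differentiable ('D_(basis_vec j) u) x.

Definition conical_at_0 u : Prop :=
  (\forall x \near within quadrant (nbhs (0 : R * R)),
     twice_differentiable u x) /\
  (`|hessian u x| @[x --> within quadrant (nbhs (0 : R * R))] --> +oo).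

Record is_P_bar c u : Prop := IsPBar {
  P_bar_sol : convex_solution c u ;
  P_bar_between : forall x, quadrant x -> P_minus c x < u x < P_plus c x ;
  P_bar_normalized : u (1, 1) = 1 ;
  P_bar_C2 : exists alpha, 0 < alpha < 1 /\ pointwise_C2_at_0 u alpha
}.

Record is_P_underline c u : Prop := IsPUnderline {
  P_underline_sol : convex_solution c u ;
  P_underline_below : forall x, quadrant x -> u x < P_minus c x ;
  P_underline_normalized : u (1, 1) = 0 ;
  P_underline_conical : conical_at_0 u
}.

End Defs.

(* Main.v *)
Require Import Defs.
From HB Require Import structures.
From mathcomp Require Import all_boot all_order all_algebra.
From mathcomp Require Import all_classical all_reals all_analysis.
From mathcomp Require Import measurable_realfun ring lra.
Set Implicit Arguments.
Unset Strict Implicit.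
Unset Printing Implicit Defensive.
Import Order.TTheory GRing.Theory Num.Theory.
Import numFieldNormedType.Exports.
Local Open Scope classical_set_scope.
Local Open Scope ring_scope.

(* The partial Legendre transform f(q, y) = sup_x (sqrt c q x - u(x, y)) turns det D^2 u = c into
   Delta f = 0, and g = f + y^2/2 into a nonnegative solution of an obstacle-type problem in the
   upper half plane whose boundary values on {y = 0} do not depend on u; larger g means smaller u.
   For two solutions the positive and negative parts of g1 - g2 are subharmonic with disjoint
   supports in the half plane, and grow at most quadratically.  The Alt-Caffarelli-Friedman type
   monotonicity in log-polar coordinates forces exactly quadratic growth of both, but
   g <= y^2/2 + O(1 + y) for q << 0 keeps their supports essentially away from the angle pi, which
   makes the monotonicity strict: a contradiction.  Hence any two solutions are ordered.

   The infimum or supremum of the rescalings l^2 g(. / l) of one solution is therefore the limit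
   of a chain, so it is again a solution, now homogeneous of degree two, and an explicit
   computation shows that it comes from P^+ or P^-.  Comparing u with all the rescalings of
   Pbar, either one of them equals u (by connectedness of the scales), or all lie below u, which
   gives u = P^+, or all lie above u, so u <= P^-; in this last case the same comparison with the
   rescalings of Punder leaves only u = P^- and the rescalings of Punder. *)

(** * Continuity, derivatives and integrals on the line *)

(** The Alexandrov equation only compares areas. In the mixed variables (q, y) both areas become
    integrals along the sides of a rectangle: x = f_q / sqrt c measures the set of points and - f_y
    its normal image, and the factor sqrt c in the transform gives both integrals the same weight.
    So the sign of Delta f is read off rectangles, with no differentiability of u. Equality can fail
    only where the maximiser is x = 0, on the boundary of the quadrant, and there g = 0.

    Two disjoint arcs of a half circle have total length at most pi, which makes the product of the
    two energies grow like r^8. This is exactly the largest rate that quadratic growth permits, so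
    growth alone gives no contradiction. Removing an angle th near pi raises the rate by an amount
    linear in th, while g is there of size th^2 r^2 at large r, and discarding it costs only order
    th^2: a small th wins.

    All functions are merely continuous. On each bounded range of radii they are replaced by
    averages at a scale depending on that range, with constants independent of it. *)

Section ContinuousOperations.
Context {R : realType} {T : topologicalType}.
Implicit Types f g : T -> R.

Lemma contC (k : R) : continuous (fun _ : T => k).
Proof. by move=> x; exact: cvg_cst. Qed.

Lemma contD f g : continuous f -> continuous g -> continuous (fun x => f x + g x).
Proof. by move=> cf cg x; apply: cvgD; [exact: cf|exact: cg]. Qed.

Lemma contN f : continuous f -> continuous (fun x => - f x).
Proof. by move=> cf x; apply: cvgN; exact: cf. Qed.

Lemma contB f g : continuous f -> continuous g -> continuous (fun x => f x - g x).
Proof. by move=> cf cg; apply: contD => //; exact: contN. Qed.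

Lemma contM f g : continuous f -> continuous g -> continuous (fun x => f x * g x).
Proof. by move=> cf cg x; apply: cvgM; [exact: cf|exact: cg]. Qed.

Lemma contX f n : continuous f -> continuous (fun x => f x ^+ n).
Proof.
move=> cf; elim: n => [|n IH]; first exact: contC.
rewrite [X in continuous X](_ : _ = fun x => f x * f x ^+ n); first exact: contM.
by apply/funext => x; rewrite exprS.
Qed.

Lemma contV f : continuous f -> (forall x, f x != 0) -> continuous (fun x => (f x)^-1).
Proof. by move=> cf f0 x; apply: cvgV; [exact: f0|exact: cf]. Qed.

Lemma cont1 (h : R -> R) f : continuous h -> continuous f -> continuous (fun x => h (f x)).
Proof. by move=> ch cf x; apply: continuous_comp; [exact: cf|exact: ch]. Qed.

Lemma cont2 (h : R * R -> R) f g : continuous h -> continuous f -> continuous g ->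
  continuous (fun x => h (f x, g x)).
Proof.
move=> ch cf cg x.
have ch' : h (z.1, z.2) @[z --> (f x, g x)] --> h (f x, g x).
  by rewrite (_ : (fun z => _) = h); [exact: ch|apply/funext => -[]].
exact: (@continuous2_cvg T R R R (nbhs x) _ f g (fun a b => h (a, b)) _ _ ch' (cf x) (cg x)).
Qed.

End ContinuousOperations.

Section ContinuousBase.
Context {R : realType}.

Lemma contI : continuous (fun x : R => x).
Proof. by move=> x; exact: cvg_id. Qed.

Lemma contF : continuous (fun z : R * R => z.1).
Proof. by move=> x; exact: cvg_fst. Qed.

Lemma contS : continuous (fun z : R * R => z.2).
Proof. by move=> x; exact: cvg_snd. Qed.

End ContinuousBase.

Section Calculus1.
Context {R : realType}.
Implicit Types (f df : R -> R) (F : R * R -> R).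

Lemma cont1P f : continuous f <->
  forall x e, 0 < e -> exists2 d, 0 < d & forall y, `|y - x| < d -> `|f y - f x| < e.
Proof.
split=> [cf x e e0|H x].
  have /cvgrPdist_lt /(_ _ e0) := cf x.
  move=> /nbhs_ballP[d /= d0 Hd]; exists d => // y yx.
  by rewrite distrC; apply: Hd; rewrite /ball /= distrC.
apply/cvgrPdist_lt => e e0; have [d d0 Hd] := H x e e0.
apply: (filterS _ (nbhsx_ballx x d d0)) => y; rewrite /ball /= distrC => yx.
by rewrite distrC; exact: Hd.
Qed.

Lemma cont2P F : continuous F <->
  forall z e, 0 < e -> exists2 d, 0 < d & forall y : R * R,
    `|y.1 - z.1| < d -> `|y.2 - z.2| < d -> `|F y - F z| < e.
Proof.
split=> [cf x e e0|H x].
  have /cvgrPdist_lt /(_ _ e0) := cf x.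
  move=> /nbhs_ballP[d /= d0 Hd]; exists d => // y y1 y2.
  by rewrite distrC; apply: Hd; split; rewrite /ball /= distrC.
apply/cvgrPdist_lt => e e0; have [d d0 Hd] := H x e e0.
apply: (filterS _ (nbhsx_ballx x d d0)) => y [] /=; rewrite /ball /= => y1 y2.
by rewrite distrC; apply: Hd; rewrite distrC.
Qed.

(** Compactness in its near-covering form, with the filter of small positive radii. Only [z] is
    confined to the square, so that [y] may be a translate of [z] leaving it. *)
Lemma unif2 F (M e : R) : continuous F -> 0 < e ->
  exists2 d, 0 < d & forall z y : R * R, `|z.1| <= M -> `|z.2| <= M ->
    `|y.1 - z.1| < d -> `|y.2 - z.2| < d -> `|F y - F z| < e.
Proof.
move=> cF e0.
have cK : compact (`[- M, M]%classic `*` `[- M, M]%classic : set (R * R)).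
  by apply: compact_setX; exact: segment_compact.
pose P (i : R) (z : R * R) := forall y : R * R,
  `|y.1 - z.1| < i -> `|y.2 - z.2| < i -> `|F y - F z| < e.
have := (compact_near_coveringP _).1 cK _ (at_right (0 : R)) P _.
have H : forall x : R * R, (`[- M, M]%classic `*` `[- M, M]%classic) x ->
    \forall x' \near x & i \near (0 : R)^'+, P i x'.
  move=> x _; have e20 : 0 < e / 2 by rewrite divr_gt0.
  have [d d0 Hd] := (cont2P F).1 cF x _ e20.
  have d20 : 0 < d / 2 by rewrite divr_gt0.
  exists (ball x (d / 2), [set i | 0 < i < d / 2]) => /=.
    split; first exact: nbhsx_ballx.
    exists (d / 2) => //= i; rewrite /ball /= sub0r normrN => id2 i0.
    by rewrite i0 /= (le_lt_trans (ler_norm _) id2).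
  move=> [z i] /= [[z1 z2] /andP[i0 id2]] y y1 y2.
  rewrite /ball /= in z1 z2; rewrite distrC in z1; rewrite distrC in z2.
  have Hz : `|F z - F x| < e / 2.
    by apply: Hd; lra.
  have Hy : `|F y - F x| < e / 2.
    apply: Hd.
      rewrite (le_lt_trans (ler_distD z.1 _ _))//; lra.
    rewrite (le_lt_trans (ler_distD z.2 _ _))//; lra.
  rewrite (le_lt_trans (ler_distD (F x) _ _))// (distrC (F x)); lra.
move=> /(_ _ H) [d /= d0 Hd].
exists (d / 2); first by rewrite divr_gt0.
move=> z y z1 z2; apply: (Hd (d / 2)).
- rewrite /ball /= sub0r normrN gtr0_norm ?divr_gt0//.
  by rewrite ltr_pdivrMr// ltr_pMr// ltr1n.
- by rewrite divr_gt0.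
- by split => /=; rewrite in_itv /= -ler_norml.
Qed.

Lemma bound2 F (M : R) : continuous F ->
  exists B, forall z : R * R, `|z.1| <= M -> `|z.2| <= M -> `|F z| <= B.
Proof.
move=> cF.
have cK : compact (`[- M, M]%classic `*` `[- M, M]%classic : set (R * R)).
  by apply: compact_setX; exact: segment_compact.
have cN : {within (`[- M, M]%classic `*` `[- M, M]%classic : set (R * R)), continuous F}.
  by apply: continuous_subspaceT.
have /compact_bounded := continuous_compact cN cK.
move=> [B [_ HB]]; exists (B + 1) => z z1 z2.
apply: (HB (B + 1)); first by rewrite ltrDl.
by exists z => //; split => /=; rewrite in_itv /= -ler_norml.
Qed.

Lemma is_deriveP f x l :
  (forall e, 0 < e -> exists2 d, 0 < d & forall h, `|h| < d ->
      `|f (x + h) - f x - h * l| <= e * `|h|) ->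
  is_derive x (1 : R) f l.
Proof.
move=> H.
have cv : (fun h : R => h^-1 *: (f (h *: (1:R) + x) - f x)) @ (0 : R)^' --> l.
  apply/cvgrPdist_le => e e0; have [d d0 Hd] := H e e0.
  exists d => //= h; rewrite /ball /= sub0r normrN => hd h0.
  have := Hd h hd; rewrite {1}[x + h]addrC => Hh.
  rewrite /GRing.scale /= mulr1 distrC.
  have -> : h^-1 * (f (h + x) - f x) - l = h^-1 * (f (h + x) - f x - h * l).
    by rewrite [RHS]mulrBr mulKf.
  by rewrite normrM normfV ler_pdivrMl ?normr_gt0// [_ * e]mulrC.
apply: DeriveDef; first by apply/cvg_ex; exists l.
exact/cvg_lim.
Qed.

Lemma is_derive_bound f x l : is_derive x (1 : R) f l -> forall e, 0 < e ->
  exists2 d, 0 < d & forall h, `|h| < d -> `|f (x + h) - f x - h * l| <= e * `|h|.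
Proof.
move=> [Hex Hl] e e0.
have /cvgrPdist_le /(_ e e0) : (fun h : R => h^-1 *: (f (h *: (1:R) + x) - f x)) @ (0 : R)^' --> l.
  by rewrite -Hl; exact: Hex.
move=> [d /= d0 Hd]; exists d => // h hd.
have [->|h0] := eqVneq h 0; first by rewrite addr0 subrr mul0r subr0 normr0 mulr0.
have := Hd h; rewrite /ball /= sub0r normrN => /(_ hd h0).
rewrite /GRing.scale /= mulr1 distrC => Hh.
have -> : f (x + h) - f x - h * l = h * (h^-1 * (f (h + x) - f x) - l).
  by rewrite [RHS]mulrBr mulVKf// [x + h]addrC.
by rewrite normrM mulrC ler_wpM2r.
Qed.

Lemma is_derive_cont f x l : is_derive x (1 : R) f l -> {for x, continuous f}.
Proof.
by move=> [Hex _]; apply: differentiable_continuous; apply/derivable1_diffP.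
Qed.

Lemma derive_continuous f df : (forall x, is_derive x (1 : R) f (df x)) -> continuous f.
Proof. by move=> H x; apply: is_derive_cont (H x). Qed.

Lemma mvt f df (a b : R) : a <= b ->
  (forall x, a <= x <= b -> is_derive x (1 : R) f (df x)) ->
  exists2 c, a <= c <= b & f b - f a = df c * (b - a).
Proof.
move=> ab H.
have [||c cab ->] := @MVT_segment _ f df a b ab.
- by move=> x /[!in_itv]/= /andP[ax xb]; apply: H; rewrite !ltW.
- apply: derivable_within_continuous => x /[!in_itv]/= xab.
  by have [] := H x xab.
- by exists c => //; rewrite in_itv /= in cab.
Qed.

Lemma derive_ge0_le f df (a b : R) : a <= b ->
  (forall x, a <= x <= b -> is_derive x (1 : R) f (df x)) ->
  (forall x, a <= x <= b -> 0 <= df x) -> f a <= f b.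
Proof.
move=> ab H H0; have [c cab E] := mvt ab H.
by rewrite -subr_ge0 E mulr_ge0 ?H0// subr_ge0.
Qed.

End Calculus1.

(** * The integral of a continuous function as the increment of a primitive *)

Section Integral1.
Context {R : realType}.
Implicit Types (f df : R -> R) (F : R * R -> R).
Local Notation mu := (@lebesgue_measure R).

Lemma exists_prim f : continuous f -> exists G : R -> R,
  (forall x, is_derive x (1 : R) G (f x)) /\
  (forall a b, a <= b -> \int[mu]_(x in `[a, b]) f x = G b - G a).
Proof.
move=> cf.
have intf a b : mu.-integrable `[a, b] (EFin \o f).
  apply: continuous_compact_integrable; first exact: segment_compact.
  exact: continuous_subspaceT.
have chas a b d : a <= b -> b <= d ->
    \int[mu]_(x in `[a, d]) f x - \int[mu]_(x in `[a, b]) f x = \int[mu]_(x in `[b, d]) f x.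
  move=> ab bd; rewrite Rintegral_itvB ?bnd_simp//.
  rewrite Rintegral_itv_obnd_cbnd//.
  by apply: (integrableS _ _ _ (intf b d)) => //; exact: subset_itv_oc_cc.
have lin3 (p q r s t : R) : p - q = r -> s - q = t -> r - t = p - s by lra.
pose J a x := \int[mu]_(t in `[a, x]) f t.
(* The base point moves with [x] because [J a] is an integral only to the right of [a]. [GE] shows
   that every base point far enough to the left gives the same value, so that a fixed one may be
   used near a given point. *)
pose G x := J (- `|x| - 1) x - J (- `|x| - 1) 0.
have GE a x : a <= x -> a <= 0 -> a < - `|x| -> G x = J a x - J a 0.
  move=> ax a0 aN; rewrite /G.
  have [h|h] := leP a (- `|x| - 1).
    have e1 : - `|x| - 1 <= x by have := ler_norm (- x); rewrite normrN; lra.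
    have e2 : - `|x| - 1 <= 0 by have := normr_ge0 x; lra.
    by rewrite (lin3 _ _ _ _ _ (chas _ _ _ h e1) (chas _ _ _ h e2)).
  by rewrite (lin3 _ _ _ _ _ (chas _ _ _ (ltW h) ax) (chas _ _ _ (ltW h) a0)).
exists G; split.
  move=> x; pose a := - `|x| - 2.
  have Hd : is_derive x (1 : R) (fun z => J a z - J a 0) (f x).
    have xx1 : x < x + 1 by rewrite ltrDl.
    have ax : a < x by rewrite /a; have := ler_norm (- x); rewrite normrN; lra.
    have [d1 d2] := @continuous_FTC1_closed R f a x (x + 1) xx1 (intf a (x + 1)) ax (cf x).
    have d3 : is_derive x (1 : R) (J a) (f x).
      by apply: DeriveDef; [exact: d1|rewrite -derive1E; exact: d2].
    rewrite -[X in is_derive _ _ _ X]subr0.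
    by exact: is_deriveB.
  apply: (near_eq_is_derive _ Hd).
  near=> z.
  have zx : `|z - x| < 1.
    by near: z; apply: (filterS _ (nbhsx_ballx x 1 ltr01)) => y; rewrite /ball /= distrC.
  have zn : `|z| < `|x| + 1.
    by have := ler_normD (z - x) x; rewrite subrK; move: zx; clear; lra.
  have az : a < - `|z| by rewrite /a; move: zn; clear; lra.
  have a0 : a <= 0 by rewrite /a; have := normr_ge0 x; clear; lra.
  rewrite (GE a)// ltW// (lt_le_trans az)//.
  by have := ler_norm (- z); rewrite normrN; clear; lra.
move=> a b ab; pose m := - `|a| - `|b| - 1.
have [ma mb m0] : [/\ m < - `|a|, m < - `|b| & m <= 0].
  by rewrite /m; have := normr_ge0 a; have := normr_ge0 b; clear; split; lra.
have ma' : m <= a by rewrite ltW// (lt_le_trans ma)//; have := ler_norm (- a); rewrite normrN; clear; lra.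
have mb' : m <= b := le_trans ma' ab.
have := chas _ _ _ ma' ab; rewrite (GE m)// (GE m a)// /J => <-; clear; lra.
Unshelve. all: by end_near.
Qed.

Definition prim f : R -> R :=
  if pselect (continuous f) is left cf then projT1 (cid (exists_prim cf)) else fun=> 0.

Lemma primP f : continuous f -> forall x, is_derive x (1 : R) (prim f) (f x).
Proof.
move=> cf; rewrite /prim; case: pselect => // cf'.
by case: cid => G /= [H _].
Qed.

(** Taking the increment of a chosen primitive makes additivity over intervals an algebraic
    identity, for end points in any order. [itg_Rintegral] links it to the Lebesgue integral. *)
Definition itg (a b : R) f : R := prim f b - prim f a.

Lemma itg_Rintegral f a b : continuous f -> a <= b ->
  itg a b f = \int[mu]_(x in `[a, b]) f x.
Proof.
move=> cf; rewrite /itg /prim; case: pselect => // cf'.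
by case: cid => G /= [_ H] ab; rewrite H.
Qed.

Lemma itgE f G a b : (forall x, is_derive x (1 : R) G (f x)) -> continuous f ->
  itg a b f = G b - G a.
Proof.
move=> HG cf; rewrite /itg.
have H x : is_derive x (1 : R) (fun y => prim f y - G y) 0.
  by rewrite -(subrr (f x)); have h1 := primP cf x; have h2 := HG x; exact: is_deriveB.
by have := is_derive_0_is_cst b a H; lra.
Qed.

Lemma itgD f g a b : continuous f -> continuous g ->
  itg a b (fun x => f x + g x) = itg a b f + itg a b g.
Proof.
move=> cf cg.
have H x : is_derive x (1 : R) (fun x => prim f x + prim g x) (f x + g x).
  by have h1 := primP cf x; have h2 := primP cg x; exact: is_deriveD.
rewrite (itgE _ _ H); first by rewrite /itg; clear; lra.
by move=> x; apply: cvgD; [exact: cf|exact: cg].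
Qed.

Lemma itgZ f (k : R) a b : continuous f -> itg a b (fun x => k * f x) = k * itg a b f.
Proof.
move=> cf.
have H x : is_derive x (1 : R) (fun x => k * prim f x) (k * f x).
  rewrite -[X in is_derive _ _ _ X]/(k *: f x).
  by have h1 := primP cf x; exact: is_deriveZ.
rewrite (itgE _ _ H); first by rewrite /itg mulrBr.
by move=> x; apply: cvgM; [exact: cvg_cst|exact: cf].
Qed.

Lemma itgN f a b : continuous f -> itg a b (fun x => - f x) = - itg a b f.
Proof.
move=> cf; rewrite -mulN1r -itgZ//; congr itg.
by apply/funext => x; rewrite mulN1r.
Qed.

Lemma itgB f g a b : continuous f -> continuous g ->
  itg a b (fun x => f x - g x) = itg a b f - itg a b g.
Proof.
move=> cf cg; rewrite itgD// ?itgN// => x.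
by apply: cvgN; exact: cg.
Qed.

Lemma itg_cst (k : R) a b : itg a b (fun=> k) = k * (b - a).
Proof.
have H x : is_derive x (1 : R) (fun x => k * x) k.
  rewrite -[X in is_derive _ _ _ X]mulr1 -[X in is_derive _ _ _ X]/(k *: 1).
  by exact: is_deriveZ.
rewrite (itgE _ _ H); first by rewrite mulrBr.
by move=> x; exact: cvg_cst.
Qed.

Lemma itg_chasles a b d f : itg a b f + itg b d f = itg a d f.
Proof. by rewrite /itg; lra. Qed.

Lemma itg_le f g a b : a <= b -> continuous f -> continuous g ->
  (forall x, a <= x <= b -> f x <= g x) -> itg a b f <= itg a b g.
Proof.
move=> ab cf cg H; rewrite -subr_ge0 -itgB// /itg subr_ge0.
apply: (derive_ge0_le ab (df := fun x => g x - f x)).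
- move=> x _; apply: primP => y; apply: cvgB; [exact: cg|exact: cf].
- by move=> x xab; rewrite subr_ge0 H.
Qed.

Lemma itg_ge0 f a b : a <= b -> continuous f ->
  (forall x, a <= x <= b -> 0 <= f x) -> 0 <= itg a b f.
Proof.
move=> ab cf H; rewrite -[0](mul0r (b - a)) -itg_cst; apply: itg_le => //.
by move=> x; exact: cvg_cst.
Qed.

Lemma itg_norm_le f (K a b : R) : a <= b -> continuous f ->
  (forall x, a <= x <= b -> `|f x| <= K) -> `|itg a b f| <= K * (b - a).
Proof.
move=> ab cf H; rewrite ler_norml -mulNr -!itg_cst.
have cc k : continuous (fun _ : R => k : R) by exact: contC.
by apply/andP; split; apply: itg_le => // x /H; rewrite ler_norml => /andP[].
Qed.

Lemma itg_shift f a b t : continuous f -> itg (a + t) (b + t) f = itg a b (fun x => f (x + t)).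
Proof.
move=> cf.
have H x : is_derive x (1 : R) (fun x => prim f (x + t)) (f (x + t)).
  rewrite -[f _]mulr1.
  have h1 := primP cf (x + t).
  have h2 : is_derive x (1 : R) (fun x => x + t) 1.
    by rewrite -[X in is_derive _ _ _ X]addr0; exact: is_deriveD.
  exact: (is_derive1_comp (f := prim f)).
rewrite (itgE _ _ H)//.
by apply: cont1 => //; apply: contD; [exact: contI|exact: contC].
Qed.

Lemma itg_scale f a b t : continuous f -> t * itg a b (fun x => f (t * x)) = itg (t * a) (t * b) f.
Proof.
move=> cf.
have cf' : continuous (fun x => f (t * x)).
  by apply: cont1 => //; apply: contM; [exact: contC|exact: contI].
rewrite -itgZ//.
have H x : is_derive x (1 : R) (fun x => prim f (t * x)) (t * f (t * x)).
  rewrite mulrC; have h1 := primP cf (t * x).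
  have h2 : is_derive x (1 : R) (fun x => t * x) t.
    rewrite -[X in is_derive _ _ _ X]mulr1 -[X in is_derive _ _ _ X]/(t *: 1).
    by exact: is_deriveZ.
  exact: (is_derive1_comp (f := prim f)).
rewrite (itgE _ _ H)// => x.
by apply: cvgM; [exact: cvg_cst|exact: cf'].
Qed.

End Integral1.

(** * Integrals depending on a parameter *)

Section Integral2.
Context {R : realType}.
Implicit Types (F : R * R -> R).

Lemma contP1 F x : continuous F -> continuous (fun t => F (x, t)).
Proof. by move=> cF; apply: cont2 => //; [exact: contC|exact: contI]. Qed.

Lemma contP2 F y : continuous F -> continuous (fun t => F (t, y)).
Proof. by move=> cF; apply: cont2 => //; [exact: contI|exact: contC]. Qed.

Lemma itg_bound_abs (f : R -> R) (K a b : R) : continuous f ->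
  (forall x, `|x| <= Num.max `|a| `|b| -> `|f x| <= K) -> `|itg a b f| <= K * `|b - a|.
Proof.
move=> cf.
have key (u v : R) : u <= v -> (forall x, `|x| <= Num.max `|u| `|v| -> `|f x| <= K) ->
    `|itg u v f| <= K * `|v - u|.
  move=> uv H; rewrite (ger0_norm (x := v - u)) ?subr_ge0//.
  apply: itg_norm_le => // x /andP[ux xv]; apply: H.
  rewrite le_max !ler_norml; have [x0|x0] := leP 0 x.
    apply/orP; right; rewrite (le_trans xv (ler_norm _)) andbT.
    by rewrite (le_trans _ x0)// oppr_le0.
  apply/orP; left; rewrite (le_trans (ltW x0)) ?andbT//.
  by rewrite (le_trans _ ux)// lerNl -normrN ler_norm.
have [ab|ba] := leP a b; first exact: key.
move=> H; rewrite (distrC b a).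
have -> : itg a b f = - itg b a f by rewrite /itg opprB.
rewrite normrN.
by apply: key; [exact: ltW|move=> x; rewrite maxC; exact: H].
Qed.

Lemma itg_param0_cont F : continuous F ->
  continuous (fun z : R * R => itg 0 z.2 (fun t => F (z.1, t))).
Proof.
move=> cF; apply/cont2P => -[q b] e e0 /=.
pose M := `|q| + `|b| + 1.
have [B HB] := bound2 M cF.
have B0 : 0 <= B.
  apply: le_trans (HB (q, b) _ _); rewrite ?normr_ge0//= /M.
    by have := normr_ge0 b; clear; lra.
  by have := normr_ge0 q; clear; lra.
have M1 : 0 < M by rewrite /M; have := normr_ge0 q; have := normr_ge0 b; clear; lra.
have e1 : 0 < e / (2 * M) by rewrite divr_gt0// mulr_gt0.
have [d d0 Hd] := unif2 M cF e1.
have dd : 0 < Num.min 1 (Num.min d (e / (2 * (B + 1)))).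
  by rewrite !lt_min ltr01 d0 divr_gt0// mulr_gt0// ltr_wpDl.
exists (Num.min 1 (Num.min d (e / (2 * (B + 1))))) => // -[q' b'] /=.
rewrite !lt_min => /andP[q1 /andP[q2 _]] /andP[b1 /andP[_ b3]].
have -> : itg 0 b' (fun t => F (q', t)) - itg 0 b (fun t => F (q, t)) =
    itg 0 b (fun t => F (q', t) - F (q, t)) + itg b b' (fun t => F (q', t)).
  rewrite itgB; [|exact: contP1..].
  by rewrite -(itg_chasles 0 b b'); clear; lra.
have nb' : `|b'| <= M.
  by have := ler_normD (b' - b) b; rewrite subrK /M; have := normr_ge0 q; move: b1; clear; lra.
have nq' : `|q'| <= M.
  by have := ler_normD (q' - q) q; rewrite subrK /M; have := normr_ge0 b; move: q1; clear; lra.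
have nb : `|b| <= M by rewrite /M; have := normr_ge0 q; clear; lra.
have nq : `|q| <= M by rewrite /M; have := normr_ge0 b; clear; lra.
have h1 : `|itg 0 b (fun t => F (q', t) - F (q, t))| <= e / (2 * M) * `|b - 0|.
  apply: itg_bound_abs; first by apply: contB; exact: contP1.
  move=> x; rewrite normr0 (max_r (normr_ge0 b)) => xb.
  apply/ltW; apply: (Hd (q, x) (q', x)) => //=; first exact: le_trans nb.
  by rewrite subrr normr0.
have h2 : `|itg b b' (fun t => F (q', t))| <= B * `|b' - b|.
  apply: itg_bound_abs; first exact: contP1.
  move=> x xb; apply: HB => //=; apply: le_trans xb _.
  by rewrite ge_max nb nb'.
apply: le_lt_trans (ler_normD _ _) _.
have h3 : e / (2 * M) * `|b - 0| <= e / 2.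
  rewrite subr0 invfM mulrA -mulrA ler_piMr//; first by rewrite divr_ge0// ltW.
  by rewrite ler_pdivrMl// mulr1.
have h4 : B * `|b' - b| < e / 2.
  have h5 : (B + 1) * `|b' - b| < e / 2.
    rewrite mulrC -ltr_pdivlMr ?ltr_wpDl//.
    by move: b3; rewrite invfM mulrA.
  apply: le_lt_trans h5; rewrite ler_wpM2r// lerDl//.
by move: h1 h2 h3 h4; clear; lra.
Qed.

Lemma itg_cont (T : topologicalType) F (q a b : T -> R) : continuous F ->
  continuous q -> continuous a -> continuous b ->
  continuous (fun z => itg (a z) (b z) (fun t => F (q z, t))).
Proof.
move=> cF cq ca cb.
have h := itg_param0_cont cF.
rewrite [X in continuous X](_ : _ = fun z =>
  itg 0 (b z) (fun t => F (q z, t)) - itg 0 (a z) (fun t => F (q z, t))).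
  by apply: contB; [exact: (cont2 h cq cb)|exact: (cont2 h cq ca)].
by apply/funext => z; rewrite -(itg_chasles 0 (a z) (b z)) addrAC subrr add0r.
Qed.

Lemma contSwap F : continuous F -> continuous (fun z : R * R => F (z.2, z.1)).
Proof. by move=> cF; apply: cont2 => //; [exact: contS|exact: contF]. Qed.

Lemma itg_cont' (T : topologicalType) F (q a b : T -> R) : continuous F ->
  continuous q -> continuous a -> continuous b ->
  continuous (fun z => itg (a z) (b z) (fun t => F (t, q z))).
Proof. by move=> cF; apply: (itg_cont (F := fun z => F (z.2, z.1))); exact: contSwap. Qed.

Lemma derive_itg (V Vs : R * R -> R) (a b s : R) : a <= b -> continuous V -> continuous Vs ->
  (forall s t, is_derive s (1 : R) (fun s => V (s, t)) (Vs (s, t))) ->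
  is_derive s (1 : R) (fun s => itg a b (fun t => V (s, t))) (itg a b (fun t => Vs (s, t))).
Proof.
move=> ab cV cVs H; apply: is_deriveP => e e0.
pose M := `|s| + `|a| + `|b| + 1.
have ba0 : 0 < b - a + 1 by rewrite ltr_wpDl// subr_ge0.
have e1 : 0 < e / (b - a + 1) by rewrite divr_gt0.
have [d d0 Hd] := unif2 M cVs e1.
have dd : 0 < Num.min 1 d by rewrite lt_min ltr01.
exists (Num.min 1 d) => // h; rewrite lt_min => /andP[h1 hd].
have cc k : continuous (fun t => h * Vs (k, t)) by apply: contM; [exact: contC|exact: contP1].
rewrite -itgB; [|exact: contP1..].
rewrite -itgZ; last exact: contP1.
rewrite -itgB; [|by apply: contB; exact: contP1|exact: cc].
have pt t : a <= t <= b -> `|V (s + h, t) - V (s, t) - h * Vs (s, t)| <= e / (b - a + 1) * `|h|.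
  move=> /andP[at_ tb].
  have nt : `|t| <= M.
    rewrite /M ler_norml; have := ler_norm b; have := ler_norm (- a); rewrite normrN.
    by have := normr_ge0 s; have := normr_ge0 a; have := normr_ge0 b; move: at_ tb; clear; lra.
  have ns : `|s| <= M by rewrite /M; have := normr_ge0 a; have := normr_ge0 b; clear; lra.
  (* The mean value theorem in [s], applied for each [t] separately, reduces the claim to the
     uniform continuity of [Vs]. *)
  have [c cs ->] : exists2 c, `|c - s| <= `|h| & V (s + h, t) - V (s, t) = Vs (c, t) * h.
    have [h0|h0] := leP 0 h.
      have sh : s <= s + h by rewrite lerDl.
      have [c /andP[c1 c2] ->] := mvt sh (fun x _ => H x t).
      exists c; last by congr (_ * _); clear; lra.
      by rewrite !ger0_norm ?subr_ge0//; move: c2; clear; lra.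
    have sh : s + h <= s by rewrite gerDl ltW.
    have [c /andP[c1 c2] E] := mvt sh (fun x _ => H x t).
    exists c; last by rewrite -opprB E; clear; lra.
    by rewrite ler0_norm ?subr_le0// ltr0_norm//; move: c1; clear; lra.
  have -> : Vs (c, t) * h - h * Vs (s, t) = (Vs (c, t) - Vs (s, t)) * h by clear; lra.
  rewrite normrM ler_wpM2r//; apply/ltW; apply: (Hd (s, t) (c, t)) => //=.
    exact: le_lt_trans hd.
  by rewrite subrr normr0.
have := itg_norm_le ab _ pt; move=> /(_ _)/le_trans; apply.
  by apply: contB; [by apply: contB; exact: contP1|exact: cc].
have k1 : (b - a) / (b - a + 1) <= 1 by rewrite ler_pdivrMr// mul1r lerDl.
rewrite mulrAC ler_wpM2r//.
by rewrite mulrAC -mulrA ler_piMr// ltW.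
Qed.

(** Both sides vanish at [b = a] and have the same derivative in [b]. *)
Lemma itg_swap F (a b k d : R) : k <= d -> continuous F ->
  itg a b (fun x => itg k d (fun y => F (x, y))) =
  itg k d (fun y => itg a b (fun x => F (x, y))).
Proof.
move=> kd cF.
have c1 : continuous (fun x => itg k d (fun y => F (x, y))).
  by apply: itg_cont => //; [exact: contI|exact: contC..].
have H b' : is_derive b' (1 : R)
   (fun b => itg k d (fun y => itg a b (fun x => F (x, y)))) (itg k d (fun y => F (b', y))).
  apply: (derive_itg (V := fun z => itg a z.1 (fun x => F (x, z.2))) (Vs := F)) => //.
    by apply: itg_cont' => //; [exact: contS|exact: contC|exact: contF].
  move=> s t /=; have h := primP (contP2 (y := t) cF) s.
  by rewrite -[X in is_derive _ _ _ X]subr0; exact: is_deriveB.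
rewrite (itgE _ _ H)//.
have -> : (fun y => itg a a (fun x => F (x, y))) = fun=> 0.
  by apply/funext => y; rewrite /itg subrr.
by rewrite itg_cst mul0r subr0.
Qed.

End Integral2.

(** * Smoothing by iterated averages *)

Section Smoothing.
Context {R : realType}.
Implicit Types (F G : R * R -> R) (a q y : R) (z : R * R).

(** The averages are one-sided so that the derivative of [avg1 a F] is the difference quotient
    [dif1 a F]. Two averages in each variable therefore turn a continuous function into one of class
    C^2. *)
Definition avg1 a F z : R := a^-1 * itg z.1 (z.1 + a) (fun t => F (t, z.2)).
Definition avg2 a F z : R := a^-1 * itg z.2 (z.2 + a) (fun t => F (z.1, t)).
Definition dif1 a F z : R := a^-1 * (F (z.1 + a, z.2) - F z).
Definition dif2 a F z : R := a^-1 * (F (z.1, z.2 + a) - F z).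
Definition trans (s t : R) F z : R := F (z.1 + s, z.2 + t).

Lemma cont_trans s t F : continuous F -> continuous (trans s t F).
Proof.
move=> cF; apply: cont2 => //; apply: contD; (try exact: contC);
  [exact: contF|exact: contS].
Qed.

Lemma cont_avg1 a F : continuous F -> continuous (avg1 a F).
Proof.
move=> cF; apply: contM; first exact: contC.
apply: itg_cont' => //; [exact: contS|exact: contF|].
by apply: contD; [exact: contF|exact: contC].
Qed.

Lemma cont_avg2 a F : continuous F -> continuous (avg2 a F).
Proof.
move=> cF; apply: contM; first exact: contC.
apply: itg_cont => //; [exact: contF|exact: contS|].
by apply: contD; [exact: contS|exact: contC].
Qed.

Lemma dif1E a F : dif1 a F = fun z => a^-1 * (trans a 0 F z - F z).
Proof. by apply/funext => z; rewrite /dif1 /trans addr0. Qed.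

Lemma dif2E a F : dif2 a F = fun z => a^-1 * (trans 0 a F z - F z).
Proof. by apply/funext => z; rewrite /dif2 /trans addr0. Qed.

Lemma cont_dif1 a F : continuous F -> continuous (dif1 a F).
Proof.
move=> cF; rewrite dif1E; apply: contM; first exact: contC.
by apply: contB => //; exact: cont_trans.
Qed.

Lemma cont_dif2 a F : continuous F -> continuous (dif2 a F).
Proof.
move=> cF; rewrite dif2E; apply: contM; first exact: contC.
by apply: contB => //; exact: cont_trans.
Qed.

Lemma avg12 a b F : 0 < a -> continuous F -> avg1 a (avg2 b F) = avg2 b (avg1 a F).
Proof.
move=> a0 cF; apply/funext => -[q y]; rewrite /avg1 /avg2 /=.
have az : q <= q + a by rewrite lerDl ltW.
rewrite itgZ; last by apply: itg_cont => //; [exact: contI|exact: contC..].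
rewrite itgZ; last by apply: itg_cont' => //; [exact: contI|exact: contC..].
rewrite -(itg_swap (F := fun z => F (z.2, z.1)) y (y + b) az)//; last exact: contSwap.
by rewrite /= mulrCA.
Qed.

Lemma derive_avg1 a F q y : continuous F ->
  is_derive q (1 : R) (fun t => avg1 a F (t, y)) (dif1 a F (q, y)).
Proof.
move=> cF; rewrite /avg1 /dif1 /=.
have h1 x := primP (contP2 (y := y) cF) x.
have h2 : is_derive q (1 : R) (fun t => prim (fun s => F (s, y)) (t + a)) (F (q + a, y)).
  rewrite -[F _]mulr1.
  have h : is_derive q (1 : R) (fun x => x + a) 1.
    by rewrite -[X in is_derive _ _ _ X]addr0; exact: is_deriveD.
  exact: (is_derive1_comp (f := prim (fun s => F (s, y)))).
have h3 := h1 q.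
rewrite -[X in is_derive _ _ _ X]/(a^-1 *: (F (q + a, y) - F (q, y))).
by apply: is_deriveZ; exact: is_deriveB.
Qed.

Lemma derive_avg2 a F q y : continuous F ->
  is_derive y (1 : R) (fun t => avg2 a F (q, t)) (dif2 a F (q, y)).
Proof.
by move=> cF; exact: (derive_avg1 a y q (contSwap cF)).
Qed.

Lemma derive_dif1 a F D q y : (forall q, is_derive q (1 : R) (fun t => F (t, y)) (D (q, y))) ->
  is_derive q (1 : R) (fun t => dif1 a F (t, y)) (dif1 a D (q, y)).
Proof.
move=> H; rewrite /dif1 /=.
have h1 : is_derive q (1 : R) (fun t => F (t + a, y)) (D (q + a, y)).
  rewrite -[D _]mulr1; have h2 := H (q + a).
  have h : is_derive q (1 : R) (fun x => x + a) 1.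
    by rewrite -[X in is_derive _ _ _ X]addr0; exact: is_deriveD.
  exact: (is_derive1_comp (f := fun t => F (t, y))).
have h3 := H q.
rewrite -[X in is_derive _ _ _ X]/(a^-1 *: (D (q + a, y) - D (q, y))).
by apply: is_deriveZ; exact: is_deriveB.
Qed.

Lemma derive_dif1' a F D q y : (forall q y, is_derive y (1 : R) (fun t => F (q, t)) (D (q, y))) ->
  is_derive y (1 : R) (fun t => dif1 a F (q, t)) (dif1 a D (q, y)).
Proof.
move=> H; rewrite /dif1 /=.
have h1 := H (q + a) y; have h3 := H q y.
rewrite -[X in is_derive _ _ _ X]/(a^-1 *: (D (q + a, y) - D (q, y))).
by apply: is_deriveZ; exact: is_deriveB.
Qed.

Lemma derive_dif2 a F D q y : (forall y, is_derive y (1 : R) (fun t => F (q, t)) (D (q, y))) ->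
  is_derive y (1 : R) (fun t => dif2 a F (q, t)) (dif2 a D (q, y)).
Proof. exact: (@derive_dif1 a (fun z => F (z.2, z.1)) (fun z => D (z.2, z.1)) y q). Qed.

Lemma derive_dif2' a F D q y : (forall q y, is_derive q (1 : R) (fun t => F (t, y)) (D (q, y))) ->
  is_derive q (1 : R) (fun t => dif2 a F (t, y)) (dif2 a D (q, y)).
Proof.
move=> H; apply: (@derive_dif1' a (fun z => F (z.2, z.1)) (fun z => D (z.2, z.1)) y q).
by move=> u v; exact: H.
Qed.

Record C2 (F F1 F2 F11 F12 F21 F22 : R * R -> R) : Prop := MkC2 {
  C2_cont1 : continuous F1 ; C2_cont2 : continuous F2 ;
  C2_cont11 : continuous F11 ; C2_cont12 : continuous F12 ;
  C2_cont21 : continuous F21 ; C2_cont22 : continuous F22 ;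
  C2_cont : continuous F ;
  C2_d1 : forall q y, is_derive q (1 : R) (fun t => F (t, y)) (F1 (q, y)) ;
  C2_d2 : forall q y, is_derive y (1 : R) (fun t => F (q, t)) (F2 (q, y)) ;
  C2_d11 : forall q y, is_derive q (1 : R) (fun t => F1 (t, y)) (F11 (q, y)) ;
  C2_d12 : forall q y, is_derive y (1 : R) (fun t => F1 (q, t)) (F12 (q, y)) ;
  C2_d21 : forall q y, is_derive q (1 : R) (fun t => F2 (t, y)) (F21 (q, y)) ;
  C2_d22 : forall q y, is_derive y (1 : R) (fun t => F2 (q, t)) (F22 (q, y)) }.

Definition smooth a F := avg1 a (avg1 a (avg2 a (avg2 a F))).

(** The Laplacian of [smooth a F], written through averages and difference quotients of [F], so that
    sign conditions on it make sense for a continuous [F]. *)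
Definition lap a F z : R :=
  dif1 a (dif1 a (avg2 a (avg2 a F))) z + dif2 a (dif2 a (avg1 a (avg1 a F))) z.

Lemma smooth_C2 a F : 0 < a -> continuous F ->
  exists F1 F2 F11 F12 F21 F22, C2 (smooth a F) F1 F2 F11 F12 F21 F22 /\
    forall z, F11 z + F22 z = lap a F z.
Proof.
move=> a0 cF.
have c1 := @cont_avg1 a; have c2 := @cont_avg2 a.
have d1 := @cont_dif1 a; have d2 := @cont_dif2 a.
(* Averages in the two directions commute, which brings the average to be differentiated to the
   outside. *)
have E1 : smooth a F = avg2 a (avg2 a (avg1 a (avg1 a F))).
  rewrite /smooth (@avg12 a a (avg2 a F) a0 (c2 _ cF)) (@avg12 a a F a0 cF).
  rewrite (@avg12 a a (avg2 a (avg1 a F)) a0 (c2 _ (c1 _ cF))).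
  by rewrite (@avg12 a a (avg1 a F) a0 (c1 _ cF)).
have E2 : avg1 a (avg2 a (avg2 a F)) = avg2 a (avg1 a (avg2 a F)).
  by rewrite (@avg12 a a (avg2 a F) a0 (c2 _ cF)).
have E3 : avg2 a (avg1 a (avg1 a F)) = avg1 a (avg2 a (avg1 a F)).
  by rewrite (@avg12 a a (avg1 a F) a0 (c1 _ cF)).
exists (dif1 a (avg1 a (avg2 a (avg2 a F)))), (dif2 a (avg2 a (avg1 a (avg1 a F)))).
exists (dif1 a (dif1 a (avg2 a (avg2 a F)))), (dif1 a (dif2 a (avg1 a (avg2 a F)))).
exists (dif2 a (dif1 a (avg2 a (avg1 a F)))), (dif2 a (dif2 a (avg1 a (avg1 a F)))).
split; last by [].
split.
- exact: (d1 _ (c1 _ (c2 _ (c2 _ cF)))).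
- exact: (d2 _ (c2 _ (c1 _ (c1 _ cF)))).
- exact: (d1 _ (d1 _ (c2 _ (c2 _ cF)))).
- exact: (d1 _ (d2 _ (c1 _ (c2 _ cF)))).
- exact: (d2 _ (d1 _ (c2 _ (c1 _ cF)))).
- exact: (d2 _ (d2 _ (c1 _ (c1 _ cF)))).
- exact: (c1 _ (c1 _ (c2 _ (c2 _ cF)))).
- by move=> q y; apply: derive_avg1; exact: (c1 _ (c2 _ (c2 _ cF))).
- by move=> q y; rewrite E1; apply: derive_avg2; exact: (c2 _ (c1 _ (c1 _ cF))).
- by move=> q y; apply: derive_dif1 => q'; apply: derive_avg1; exact: (c2 _ (c2 _ cF)).
- move=> q y; rewrite E2; apply: derive_dif1' => q' y'.
  by apply: derive_avg2; exact: (c1 _ (c2 _ cF)).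
- move=> q y; rewrite E3; apply: derive_dif2' => q' y'.
  by apply: derive_avg1; exact: (c2 _ (c1 _ cF)).
- by move=> q y; apply: derive_dif2 => y'; apply: derive_avg2; exact: (c1 _ (c1 _ cF)).
Qed.

Lemma avg1D a F G : continuous F -> continuous G ->
  avg1 a (fun z => F z - G z) = fun z => avg1 a F z - avg1 a G z.
Proof.
move=> cF cG; apply/funext => z; rewrite /avg1 itgB ?mulrBr//; exact: contP2.
Qed.

Lemma avg2D a F G : continuous F -> continuous G ->
  avg2 a (fun z => F z - G z) = fun z => avg2 a F z - avg2 a G z.
Proof.
move=> cF cG; apply/funext => z; rewrite /avg2 itgB ?mulrBr//; exact: contP1.
Qed.

Lemma avg1Z a (k : R) F : continuous F -> avg1 a (fun z => k * F z) = fun z => k * avg1 a F z.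
Proof.
by move=> cF; apply/funext => z; rewrite /avg1 itgZ 1?mulrCA//; exact: contP2.
Qed.

Lemma avg2Z a (k : R) F : continuous F -> avg2 a (fun z => k * F z) = fun z => k * avg2 a F z.
Proof.
by move=> cF; apply/funext => z; rewrite /avg2 itgZ 1?mulrCA//; exact: contP1.
Qed.

Lemma dif1D a F G : dif1 a (fun z => F z - G z) = fun z => dif1 a F z - dif1 a G z.
Proof. by apply/funext => z; rewrite /dif1 -mulrBr; congr (_ * _); lra. Qed.

Lemma dif2D a F G : dif2 a (fun z => F z - G z) = fun z => dif2 a F z - dif2 a G z.
Proof. by apply/funext => z; rewrite /dif2 -mulrBr; congr (_ * _); lra. Qed.

Lemma dif1N a F : dif1 a (fun z => - F z) = fun z => - dif1 a F z.
Proof. by apply/funext => z; rewrite /dif1 -mulrN; congr (_ * _); lra. Qed.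

Lemma dif2N a F : dif2 a (fun z => - F z) = fun z => - dif2 a F z.
Proof. by apply/funext => z; rewrite /dif2 -mulrN; congr (_ * _); lra. Qed.

Lemma lapB a F G : continuous F -> continuous G ->
  lap a (fun z => F z - G z) = fun z => lap a F z - lap a G z.
Proof.
move=> cF cG; have c1 := @cont_avg1 a; have c2 := @cont_avg2 a.
apply/funext => z; rewrite /lap (avg2D _ cF cG) (avg2D _ (c2 _ cF) (c2 _ cG)).
rewrite (avg1D _ cF cG) (avg1D _ (c1 _ cF) (c1 _ cG)).
by rewrite !(dif1D, dif2D) opprD addrACA.
Qed.

Lemma avg1_le a F K z : 0 < a -> continuous F ->
  (forall t, z.1 <= t <= z.1 + a -> F (t, z.2) <= K) -> avg1 a F z <= K.
Proof.
move=> a0 cF H; rewrite /avg1 ler_pdivrMl//.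
have az : z.1 <= z.1 + a by rewrite lerDl ltW.
have -> : a * K = itg z.1 (z.1 + a) (fun=> K) by rewrite itg_cst mulrC addrAC subrr add0r.
by apply: itg_le => //; [exact: contP2|exact: contC].
Qed.

Lemma avg2_le a F K z : 0 < a -> continuous F ->
  (forall t, z.2 <= t <= z.2 + a -> F (z.1, t) <= K) -> avg2 a F z <= K.
Proof.
move=> a0 cF H; exact: (@avg1_le a (fun z => F (z.2, z.1)) K (z.2, z.1) a0 (contSwap cF)).
Qed.

Lemma smooth_le a F K z : 0 < a -> continuous F ->
  (forall s t, z.1 <= s <= z.1 + 2 * a -> z.2 <= t <= z.2 + 2 * a -> F (s, t) <= K) ->
  smooth a F z <= K.
Proof.
move=> a0 cF H; have c1 := @cont_avg1 a; have c2 := @cont_avg2 a.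
apply: avg1_le => //; first exact: (c1 _ (c2 _ (c2 _ cF))).
move=> s /andP[s1 s2]; apply: avg1_le => //=; first exact: (c2 _ (c2 _ cF)).
move=> s' /andP[s1' s2']; apply: avg2_le => //=; first exact: (c2 _ cF).
move=> t /andP[t1 t2]; apply: avg2_le => //= t' /andP[t1' t2'].
apply: H; apply/andP; split; move: a0 s1 s2 s1' s2' t1 t2 t1' t2'; clear; lra.
Qed.

Lemma avg1N a F : continuous F -> avg1 a (fun z => - F z) = fun z => - avg1 a F z.
Proof.
by move=> cF; apply/funext => z; rewrite /avg1 itgN ?mulrN//; exact: contP2.
Qed.

Lemma avg2N a F : continuous F -> avg2 a (fun z => - F z) = fun z => - avg2 a F z.
Proof.
by move=> cF; apply/funext => z; rewrite /avg2 itgN ?mulrN//; exact: contP1.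
Qed.

Lemma smoothN a F : continuous F -> smooth a (fun z => - F z) = fun z => - smooth a F z.
Proof.
move=> cF; have c1 := @cont_avg1 a; have c2 := @cont_avg2 a.
rewrite /smooth (avg2N _ cF) (avg2N _ (c2 _ cF)).
by rewrite (avg1N _ (c2 _ (c2 _ cF))) (avg1N _ (c1 _ (c2 _ (c2 _ cF)))).
Qed.

Lemma lapN a F : continuous F -> lap a (fun z => - F z) = fun z => - lap a F z.
Proof.
move=> cF; have c1 := @cont_avg1 a; have c2 := @cont_avg2 a.
apply/funext => z; rewrite /lap (avg2N _ cF) (avg2N _ (c2 _ cF)).
rewrite (avg1N _ cF) (avg1N _ (c1 _ cF)).
by rewrite !(dif1N, dif2N) opprD.
Qed.

Lemma smooth_ge a F K z : 0 < a -> continuous F ->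
  (forall s t, z.1 <= s <= z.1 + 2 * a -> z.2 <= t <= z.2 + 2 * a -> K <= F (s, t)) ->
  K <= smooth a F z.
Proof.
move=> a0 cF H; rewrite -[smooth a F z]opprK -[- smooth a F z]/((fun z => - smooth a F z) z).
rewrite -smoothN// lerNr; apply: smooth_le => //; first exact: contN.
by move=> s t hs ht; rewrite lerN2; exact: H.
Qed.

Lemma smooth_near F (M e : R) : continuous F -> 0 < e -> exists2 d, 0 < d &
  forall a z, 0 < a < d -> `|z.1| <= M -> `|z.2| <= M -> `|smooth a F z - F z| <= e.
Proof.
move=> cF e0; have [d d0 Hd] := unif2 M cF e0.
exists (d / 2); first by rewrite divr_gt0.
move=> a' z /andP[a0 ad] z1 z2.
have H s t : z.1 <= s <= z.1 + 2 * a' -> z.2 <= t <= z.2 + 2 * a' ->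
    `|F (s, t) - F z| <= e.
  move=> /andP[s1 s2] /andP[t1 t2]; apply/ltW; apply: Hd => //=; rewrite ger0_norm ?subr_ge0//;
    move: s1 s2 t1 t2 ad; clear; lra.
rewrite ler_norml; apply/andP; split.
  rewrite lerBrDr; apply: smooth_ge => // s t hs ht.
  by have := H s t hs ht; rewrite ler_norml => /andP[h _]; move: h; clear; lra.
rewrite lerBlDr; apply: smooth_le => // s t hs ht.
by have := H s t hs ht; rewrite ler_norml => /andP[_ h]; move: h; clear; lra.
Qed.

Lemma avg1_mono a F G z : 0 < a -> continuous F -> continuous G ->
  (forall t, z.1 <= t <= z.1 + a -> F (t, z.2) <= G (t, z.2)) -> avg1 a F z <= avg1 a G z.
Proof.
move=> a0 cF cG H; rewrite /avg1; apply: ler_wpM2l; first by rewrite invr_ge0 ltW.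
apply: itg_le => //; [|exact: contP2..].
by rewrite lerDl ltW.
Qed.

Lemma avg2_mono a F G z : 0 < a -> continuous F -> continuous G ->
  (forall t, z.2 <= t <= z.2 + a -> F (z.1, t) <= G (z.1, t)) -> avg2 a F z <= avg2 a G z.
Proof.
move=> a0 cF cG H.
exact: (@avg1_mono a (fun z => F (z.2, z.1)) (fun z => G (z.2, z.1)) (z.2, z.1) a0
  (contSwap cF) (contSwap cG)).
Qed.

Lemma avg1_trans a s t F : continuous F -> avg1 a (trans s t F) = trans s t (avg1 a F).
Proof.
move=> cF; apply/funext => z; rewrite /avg1 /trans /=; congr (_ * _).
have := itg_shift z.1 (z.1 + a) s (contP2 (y := z.2 + t) cF).
by rewrite addrAC => ->.
Qed.

Lemma avg2_trans a s t F : continuous F -> avg2 a (trans s t F) = trans s t (avg2 a F).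
Proof.
move=> cF; apply/funext => z; rewrite /avg2 /trans /=; congr (_ * _).
have := itg_shift z.2 (z.2 + a) t (contP1 (x := z.1 + s) cF).
by rewrite addrAC => ->.
Qed.

End Smoothing.

(** * The free boundary problem *)

Section Obstacle.
Context {R : realType}.
Implicit Types (F g : R * R -> R) (a q y : R) (z : R * R).

Definition parab z : R := z.2 ^+ 2 / 2.
Definition frc g z : R := g z - parab z.

(* The properties that [g(q, y) = sup_x (sqrt c * q * x - u(x, y)) + y^2 / 2] inherits from [u],
   extended to [y < 0] by its value at [y = 0].  The flux conditions compare the area of the set
   of points (x, y) with y0 < y < y1 whose slope q lies in (q0, q1) with the area of its normal
   image, with difference quotients in place of derivatives: [g - y^2 / 2] is superharmonic for
   y > 0, and harmonic where g > 0. *)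
Record gsol (c : R) (g : R * R -> R) : Prop := MkGsol {
  g_cont : continuous g ;
  g_low : forall q y, y <= 0 -> g (q, y) = c * (Num.max q 0) ^+ 2 / 2 ;
  g_ge0 : forall z, 0 <= g z ;
  g_mono : forall q q' y, q <= q' -> g (q, y) <= g (q', y) ;
  g_conv : forall y q q' t, 0 <= t <= 1 ->
    g ((1 - t) * q + t * q', y) <= (1 - t) * g (q, y) + t * g (q', y) ;
  g_conc : forall q y y' t, 0 <= y -> 0 <= y' -> 0 <= t <= 1 ->
    (1 - t) * frc g (q, y) + t * frc g (q, y') <= frc g (q, (1 - t) * y + t * y') ;
  g_left : exists2 C, 0 < C & forall q y, q <= - C -> 0 <= y ->
    g (q, y) <= y ^+ 2 / 2 + C * (1 + y) ;
  g_flux_le : forall q0 q1 y0 y1 h k, 0 < h -> 0 < k -> k <= y0 -> y0 <= y1 -> q0 <= q1 ->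
    h^-1 * itg y0 y1 (fun y => g (q1, y) - g (q1 - h, y) - (g (q0 + h, y) - g (q0, y))) <=
    k^-1 * itg q0 q1 (fun q => frc g (q, y0) - frc g (q, y0 - k)
                               - (frc g (q, y1 + k) - frc g (q, y1))) ;
  g_flux_ge : forall q0 q1 y0 y1 h k, 0 < h -> 0 < k -> 0 < y0 -> y0 + k <= y1 -> q0 <= q1 ->
    (forall y, y0 <= y <= y1 -> 0 < g (q0, y)) ->
    k^-1 * itg q0 q1 (fun q => frc g (q, y0 + k) - frc g (q, y0)
                               - (frc g (q, y1) - frc g (q, y1 - k))) <=
    h^-1 * itg y0 y1 (fun y => g (q1 + h, y) - g (q1, y) - (g (q0, y) - g (q0 - h, y))) }.

Lemma cont_parab : continuous parab.
Proof. by apply: contM; [apply: contX; exact: contS|exact: contC]. Qed.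

Lemma cont_frc g : continuous g -> continuous (frc g).
Proof. by move=> cg; apply: contB => //; exact: cont_parab. Qed.

Lemma dif_quotient_near (K : R -> R) x l e : is_derive x (1 : R) K l -> 0 < e ->
  exists2 d, 0 < d & forall h, 0 < h < d ->
    `|h^-1 * (K (x + h) - K x) - l| <= e /\ `|h^-1 * (K x - K (x - h)) - l| <= e.
Proof.
move=> /is_derive_bound H e0; have [d d0 Hd] := H e e0.
exists d => // h /andP[h0 hd]; split.
  have := Hd h; rewrite gtr0_norm// => /(_ hd) Hh.
  have -> : h^-1 * (K (x + h) - K x) - l = h^-1 * (K (x + h) - K x - h * l).
    by rewrite [RHS]mulrBr mulKf// gt_eqF.
  by rewrite normrM gtr0_norm ?invr_gt0// ler_pdivrMl// [h * e]mulrC.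
have := Hd (- h); rewrite normrN gtr0_norm// => /(_ hd) Hh.
have -> : h^-1 * (K x - K (x - h)) - l = h^-1 * - (K (x - h) - K x - - h * l).
  have -> : - (K (x - h) - K x - - h * l) = K x - K (x - h) - h * l by lra.
  by rewrite [RHS]mulrBr mulKf// gt_eqF.
by rewrite normrM gtr0_norm ?invr_gt0// ler_pdivrMl// normrN [h * e]mulrC.
Qed.

Lemma avg1_dif1 a h F : continuous F -> avg1 a (dif1 h F) = dif1 h (avg1 a F).
Proof.
move=> cF; have cT := @cont_trans R h 0 F cF.
rewrite (dif1E h F) (dif1E h (avg1 a F)) (avg1Z a _ (contB cT cF)) (avg1D a cT cF).
by rewrite (avg1_trans a h 0 cF).
Qed.

Lemma avg2_dif1 a h F : continuous F -> avg2 a (dif1 h F) = dif1 h (avg2 a F).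
Proof.
move=> cF; have cT := @cont_trans R h 0 F cF.
rewrite (dif1E h F) (dif1E h (avg2 a F)) (avg2Z a _ (contB cT cF)) (avg2D a cT cF).
by rewrite (avg2_trans a h 0 cF).
Qed.

Lemma avg1_dif2 a h F : continuous F -> avg1 a (dif2 h F) = dif2 h (avg1 a F).
Proof.
move=> cF; have cT := @cont_trans R 0 h F cF.
rewrite (dif2E h F) (dif2E h (avg1 a F)) (avg1Z a _ (contB cT cF)) (avg1D a cT cF).
by rewrite (avg1_trans a 0 h cF).
Qed.

Lemma avg2_dif2 a h F : continuous F -> avg2 a (dif2 h F) = dif2 h (avg2 a F).
Proof.
move=> cF; have cT := @cont_trans R 0 h F cF.
rewrite (dif2E h F) (dif2E h (avg2 a F)) (avg2Z a _ (contB cT cF)) (avg2D a cT cF).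
by rewrite (avg2_trans a 0 h cF).
Qed.

Lemma avg_dif1_trans a h s t s' t' F : continuous F ->
  avg1 a (avg2 a (fun z => trans s t (dif1 h F) z - trans s' t' (dif1 h F) z)) =
  fun z => trans s t (dif1 h (avg1 a (avg2 a F))) z - trans s' t' (dif1 h (avg1 a (avg2 a F))) z.
Proof.
move=> cF; have cD := cont_dif1 (a := h) cF.
have cT s0 t0 := @cont_trans R s0 t0 _ cD.
rewrite (avg2D a (cT _ _) (cT _ _)) (avg1D a (cont_avg2 (cT _ _)) (cont_avg2 (cT _ _))).
rewrite !(avg2_trans a _ _ cD) !(avg1_trans a _ _ (cont_avg2 cD)).
by rewrite (avg2_dif1 _ _ cF) (avg1_dif1 _ _ (cont_avg2 cF)).
Qed.

Lemma avg_dif2_trans a h s t s' t' F : continuous F -> 0 < a ->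
  avg1 a (avg2 a (fun z => trans s t (dif2 h F) z - trans s' t' (dif2 h F) z)) =
  fun z => trans s t (dif2 h (avg2 a (avg1 a F))) z - trans s' t' (dif2 h (avg2 a (avg1 a F))) z.
Proof.
move=> cF a0; have cD := cont_dif2 (a := h) cF.
have cT s0 t0 := @cont_trans R s0 t0 _ cD.
rewrite (avg2D a (cT _ _) (cT _ _)) (avg1D a (cont_avg2 (cT _ _)) (cont_avg2 (cT _ _))).
rewrite !(avg2_trans a _ _ cD) !(avg1_trans a _ _ (cont_avg2 cD)).
by rewrite (avg2_dif2 _ _ cF) (avg1_dif2 _ _ (cont_avg2 cF)) (avg12 _ a0 cF).
Qed.

Lemma itg_avg2 a F q y : 0 < a -> itg y (y + a) (fun t => F (q, t)) = a * avg2 a F (q, y).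
Proof. by move=> a0; rewrite /avg2 mulVKf// gt_eqF. Qed.

Lemma itg_avg1 a F q y : 0 < a -> itg q (q + a) (fun t => F (t, y)) = a * avg1 a F (q, y).
Proof. by move=> a0; rewrite /avg1 mulVKf// gt_eqF. Qed.

Lemma itgB4 (f1 f2 f3 f4 : R -> R) u v : continuous f1 -> continuous f2 -> continuous f3 ->
  continuous f4 -> itg u v (fun x => f1 x - f2 x - (f3 x - f4 x)) =
  itg u v f1 - itg u v f2 - (itg u v f3 - itg u v f4).
Proof.
move=> c1 c2 c3 c4; rewrite itgB; [|exact: contB..].
by rewrite (itgB u v c1 c2) (itgB u v c3 c4).
Qed.

(** Horizontal differences do not see a function of y alone. This is why the flux conditions may use
    [g] on the vertical sides and [frc g] on the horizontal ones. *)
Lemma lap_frcE a g z : continuous g ->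
  dif1 a (dif1 a (avg2 a (avg2 a g))) z = dif1 a (dif1 a (avg2 a (avg2 a (frc g)))) z.
Proof.
move=> cg.
have E : dif1 a (avg2 a (avg2 a (frc g))) = dif1 a (avg2 a (avg2 a g)).
  rewrite /frc (avg2D _ cg cont_parab) (avg2D _ (cont_avg2 cg) (cont_avg2 cont_parab)).
  apply/funext => w; rewrite /dif1.
  have PE : avg2 a (avg2 a parab) (w.1 + a, w.2) = avg2 a (avg2 a parab) w by [].
  by rewrite PE; congr (_ * _); rewrite opprB addrA subrK.
by rewrite -[in LHS]E.
Qed.

(** Three of the four averages of [smooth]; the remaining one is taken by the difference across a
    cell of side [a]. *)
Definition sm1 a F := avg1 a (avg2 a (avg2 a F)).
Definition sm2 a F := avg2 a (avg1 a (avg1 a F)).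

Lemma limit_le (x1 x2 x3 x4 z1 z2 z3 z4 e : R) : `|x1 - z1| <= e / 4 -> `|x2 - z2| <= e / 4 ->
  `|x3 - z3| <= e / 4 -> `|x4 - z4| <= e / 4 -> x1 - x2 <= x3 - x4 ->
  z1 - z2 + (z4 - z3) <= e.
Proof. by rewrite !ler_norml => /andP[? ?] /andP[? ?] /andP[? ?] /andP[? ?] ?; lra. Qed.

Lemma limit_ge (x1 x2 x3 x4 z1 z2 z3 z4 e : R) : `|x1 - z1| <= e / 4 -> `|x2 - z2| <= e / 4 ->
  `|x3 - z3| <= e / 4 -> `|x4 - z4| <= e / 4 -> x3 - x4 <= x1 - x2 ->
  0 <= z1 - z2 + (z4 - z3) + e.
Proof. by rewrite !ler_norml => /andP[? ?] /andP[? ?] /andP[? ?] /andP[? ?] ?; lra. Qed.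

Variables (c : R) (g : R * R -> R).
Hypothesis gs : gsol c g.
Let cg := g_cont gs.
Let cf := cont_frc cg.

(** The flux inequality over the cell with corner (P, Y) and side [a] relates [avg2 a g] to
    [avg1 a (frc g)]. Averaging over the corner in both directions produces [sm1] and [sm2]. *)
Lemma flux_avg_le a h k q y : 0 < a -> 0 < h -> 0 < k -> k <= y ->
  h^-1 * (sm1 a g (q + a, y) - sm1 a g (q + a - h, y)) - h^-1 * (sm1 a g (q + h, y) - sm1 a g (q, y)) <=
  k^-1 * (sm2 a (frc g) (q, y) - sm2 a (frc g) (q, y - k)) - k^-1 * (sm2 a (frc g) (q, y + a + k) - sm2 a (frc g) (q, y + a)).
Proof.
move=> a0 h0 k0 ky.
pose U := avg2 a g; pose W := avg1 a (frc g).
have cU : continuous U := cont_avg2 cg.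
have cW : continuous W := cont_avg1 cf.
pose A z := trans (a - h) 0 (dif1 h U) z - trans 0 0 (dif1 h U) z.
pose B z := trans 0 (- k) (dif2 k W) z - trans 0 a (dif2 k W) z.
have pt P Y : k <= Y -> A (P, Y) <= B (P, Y).
  move=> kY.
  have := @g_flux_le _ _ gs P (P + a) Y (Y + a) h k h0 k0 kY.
  rewrite !lerDl (ltW a0) => /(_ isT isT).
  rewrite (itgB4 _ _ (contP1 cg) (contP1 cg) (contP1 cg) (contP1 cg)).
  rewrite (itgB4 _ _ (contP2 cf) (contP2 cf) (contP2 cf) (contP2 cf)).
  rewrite !(itg_avg2 _ _ _ a0) !(itg_avg1 _ _ _ a0) -/U -/W -!mulrBr.
  rewrite !(mulrCA _ a) ler_pM2l//.
  rewrite /A /B /trans /dif1 /dif2 /= !addr0 -!mulrBr subrK.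
  by rewrite [P + (a - h)]addrA subrK.
have cA : continuous A.
  by apply: contB; apply: cont_trans; exact: cont_dif1.
have cB : continuous B.
  by apply: contB; apply: cont_trans; exact: cont_dif2.
have : avg1 a (avg2 a A) (q, y) <= avg1 a (avg2 a B) (q, y).
  apply: avg1_mono => //; [exact: cont_avg2|exact: cont_avg2|].
  move=> P _; apply: avg2_mono => // Y /= /andP[yY _]; apply: pt.
  exact: le_trans yY.
rewrite /A /B (avg_dif1_trans _ _ _ _ _ _ cU) (avg_dif2_trans _ _ _ _ _ cW a0) /trans /dif1 /dif2 /=.
rewrite !addr0 [q + (a - h)]addrA !subrK.
by [].
Qed.

Lemma flux_avg_ge a h k q y : 0 < a -> 0 < h -> 0 < k -> k <= a -> 0 < y ->
  (forall P Y, q <= P <= q + 2 * a -> y <= Y <= y + 2 * a -> 0 < g (P, Y)) ->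
  k^-1 * (sm2 a (frc g) (q, y + k) - sm2 a (frc g) (q, y)) - k^-1 * (sm2 a (frc g) (q, y + a) - sm2 a (frc g) (q, y + a - k)) <=
  h^-1 * (sm1 a g (q + a + h, y) - sm1 a g (q + a, y)) - h^-1 * (sm1 a g (q, y) - sm1 a g (q - h, y)).
Proof.
move=> a0 h0 k0 ka y0 gp.
pose U := avg2 a g; pose W := avg1 a (frc g).
have cU : continuous U := cont_avg2 cg.
have cW : continuous W := cont_avg1 cf.
pose A z := trans a 0 (dif1 h U) z - trans (- h) 0 (dif1 h U) z.
pose B z := trans 0 0 (dif2 k W) z - trans 0 (a - k) (dif2 k W) z.
have pt P Y : q <= P <= q + a -> y <= Y <= y + a -> B (P, Y) <= A (P, Y).
  move=> /andP[P1 P2] /andP[Y1 Y2].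
  have := @g_flux_ge _ _ gs P (P + a) Y (Y + a) h k h0 k0 (lt_le_trans y0 Y1).
  rewrite lerDl (ltW a0) lerD2l ka => /(_ isT isT).
  have h1 : forall Y0, Y <= Y0 <= Y + a -> 0 < g (P, Y0).
    move=> Y0 /andP[h1 h2]; apply: gp; apply/andP; split;
      move: a0 P1 P2 Y1 Y2 h1 h2; clear; lra.
  move=> /(_ h1).
  rewrite (itgB4 _ _ (contP1 cg) (contP1 cg) (contP1 cg) (contP1 cg)).
  rewrite (itgB4 _ _ (contP2 cf) (contP2 cf) (contP2 cf) (contP2 cf)).
  rewrite !(itg_avg2 _ _ _ a0) !(itg_avg1 _ _ _ a0) -/U -/W -!mulrBr.
  rewrite !(mulrCA _ a) ler_pM2l//.
  rewrite /A /B /trans /dif1 /dif2 /= !addr0 -!mulrBr subrK.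
  by rewrite [Y + (a - k)]addrA subrK.
have cA : continuous A.
  by apply: contB; apply: cont_trans; exact: cont_dif1.
have cB : continuous B.
  by apply: contB; apply: cont_trans; exact: cont_dif2.
have : avg1 a (avg2 a B) (q, y) <= avg1 a (avg2 a A) (q, y).
  apply: avg1_mono => //; [exact: cont_avg2|exact: cont_avg2|].
  by move=> P hP; apply: avg2_mono => // Y /= hY; apply: pt.
rewrite /A /B (avg_dif1_trans _ _ _ _ _ _ cU) (avg_dif2_trans _ _ _ _ _ cW a0) /trans /dif1 /dif2 /=.
rewrite !addr0 [y + (a - k)]addrA !subrK.
by [].
Qed.

Let dK1 a q y := @derive_avg1 R a (avg2 a (avg2 a g)) q y (cont_avg2 (cont_avg2 cg)).
Let dK2 a q y := @derive_avg2 R a (avg1 a (avg1 a (frc g))) q y (cont_avg1 (cont_avg1 cf)).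

Lemma lap_frc_split a q y :
  lap a (frc g) (q, y) = a^-1 * (dif1 a (avg2 a (avg2 a g)) (q + a, y) -
     dif1 a (avg2 a (avg2 a g)) (q, y)) +
   a^-1 * (dif2 a (avg1 a (avg1 a (frc g))) (q, y + a) -
     dif2 a (avg1 a (avg1 a (frc g))) (q, y)).
Proof. by rewrite /lap -lap_frcE. Qed.

(** As the steps h = k tend to 0, the quotients in [flux_avg_le] tend to derivatives of [sm1] and
    [sm2], which are difference quotients of step [a]; together they form [lap]. *)
Lemma lap_frc_le0 a q y : 0 < a -> 0 < y -> lap a (frc g) (q, y) <= 0.
Proof.
move=> a0 y0; rewrite lap_frc_split -mulrDr pmulr_rle0 ?invr_gt0//.
apply/ler_addgt0Pr => e e0; rewrite add0r.
have e40 : 0 < e / 4 by rewrite divr_gt0.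
have [d1 d10 H1] := dif_quotient_near (dK1 a (q + a) y) e40.
have [d2 d20 H2] := dif_quotient_near (dK1 a q y) e40.
have [d3 d30 H3] := dif_quotient_near (dK2 a q y) e40.
have [d4 d40 H4] := dif_quotient_near (dK2 a q (y + a)) e40.
(* The step also stays below [y], since the flux inequality evaluates at the height y - h. *)
pose h := Num.min (Num.min d1 d2) (Num.min (Num.min d3 d4) y) / 2.
have m0 : 0 < Num.min (Num.min d1 d2) (Num.min (Num.min d3 d4) y).
  by rewrite !lt_min d10 d20 d30 d40 y0.
have h0 : 0 < h by rewrite divr_gt0.
have : h < Num.min (Num.min d1 d2) (Num.min (Num.min d3 d4) y).
  by rewrite ltr_pdivrMr// ltr_pMr// ltr1n.
rewrite !lt_min => /andP[/andP[l1 l2] /andP[/andP[l3 l4] l5]].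
have [_ h1] := H1 h (introT andP (conj h0 l1)).
have [h2 _] := H2 h (introT andP (conj h0 l2)).
have [_ h3] := H3 h (introT andP (conj h0 l3)).
have [h4 _] := H4 h (introT andP (conj h0 l4)).
exact: (limit_le h1 h2 h3 h4 (@flux_avg_le a h h q y a0 h0 h0 (ltW l5))).
Qed.

Lemma lap_frc_ge0 a q y : 0 < a -> 0 < y ->
  (forall P Y, q <= P <= q + 2 * a -> y <= Y <= y + 2 * a -> 0 < g (P, Y)) ->
  0 <= lap a (frc g) (q, y).
Proof.
move=> a0 y0 gp; rewrite lap_frc_split -mulrDr pmulr_rge0 ?invr_gt0//.
apply/ler_addgt0Pr => e e0.
have e40 : 0 < e / 4 by rewrite divr_gt0.
have [d1 d10 H1] := dif_quotient_near (dK1 a (q + a) y) e40.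
have [d2 d20 H2] := dif_quotient_near (dK1 a q y) e40.
have [d3 d30 H3] := dif_quotient_near (dK2 a q y) e40.
have [d4 d40 H4] := dif_quotient_near (dK2 a q (y + a)) e40.
pose h := Num.min (Num.min d1 d2) (Num.min (Num.min d3 d4) a) / 2.
have m0 : 0 < Num.min (Num.min d1 d2) (Num.min (Num.min d3 d4) a).
  by rewrite !lt_min d10 d20 d30 d40 a0.
have h0 : 0 < h by rewrite divr_gt0.
have : h < Num.min (Num.min d1 d2) (Num.min (Num.min d3 d4) a).
  by rewrite ltr_pdivrMr// ltr_pMr// ltr1n.
rewrite !lt_min => /andP[/andP[l1 l2] /andP[/andP[l3 l4] l5]].
have [h1 _] := H1 h (introT andP (conj h0 l1)).
have [_ h2] := H2 h (introT andP (conj h0 l2)).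
have [h3 _] := H3 h (introT andP (conj h0 l3)).
have [_ h4] := H4 h (introT andP (conj h0 l4)).
exact: (limit_ge h1 h2 h3 h4 (@flux_avg_ge a h h q y a0 h0 h0 (ltW l5) y0 gp)).
Qed.

End Obstacle.

(** * Areas of plane regions *)

Section Area.
Context {R : realType}.
Local Notation mu := (@lebesgue_measure R).
Local Notation TR := (measurableTypeR R).
Implicit Types (f : R -> R) (A : set (TR * TR)).

Lemma itgEFin f a b : continuous f -> a <= b ->
  (itg a b f)%:E = (\int[mu]_(x in `[a, b]) (f x)%:E)%E.
Proof.
move=> cf ab; rewrite itg_Rintegral// /Rintegral fineK//.
apply: integrable_fin_num => //.
by apply: continuous_compact_integrable; [exact: segment_compact|exact: continuous_subspaceT].
Qed.

Lemma lebesgue2_xsection A : measurable A -> lebesgue2 A = (\int[mu]_x mu (xsection A x))%E.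
Proof. by move=> mA; rewrite /lebesgue2 measurable_mu_extE. Qed.

Lemma lebesgue2_ysection A : measurable A -> lebesgue2 A = (\int[mu]_y mu (ysection A y))%E.
Proof.
move=> mA; rewrite lebesgue2_xsection//.
have := indic_fubini_tonelli mu mu mA.
rewrite (_ : fubini_F mu _ = mu \o xsection A); last exact: indic_fubini_tonelli_FE.
by rewrite (_ : fubini_G mu _ = mu \o ysection A); last exact: indic_fubini_tonelli_GE.
Qed.

Lemma cont_measurable f : continuous f -> measurable_fun (setT : set TR) (f : TR -> TR).
Proof.
exact: continuous_measurable_fun.
Qed.

Lemma integral_le_itg (phi : R -> \bar R) f a b : a <= b -> continuous f ->
  measurable_fun (setT : set TR) phi -> (forall x, 0 <= phi x)%E ->
  (forall x, ~ (a <= x <= b)%R -> phi x = 0%E) -> (forall x, a <= x <= b -> (phi x <= (f x)%:E)%E) ->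
  (\int[mu]_x phi x <= (itg a b f)%:E)%E.
Proof.
move=> ab cf mphi phi0 phiz phile; rewrite (itgEFin cf ab).
have -> : (\int[mu]_x phi x = \int[mu]_(x in `[a, b]) phi x)%E.
  rewrite [RHS]integral_mkcond; apply: eq_integral => x _; rewrite patchE.
  case: ifPn => // /negP xab; apply: phiz => h; apply: xab.
  by rewrite inE /= in_itv.
apply: ge0_le_integral => //.
- exact: measurable_funTS.
- by apply/measurable_EFinP; apply: measurable_funTS; exact: cont_measurable.
Qed.

Lemma integral_ge_itg (phi : R -> \bar R) f a b : a <= b -> continuous f ->
  measurable_fun (setT : set TR) phi -> (forall x, 0 <= phi x)%E ->
  (forall x, a <= x <= b -> ((f x)%:E <= phi x)%E) ->
  ((itg a b f)%:E <= \int[mu]_x phi x)%E.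
Proof.
move=> ab cf mphi phi0 phige; rewrite (itgEFin cf ab).
apply: (@le_trans _ _ (\int[mu]_(x in `[a, b]) phi x)%E); last first.
  by apply: ge0_subset_integral => //; exact: measurable_funTS.
(* Comparing with [phi] calls for a nonnegative integrand, hence the positive part of [f] in
   between. *)
apply: (@le_trans _ _ (\int[mu]_(x in `[a, b]) (Num.max (f x) 0)%:E)%E).
  apply: le_integral => //.
  - by apply: continuous_compact_integrable; [exact: segment_compact|exact: continuous_subspaceT].
  - apply: continuous_compact_integrable; first exact: segment_compact.
    apply: continuous_subspaceT => x; apply: continuous_max; [exact: cf|exact: cvg_cst].
  - by move=> x _; rewrite lee_fin le_max lexx.
apply: ge0_le_integral => //.
- by move=> x _; rewrite lee_fin le_max lexx orbT.
- apply/measurable_EFinP; apply: measurable_funTS; apply: cont_measurable => x.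
  by apply: continuous_max; [exact: cf|exact: cvg_cst].
- exact: measurable_funTS.
- move=> x /= /[!in_itv]/= xab; rewrite EFin_max ge_max phi0 andbT; exact: phige.
Qed.

(** Cavalieri's principle: only the length [f] of the sections enters the integral, so the position
    [u] of the sections can be any function. In the lower bounds below [f] may change sign, an
    interval of negative length being empty. *)
Lemma lebesgue2_le1 A f u a b : measurable A -> a <= b -> continuous f ->
  (forall z, A z -> a <= z.1 <= b) ->
  (forall x, a <= x <= b -> 0 <= f x) ->
  (forall z, A z -> u z.1 <= z.2 <= u z.1 + f z.1) ->
  (lebesgue2 A <= (itg a b f)%:E)%E.
Proof.
move=> mA ab cf Aab f0 Au; rewrite lebesgue2_xsection//.
apply: integral_le_itg => //.
- exact: (measurable_fun_xsection mu mA).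
- move=> x xab; rewrite (_ : xsection A x = set0) ?measure0//.
  by apply/seteqP; split=> // y; rewrite /xsection /= inE => /Aab.
- move=> x xab; apply: (@le_trans _ _ (mu `[u x, u x + f x]%classic)).
    apply: le_measure; rewrite ?inE//; first exact: measurable_xsection.
    by move=> y; rewrite /xsection /= inE in_itv /= => /Au.
  rewrite lebesgue_measure_itv /= lte_fin; case: ifPn => _; last by rewrite lee_fin f0.
  by rewrite -EFinB lee_fin addrAC subrr add0r.
Qed.

Lemma lebesgue2_ge1 A f u a b : measurable A -> a <= b -> continuous f ->
  (forall x y, a <= x <= b -> u x < y < u x + f x -> A (x, y)) ->
  ((itg a b f)%:E <= lebesgue2 A)%E.
Proof.
move=> mA ab cf Au; rewrite lebesgue2_xsection//.
apply: integral_ge_itg => //.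
- exact: (measurable_fun_xsection mu mA).
- move=> x xab; apply: (@le_trans _ _ (mu `]u x, (u x + f x)[%classic)).
    rewrite lebesgue_measure_itv /= lte_fin; case: ifPn => [_|].
      by rewrite -EFinB lee_fin addrAC subrr add0r.
    by rewrite ltrDl -leNgt lee_fin.
  apply: le_measure; rewrite ?inE//; first exact: measurable_xsection.
  by move=> y; rewrite /xsection /= inE in_itv /= => h; apply: Au.
Qed.

Lemma lebesgue2_le2 A f u a b : measurable A -> a <= b -> continuous f ->
  (forall z, A z -> a <= z.2 <= b) ->
  (forall x, a <= x <= b -> 0 <= f x) ->
  (forall z, A z -> u z.2 <= z.1 <= u z.2 + f z.2) ->
  (lebesgue2 A <= (itg a b f)%:E)%E.
Proof.
move=> mA ab cf Aab f0 Au; rewrite lebesgue2_ysection//.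
apply: integral_le_itg => //.
- exact: (measurable_fun_ysection mu mA).
- move=> x xab; rewrite (_ : ysection A x = set0) ?measure0//.
  by apply/seteqP; split=> // y; rewrite /ysection /= inE => /Aab.
- move=> x xab; apply: (@le_trans _ _ (mu `[u x, u x + f x]%classic)).
    apply: le_measure; rewrite ?inE//; first exact: measurable_ysection.
    by move=> y; rewrite /ysection /= inE in_itv /= => /Au.
  rewrite lebesgue_measure_itv /= lte_fin; case: ifPn => _; last by rewrite lee_fin f0.
  by rewrite -EFinB lee_fin addrAC subrr add0r.
Qed.

Lemma lebesgue2_ge2 A f u a b : measurable A -> a <= b -> continuous f ->
  (forall x y, a <= y <= b -> u y < x < u y + f y -> A (x, y)) ->
  ((itg a b f)%:E <= lebesgue2 A)%E.
Proof.
move=> mA ab cf Au; rewrite lebesgue2_ysection//.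
apply: integral_ge_itg => //.
- exact: (measurable_fun_ysection mu mA).
- move=> x xab; apply: (@le_trans _ _ (mu `]u x, (u x + f x)[%classic)).
    rewrite lebesgue_measure_itv /= lte_fin; case: ifPn => [_|].
      by rewrite -EFinB lee_fin addrAC subrr add0r.
    by rewrite ltrDl -leNgt lee_fin.
  apply: le_measure; rewrite ?inE//; first exact: measurable_ysection.
  by move=> y; rewrite /ysection /= inE in_itv /= => h; apply: Au.
Qed.

Lemma lebesgue2_mono (A B : set (TR * TR)) : A `<=` B -> (lebesgue2 A <= lebesgue2 B)%E.
Proof. exact: le_mu_ext. Qed.

Lemma lebesgue2_set0 : lebesgue2 (set0 : set (TR * TR)) = 0%E.
Proof. exact: mu_ext0. Qed.

Lemma measurable_lt2 (f g : TR * TR -> TR) : measurable_fun setT f -> measurable_fun setT g ->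
  measurable [set z | (f z < g z)%R].
Proof.
move=> mf mg; rewrite -[X in measurable X]setTI.
have -> : [set z | f z < g z] = [set z | (EFin \o f) z < (EFin \o g) z]%E.
  by apply/seteqP; split=> z /=; rewrite lte_fin.
by apply: measurable_lte => //; exact/measurable_EFinP.
Qed.

Lemma measurable_le2 (f g : TR * TR -> TR) : measurable_fun setT f -> measurable_fun setT g ->
  measurable [set z | (f z <= g z)%R].
Proof.
move=> mf mg; rewrite -[X in measurable X]setTI.
have -> : [set z | f z <= g z] = [set z | (EFin \o f) z <= (EFin \o g) z]%E.
  by apply/seteqP; split=> z /=; rewrite lee_fin.
by apply: measurable_lee => //; exact/measurable_EFinP.
Qed.

Lemma measurable_comp1 f : continuous f -> measurable_fun setT (fun z : TR * TR => f z.1 : TR).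
Proof. by move=> cf; apply: measurableT_comp; [exact: cont_measurable|exact: measurable_fst]. Qed.

Lemma measurable_comp2 f : continuous f -> measurable_fun setT (fun z : TR * TR => f z.2 : TR).
Proof. by move=> cf; apply: measurableT_comp; [exact: cont_measurable|exact: measurable_snd]. Qed.

End Area.

(** * The partial Legendre transform *)

Section Quadrant.
Context {R : realType}.
Implicit Types (z : R * R).

Lemma closure_quadrant z : closure (@quadrant R) z <-> 0 <= z.1 /\ 0 <= z.2.
Proof.
split=> [cz|[z1 z2] B /nbhs_ballP[e /= e0 Be]].
  have key e : 0 < e -> exists y, quadrant y /\ ball z e y.
    by move=> e0; have [y []] := cz _ (nbhsx_ballx z e e0); exists y.
  split; rewrite leNgt; apply/negP => zn.
    have [|[y1 y2] [[/= p1 p2] [/= b1 b2]]] := key (- z.1); first by rewrite oppr_gt0.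
    by move: b1; rewrite /ball /= ltr_norml => /andP[h _]; move: h p1; clear; lra.
  have [|[y1 y2] [[/= p1 p2] [/= b1 b2]]] := key (- z.2); first by rewrite oppr_gt0.
  by move: b2; rewrite /ball /= ltr_norml => /andP[h _]; move: h p2; clear; lra.
exists (z.1 + e / 2, z.2 + e / 2); split.
  by split => /=; rewrite ltr_wpDl// divr_gt0.
apply: Be; split; rewrite /ball /= opprD addrA subrr sub0r normrN gtr0_norm ?divr_gt0//;
  by rewrite ltr_pdivrMr// ltr_pMr// ltr1n.
Qed.

Lemma normB_max (a b : R) : `|Num.max a 0 - Num.max b 0| <= `|a - b|.
Proof.
have h := ler_norm (a - b); have h' := ler_norm (b - a); rewrite distrC in h'.
have h0 := normr_ge0 (a - b).
by rewrite ler_norml; case: (leP a 0) => ?; case: (leP b 0) => ?; apply/andP; split; lra.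
Qed.

Variables (c : R) (u : R * R -> R).
Hypothesis hc : 0 < c < 1.
Hypothesis hu : convex_solution c u.

(** The projection onto the closed quadrant extends [u] continuously to the plane, where the lemmas
    on continuous functions apply. *)
Definition clamped z : R := u (Num.max z.1 0, Num.max z.2 0).

Lemma clampedE x y : 0 <= x -> 0 <= y -> clamped (x, y) = u (x, y).
Proof. by move=> x0 y0; rewrite /clamped /= !max_l. Qed.

Lemma cont_clamped : continuous clamped.
Proof.
have /subspace_continuousP cu := sol_continuous hu.
apply/cont2P => z e e0.
pose m : R * R := (Num.max z.1 0, Num.max z.2 0).
have Qm w : closure quadrant (Num.max w.1 0 : R, Num.max w.2 0 : R).
  by apply/closure_quadrant; rewrite /= !le_max !lexx !orbT.
have /cvgrPdist_lt /(_ _ e0) := cu m (Qm z).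
move=> /nbhs_ballP[d /= d0 Hd]; exists d => // w w1 w2.
rewrite /clamped -/m distrC; apply: Hd; last exact: Qm.
split; rewrite /ball /= distrC; apply: le_lt_trans (normB_max _ _) _ => //.
Qed.

Lemma sol_axis1 x : 0 <= x -> u (x, 0) = x ^+ 2 / 2.
Proof.
move=> x0; rewrite (sol_boundary hu); last first.
  split; first by apply/closure_quadrant.
  by move=> /interior_subset [] /= _; rewrite ltxx.
by rewrite /euclid_norm /= expr0n addr0 sqr_sqrtr// sqr_ge0.
Qed.

Lemma sol_axis2 y : 0 <= y -> u (0, y) = y ^+ 2 / 2.
Proof.
move=> y0; rewrite (sol_boundary hu); last first.
  split; first by apply/closure_quadrant.
  by move=> /interior_subset [] /=; rewrite ltxx.
by rewrite /euclid_norm /= expr0n add0r sqr_sqrtr// sqr_ge0.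
Qed.

Lemma sol_conv x1 x2 y1 y2 t : 0 <= x1 -> 0 <= x2 -> 0 <= y1 -> 0 <= y2 -> 0 <= t <= 1 ->
  u ((1 - t) * x1 + t * y1, (1 - t) * x2 + t * y2) <= (1 - t) * u (x1, x2) + t * u (y1, y2).
Proof.
move=> x10 x20 y10 y20 t01.
have h1 : (y1, y2) \in closure (@quadrant R) by rewrite inE; apply/closure_quadrant.
have h2 : (x1, x2) \in closure (@quadrant R) by rewrite inE; apply/closure_quadrant.
have /andP[t0 t1] := t01.
have H : u (t * y1 + (1 - t) * x1, t * y2 + (1 - t) * x2) <=
    t * u (y1, y2) + (1 - t) * u (x1, x2).
  exact: (sol_convex hu (Itv01 t0 t1) h1 h2).
by rewrite addrC [(1 - t) * x2 + _]addrC [leRHS]addrC.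
Qed.

Lemma sqrtc_gt0 : 0 < Num.sqrt c.
Proof. by rewrite sqrtr_gt0; case/andP: hc. Qed.

Lemma sqrtc_sqr : Num.sqrt c * Num.sqrt c = c.
Proof. by rewrite -expr2 sqr_sqrtr// ltW//; case/andP: hc. Qed.

Local Notation rc := (Num.sqrt c).
Let rc0 := sqrtc_gt0.

(** On the axis u = x^2 / 2, so at x = w = 2 M + 2 and for small heights u exceeds M w. Since u
    vanishes at the origin, convexity along rays carries this bound to points n times farther, whose
    heights may be n times larger. *)
Lemma sol_coercive M B : 0 <= M -> 0 <= B ->
  exists2 X, 0 < X & forall x y, X <= x -> 0 <= y <= B -> M * x <= u (x, y).
Proof.
move=> M0 B0; pose w := 2 * M + 2.
have w0 : 0 < w by rewrite /w ltr_wpDl// mulr_ge0.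
have [d d0 Hd] := (cont2P _).1 cont_clamped (w, 0) w w0.
(* With n at least 2 B / d the contracted height y / n falls below [d]. *)
pose n0 := Num.max 1 (2 * B / d).
have n01 : 1 <= n0 by rewrite le_max lexx.
exists (n0 * w); first by rewrite mulr_gt0// (lt_le_trans ltr01).
move=> x y xX /andP[y0 yB].
pose n := x / w; have xE : x = n * w by rewrite /n mulfVK// gt_eqF.
have nn : n0 <= n by rewrite /n ler_pdivlMr.
have n1 : 1 <= n := le_trans n01 nn.
have n_gt0 : 0 < n := lt_le_trans ltr01 n1.
have ynd : y / n < d.
  rewrite ltr_pdivrMr//.
  have : 2 * B / d <= n by apply: le_trans nn; rewrite le_max lexx orbT.
  rewrite ler_pdivrMr// [n * d]mulrC => h.
  by have := mulr_gt0 d0 n_gt0; move: h yB; clear; lra.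
have yn0 : 0 <= y / n by rewrite divr_ge0// ltW.
have := Hd (w, y / n); rewrite /= subrr normr0 subr0 ger0_norm// => /(_ d0 ynd).
have w0' := ltW w0.
rewrite (clampedE w0' yn0) (clampedE w0' (lexx 0)) (sol_axis1 w0') ltr_norml => /andP[lo _].
have x0 : 0 <= x by rewrite xE mulr_ge0// ltW.
have ninv : 0 <= n^-1 <= 1 by rewrite invr_ge0 ltW//= invf_le1.
have := sol_conv (lexx 0) (lexx 0) x0 y0 ninv.
rewrite !mulr0 !add0r sol_axis1// expr0n mul0r mulr0 add0r.
have -> : n^-1 * x = w by rewrite xE mulKf// gt_eqF.
rewrite [n^-1 * y]mulrC => hi.
have : M * w < n^-1 * u (x, y).
  apply: lt_le_trans hi.
  have E : w ^+ 2 / 2 = (M + 1) * w by rewrite /w; lra.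
  by move: lo; rewrite E; clear; lra.
rewrite ltr_pdivlMl// => h; apply/ltW; apply: le_lt_trans h.
by rewrite xE mulrCA.
Qed.

Definition legf q y x : R := rc * q * x - u (x, y).

Definition is_opt q y x := 0 <= x /\ forall x', 0 <= x' -> legf q y x' <= legf q y x.

Lemma opt_exists Q B : 0 <= B -> exists2 X, 0 < X & forall q y, q <= Q -> 0 <= y <= B ->
  exists2 x, 0 <= x <= X & is_opt q y x.
Proof.
move=> B0; pose M := rc * `|Q| + 1.
have M0 : 0 <= M by rewrite addr_ge0// mulr_ge0// ltW.
have [X0 X00 HX] := sol_coercive M0 B0.
(* Beyond [X] the objective is at most - x' <= - B^2, which is no better than its value - y^2 / 2 at
   x = 0. *)
pose X := Num.max X0 (B ^+ 2).
exists X; first by rewrite lt_max X00.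
move=> q y qQ /andP[y0 yB].
have X_ge0 : 0 <= X by rewrite le_max ltW.
have cl : continuous (fun x => rc * q * x - clamped (x, y)).
  apply: contB; first by apply: contM; [exact: contC|exact: contI].
  exact: contP2 cont_clamped.
have [x xX xmax] := EVT_max X_ge0 (continuous_subspaceT cl).
rewrite in_itv /= in xX; exists x => //.
have /andP[x0 xX'] := xX.
split=> // x' x'0.
have [x'X|Xx'] := leP x' X.
  by have := xmax x'; rewrite in_itv /= x'0 x'X !clampedE// => /(_ isT).
apply: (@le_trans _ _ (legf q y 0)); last first.
  by have := xmax 0; rewrite in_itv /= lexx X_ge0 !clampedE// => /(_ isT).
have h1 : M * x' <= u (x', y).
  apply: HX; last by rewrite y0.
  by apply: le_trans (ltW Xx'); rewrite le_max lexx.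
have h2 : B ^+ 2 <= x' by apply: le_trans (ltW Xx'); rewrite le_max lexx orbT.
have h3 : y ^+ 2 <= B ^+ 2 by rewrite ler_pXn2r// nnegrE.
have h4 : rc * q * x' <= rc * `|Q| * x'.
  apply: ler_wpM2r => //; apply: ler_wpM2l; first exact: ltW.
  exact: le_trans (ler_norm _).
rewrite /legf sol_axis2// mulr0 sub0r.
have h5 : 0 <= y ^+ 2 := sqr_ge0 y.
by move: h1 h2 h3 h4 h5; rewrite /M mulrDl mul1r; clear; lra.
Qed.

Definition opt q y : R := xget 0 (is_opt q y).
Definition leg q y : R := legf q y (opt q y).

Lemma optP q y : 0 <= y -> is_opt q y (opt q y).
Proof.
move=> y0; have [X X0 H] := opt_exists q y0.
have [|x _ xo] := H q y (lexx q); first by rewrite y0 lexx.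
by rewrite /opt; exact: xgetPex (ex_intro _ x xo).
Qed.

Lemma leg_ge q y x : 0 <= y -> 0 <= x -> legf q y x <= leg q y.
Proof. by move=> y0 x0; have [_] := optP q y0; apply. Qed.

Lemma leg_opt q y x : 0 <= y -> is_opt q y x -> leg q y = legf q y x.
Proof.
move=> y0 [x0 xo]; apply/eqP; rewrite eq_le leg_ge// andbT.
by apply: xo; have [] := optP q y0.
Qed.

(** Keeping the maximiser [x] while [q] changes bounds the new supremum from below. Thus [rc * x] is
    a subgradient in [q], which replaces the derivative of [leg] in what follows. *)
Lemma leg_subgrad q q' y x : 0 <= y -> is_opt q y x ->
  leg q y + rc * (q' - q) * x <= leg q' y.
Proof.
move=> y0 xo; rewrite (leg_opt y0 xo).
by apply: le_trans (leg_ge q' y0 xo.1); rewrite /legf; lra.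
Qed.

Lemma leg_mono q q' y : 0 <= y -> q <= q' -> leg q y <= leg q' y.
Proof.
move=> y0 qq; apply: le_trans (leg_subgrad q' y0 (optP q y0)).
by rewrite lerDl mulr_ge0//; [rewrite mulr_ge0 ?subr_ge0// ltW|have [] := optP q y0].
Qed.

Lemma opt_mono q q' y x x' : 0 <= y -> q < q' -> is_opt q y x -> is_opt q' y x' -> x <= x'.
Proof.
move=> y0 qq xo xo'.
have h1 := leg_subgrad q' y0 xo; have h2 := leg_subgrad q y0 xo'.
have : 0 <= (rc * (q' - q)) * (x' - x) by move: h1 h2; clear; lra.
by rewrite pmulr_rge0 ?subr_ge0// mulr_gt0// subr_gt0.
Qed.

Lemma leg_slope_left q0 q y x h : 0 <= y -> 0 < h -> q0 <= q -> is_opt q y x ->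
  leg q0 y - leg (q0 - h) y <= rc * h * x.
Proof.
move=> y0 h0 qq xo.
have [x' xo' x'x] : exists2 x', is_opt q0 y x' & x' <= x.
  have [E|ne] := eqVneq q0 q; first by exists x => //; rewrite E.
  exists (opt q0 y); first exact: optP.
  by apply: (opt_mono y0 _ (optP q0 y0) xo); rewrite lt_neqAle ne.
have := leg_subgrad (q0 - h) y0 xo'.
have : rc * h * x' <= rc * h * x by rewrite ler_pM2l ?mulr_gt0.
by clear; lra.
Qed.

Lemma leg_slope_right q q1 y x h : 0 <= y -> 0 < h -> q <= q1 -> is_opt q y x ->
  rc * h * x <= leg (q1 + h) y - leg q1 y.
Proof.
move=> y0 h0 qq xo.
have [x' xo' x'x] : exists2 x', is_opt q1 y x' & x <= x'.
  have [E|ne] := eqVneq q q1; first by exists x => //; rewrite -E.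
  exists (opt q1 y); first exact: optP.
  by apply: (opt_mono y0 _ xo (optP q1 y0)); rewrite lt_neqAle ne.
have := leg_subgrad (q1 + h) y0 xo'.
have : rc * h * x <= rc * h * x' by rewrite ler_pM2l ?mulr_gt0.
by clear; lra.
Qed.

Lemma leg_ge_parab q y : 0 <= y -> - (y ^+ 2 / 2) <= leg q y.
Proof.
by move=> y0; have := leg_ge q y0 (lexx 0); rewrite /legf sol_axis2// mulr0 sub0r.
Qed.

Lemma leg_conv y q q' t : 0 <= y -> 0 <= t <= 1 ->
  leg ((1 - t) * q + t * q') y <= (1 - t) * leg q y + t * leg q' y.
Proof.
move=> y0 /andP[t0 t1]; pose p := (1 - t) * q + t * q'.
have po := optP p y0.
have h1 := leg_subgrad q y0 po; have h2 := leg_subgrad q' y0 po.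
have t1' : 0 <= 1 - t by rewrite subr_ge0.
have h3 := ler_wpM2l t1' h1; have h4 := ler_wpM2l t0 h2.
rewrite -/p; have -> : leg p y = (1 - t) * (leg p y + rc * (q - p) * opt p y) +
   t * (leg p y + rc * (q' - p) * opt p y).
  by rewrite /p; ring.
exact: lerD.
Qed.

(** Joint convexity of [u] makes the objective jointly concave in (x, y), and a supremum over x of
    such a function is concave in y. *)
Lemma leg_conc q y y' t : 0 <= y -> 0 <= y' -> 0 <= t <= 1 ->
  (1 - t) * leg q y + t * leg q y' <= leg q ((1 - t) * y + t * y').
Proof.
move=> y0 y0' t01; have /andP[t0 t1] := t01.
have t1' : 0 <= 1 - t by rewrite subr_ge0.
have [x0 _] := optP q y0; have [x0' _] := optP q y0'.
have z0 : 0 <= (1 - t) * opt q y + t * opt q y' by rewrite addr_ge0// mulr_ge0.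
have w0 : 0 <= (1 - t) * y + t * y' by rewrite addr_ge0// mulr_ge0.
apply: le_trans (leg_ge q w0 z0); rewrite /leg /legf.
by have := sol_conv x0 y0 x0' y0' t01; lra.
Qed.

Lemma leg0 q : leg q 0 = c * (Num.max q 0) ^+ 2 / 2.
Proof.
have [x0 _] := optP q (lexx 0).
have m0 : 0 <= Num.max q 0 by rewrite le_max lexx orbT.
have mq : rc * q * Num.max q 0 = rc * Num.max q 0 * Num.max q 0.
  by rewrite /Num.max; case: ltP => // _; rewrite !mulr0.
apply/eqP; rewrite eq_le; apply/andP; split.
  rewrite /leg /legf sol_axis1//.
  have -> : c * Num.max q 0 ^+ 2 / 2 = (rc * Num.max q 0) ^+ 2 / 2.
    by rewrite exprMn (expr2 rc) sqrtc_sqr.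
  have h1 : rc * q * opt q 0 <= rc * Num.max q 0 * opt q 0.
    by rewrite ler_wpM2r// ler_pM2l// le_max lexx.
  have := sqr_ge0 (rc * Num.max q 0 - opt q 0).
  by move: h1; clear; set a := rc * _ * _; set b := rc * Num.max q 0; lra.
have z0 : 0 <= rc * Num.max q 0 by rewrite mulr_ge0// ltW.
apply: le_trans (leg_ge q (lexx 0) z0); rewrite /legf sol_axis1//.
have -> : rc * q * (rc * Num.max q 0) = c * Num.max q 0 ^+ 2.
  by rewrite mulrCA mq mulrA mulrA sqrtc_sqr expr2 mulrA.
by rewrite exprMn (expr2 rc) sqrtc_sqr; lra.
Qed.

Lemma leg_cont : continuous (fun z : R * R => leg z.1 (Num.max z.2 0)).
Proof.
apply/cont2P => -[q0 y0] e e0 /=.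
have [B BE] : exists B : R, B = `|y0| + 1 by eexists.
have [Q QE] : exists Q : R, Q = `|q0| + 1 by eexists.
have B0 : 0 <= B by rewrite BE addr_ge0.
have [X X0 HX] := opt_exists Q B0.
have e20 : 0 < e / 2 by rewrite divr_gt0.
have [d d0 Hd] := unif2 (Num.max X B) cont_clamped e20.

have k0 : 0 < 2 * rc * X by rewrite !mulr_gt0.
exists (Num.min 1 (Num.min d (e / (2 * rc * X)))); first by rewrite !lt_min ltr01 d0 divr_gt0.
move=> [q y] /=; rewrite !lt_min => /andP[q1 /andP[_ q3]] /andP[y1 /andP[y2 _]].
have nq : q <= Q.
  have := ler_norm (q - q0); have := ler_norm q0; lra.
have nq0 : q0 <= Q by have := ler_norm q0; lra.
have m0 a : 0 <= Num.max a (0 : R) by rewrite le_max lexx orbT.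
have my : 0 <= Num.max y 0 <= B.
  rewrite m0 ge_max B0 andbT; have := ler_norm (y - y0); have := ler_norm y0.
  lra.
have my0 : 0 <= Num.max y0 0 <= B.
  by rewrite m0 ge_max B0 andbT; have := ler_norm y0; lra.
have ydiff : `|Num.max y 0 - Num.max y0 0| < d by apply: le_lt_trans (normB_max _ _) _.
have uclose a b x : 0 <= a <= B -> 0 <= b <= B -> `|a - b| < d -> 0 <= x <= X ->
    `|u (x, a) - u (x, b)| < e / 2.
  move=> /andP[a0 aB] /andP[b0 bB] ab /andP[x0 xX].
  rewrite -!clampedE//; apply: Hd => /=.
  - by rewrite ger0_norm// le_max xX.
  - by rewrite ger0_norm// le_max bB orbT.
  - by rewrite subrr normr0.
  - by [].
have qclose x : 0 <= x <= X -> `|rc * (q - q0) * x| < e / 2.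
  move=> /andP[x0 xX]; rewrite !normrM (ger0_norm (ltW rc0)) (ger0_norm x0).
  have h : rc * `|q - q0| * x <= rc * `|q - q0| * X by rewrite ler_wpM2l// mulr_ge0// ltW.
  apply: le_lt_trans h _; rewrite ltr_pdivlMr// in q3.
  by rewrite ltr_pdivlMr//; move: q3; clear; lra.
(* Each maximiser, inserted into the other objective, gives one of the two bounds. Both lie in
   [0, X] because [X] depends only on the bounds [Q] and [B]. *)
have [x xX xo] := HX q _ nq my; have [x' xX' xo'] := HX q0 _ nq0 my0.
have y0m : 0 <= Num.max y 0 by case/andP: my.
have y00m : 0 <= Num.max y0 0 by case/andP: my0.
rewrite ltr_norml; apply/andP; split.
  rewrite (leg_opt y00m xo').
  have := leg_ge q y0m xo'.1; rewrite /legf.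
  have := uclose _ _ _ my my0 ydiff xX'; have := qclose _ xX'.
  by rewrite !ltr_norml => /andP[? ?] /andP[? ?] ?; lra.
rewrite (leg_opt y0m xo).
have := leg_ge q0 y00m xo.1; rewrite /legf.
have := uclose _ _ _ my my0 ydiff xX; have := qclose _ xX.
by rewrite !ltr_norml => /andP[? ?] /andP[? ?] ?; lra.
Qed.

End Quadrant.

(** * Solutions of the Monge-Ampere equation as solutions of the free boundary problem *)

Section LegendreSolution.
Context {R : realType}.
Variables (c : R) (u : R * R -> R).
Hypothesis hc : 0 < c < 1.
Hypothesis hu : convex_solution c u.
Local Notation rc := (Num.sqrt c).
Local Notation lg := (leg c u).
Local Notation TR := (measurableTypeR R).
Let rc0 := sqrtc_gt0 hc.

(** With y^2 / 2 added the competitor x = 0 has value 0, so that for y >= 0 the function is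
    nonnegative and vanishes exactly where x = 0 is a maximiser. *)
Definition gof (z : R * R) : R := lg z.1 (Num.max z.2 0) + (Num.max z.2 0) ^+ 2 / 2.

Lemma gofE q y : 0 <= y -> gof (q, y) = lg q y + y ^+ 2 / 2.
Proof. by move=> y0; rewrite /gof /= max_l. Qed.

Lemma frc_gof q y : 0 <= y -> frc gof (q, y) = lg q y.
Proof. by move=> y0; rewrite /frc gofE// /parab /= addrK. Qed.

Lemma gof_diff q q' y : 0 <= y -> gof (q, y) - gof (q', y) = lg q y - lg q' y.
Proof. by move=> y0; rewrite !gofE//; lra. Qed.

Lemma conc_slope (L : R -> R) (a b d e : R) :
  (forall x y t, 0 <= x -> 0 <= y -> 0 <= t <= 1 ->
     (1 - t) * L x + t * L y <= L ((1 - t) * x + t * y)) ->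
  0 <= a -> a < b -> b <= d -> d < e -> (L e - L d) * (b - a) <= (L b - L a) * (e - d).
Proof.
move=> cL a0 ab bd de.
have three x y z : 0 <= x -> x < y -> y < z -> (L z - L y) * (y - x) <= (L y - L x) * (z - y).
  move=> x0 xy yz; have zx : 0 < z - x by rewrite subr_gt0 (lt_trans xy).
  have t01 : 0 <= (y - x) / (z - x) <= 1.
    rewrite divr_ge0 ?(ltW zx) ?subr_ge0 ?(ltW xy)//=.
    by rewrite ler_pdivrMr// mul1r lerD2r ltW.
  have z0 : 0 <= z by rewrite (le_trans x0)// ltW// (lt_trans xy).
  have := cL x z _ x0 z0 t01.
  have -> : (1 - (y - x) / (z - x)) * x + (y - x) / (z - x) * z = y.
    have -> : (1 - (y - x) / (z - x)) * x + (y - x) / (z - x) * z =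
        x + (y - x) * ((z - x) / (z - x)) by ring.
    by rewrite divff ?gt_eqF// mulr1 addrC subrK.
  rewrite -(ler_pM2r zx).
  have -> : ((1 - (y - x) / (z - x)) * L x + (y - x) / (z - x) * L z) * (z - x) =
     (z - x) * L x + (y - x) * ((z - x) / (z - x)) * (L z - L x) by ring.
  rewrite divff ?gt_eqF// mulr1 => h; rewrite -subr_ge0.
  by move: h; rewrite -subr_ge0 => h; apply: le_trans h _; rewrite le_eqVlt; apply/orP; left; apply/eqP; ring.
have b0 : 0 <= b by rewrite (le_trans a0)// ltW.
have [bd'|bd'] := eqVneq b d; first by rewrite -bd'; apply: three => //; rewrite bd'.
have bd2 : b < d by rewrite lt_neqAle bd'.
have h1 := three a b d a0 ab bd2; have h2 := three b d e b0 bd2 de.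
have p1 : 0 < b - a by rewrite subr_gt0.
have p2 : 0 < e - d by rewrite subr_gt0.
have p3 : 0 < d - b by rewrite subr_gt0.
rewrite -(ler_pM2r p3).
have h1' := ler_wpM2r (ltW p2) h1; have h2' := ler_wpM2r (ltW p1) h2.
apply: (le_trans (y := (L d - L b) * (e - d) * (b - a))).
  by move: h2'; rewrite (mulrAC (L e - L d)).
by move: h1'; rewrite (mulrAC (L b - L a)) (mulrAC (L d - L b)).
Qed.

Let cleg q : forall x y t, 0 <= x -> 0 <= y -> 0 <= t <= 1 ->
     (1 - t) * lg q x + t * lg q y <= lg q ((1 - t) * x + t * y).
Proof. by move=> x y t; exact: leg_conc. Qed.

Lemma subdiff_leg q r x y : 0 <= x -> 0 <= y ->
  subdifferential quadrant u (x, y) (rc * q, r) ->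
  is_opt c u q y x /\ forall y', 0 <= y' -> lg q y' <= lg q y - r * (y' - y).
Proof.
move=> x0 y0 sub.
(* The subdifferential tests only points of the open quadrant; continuity carries the inequality to
   the closure. *)
have sub' z1 z2 : 0 <= z1 -> 0 <= z2 ->
    u (x, y) + rc * q * (z1 - x) + r * (z2 - y) <= u (z1, z2).
  move=> z10 z20; apply/ler_addgt0Pr => e e0.
  pose F z := clamped u z - rc * q * (z.1 - x) - r * (z.2 - y).
  have cF : continuous F.
    apply: contB; first apply: contB.
    - exact: (cont_clamped hu).
    - apply: contM; first exact: contC.
      by apply: contB; [exact: contF|exact: contC].
    - apply: contM; first exact: contC.
      by apply: contB; [exact: contS|exact: contC].
  have [d d0 Hd] := (cont2P F).1 cF (z1, z2) e e0.
  have dd : 0 < d / 2 by rewrite divr_gt0.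
  have ad : `|d / 2| < d by rewrite gtr0_norm// ltr_pdivrMr// ltr_pMr// ltr1n.
  have := Hd (z1 + d / 2, z2 + d / 2); rewrite /= ![_ + d / 2]addrC !addrK => /(_ ad ad).
  have p1 : 0 < d / 2 + z1 by rewrite ltr_wpDr.
  have p2 : 0 < d / 2 + z2 by rewrite ltr_wpDr.
  have := sub (d / 2 + z1, d / 2 + z2) (conj p1 p2).
  rewrite /F /= !clampedE ?(ltW p1) ?(ltW p2)//.
  by rewrite ltr_norml => ? /andP[? ?]; lra.
have xo : is_opt c u q y x.
  split=> // x' x'0; rewrite /legf.
  by have := sub' x' y x'0 y0; rewrite subrr mulr0 addr0; lra.
split=> // y' y'0; rewrite (leg_opt hc hu y0 xo).
have [po0 _] := optP hc hu q y'0.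
move: (sub' _ y' po0 y'0); rewrite /leg /legf; lra.
Qed.


(** The equation gives the normal image of the square [1, 2]^2 a measure at least c > 0, so it
    contains some slope, and the corresponding affine function lies below [u] everywhere. *)
Lemma subgrad_exists : exists K p1 p2 : R, 0 <= K /\ forall x y, 0 <= x -> 0 <= y ->
  p1 * x + p2 * y - K <= u (x, y).
Proof.
pose E : set (TR * TR) := [set z | 1 <= z.1 <= 2 /\ 1 <= z.2 <= 2].
have mE : measurable E.
  have -> : E = ([set z | (1 : R) <= z.1] `&` [set z | z.1 <= (2 : R)]) `&`
      ([set z | (1 : R) <= z.2] `&` [set z | z.2 <= (2 : R)]).
    apply/seteqP; split=> z; rewrite /E /=; first by move=> [/andP[? ?] /andP[? ?]].
    by move=> [[-> ->] [-> ->]].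
  have cst (k : R) : measurable_fun setT (fun _ : TR * TR => k : TR) by exact: measurable_cst.
  by apply: measurableI; apply: measurableI; apply: measurable_le2 => //;
     (exact: measurable_fst || exact: measurable_snd).
have EQ : E `<=` quadrant.
  by move=> z [/andP[z1 _] /andP[z2 _]]; split; rewrite (lt_le_trans ltr01).
have Epos : (1%:E <= lebesgue2 E)%E.
  have -> : (1 : R) = itg 1 2 (fun=> 1) by rewrite itg_cst mul1r; lra.
  apply: (@lebesgue2_ge1 _ _ _ (fun=> 1)) => //; first by rewrite ler1n.
    by move=> x; exact: cvg_cst.
  move=> x y xx /andP[y1 y2]; split=> //=; rewrite (ltW y1) /=; lra.
have [K0|] := pselect (normal_image quadrant u E = set0).
  have := sol_equation hu mE EQ; rewrite K0 lebesgue2_set0 => /esym E0.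
  have c0 : 0 < c by case/andP: hc.
  have : (c%:E * 1%:E <= c%:E * lebesgue2 E)%E by rewrite lee_pmul2l.
  by rewrite E0 mule1 lee_fin leNgt c0.
move=> /eqP/set0P[[p1 p2] [[x0 y0] /EQ[/= x00 y00] sub]].
have p1E : p1 = rc * (p1 / rc) by rewrite mulrC divfK// gt_eqF.
rewrite p1E in sub.
have [xo hy] := subdiff_leg (ltW x00) (ltW y00) sub.
pose K := p1 * x0 + p2 * y0 - u (x0, y0).
exists `|K|, p1, p2; split=> // x y x1 y1.
have h1 := leg_ge hc hu (p1 / rc) y1 x1.
have h2 := hy _ y1; rewrite (leg_opt hc hu (ltW y00) xo) in h2.
rewrite /legf -p1E in h1 h2.
have := ler_norm K; rewrite /K => h3; apply: le_trans (_ : p1 * x + p2 * y - K <= _).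
  by rewrite lerD2l lerN2 /K.
by rewrite /K; lra.
Qed.

(** With an affine minorant of slope (p1, p2), as soon as rc q <= p1 the terms in x have the right
    sign and only K - p2 y remains. This bound later keeps the two phases small near the angle
    pi. *)
Lemma leg_left : exists2 C, 0 < C & forall q y, q <= - C -> 0 <= y -> lg q y <= C * (1 + y).
Proof.
have [K [p1 [p2 [K0 H]]]] := subgrad_exists.
pose C := K + `|p2| + `|p1| / rc + 1.
have C0 : 0 < C by rewrite ltr_wpDl// !addr_ge0// divr_ge0// ltW.
exists C => // q y qC y0; rewrite /leg /legf.
have [po _] := optP hc hu q y0.
have h1 : rc * q <= p1.
  have : rc * q <= rc * - C by rewrite ler_pM2l.
  move=> h; apply: le_trans h _.
  have h2 : `|p1| / rc <= C by rewrite /C; have := normr_ge0 p2; lra.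
  rewrite ler_pdivrMr// in h2.
  by have := ler_norm (- p1); rewrite normrN; lra.
have h2 : rc * q * opt c u q y <= p1 * opt c u q y by rewrite ler_wpM2r.
have h3 := H _ _ po y0.
have h4 : K <= C by rewrite /C; have := normr_ge0 p2; have := divr_ge0 (normr_ge0 p1) (ltW rc0); lra.
have h5 : - p2 <= C.
  have := ler_norm (- p2); rewrite normrN /C.
  by have := divr_ge0 (normr_ge0 p1) (ltW rc0); lra.
have h6 : - p2 * y <= C * y by rewrite ler_wpM2r.
by lra.
Qed.

Lemma cont_leg q : continuous (fun y : R => lg q (Num.max y 0)).
Proof. exact: (contP1 (x := q) (leg_cont hc hu)). Qed.

Lemma max0E (y : R) : 0 <= y -> Num.max y 0 = y.
Proof. by move=> y0; rewrite max_l. Qed.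

Let meas_region (p0 p1 : R) (a b : R -> R) : continuous a -> continuous b ->
  measurable ([set w : TR * TR | p0 <= w.1 <= p1 /\ a w.1 <= w.2 <= b w.1] : set (TR * TR)).
Proof.
move=> ca cb.
have cst (k : R) : measurable_fun setT (fun _ : TR * TR => k : TR) by exact: measurable_cst.
have -> : [set w : TR * TR | p0 <= w.1 <= p1 /\ a w.1 <= w.2 <= b w.1] =
   ([set z | p0 <= z.1] `&` [set z | z.1 <= p1]) `&`
      ([set z | a z.1 <= z.2] `&` [set z | z.2 <= b z.1]).
  apply/seteqP; split=> z /=; first by move=> [/andP[? ?] /andP[? ?]].
  by move=> [[-> ->] [-> ->]].
have m1 := @measurable_fst _ _ TR TR; have m2 := @measurable_snd _ _ TR TR.
have ma := measurable_comp1 ca; have mb := measurable_comp1 cb.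
by apply: measurableI; apply: measurableI; apply: measurable_le2.
Qed.


Lemma cont_gof : continuous gof.
Proof.
apply: contD; first exact: (leg_cont hc hu).
apply: contM; last exact: contC.
apply: contX => z; apply: continuous_max; [exact: contS|exact: cvg_cst].
Qed.

(** [slope1] is a difference quotient in q divided by sqrt c, standing for the maximiser x. [slope2]
    is one in y at q = p / sqrt c, standing for minus the second component of the gradient of
    [u]. *)
Let slope1 (h q q' y : R) := (h * rc)^-1 * (gof (q, y) - gof (q', y)).
Let slope2 (k y y' p : R) := k^-1 * (frc gof (p / rc, y) - frc gof (p / rc, y')).

Let cont_slope1 h q q' : continuous (slope1 h q q').
Proof.
apply: contM; first exact: contC.
by apply: contB; exact: contP1 cont_gof.
Qed.

Let cont_slope2 k y y' : continuous (slope2 k y y').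
Proof.
have cr : continuous (fun p : R => p / rc) by apply: contM; [exact: contI|exact: contC].
have cg := cont_frc cont_gof.
by apply: contM; first exact: contC; apply: contB; apply: cont2 => //; exact: contC.
Qed.

(** The constant c of the equation divided by the [rc] in [slope1] leaves one factor [rc], the same
    one that the substitution p = rc q produces in [slope_itg']. This balance is the purpose of sqrt
    c in the transform. *)
Let slope_itg h q1 q2 q3 q4 y0 y1 : 0 < h ->
  c * itg y0 y1 (fun y => slope1 h q1 q2 y - slope1 h q3 q4 y) =
  rc * (h^-1 * itg y0 y1 (fun y => gof (q1, y) - gof (q2, y) - (gof (q3, y) - gof (q4, y)))).
Proof.
move=> h0; rewrite /slope1.
under [X in itg _ _ X]funext => y do rewrite -mulrBr.
rewrite itgZ; last by apply: contB; apply: contB; exact: contP1 cont_gof.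
rewrite !mulrA; congr (_ * _).
by rewrite invfM mulrCA -{1}(sqrtc_sqr hc) mulfK ?gt_eqF// mulrC.
Qed.

Let slope_itg' k q0 q1 y1 y2 y3 y4 :
  itg (rc * q0) (rc * q1) (fun p => slope2 k y1 y2 p - slope2 k y3 y4 p) =
  rc * (k^-1 * itg q0 q1 (fun q => frc gof (q, y1) - frc gof (q, y2)
                               - (frc gof (q, y3) - frc gof (q, y4)))).
Proof.
rewrite -itg_scale; last by apply: contB; exact: cont_slope2.
congr (_ * _); rewrite -itgZ; last by apply: contB; apply: contB; exact: contP2 (cont_frc cont_gof).
congr itg; apply/funext => q; rewrite /slope2.
by rewrite [rc * q]mulrC mulfK ?gt_eqF// -mulrBr.
Qed.

(** [E] is taken small: a point beyond the forward quotient at q0 and before the backward quotient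
    at q1 has slopes only in [q0, q1]. By concavity in y the second component of its slopes lies
    between the quotients outside [y0, y1]. Hence the normal image of [E] is contained in [S], and
    the equation compares the two areas. *)
Lemma flux_upper q0 q1 y0 y1 h k : 0 < h -> 0 < k -> k <= y0 -> y0 <= y1 -> q0 <= q1 ->
  h^-1 * itg y0 y1 (fun y => gof (q1, y) - gof (q1 - h, y) - (gof (q0 + h, y) - gof (q0, y))) <=
    k^-1 * itg q0 q1 (fun q => frc gof (q, y0) - frc gof (q, y0 - k)
                               - (frc gof (q, y1 + k) - frc gof (q, y1))).
Proof.
move=> h0 k0 ky0 yy qq.
have y00 : 0 < y0 := lt_le_trans k0 ky0.
have y10 : 0 <= y1 := le_trans (ltW y00) yy.
rewrite -(ler_pM2l rc0) -(slope_itg q1 (q1 - h) (q0 + h) q0 y0 y1 h0).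
rewrite -(slope_itg' k q0 q1 y0 (y0 - k) (y1 + k) y1).
have hrc : 0 < h * rc by rewrite mulr_gt0.
have e1 : y0 - (y0 - k) = k by lra.
have e2 : y1 + k - y1 = k by lra.
set al := slope1 h (q0 + h) q0; set be := slope1 h q1 (q1 - h).
set A := slope2 k y0 (y0 - k); set B := slope2 k (y1 + k) y1.
have ca : continuous al by exact: cont_slope1.
have cb : continuous be by exact: cont_slope1.
have cA : continuous A by exact: cont_slope2.
have cB : continuous B by exact: cont_slope2.
pose E : set (TR * TR) := [set z | y0 <= z.2 <= y1 /\ al z.2 < z.1 < be z.2].
have mE : measurable E.
  have -> : E = ([set z | y0 <= z.2] `&` [set z | z.2 <= y1]) `&`
      ([set z | al z.2 < z.1] `&` [set z | z.1 < be z.2]).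
    apply/seteqP; split=> z; rewrite /E /=; first by move=> [/andP[? ?] /andP[? ?]].
    by move=> [[-> ->] [-> ->]].
  have m1 := @measurable_fst _ _ TR TR; have m2 := @measurable_snd _ _ TR TR.
  have cst (r : R) : measurable_fun setT (fun _ : TR * TR => r : TR) by exact: measurable_cst.
  have ma := measurable_comp2 ca; have mb := measurable_comp2 cb.
  by apply: measurableI; apply: measurableI; (exact: measurable_le2 || exact: measurable_lt2).
have al0 y : 0 <= y -> 0 <= al y.
  move=> y0'; rewrite /al /slope1 gof_diff// mulr_ge0// ?subr_ge0 ?invr_ge0 ?(ltW hrc)//.
  by apply: (leg_mono hc hu) => //; rewrite lerDl ltW.
have EQ : E `<=` quadrant.
  move=> z [/andP[z1 _] /andP[z2 _]]; have z20 : 0 < z.2 := lt_le_trans y00 z1.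
  by split => //; exact: le_lt_trans (al0 _ (ltW z20)) z2.
have lo : ((itg y0 y1 (fun y => be y - al y))%:E <= lebesgue2 E)%E.
  apply: (lebesgue2_ge2 (u := al) mE yy); first exact: contB.
  by move=> x y yy' /andP[h1 h2]; split=> //=; rewrite h1 /=; move: h2; rewrite addrC subrK.
pose S : set (TR * TR) := [set w | rc * q0 <= w.1 <= rc * q1 /\ - A w.1 <= w.2 <= - B w.1].
have mS : measurable S.
  exact: (meas_region _ _ (contN cA) (contN cB)).
have AB p : 0 <= A p - B p.
  rewrite subr_ge0 /A /B /slope2 ler_pM2l ?invr_gt0//.
  rewrite !frc_gof ?subr_ge0 ?addr_ge0 ?(ltW k0) ?(ltW y00)//.
  have y0k : 0 <= y0 - k by rewrite subr_ge0.
  have y0k' : y0 - k < y0 by rewrite ltrBlDr ltrDl.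
  have y1k : y1 < y1 + k by rewrite ltrDl.
  have := conc_slope (cleg (p / rc)) y0k y0k' yy y1k.
  by rewrite e1 e2 ler_pM2r.
have imS : normal_image quadrant u E `<=` S.
  move=> [p r] [[x y] /= [/andP[yy0 yy1] /= /andP[xa xb]] sub].
  have yp : 0 <= y := le_trans (ltW y00) yy0.
  have xp : 0 <= x := le_trans (al0 _ yp) (ltW xa).
  have pE : p = rc * (p / rc) by rewrite mulrC divfK// gt_eqF.
  rewrite pE in sub; move: pE sub; set q := p / rc => pE sub.
  have [xo hy] := subdiff_leg xp yp sub.
  have q0q : q0 <= q.
    rewrite leNgt; apply/negP => qq0.
    have := leg_slope_right hc hu yp h0 (ltW qq0) xo.
    move: xa; rewrite /al /slope1 gof_diff// ltr_pdivrMl// => h1 h2.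
    by move: h1; rewrite ltNge [h * rc]mulrC h2.
  have qq1 : q <= q1.
    rewrite leNgt; apply/negP => qq0.
    have := leg_slope_left hc hu yp h0 (ltW qq0) xo.
    move: xb; rewrite /be /slope1 gof_diff// ltr_pdivlMl// => h1 h2.
    by move: h1; rewrite ltNge [h * rc]mulrC h2.
  split => /=; first by rewrite pE !ler_pM2l// q0q qq1.
  rewrite /A /B /slope2 -/q !frc_gof ?subr_ge0 ?addr_ge0 ?(ltW k0) ?(ltW y00)//.
  have y0k : 0 <= y0 - k by rewrite subr_ge0.
  have y0k' : y0 - k < y0 by rewrite ltrBlDr ltrDl.
  have y1k : y1 < y1 + k by rewrite ltrDl.
  apply/andP; split.
    rewrite lerNl ler_pdivlMl// mulrN.
    have [E0|ne] := eqVneq y0 y.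
      have := hy _ y0k; rewrite -E0.
      by move: (lg q y0) (lg q (y0 - k)) => l0 lk h1; lra.
    have yyl : y0 < y by rewrite lt_neqAle ne.
    have := conc_slope (cleg q) y0k y0k' (lexx _) yyl.
    have := hy _ (ltW y00); rewrite e1 => h1 h2.
    have p1 : 0 < y - y0 by rewrite subr_gt0.
    rewrite -(ler_pM2r p1).
    have h3 := ler_wpM2r (ltW k0) h1.
    by move: h2 h3; move: (lg q y0) (lg q y) (lg q (y0 - k)) => l0 l lk h2 h3; lra.
  rewrite lerNr ler_pdivrMl// mulrN.
  have y1k0 : 0 <= y1 + k by rewrite addr_ge0// ltW.
  have [E0|ne] := eqVneq y1 y.
    have := hy _ y1k0; rewrite -E0.
    by rewrite e2; move: (lg q y1) (lg q (y1 + k)) => l0 lk h1; lra.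
  have yyl : y < y1 by rewrite lt_neqAle eq_sym ne.
  have := conc_slope (cleg q) yp yyl (lexx _) y1k.
  have := hy _ y10; rewrite e2 => h1 h2.
  have p1 : 0 < y1 - y by rewrite subr_gt0.
  rewrite -(ler_pM2r p1).
  have h3 := ler_wpM2r (ltW k0) h1.
  by move: h2 h3; move: (lg q y1) (lg q y) (lg q (y1 + k)) => l0 l lk h2 h3; lra.
have hi : (lebesgue2 S <= (itg (rc * q0) (rc * q1) (fun p => A p - B p))%:E)%E.
  apply: (lebesgue2_le1 (u := fun p => - A p) mS) => //.
  - by rewrite ler_pM2l.
  - exact: contB.
  - by move=> z [].
  - by move=> z [_ /= /andP[-> h2]] /=; rewrite addKr.
have c0 : 0 < c by case/andP: hc.
rewrite -lee_fin; apply: le_trans hi; apply: le_trans (lebesgue2_mono imS).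
by rewrite (sol_equation hu mE EQ) EFinM lee_pmul2l.
Qed.


(** The quotients are now taken on the other sides, so that [E] contains every relevant maximiser
    and [S] is small enough to be covered. For (p, r) in [S] the function leg + r y has an interior
    maximum in [y0, y1]; with the maximiser in x it gives a point of [E] with slope (p, r), provided
    that x > 0. *)
Lemma flux_lower q0 q1 y0 y1 h k : 0 < h -> 0 < k -> 0 < y0 -> y0 + k <= y1 -> q0 <= q1 ->
  (forall y, y0 <= y <= y1 -> 0 < gof (q0, y)) ->
  k^-1 * itg q0 q1 (fun q => frc gof (q, y0 + k) - frc gof (q, y0)
                               - (frc gof (q, y1) - frc gof (q, y1 - k))) <=
  h^-1 * itg y0 y1 (fun y => gof (q1 + h, y) - gof (q1, y) - (gof (q0, y) - gof (q0 - h, y))).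
Proof.
move=> h0 k0 y00 yk qq gp.
have yy : y0 <= y1 by rewrite (le_trans _ yk)// lerDl ltW.
have y10 : 0 <= y1 := le_trans (ltW y00) yy.
have y0k : 0 <= y0 + k by rewrite addr_ge0// ltW.
have y1k : y0 <= y1 - k by rewrite lerBrDr.
have y1k0 : 0 <= y1 - k := le_trans (ltW y00) y1k.
rewrite -(ler_pM2l rc0) -(slope_itg' k q0 q1 (y0 + k) y0 y1 (y1 - k)).
rewrite -(slope_itg (q1 + h) q1 q0 (q0 - h) y0 y1 h0).
have hrc : 0 < h * rc by rewrite mulr_gt0.
set al := slope1 h q0 (q0 - h); set be := slope1 h (q1 + h) q1.
set A := slope2 k (y0 + k) y0; set B := slope2 k y1 (y1 - k).
have ca : continuous al by exact: cont_slope1.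
have cb : continuous be by exact: cont_slope1.
have cA : continuous A by exact: cont_slope2.
have cB : continuous B by exact: cont_slope2.
pose E : set (TR * TR) := [set z | (0 < z.1 /\ y0 <= z.2 <= y1) /\ al z.2 <= z.1 <= be z.2].
have mE : measurable E.
  have -> : E = ([set z | 0 < z.1] `&` ([set z | y0 <= z.2] `&` [set z | z.2 <= y1])) `&`
      ([set z | al z.2 <= z.1] `&` [set z | z.1 <= be z.2]).
    apply/seteqP; split=> z; rewrite /E /=; first by move=> [[? /andP[? ?]] /andP[? ?]].
    by move=> [[-> [-> ->]] [-> ->]].
  have m1 := @measurable_fst _ _ TR TR; have m2 := @measurable_snd _ _ TR TR.
  have cst (r : R) : measurable_fun setT (fun _ : TR * TR => r : TR) by exact: measurable_cst.
  have ma := measurable_comp2 ca; have mb := measurable_comp2 cb.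
  apply: measurableI; apply: measurableI; do ?[exact: measurable_le2|exact: measurable_lt2].
  by apply: measurableI; exact: measurable_le2.
have EQ : E `<=` quadrant.
  by move=> z [[z1 /andP[z2 _]] _]; split => //; exact: lt_le_trans z2.
have hi : (lebesgue2 E <= (itg y0 y1 (fun y => be y - al y))%:E)%E.
  apply: (lebesgue2_le2 (u := al) mE yy); first exact: contB.
  - by move=> z [[]].
  - move=> y /andP[yy0 yy1]; have yp : 0 <= y := le_trans (ltW y00) yy0.
    rewrite subr_ge0 /al /be /slope1 !gof_diff// ler_pM2l ?invr_gt0//.
    have xo := optP hc hu q0 yp.
    apply: le_trans (leg_slope_left hc hu yp h0 (lexx _) xo) _.
    exact: (leg_slope_right hc hu yp h0 qq xo).
  - by move=> z [_ /andP[-> h2]] /=; rewrite addrC subrK.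
pose S : set (TR * TR) := [set w | rc * q0 <= w.1 <= rc * q1 /\ - A w.1 < w.2 < - B w.1].
have mS : measurable S.
  have cst (r : R) : measurable_fun setT (fun _ : TR * TR => r : TR) by exact: measurable_cst.
  have -> : S = ([set z | rc * q0 <= z.1] `&` [set z | z.1 <= rc * q1]) `&`
      ([set z | - A z.1 < z.2] `&` [set z | z.2 < - B z.1]).
    apply/seteqP; split=> z; rewrite /S /=; first by move=> [/andP[? ?] /andP[? ?]].
    by move=> [[-> ->] [-> ->]].
  have m1 := @measurable_fst _ _ TR TR; have m2 := @measurable_snd _ _ TR TR.
  have ma := measurable_comp1 (contN cA); have mb := measurable_comp1 (contN cB).
  by apply: measurableI; apply: measurableI; (exact: measurable_le2 || exact: measurable_lt2).
have imS : S `<=` normal_image quadrant u E.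
  move=> [p r] [/= pq /andP[rA rB]].
  have pE : p = rc * (p / rc) by rewrite mulrC divfK// gt_eqF.
  move: pq rA rB; rewrite /A /B /slope2 [in rc * q0 <= p]pE [in p <= rc * q1]pE !ler_pM2l//.
  set q := p / rc in pE * => /andP[q0q qq1].
  rewrite !frc_gof ?(ltW y00)// => rA rB.
  have rA' : lg q y0 + r * y0 < lg q (y0 + k) + r * (y0 + k).
    move: rA; rewrite ltrNl ltr_pdivlMl// mulrN.
    by move: (lg q y0) (lg q (y0 + k)) => l0 lk h1; lra.
  have rB' : lg q y1 + r * y1 < lg q (y1 - k) + r * (y1 - k).
    move: rB; rewrite ltrNr ltr_pdivrMl// mulrN.
    by move: (lg q y1) (lg q (y1 - k)) => l0 lk h1; lra.
  have cL : continuous (fun y : R => lg q (Num.max y 0) + r * y).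
    apply: contD; first exact: cont_leg.
    by apply: contM; [exact: contC|exact: contI].
  have [y /[!in_itv]/= /andP[yy0 yy1] ymax] := EVT_max yy (continuous_subspaceT cL).
  have yp : 0 < y := lt_le_trans y00 yy0.
  have ymax' t : y0 <= t <= y1 -> lg q t + r * t <= lg q y + r * y.
    move=> /andP[t0 t1]; have := ymax t; rewrite in_itv /= t0 t1 => /(_ isT).
    by rewrite !max0E// ?(ltW yp)// (le_trans _ t0)// ltW.
  have y0y : y0 < y.
    rewrite lt_neqAle yy0 andbT; apply/eqP => E0.
    have := ymax' (y0 + k); rewrite lerDl (ltW k0) yk => /(_ isT).
    by rewrite -E0 leNgt rA'.
  have yy1' : y < y1.
    rewrite lt_neqAle yy1 andbT; apply/eqP => E0.
    have := ymax' (y1 - k); rewrite y1k gerBl (ltW k0) => /(_ isT).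
    by rewrite E0 leNgt rB'.
  (* An interior maximum of a concave function is global. The weight [s] moves from y towards t by
     at most [m], the distance to the ends of [y0, y1]. *)
  have ymaxg t : 0 <= t -> lg q t + r * t <= lg q y + r * y.
    move=> t0; rewrite leNgt; apply/negP => tl.
    pose m := Num.min (y - y0) (y1 - y).
    have m0 : 0 < m by rewrite lt_min !subr_gt0 y0y.
    have d0 : 0 < m + `|t - y| by rewrite ltr_wpDr.
    pose s := m / (m + `|t - y|).
    have s0 : 0 < s by rewrite divr_gt0.
    have s1 : s <= 1 by rewrite ler_pdivrMr// mul1r lerDl.
    have sm : `|s * (t - y)| <= m.
      rewrite normrM gtr0_norm// /s mulrAC -mulrA ler_piMr ?(ltW m0)//.
      by rewrite ler_pdivrMr// mul1r lerDr ltW.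
    have s01 : 0 <= s <= 1 by rewrite ltW.
    have hc' := cleg q (ltW yp) t0 s01.
    have zE : (1 - s) * y + s * t = y + s * (t - y) by ring.
    have zin : y0 <= y + s * (t - y) <= y1.
      have m1 : m <= y - y0 by rewrite ge_min lexx.
      have m2 : m <= y1 - y by rewrite ge_min lexx orbT.
      move: sm; rewrite ler_norml => /andP[h1 h2].
      by apply/andP; split; lra.
    have := ymax' _ zin; rewrite zE in hc'.
    have : s * (lg q y + r * y) < s * (lg q t + r * t) by rewrite ltr_pM2l.
    move: hc'; move: (lg q y) (lg q t) (lg q (y + s * (t - y))) => l1 l2 l3 h1 h2 h3.
    by lra.
  have xo := optP hc hu q (ltW yp).
  have [po _] := xo.
  (* This is where positivity of g enters: the maximiser x = 0 would give g (q, y) = 0, although g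
     (q, y) >= g (q0, y) > 0. *)
  have xp : 0 < opt c u q y.
    rewrite lt_neqAle po andbT; apply/eqP => x0.
    have := gp y; rewrite yy0 yy1 => /(_ isT); rewrite (gofE _ (ltW yp)).
    have := leg_mono hc hu (ltW yp) q0q.
    rewrite /leg -x0 {2}/legf (sol_axis2 hu (ltW yp)) mulr0 sub0r => h1 h2.
    by move: (lt_le_trans h2 (lerD h1 (lexx (y ^+ 2 / 2)))); rewrite addNr ltxx.
  exists (opt c u q y, y).
    split => /=; first by rewrite xp yy0 yy1.
    rewrite /al /be /slope1 !(gof_diff _ _ (ltW yp)) ler_pdivrMl// ler_pdivlMl//.
    rewrite [h * rc]mulrC (leg_slope_left hc hu (ltW yp) h0 q0q xo).
    by rewrite (leg_slope_right hc hu (ltW yp) h0 qq1 xo).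
  move=> [z1 z2] [/= z10 z20].
  have h1 := leg_ge hc hu q (ltW z20) (ltW z10).
  have h2 := ymaxg _ (ltW z20).
  rewrite /legf -pE in h1; rewrite {2}/leg /legf -pE in h2.
  move: h1 h2; move: (lg q z2) (u (z1, z2)) (u (opt c u q y, y)) (opt c u q y) => l u1 u2 o h1 h2.
  by lra.
have lo : ((itg (rc * q0) (rc * q1) (fun p => A p - B p))%:E <= lebesgue2 S)%E.
  apply: (lebesgue2_ge1 (u := fun p => - A p) mS).
  - by rewrite ler_pM2l.
  - exact: contB.
  - by move=> x y xx /andP[h1]; rewrite addKr => h2; split=> //=; rewrite h1.
have c0 : 0 < c by case/andP: hc.
rewrite -lee_fin; apply: le_trans lo _; apply: le_trans (lebesgue2_mono imS) _.
by rewrite (sol_equation hu mE EQ) EFinM lee_pmul2l.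
Qed.

Lemma gsol_gof : gsol c gof.
Proof.
split.
- exact: cont_gof.
- by move=> q y y0; rewrite /gof /= max_r// (leg0 hc hu) expr0n mul0r addr0.
- move=> [q y]; rewrite /gof /= -lerBlDr sub0r.
  by apply: (leg_ge_parab hc hu); rewrite le_max lexx orbT.
- by move=> q q' y qq; rewrite /gof /= lerD2r (leg_mono hc hu)// le_max lexx orbT.
- move=> y q q' t t01; rewrite /gof /=; set m := Num.max y 0.
  have m0 : 0 <= m by rewrite le_max lexx orbT.
  by have := leg_conv hc hu q q' m0 t01; move: (lg _ _) (lg _ _) (lg _ _) => l1 l2 l3; lra.
- move=> q y y' t y0 y0' t01; have /andP[t0 t1] := t01.
  rewrite !frc_gof//; first exact: leg_conc.
  by rewrite addr_ge0// mulr_ge0// subr_ge0.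
- have [C C0 H] := leg_left; exists C => // q y qC y0.
  by rewrite gofE// addrC lerD2l H.
- exact: flux_upper.
- exact: flux_lower.
Qed.

(** A supporting line of the convex function u (., y) at the interior point [x], with slope the
    supremum of the slopes of the chords to the left. *)
Lemma convex_subgrad x y : 0 < x -> 0 <= y -> exists q, is_opt c u q y x.
Proof.
move=> x0 y0.
pose S := [set (u (x, y) - u (t, y)) / (x - t) | t in [set t | 0 <= t < x]].
have three a b : 0 <= a < x -> x < b ->
    (u (x, y) - u (a, y)) / (x - a) <= (u (b, y) - u (x, y)) / (b - x).
  move=> /andP[a0 ax] xb.
  have p1 : 0 < x - a by rewrite subr_gt0.
  have p2 : 0 < b - x by rewrite subr_gt0.
  have p3 : 0 < b - a by rewrite subr_gt0 (lt_trans ax).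
  have b0 : 0 <= b by rewrite ltW// (lt_trans x0).
  have t01 : 0 <= (x - a) / (b - a) <= 1.
    by rewrite divr_ge0 ?(ltW p1) ?(ltW p3)//= ler_pdivrMr// mul1r lerD2r ltW.
  have := sol_conv hu a0 y0 b0 y0 t01.
  have e1 : (1 - (x - a) / (b - a)) * a + (x - a) / (b - a) * b = x.
    by field; rewrite gt_eqF.
  have e2 : (1 - (x - a) / (b - a)) * y + (x - a) / (b - a) * y = y by ring.
  rewrite e1 e2 -(ler_pM2r p3).
  have -> : ((1 - (x - a) / (b - a)) * u (a, y) + (x - a) / (b - a) * u (b, y)) * (b - a) =
      (b - x) * u (a, y) + (x - a) * u (b, y) by field; rewrite gt_eqF.
  move: (u (x, y)) (u (a, y)) (u (b, y)) => u1 u2 u3 h.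
  by rewrite ler_pdivrMr// mulrAC ler_pdivlMr//; lra.
have S0 : S ((u (x, y) - u (0, y)) / (x - 0)) by exists 0 => //=; rewrite lexx.
have Sub b : x < b -> ubound S ((u (b, y) - u (x, y)) / (b - x)).
  by move=> xb _ [a ax <-]; exact: three.
have x1 : x < x + 1 by rewrite ltrDl.
have Ssup : has_sup S by split; [eexists; exact: S0|eexists; exact: (Sub _ x1)].
exists (sup S / rc); split; first exact: ltW.
move=> t t0; rewrite /legf [rc * _]mulrC divfK ?gt_eqF//.
have [tx|xt|->//] := ltgtP t x.
  have St : S ((u (x, y) - u (t, y)) / (x - t)) by exists t => //=; rewrite t0.
  have := sup_upper_bound Ssup St; rewrite ler_pdivrMr ?subr_gt0//.
  by move: (u (x, y)) (u (t, y)) (sup S) => u1 u2 s h; lra.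
have : sup S <= (u (t, y) - u (x, y)) / (t - x).
  by apply: sup_le_ub; [eexists; exact: S0|exact: Sub].
rewrite ler_pdivlMr ?subr_gt0//.
by move: (u (x, y)) (u (t, y)) (sup S) => u1 u2 s h; lra.
Qed.

(** Order reversal of the inverse transform: [q] is taken to be a slope of u (., y) at [x], so that
    the supremum defining the transform of [u] is attained there. *)
Lemma le_of_leg (v : R * R -> R) (lv : R -> R -> R) x y : 0 < x -> 0 <= y ->
  (forall q, rc * q * x - v (x, y) <= lv q y) -> (forall q, lv q y <= lg q y) ->
  u (x, y) <= v (x, y).
Proof.
move=> x0 y0 Hv Hl; have [q xo] := convex_subgrad x0 y0.
have := le_trans (Hv q) (Hl q); rewrite (leg_opt hc hu y0 xo) /legf.
by move: (u (x, y)) (v (x, y)) => u1 v1 h; lra.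
Qed.

End LegendreSolution.

(** * Quadratic growth *)

Section Growth.
Context {R : realType}.
Variables (c : R) (g : R * R -> R).
Hypothesis gs : gsol c g.
Local Notation f := (frc g).
Let cg := g_cont gs.
Let cf := cont_frc cg.

Lemma itg_id (a b : R) : itg a b (fun x => x) = (b ^+ 2 - a ^+ 2) / 2.
Proof.
have H x : is_derive x (1 : R) (fun x : R => 2^-1 * (x * x)) x.
  have h : is_derive x (1 : R) (fun x : R => x * x) (x *: (1 : R) + x *: (1 : R)).
    by exact: is_deriveM.
  have -> : is_derive x (1 : R) (fun x : R => 2^-1 * (x * x)) x =
     is_derive x (1 : R) (fun x : R => 2^-1 * (x * x)) (2^-1 *: (x *: (1 : R) + x *: (1 : R))).
    by congr is_derive; rewrite /GRing.scale /= mulr1; lra.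
  by exact: is_deriveZ.
by rewrite (itgE _ _ H (@contI R)) !expr2; lra.
Qed.

Lemma frc_ge q y : - (y ^+ 2 / 2) <= f (q, y).
Proof. by rewrite /frc /parab /= -lerBlDr opprK addNr; exact: g_ge0 gs _. Qed.

Lemma frc_le_g q y : f (q, y) <= g (q, y).
Proof. by rewrite /frc /parab /= gerBl divr_ge0// sqr_ge0. Qed.

Lemma frc0_ge q : 0 <= f (q, 0).
Proof. by rewrite /frc /parab /= expr0n mul0r subr0; exact: g_ge0 gs _. Qed.

(** A concave function lies above its chord, and the left-hand side is the integral of the chord. *)
Lemma conc_trapezoid q r : 0 < r -> r / 2 * (f (q, r) + f (q, 2 * r)) <= itg r (2 * r) (fun y => f (q, y)).
Proof.
move=> r0; pose B := (f (q, 2 * r) - f (q, r)) / r.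
have rr : r <= 2 * r by lra.
apply: (le_trans (y := itg r (2 * r) (fun y => (f (q, r) - B * r) + B * y))).
  rewrite itgD; [|exact: contC|by apply: contM; [exact: contC|exact: contI]].
  rewrite itg_cst itgZ; last exact: contI.
  rewrite itg_id /B divfK ?gt_eqF//.
  have -> : (f (q, 2 * r) - f (q, r)) / r * (((2 * r) ^+ 2 - r ^+ 2) / 2) =
     (f (q, 2 * r) - f (q, r)) * (r / r) * r * (3 / 2) by field; rewrite gt_eqF.
  rewrite divff ?gt_eqF//.
  by move: (f (q, r)) (f (q, 2 * r)) => a b; rewrite le_eqVlt; apply/orP; left; apply/eqP; field.
apply: itg_le => //.
- apply: contD; first exact: contC.
  by apply: contM; [exact: contC|exact: contI].
- exact: contP1 cf.
- move=> y /andP[y1 y2].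
  have t01 : 0 <= (y - r) / r <= 1.
    by rewrite divr_ge0 ?subr_ge0// ?(ltW r0)//= ler_pdivrMr//; lra.
  have r20 : 0 <= 2 * r by rewrite mulr_ge0// ltW.
  have := g_conc gs q (ltW r0) r20 t01.
  have -> : (1 - (y - r) / r) * r + (y - r) / r * (2 * r) = y.
    by field; rewrite gt_eqF.
  move=> h; apply: le_trans h; rewrite /B.
  move: (f (q, r)) (f (q, 2 * r)) => a b; rewrite le_eqVlt; apply/orP; left; apply/eqP.
  by field; rewrite gt_eqF.
Qed.

(** The flux inequality over [q - r/4, q + r/4] x [r, 2r] with k = r bounds the second difference of
    the mass by values of f, and concavity bounds these by the mass at q + r/4 again. With the step
    r/4 that term comes back with the factor 1/4 and is absorbed on the left. *)
Lemma mass_step q r : 0 < r ->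
  itg r (2 * r) (fun y => g (q + r / 4, y)) <= 3 * itg r (2 * r) (fun y => g (q, y)) + r ^+ 3.
Proof.
move=> r0; pose m q := itg r (2 * r) (fun y => g (q, y)).
have rr : r <= 2 * r by lra.
have h0 : 0 < r / 4 by rewrite divr_gt0.
have m0 t : 0 <= m t by apply: itg_ge0 => //; [exact: contP1|move=> x _; exact: g_ge0 gs _].
have qq : q - r / 4 <= q + r / 4 by lra.
have := g_flux_le gs h0 r0 (lexx r) rr qq.
rewrite (itgB4 _ _ (contP1 cg) (contP1 cg) (contP1 cg) (contP1 cg)) addrK subrK.
rewrite -!/(m _) subrr.
have : itg (q - r / 4) (q + r / 4) (fun q => f (q, r) - f (q, 0) - (f (q, 2 * r + r) - f (q, 2 * r)))
   <= (2 / r * m (q + r / 4) + 9 / 2 * r ^+ 2) * (r / 2).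
  have -> : r / 2 = (q + r / 4) - (q - r / 4) by lra.
  rewrite -itg_cst; apply: itg_le => //.
  - by apply: contB; apply: contB; exact: contP2 cf.
  - exact: contC.
  move=> t /andP[_ t2].
  have h1 := conc_trapezoid t r0.
  have h2 : itg r (2 * r) (fun y => f (t, y)) <= m t.
    by apply: itg_le => //; [exact: contP1|exact: contP1|move=> x _; exact: frc_le_g].
  have h3 : m t <= m (q + r / 4).
    by apply: itg_le => //; [exact: contP1|exact: contP1|move=> x _; exact: g_mono gs _ _ _ t2].
  have h4 := frc_ge t (2 * r + r); have h5 := frc0_ge t.
  have h6 : f (t, r) + f (t, 2 * r) <= 2 / r * m (q + r / 4).
    rewrite mulrAC ler_pdivlMr//.
    by move: (le_trans h1 (le_trans h2 h3)); lra.
  by move: h4 h5 h6; move: (f (t, r)) (f (t, 2 * r)) (f (t, 0)) (f (t, 2 * r + r)) (2 / r * _) =>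
    a1 a2 a3 a4 a5; lra.
rewrite -/(m q) -/(m (q + r / 4)).
have : 0 <= m (q - r / 4) := m0 _.
move: (m (q + r / 4)) (m q) (m (q - r / 4)) (m0 q) => m1 m2 m3 m20 m30 h1.
set I := itg _ _ _ in h1 *; rewrite ler_pdivrMl// => h2.
have h3 : r / 4 * (r^-1 * I) = I / 4 by field; rewrite gt_eqF.
rewrite h3 in h2.
have h4 : (2 / r * m1 + 9 / 2 * r ^+ 2) * (r / 2) = m1 + 9 / 4 * r ^+ 3.
  by field; rewrite gt_eqF.
rewrite h4 in h1.
have r3 : 0 <= r ^+ 3 by rewrite exprn_ge0// ltW.
move: h1 h2 m20 m30 r3; clear h3 h4; move: (r ^+ 3) I => r3 J h1 h2 h5 h6 h7; lra.
Qed.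

Let lin1 (r y : R) : 0 < r -> r - y <= 1 * (2 * r - y). Proof. by move=> ?; lra. Qed.
Let lin2 (r y : R) : 0 <= y -> r - y <= 1 / 2 * (2 * r - y). Proof. by move=> ?; lra. Qed.
Let lin3 (r y : R) : y <= 2 * r -> 1 / 2 * y <= r. Proof. by move=> ?; lra. Qed.
Let lin4 (t : R) : t <= 1 / 2 -> 1 / 2 <= 1 - t. Proof. by move=> ?; lra. Qed.

Lemma gsol_growth : exists2 C, 0 < C & forall q y, 0 <= y -> g (q, y) <= C * (1 + q ^+ 2 + y ^+ 2).
Proof.
have [C C_gt0 Cl] := g_left gs.
pose Bn := fix Bn n : R := if n is n'.+1 then 3 * Bn n' + 1 else 2 + 3 * C.
have Bn0 n : 0 <= Bn n.
  by elim: n => [|n IH] /=; rewrite addr_ge0// mulr_ge0// ltW.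
have mass n r : 1 <= r -> itg r (2 * r) (fun y => g (- C + n%:R * (r / 4), y)) <= Bn n * r ^+ 3.
  move=> r1; have r0 : 0 < r := lt_le_trans ltr01 r1.
  elim: n => [|n IH].
    rewrite mul0r addr0 /=.
    have -> : (2 + 3 * C) * r ^+ 3 = ((2 + 3 * C) * r ^+ 2) * (2 * r - r) by ring.
    rewrite -itg_cst; apply: itg_le; [lra|exact: contP1|exact: contC|].
    move=> y /andP[y1 y2]; apply: le_trans (Cl _ _ (lexx _) _) _; first exact: le_trans (ltW r0) y1.
    have h1 : y ^+ 2 <= (2 * r) ^+ 2 by rewrite ler_pXn2r ?nnegrE ?mulr_ge0// (le_trans (ltW r0)).
    have h2 : 1 + y <= 3 * r ^+ 2.
      have : r <= r ^+ 2 by rewrite expr2 ler_peMl// ltW.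
      by lra.
    have h3 : C * (1 + y) <= C * (3 * r ^+ 2) by rewrite ler_pM2l.
    move: h1 h3; rewrite exprMn; move: (r ^+ 2) (y ^+ 2) (C * (1 + y)) => a b d; lra.
  have -> : - C + n.+1%:R * (r / 4) = - C + n%:R * (r / 4) + r / 4.
    by rewrite -natr1; lra.
  apply: le_trans (mass_step _ r0) _ => /=.
  have r3 : 0 <= r ^+ 3 by rewrite exprn_ge0// ltW.
  by move: IH r3; move: (itg _ _ _) (r ^+ 3) (Bn n) => a b d; lra.
(* The number of steps of length r/4 that lead from - C beyond r does not depend on r >= 1, so the
   constant [Bn N] is uniform. *)
have [N NC] : exists N : nat, 4 + 4 * C <= N%:R.
  by exists (Num.bound (4 + 4 * C)); apply/ltW/archi_boundP; rewrite addr_ge0// mulr_ge0// ltW.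
have massR r : 1 <= r -> itg r (2 * r) (fun y => g (r, y)) <= Bn N * r ^+ 3.
  move=> r1; have r0 : 0 < r := lt_le_trans ltr01 r1.
  apply: le_trans (mass N r r1); apply: itg_le; [lra|exact: contP1|exact: contP1|].
  move=> y _; apply: (g_mono gs).
  have h1 : (4 + 4 * C) * (r / 4) <= N%:R * (r / 4) by rewrite ler_wpM2r// divr_ge0// ltW.
  have h2 : C <= C * r by rewrite ler_peMr// ltW.
  by move: h1 h2; move: (N%:R * _) => a; lra.
pose K := 2 * Bn N + 2.
have K0 : 0 <= K by rewrite addr_ge0// mulr_ge0.
have LR r : 1 <= r -> f (r, r) <= K * r ^+ 2.
  move=> r1; have r0 : 0 < r := lt_le_trans ltr01 r1.
  have h1 := conc_trapezoid r r0.
  have h2 : itg r (2 * r) (fun y => f (r, y)) <= itg r (2 * r) (fun y => g (r, y)).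
    by apply: itg_le => //; [lra|exact: contP1|exact: contP1|move=> x _; exact: frc_le_g].
  have h3 := le_trans h1 (le_trans h2 (massR r r1)).
  have h4 := frc_ge r (2 * r).
  have h5 : f (r, r) + f (r, 2 * r) <= 2 * Bn N * r ^+ 2.
    rewrite -(ler_pM2l (_ : 0 < r / 2)) ?divr_gt0//; apply: le_trans h3 _.
    by rewrite le_eqVlt; apply/orP; left; apply/eqP; field.
  rewrite /K; move: h4 h5; rewrite exprMn.
  by move: (f (r, r)) (f (r, 2 * r)) (r ^+ 2) (Bn N) => a b d e; lra.
(* Concavity in y spreads the bound at y = r: for y <= r by interpolating r between y and 2 r, for y
   > r between 0 and y, with the lower bounds of f at the other end. *)
have Lall r y : 1 <= r -> 0 <= y <= 2 * r -> f (r, y) <= 2 * (K + 2) * r ^+ 2.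
  move=> r1 /andP[y0 y2]; have r0 : 0 < r := lt_le_trans ltr01 r1.
  have hR := LR r r1; have r2 : 0 <= r ^+ 2 := sqr_ge0 r.
  have rr0 : 0 <= 2 * r by rewrite mulr_ge0// ltW.
  have Kr : 0 <= K * r ^+ 2 by rewrite mulr_ge0.
  have [L0|L0] := leP (f (r, y)) 0.
    by apply: le_trans L0 _; rewrite mulr_ge0// mulr_ge0// addr_ge0.
  have [yr|ry] := leP y r.
    have d0 : 0 < 2 * r - y by lra.
    pose t := (r - y) / (2 * r - y).
    have t01 : 0 <= t <= 1.
      apply/andP; split; first by rewrite divr_ge0// ?subr_ge0// ltW.
      by rewrite ler_pdivrMr//; exact: lin1.
    have t12 : t <= 1 / 2 by rewrite ler_pdivrMr//; exact: lin2.
    have := g_conc gs r y0 rr0 t01.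
    have -> : (1 - t) * y + t * (2 * r) = r by rewrite /t; field; rewrite gt_eqF.
    have h4 := frc_ge r (2 * r).
    have h5 : t * - (2 * r ^+ 2) <= t * f (r, 2 * r).
      apply: ler_wpM2l; first by case/andP: t01.
      by apply: le_trans h4; rewrite exprMn; lra.
    have h6 : (1 / 2) * f (r, y) <= (1 - t) * f (r, y) by rewrite ler_pM2r//; exact: lin4.
    have h7 : t * (2 * r ^+ 2) <= 1 / 2 * (2 * r ^+ 2) by rewrite ler_wpM2r// mulr_ge0.
    move: hR h5 h6 h7 r2 Kr; rewrite mulrN.
    by move: (f (r, y)) (f (r, 2 * r)) (f (r, r)) (r ^+ 2) => a b d e; lra.
  have y_gt0 : 0 < y := lt_trans r0 ry.
  have t01 : 0 <= r / y <= 1 by rewrite divr_ge0 ?(ltW r0)//= ler_pdivrMr// mul1r ltW.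
  have t12 : 1 / 2 <= r / y by rewrite ler_pdivlMr//; exact: lin3.
  have := g_conc gs r (lexx 0) y0 t01.
  rewrite mulr0 add0r divfK ?gt_eqF// => h1.
  have h2 : 0 <= (1 - r / y) * f (r, 0) by apply: mulr_ge0; [rewrite subr_ge0; case/andP: t01|exact: frc0_ge].
  have h3 : 1 / 2 * f (r, y) <= r / y * f (r, y) by rewrite ler_pM2r.
  move: h1 h2 h3 hR r2 Kr.
  by move: (f (r, y)) (f (r, r)) (r ^+ 2) (_ * f (r, 0)) (r / y * _) => a b d e k; lra.
pose D := 2 * (K + 2) + 2.
have D0 : 0 < D by rewrite ltr_wpDl// mulr_ge0// addr_ge0.
exists (3 * D); first by rewrite mulr_gt0.
move=> q y y0; pose r := 1 + `|q| + y.
have r1 : 1 <= r by rewrite /r -addrA lerDl addr_ge0.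
have qr : q <= r by rewrite /r; have := ler_norm q; lra.
have y2r : 0 <= y <= 2 * r by rewrite y0 /r /=; have := normr_ge0 q; lra.
apply: le_trans (g_mono gs y qr) _.
have -> : g (r, y) = f (r, y) + y ^+ 2 / 2 by rewrite /frc /parab /= subrK.
have h1 := Lall r y r1 y2r.
have h2 : y ^+ 2 <= (2 * r) ^+ 2.
  by case/andP: y2r => _ h; have h' := le_trans y0 h; rewrite ler_pXn2r ?nnegrE.
have h3 : r ^+ 2 <= 3 * (1 + q ^+ 2 + y ^+ 2).
  rewrite /r -(real_normK (num_real q)).
  have := sqr_ge0 (1 - `|q|); have := sqr_ge0 (1 - y); have := sqr_ge0 (`|q| - y).
  by move: `|q| => a; lra.
have h4 : D * r ^+ 2 <= D * (3 * (1 + q ^+ 2 + y ^+ 2)) by rewrite ler_pM2l.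
move: h1 h2 h4; rewrite /D exprMn.
by move: (f (r, y)) (r ^+ 2) (1 + q ^+ 2 + y ^+ 2) (y ^+ 2) => a b d e; lra.
Qed.

End Growth.

(** * Wirtinger inequalities *)

Section Wirtinger.
Context {R : realType}.
Implicit Types (f df : R -> R).

Definition pos_part (t : R) : R := Num.max t 0.

Lemma cont_pos_part : continuous pos_part.
Proof. by move=> t; apply: continuous_max; [exact: cvg_id|exact: cvg_cst]. Qed.

Lemma pos_part_ge0 t : 0 <= pos_part t.
Proof. by rewrite /pos_part le_max lexx orbT. Qed.

Section OneFunction.
Variables (f df : R -> R) (T m kap th : R).
Hypotheses (T0 : 0 < T) (kap0 : 0 < kap) (th0 : 0 < th) (thpi : th < pi).
Hypothesis Df : forall x, is_derive x (1 : R) f (df x).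
Hypothesis cdf : continuous df.
Hypotheses (f0 : f 0 <= m) (fT : f T <= m).
Hypothesis short : forall a b, 0 <= a -> a < b -> b <= T ->
  (forall x, a < x < b -> m < f x) -> kap * (b - a) + 2 * th <= pi.

Let cf : continuous f := derive_continuous Df.

(** If m < f x, this is the left end of the component of {f > m} that contains [x]. *)
Let start x : R := inf [set a | 0 <= a <= x /\ forall t, a < t <= x -> m < f t].

Let start_set x : 0 <= x ->
  has_inf [set a | 0 <= a <= x /\ forall t, a < t <= x -> m < f t].
Proof.
move=> x0; split.
  exists x; split; first by rewrite x0 lexx.
  by move=> t /andP[h1 h2]; have := lt_le_trans h1 h2; rewrite ltxx.
by exists 0 => a [/andP[]].
Qed.

Let start_ge0 x : 0 <= x -> 0 <= start x.
Proof.
move=> x0; apply: lb_le_inf; first by have [] := start_set x0.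
by move=> a [/andP[]].
Qed.

Let start_le x : 0 <= x -> start x <= x.
Proof.
move=> x0; apply: ge_inf; first by have [] := start_set x0.
split; first by rewrite x0 lexx.
by move=> t /andP[h1 h2]; have := lt_le_trans h1 h2; rewrite ltxx.
Qed.

Let start_gt x t : 0 <= x -> start x < t -> t <= x -> m < f t.
Proof.
move=> x0 st tx; have st0 : 0 < t - start x by rewrite subr_gt0.
have [a [_ Ha] at_] := inf_adherent st0 (start_set x0).
by apply: Ha; rewrite tx andbT; move: at_; rewrite -/(start x) addrC subrK.
Qed.

Let start_local x d : 0 < x -> 0 < d -> (forall t, `|t - x| < d -> m < f t) ->
  forall y, `|y - x| < d -> 0 < y -> start y = start x.
Proof.
move=> x0 d0 Hd.
have key u v : 0 < u -> 0 < v -> `|u - x| < d -> `|v - x| < d -> start u <= start v.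
  move=> u0 v0 ud vd; apply: lb_le_inf; first by have [] := start_set (ltW v0).
  move=> a [/andP[a0 av] Ha].
  pose b := Num.min a u.
  have b0 : 0 <= b by rewrite le_min a0 ltW.
  apply: (@le_trans _ _ b); last by rewrite ge_min lexx.
  apply: ge_inf; first by have [] := start_set (ltW u0).
  split; first by rewrite b0 ge_min lexx orbT.
  move=> t /andP[bt tu]; have [tv|vt] := leP t v.
    have [ta|at_] := leP t a; last by apply: Ha; rewrite at_.
    by move: bt; rewrite gt_min => /orP[]; rewrite ltNge ?ta ?tu.
  apply: Hd; move: ud vd; rewrite !ltr_norml => /andP[? ?] /andP[? ?].
  by apply/andP; split; lra.
move=> y yd y0; apply/eqP; rewrite eq_le.
have xd : `|x - x| < d by rewrite subrr normr0.
by rewrite !key.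
Qed.

Let ang x : R := kap * (x - start x) + th.

Let ang_bound x : 0 < x <= T -> m < f x -> th <= ang x <= pi - th.
Proof.
move=> /andP[x0 xT] fx; have x0' := ltW x0.
have h0 : 0 <= kap * (x - start x) by rewrite mulr_ge0 ?(ltW kap0)// subr_ge0 start_le.
rewrite /ang lerDr h0 /=.
have [E|ne] := eqVneq (start x) x.
  have [d d0 Hd] := (cont1P f).1 cf x (f x - m) (eq_ind_r is_true fx (subr_gt0 _ _)).
  pose e := Num.min x d / 2.
  have m0 : 0 < Num.min x d by rewrite lt_min x0.
  have e0 : 0 < e by rewrite divr_gt0.
  have ex : e < Num.min x d by rewrite ltr_pdivrMr// ltr_pMr// ltr1n.
  have [ex1 ex2] : e < x /\ e < d by move: ex; rewrite lt_min => /andP[].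
  have : start x <= x - e.
    apply: ge_inf; first by have [] := start_set x0'.
    split; first by rewrite subr_ge0 (ltW ex1) /= lerBlDr lerDl ltW.
    move=> t /andP[t1 t2].
    have : `|f t - f x| < f x - m.
      by apply: Hd; rewrite ltr_norml; apply/andP; split; lra.
    by rewrite ltr_norml => /andP[h _]; lra.
  by rewrite E lerBrDr gerDl leNgt e0.
have sx : start x < x by rewrite lt_neqAle ne start_le.
have := short (start_ge0 x0') sx xT.
have H t : start x < t < x -> m < f t by move=> /andP[h1 h2]; apply: (start_gt x0' h1); exact: ltW.
by move=> /(_ H); lra.
Qed.

Let cot x : R := cos (ang x) / sin (ang x).

Let lin_bounds (p t u : R) : 0 < p -> 0 < u -> u <= t -> t <= p - u ->
  [/\ - (p / 2) <= (t + u) / 2 <= p / 2 & 0 <= (t - u) / 2 <= p].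
Proof. by move=> *; split; apply/andP; split; lra. Qed.

Let sin_lb t : th <= t <= pi - th -> sin th <= sin t.
Proof.
move=> /andP[t1 t2]; have pi0 := @pi_gt0 R.
have h1 : sin t - sin th = 2 * (cos ((t + th) / 2) * sin ((t - th) / 2)).
  have e1 : t = (t + th) / 2 + (t - th) / 2 by lra.
  have e2 : th = (t + th) / 2 - (t - th) / 2 by lra.
  set p := (t + th) / 2 in e1 e2 *; set r := (t - th) / 2 in e1 e2 *.
  have -> : sin t = sin (p + r) by rewrite {1}e1.
  have -> : sin th = sin (p - r) by rewrite {1}e2.
  by rewrite sinD sinB; lra.
rewrite -subr_ge0 h1 mulr_ge0// mulr_ge0//.
  by apply: cos_ge0_pihalf; have [] := lin_bounds pi0 th0 t1 t2.
by apply: sin_ge0_pi; have [] := lin_bounds pi0 th0 t1 t2.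
Qed.

(* Riccati substitution: [Hf' <= df^2 - kap^2 (f - m)_+^2], where the angle [ang] restarts at the
   left end of each component of {f > m} and stays inside (0, pi) because components are short. *)
Let Hf x : R := if (0 < x < T) && (m < f x) then (f x - m) ^+ 2 * (kap * cot x) else 0.

Let integrand x : R := df x ^+ 2 - kap ^+ 2 * pos_part (f x - m) ^+ 2.

Let sinth : 0 < sin th.
Proof. by apply: sin_gt0_pi; rewrite th0. Qed.

Let Hf_bound x : `|Hf x| <= kap / sin th * pos_part (f x - m) ^+ 2.
Proof.
rewrite /Hf; case: ifPn => [/andP[/andP[x0 xT] fx]|_]; last first.
  by rewrite normr0 mulr_ge0 ?sqr_ge0// divr_ge0// ltW.
have xx : 0 < x <= T by rewrite x0 ltW.
have sx := sin_lb (ang_bound xx fx).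
have sx0 := lt_le_trans sinth sx.
rewrite /pos_part max_l ?subr_ge0 ?(ltW fx)//.
rewrite normrM (ger0_norm (sqr_ge0 _)) mulrC; apply: ler_wpM2r; first exact: sqr_ge0.
rewrite normrM (gtr0_norm kap0); apply: ler_wpM2l; first exact: ltW.
rewrite /cot normrM normfV (gtr0_norm sx0) -[leRHS]mul1r.
apply: ler_pM => //; first by rewrite invr_ge0 ltW.
  by rewrite ler_norml cos_geN1 cos_le1.
by rewrite lef_pV2.
Qed.

(** By [Hf_bound] the function is quadratically small in (f - m)_+, so it is differentiable across
    the ends of the components even though the angle jumps there. *)
Let Hf_flat x : f x <= m -> is_derive x (1 : R) Hf 0.
Proof.
move=> fx; apply: is_deriveP => e e0.
have [d1 d10 H1] := is_derive_bound (Df x) ltr01.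
pose M := kap / sin th; have M0 : 0 < M by rewrite divr_gt0.
pose L := `|df x| + 1; have L0 : 0 < L by rewrite ltr_wpDl.
have ML : 0 < M * L ^+ 2 by rewrite mulr_gt0// exprn_gt0.
exists (Num.min d1 (e / (M * L ^+ 2))); first by rewrite lt_min d10 divr_gt0.
move=> h; rewrite lt_min => /andP[hd he].
have Hx : Hf x = 0 by rewrite /Hf [m < f x]ltNge fx andbF.
rewrite Hx mulr0 !subr0; apply: le_trans (Hf_bound _) _; rewrite -/M.
have p1 : pos_part (f (x + h) - m) <= L * `|h|.
  rewrite /pos_part ge_max mulr_ge0 ?(ltW L0)// andbT.
  have := H1 h hd; rewrite mul1r => h1.
  have h2 := ler_norm (f (x + h) - f x - h * df x).
  have h3 : h * df x <= `|df x| * `|h| by rewrite mulrC -normrM ler_norm.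
  rewrite /L mulrDl mul1r; move: (le_trans h2 h1) h3 fx.
  by move: (f (x + h)) (f x) (h * df x) (`|df x| * `|h|) `|h| => a1 a2 a3 a4 a5; lra.
have p2 : pos_part (f (x + h) - m) ^+ 2 <= (L * `|h|) ^+ 2.
  by rewrite ler_pXn2r ?nnegrE ?pos_part_ge0// mulr_ge0// ltW.
apply: le_trans (ler_wpM2l (ltW M0) p2) _.
rewrite exprMn mulrA [`|h| ^+ 2]expr2 mulrA ler_wpM2r//.
by rewrite mulrC -ler_pdivlMr// ltW.
Qed.

(** Because of the Riccati equation of the cotangent, [integrand] minus the derivative is the square
    of df - kap (f - m) cot. *)
Let Hf_deriv x : 0 < x < T -> m < f x -> exists2 d, is_derive x (1 : R) Hf d & d <= integrand x.
Proof.
move=> /andP[x0 xT] fx.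
have [d d0 Hd] := (cont1P f).1 cf x (f x - m) (eq_ind_r is_true fx (subr_gt0 _ _)).
have Hd' t : `|t - x| < d -> m < f t.
  by move=> /Hd; rewrite ltr_norml => /andP[h _]; lra.
have xx : 0 < x <= T by rewrite x0 ltW.
pose a := start x; pose A y := kap * (y - a) + th.
have sx0 : 0 < sin (A x) := lt_le_trans sinth (sin_lb (ang_bound xx fx)).
pose psi y := (f y - m) * (f y - m) * (kap * (cos (A y) * (sin (A y))^-1)).
have dA : is_derive x (1 : R) A kap.
  have h1 : is_derive x (1 : R) (fun y => y - a) (1 - 0) by exact: is_deriveB.
  have h2 : is_derive x (1 : R) (fun y => kap * (y - a)) (kap *: (1 - 0)) by exact: is_deriveZ.
  have h3 : is_derive x (1 : R) A (kap *: (1 - 0) + 0) by exact: is_deriveD.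
  by apply: is_derive_eq h3 _; rewrite addr0 subr0 /GRing.scale /= mulr1.
have dc : is_derive x (1 : R) (fun y => cos (A y)) (- sin (A x) * kap).
  exact: (is_derive1_comp (f := cos) (g := A)).
have ds : is_derive x (1 : R) (fun y => sin (A y)) (cos (A x) * kap).
  exact: (is_derive1_comp (f := sin) (g := A)).
have sn0 : sin (A x) != 0 by rewrite gt_eqF.
have dV := is_deriveV sn0 ds.
have dct : is_derive x (1 : R) (fun y => cos (A y) * (sin (A y))^-1) _ := is_deriveM dc dV.
have dk : is_derive x (1 : R) (fun y => kap * (cos (A y) * (sin (A y))^-1)) _ := is_deriveZ kap dct.
have df1 : is_derive x (1 : R) (fun y => f y - m) (df x - 0) by have := Df x => ?; exact: is_deriveB.
have df2 : is_derive x (1 : R) (fun y => (f y - m) * (f y - m)) _ := is_deriveM df1 df1.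
have dpsi : is_derive x (1 : R) psi _ := is_deriveM df2 dk.
eexists.
  apply: (near_eq_is_derive _ dpsi).
  have e0 : 0 < Num.min d (Num.min x (T - x)) by rewrite !lt_min d0 x0 subr_gt0 xT.
  apply: (filterS _ (nbhsx_ballx x _ e0)) => y; rewrite /ball /= distrC.
  rewrite !lt_min => /andP[yd /andP[y1 y2]].
  have yT : 0 < y < T by move: y1 y2; rewrite !ltr_norml => /andP[? ?] /andP[? ?]; apply/andP; split; lra.
  rewrite /Hf yT Hd'//= /cot /ang (start_local x0 d0 Hd' yd); last by case/andP: yT.
  by rewrite /psi expr2.
rewrite /integrand /pos_part max_l ?subr_ge0 ?(ltW fx)// /GRing.scale /=.
have cs := cos2Dsin2 (A x).
set u := f x - m; set D := df x; set C := cos (A x) in cs *; set S := sin (A x) in cs sx0 sn0 *.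
rewrite subr0 -subr_ge0.
have -> : D ^+ 2 - kap ^+ 2 * u ^+ 2 - (u * u * (kap * (C * (- S ^- 2 * (C * kap)) + S^-1 * (- S * kap))) +
     kap * (C / S) * (u * D + u * D)) = (D - kap * u * (C / S)) ^+ 2.
  have e1 : S^-1 * (- S * kap) = - kap by rewrite mulNr mulrN mulKf.
  rewrite e1; field; exact: sn0.
exact: sqr_ge0.
Qed.

Lemma derive_ge0_le' (F : R -> R) (a b : R) : a <= b ->
  (forall x, a <= x <= b -> exists2 d, is_derive x (1 : R) F d & 0 <= d) -> F a <= F b.
Proof.
move=> ab H; apply: (derive_ge0_le ab (df := fun x => 'D_1 F x)).
  by move=> x /H[d [d1 d2] _]; exact: DeriveDef.
by move=> x /H[d [d1 ->]].
Qed.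

(** A primitive of [integrand] minus [Hf] is nondecreasing, and [Hf] vanishes at both ends. *)
Lemma wirtinger_aux : kap ^+ 2 * itg 0 T (fun x => pos_part (f x - m) ^+ 2) <=
  itg 0 T (fun x => df x ^+ 2).
Proof.
have c1 : continuous (fun x => df x ^+ 2) by exact: contX.
have c2 : continuous (fun x => pos_part (f x - m) ^+ 2).
  by apply: contX; apply: cont1; [exact: cont_pos_part|apply: contB => //; exact: contC].
have ci : continuous integrand by apply: contB => //; apply: contM => //; exact: contC.
rewrite -subr_ge0 -itgZ// -itgB//; last by apply: contM => //; exact: contC.
pose K x := prim integrand x - Hf x.
have K0T : K 0 <= K T.
  apply: derive_ge0_le'; first exact: ltW.
  move=> x /andP[x0 xT]; have h1 := primP ci x.
  have [fx|fx] := leP (f x) m.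
    have h2 := Hf_flat fx; exists (integrand x - 0); first exact: is_deriveB.
    rewrite subr0 /integrand /pos_part max_r ?subr_le0// expr0n mulr0 subr0; exact: sqr_ge0.
  have x00 : 0 < x by rewrite lt_neqAle x0 andbT; apply/eqP => E; move: fx; rewrite -E ltNge f0.
  have xTT : x < T by rewrite lt_neqAle xT andbT; apply/eqP => E; move: fx; rewrite E ltNge fT.
  have [d h2 dle] := Hf_deriv (introT andP (conj x00 xTT)) fx.
  by exists (integrand x - d); [exact: is_deriveB|rewrite subr_ge0].
move: K0T; rewrite /K /Hf ltxx ltxx andbF /= !subr0 => h.
by rewrite /itg subr_ge0.
Qed.

End OneFunction.

Lemma wirtinger f df (T m kap l : R) : 0 < T -> 0 < kap ->
  (forall x, is_derive x (1 : R) f (df x)) -> continuous df -> f 0 <= m -> f T <= m ->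
  0 <= l -> kap * l < pi ->
  (forall a b, 0 <= a -> a < b -> b <= T -> (forall x, a < x < b -> m < f x) -> b - a <= l) ->
  kap ^+ 2 * itg 0 T (fun x => pos_part (f x - m) ^+ 2) <= itg 0 T (fun x => df x ^+ 2).
Proof.
move=> T0 kap0 Df cdf f0 fT l0 lpi short.
apply: (wirtinger_aux (th := (pi - kap * l) / 2)) => //.
- by rewrite divr_gt0// subr_gt0.
- have : 0 <= kap * l by rewrite mulr_ge0// ltW.
  by have := @pi_gt0 R; lra.
- move=> a b a0 ab bT H; have h := short a b a0 ab bT H.
  have : kap * (b - a) <= kap * l by rewrite ler_pM2l.
  by lra.
Qed.

Lemma harmonic_mean_le (p x y : R) : 0 < p -> 0 < x -> 0 < y -> 4 * p / (x + y) <= p / x + p / y.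
Proof.
move=> p0 x0 y0; have s0 : 0 < x + y by rewrite addr_gt0.
rewrite -subr_ge0.
have -> : p / x + p / y - 4 * p / (x + y) = p * (x - y) ^+ 2 / (x * y * (x + y)).
  by field; rewrite !gt_eqF.
apply: divr_ge0; first by apply: mulr_ge0; [exact: ltW|exact: sqr_ge0].
by apply: ltW; rewrite !mulr_gt0.
Qed.

(* The harmonic mean inequality for the two supports, which are disjoint and miss the
   last [d] of the interval. *)
Lemma wirtinger_pair f1 df1 f2 df2 (m1 m2 d K : R) : 0 <= d -> 0 < K -> K * (pi - d) < 4 * pi ->
  (forall x, is_derive x (1 : R) f1 (df1 x)) -> (forall x, is_derive x (1 : R) f2 (df2 x)) ->
  continuous df1 -> continuous df2 -> f1 0 <= m1 -> f2 0 <= m2 ->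
  (forall x, pi - d <= x <= pi -> f1 x <= m1) -> (forall x, pi - d <= x <= pi -> f2 x <= m2) ->
  (forall x, m1 < f1 x -> f2 x <= m2) ->
  exists k1 k2, [/\ 0 < k1, 0 < k2, K <= k1 + k2,
    k1 ^+ 2 * itg 0 pi (fun x => pos_part (f1 x - m1) ^+ 2) <= itg 0 pi (fun x => df1 x ^+ 2) &
    k2 ^+ 2 * itg 0 pi (fun x => pos_part (f2 x - m2) ^+ 2) <= itg 0 pi (fun x => df2 x ^+ 2)].
Proof.
move=> d0 K0 Kd D1 D2 c1 c2 f10 f20 e1 e2 dis.
have pi0 := @pi_gt0 R.
have epi1 : f1 pi <= m1 by apply: e1; rewrite lexx andbT gerBl.
have epi2 : f2 pi <= m2 by apply: e2; rewrite lexx andbT gerBl.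
(* The value 0 keeps the set nonempty when the support is empty. *)
pose len (f : R -> R) m := [set r | r = 0 \/ exists a b, [/\ 0 <= a, a < b, b <= pi,
   (forall x, a < x < b -> m < f x) & r = b - a]].
have hs f m : has_sup (len f m).
  split; first by exists 0; left.
  exists pi => r [->|[a [b [a0 ab bT _ ->]]]]; first exact: ltW.
  by lra.
pose l1 := sup (len f1 m1); pose l2 := sup (len f2 m2).
have l10 : 0 <= l1 by apply: sup_upper_bound => //; left.
have l20 : 0 <= l2 by apply: sup_upper_bound => //; left.
have dpi : d <= pi \/ pi < d by case: (leP d pi) => h; [left|right].
have edge f m a b : (forall x, pi - d <= x <= pi -> f x <= m) -> a < b -> b <= pi ->
    (forall x, a < x < b -> m < f x) -> b <= pi - d.
  move=> ef ab bT H; rewrite leNgt; apply/negP => dlt.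
  pose x := (Num.max a (pi - d) + b) / 2.
  have mb : Num.max a (pi - d) < b by rewrite gt_max ab.
  have xm : Num.max a (pi - d) < x < b by rewrite /x; apply/andP; split; lra.
  have /andP[xm1 xb] := xm; move: xm1; rewrite gt_max => /andP[xa xd].
  have := H x; rewrite xa xb => /(_ isT); rewrite ltNge ef// (ltW xd) /=.
  by rewrite ltW// (lt_le_trans xb).
(* An interval from each family are disjoint and both end before pi - d. The maximum with 0 covers
   the case pi < d. *)
have l12 : l1 + l2 <= Num.max (pi - d) 0.
  rewrite -lerBrDr; apply: sup_le_ub; first by have [] := hs f1 m1.
  move=> r1 Hr1; rewrite lerBrDl -lerBrDr; apply: sup_le_ub; first by have [] := hs f2 m2.
  move=> r2 Hr2; rewrite lerBrDl.
  case: Hr1 => [->|[a [b [a0 ab bT H1 ->]]]].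
    case: Hr2 => [->|[a' [b' [a0' ab' bT' H2 ->]]]]; first by rewrite addr0 le_max lexx orbT.
    by have := edge _ _ _ _ e2 ab' bT' H2; rewrite le_max; move=> h; apply/orP; left; lra.
  have b1 := edge _ _ _ _ e1 ab bT H1.
  case: Hr2 => [->|[a' [b' [a0' ab' bT' H2 ->]]]].
    by rewrite le_max; apply/orP; left; lra.
  have b2 := edge _ _ _ _ e2 ab' bT' H2.
  rewrite le_max; apply/orP; left.
  have [h|h] := leP b a'; first by lra.
  have [h'|h'] := leP b' a; first by lra.
  pose x := (Num.max a a' + Num.min b b') / 2.
  have mm : Num.max a a' < Num.min b b' by rewrite gt_max !lt_min ab ab' h h'.
  have [xa xb] : Num.max a a' < x /\ x < Num.min b b' by rewrite /x; split; lra.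
  move: xa xb; rewrite gt_max lt_min => /andP[xa xa'] /andP[xb xb'].
  have := dis x (H1 x (introT andP (conj xa xb))).
  have f2x : m2 < f2 x by apply: H2; rewrite xa' xb'.
  by rewrite [f2 x <= m2]leNgt f2x.
(* Enlarging both lengths by [eta] makes kap l < pi strict and allows l = 0; the strict bound on [K]
   pays for it. *)
have [eta eta0 Keta] : exists2 eta, 0 < eta & K * (Num.max (pi - d) 0 + 2 * eta) <= 4 * pi.
  have h0 : K * Num.max (pi - d) 0 < 4 * pi.
    have [h|h] := leP (pi - d) 0; last by [].
    by rewrite mulr0 mulr_gt0.
  exists ((4 * pi - K * Num.max (pi - d) 0) / (2 * K)); first by rewrite divr_gt0 ?subr_gt0// mulr_gt0.
  rewrite le_eqVlt; apply/orP; left; apply/eqP; field; exact: lt0r_neq0.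
have p1 : 0 < l1 + eta by rewrite ltr_wpDl.
have p2 : 0 < l2 + eta by rewrite ltr_wpDl.
have kpi l : 0 <= l -> 0 < l + eta -> pi / (l + eta) * l < pi.
  by move=> l0 le0; rewrite mulrAC ltr_pdivrMr// ltr_pM2l// ltrDl.
exists (pi / (l1 + eta)), (pi / (l2 + eta)); split; rewrite ?divr_gt0//.
- have s0 : 0 < l1 + eta + (l2 + eta) by rewrite addr_gt0.
  have h1 : K * (l1 + eta + (l2 + eta)) <= 4 * pi.
    apply: le_trans Keta; rewrite ler_pM2l//; move: l12; move: (Num.max _ _) => t; lra.
  have h2 : 4 * pi / (l1 + eta + (l2 + eta)) <= pi / (l1 + eta) + pi / (l2 + eta).
    exact: harmonic_mean_le.
  by apply: le_trans h2; rewrite ler_pdivlMr.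
- apply: (wirtinger pi0 _ D1 c1 f10 epi1 l10 (kpi _ l10 p1)); first by rewrite divr_gt0.
  by move=> a b a0 ab bT H; apply: sup_upper_bound => //; right; exists a, b.
- apply: (wirtinger pi0 _ D2 c2 f20 epi2 l20 (kpi _ l20 p2)); first by rewrite divr_gt0.
  by move=> a b a0 ab bT H; apply: sup_upper_bound => //; right; exists a, b.
Qed.

End Wirtinger.

(** * Energy growth of one and of two phases *)

Section TwoPhase.
Context {R : realType}.
Implicit Types (v vs vp vss vpp : R * R -> R) (s p : R).

Lemma expR_growth (F : R -> R) (k a b : R) : a <= b ->
  (forall x, a <= x <= b -> exists2 d, is_derive x (1 : R) F d & k * F x <= d) ->
  F a * expR (k * (b - a)) <= F b.
Proof.
move=> ab H.
have dE x : is_derive x (1 : R) (fun x => expR (- k * x)) (expR (- k * x) * (- k)).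
  have h : is_derive x (1 : R) (fun x => - k * x) (- k *: 1) by exact: is_deriveZ.
  by have := is_derive1_comp (f := expR) (g := fun x => - k * x) (x := x); rewrite /GRing.scale /= mulr1 in h *; apply.
have : F a * expR (- k * a) <= F b * expR (- k * b).
  apply: (derive_ge0_le' (F := fun x => F x * expR (- k * x)) ab) => x /H[d dF kd].
  have h := is_deriveM dF (dE x); eexists; first exact: h.
  rewrite /GRing.scale /=.
  have -> : F x * (expR (- k * x) * - k) + expR (- k * x) * d = expR (- k * x) * (d - k * F x) by lra.
  by rewrite mulr_ge0 ?expR_ge0// subr_ge0.
have -> : F a * expR (- k * a) = F a * expR (k * (b - a)) * expR (- k * b).
  by rewrite -mulrA -expRD; congr (_ * expR _); lra.
by rewrite ler_pM2r// expR_gt0.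
Qed.

Definition mass v s : R := itg 0 pi (fun p => v (s, p) ^+ 2).

(** The coordinates are s = log r and the angle p. [ph_sub] asks for subharmonicity where v > 0
    only, and [ph_init] lets the energy start from zero at the inner radius. *)
Record phase (s0 s1 : R) v vs vp vss vpp : Prop := MkPhase {
  ph_cs : continuous vs ; ph_cp : continuous vp ;
  ph_css : continuous vss ; ph_cpp : continuous vpp ; ph_c : continuous v ;
  ph_ds : forall s p, is_derive s (1 : R) (fun s => v (s, p)) (vs (s, p)) ;
  ph_dp : forall s p, is_derive p (1 : R) (fun p => v (s, p)) (vp (s, p)) ;
  ph_dss : forall s p, is_derive s (1 : R) (fun s => vs (s, p)) (vss (s, p)) ;
  ph_dpp : forall s p, is_derive p (1 : R) (fun p => vp (s, p)) (vpp (s, p)) ;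
  ph_ge0 : forall z, 0 <= v z ;
  ph_init : forall p, v (s0, p) = 0 ;
  ph_edge : forall s, s0 <= s <= s1 -> v (s, 0) = 0 /\ v (s, pi) = 0 ;
  ph_sub : forall s p, s0 <= s <= s1 -> 0 <= p <= pi -> 0 <= v (s, p) * (vss (s, p) + vpp (s, p)) }.

(** * The energy of a single phase *)

Section Energy.
Variables (s0 s1 : R) (v vs vp vss vpp : R * R -> R).
Hypothesis ph : phase s0 s1 v vs vp vss vpp.

Let pi0 : 0 <= pi :> R. Proof. exact: pi_ge0. Qed.

Let cv := ph_c ph.
Let cvs := ph_cs ph.
Let cvp := ph_cp ph.
Let cvss := ph_css ph.
Let cvpp := ph_cpp ph.

(** It starts at 0 and by [derive_half_dmass] dominates the Dirichlet energy over [s0, s]. The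
    product of two such functions is the monotone quantity. *)
Definition half_dmass s : R := itg 0 pi (fun p => v (s, p) * vs (s, p)).

Lemma derive_mass s : is_derive s (1 : R) (mass v) (2 * half_dmass s).
Proof.
rewrite /half_dmass -itgZ; last by apply: contM; exact: contP1.
have cM : continuous (fun z => 2 * (v z * vs z)) by apply: contM; [exact: contC|exact: contM].
apply: (derive_itg (V := fun z => v z ^+ 2) (Vs := fun z => 2 * (v z * vs z)) s pi0) => //.
  exact: contX.
move=> t p; have h := is_deriveM (ph_ds ph t p) (ph_ds ph t p).
have -> : (fun s => v (s, p) ^+ 2) = (fun s => v (s, p)) * (fun s => v (s, p)).
  by apply/funext => x; rewrite expr2.
by apply: is_derive_eq h _; rewrite /GRing.scale /=; lra.
Qed.

Lemma mass_ge0 s : 0 <= mass v s.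
Proof.
apply: itg_ge0 => //; first by apply: contX; exact: contP1.
by move=> *; exact: sqr_ge0.
Qed.

(** Differentiation gives the integral of v_s^2 + v v_ss. Subharmonicity replaces v v_ss by - v
    v_pp, and integration by parts in p gives v_p^2, since v vanishes at both edges. *)
Lemma derive_half_dmass s : s0 <= s <= s1 -> exists2 d, is_derive s (1 : R) half_dmass d &
  itg 0 pi (fun p => vs (s, p) ^+ 2) + itg 0 pi (fun p => vp (s, p) ^+ 2) <= d.
Proof.
move=> ss; exists (itg 0 pi (fun p => vs (s, p) ^+ 2 + v (s, p) * vss (s, p))).
  apply: (derive_itg (V := fun z => v z * vs z) (Vs := fun z => vs z ^+ 2 + v z * vss z) s pi0).
  - exact: contM.
  - by apply: contD; [exact: contX|exact: contM].
  - move=> t p; have h := is_deriveM (ph_ds ph t p) (ph_dss ph t p).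
    by apply: is_derive_eq h _; rewrite /GRing.scale /=; lra.
have c1 := @contP1 R _ s cv; have c2 := @contP1 R _ s cvs; have c3 := @contP1 R _ s cvp.
have c4 := @contP1 R _ s cvss; have c5 := @contP1 R _ s cvpp.
have by_parts : itg 0 pi (fun p => vp (s, p) ^+ 2 + v (s, p) * vpp (s, p)) = 0.
  have H p : is_derive p (1 : R) (fun p => v (s, p) * vp (s, p)) (vp (s, p) ^+ 2 + v (s, p) * vpp (s, p)).
    have h := is_deriveM (ph_dp ph s p) (ph_dpp ph s p).
    by apply: is_derive_eq h _; rewrite /GRing.scale /=; lra.
  rewrite (itgE _ _ H); last by apply: contD; [exact: contX|exact: contM].
  by have [-> ->] := ph_edge ph ss; rewrite !mul0r subrr.
have hsub : 0 <= itg 0 pi (fun p => v (s, p) * vss (s, p) + v (s, p) * vpp (s, p)).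
  apply: itg_ge0 => //; first by apply: contD; exact: contM.
  by move=> p pp; rewrite -mulrDr; exact: ph_sub ph _ _ ss pp.
move: by_parts hsub; rewrite !itgD//; first by lra.
all: by [exact: contX|exact: contM].
Qed.

Lemma half_dmass_mono s t : s0 <= s -> s <= t -> t <= s1 -> half_dmass s <= half_dmass t.
Proof.
move=> h1 h2 h3; apply: derive_ge0_le' => // x /andP[x1 x2].
have xx : s0 <= x <= s1 by rewrite (le_trans h1 x1) (le_trans x2 h3).
have [d hd le] := derive_half_dmass xx; exists d => //; apply: le_trans le.
by apply: addr_ge0; apply: itg_ge0 => //; try (by move=> *; exact: sqr_ge0);
  apply: contX; exact: contP1.
Qed.

Lemma half_dmass_ge0 s : s0 <= s <= s1 -> 0 <= half_dmass s.
Proof.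
move=> /andP[h1 h2]; apply: le_trans (half_dmass_mono (lexx s0) h1 h2).
apply: itg_ge0 => //; first by apply: contM; exact: contP1.
by move=> p _; rewrite (ph_init ph) mul0r.
Qed.

Lemma mass_mono s t : s0 <= s -> s <= t -> t <= s1 -> mass v s <= mass v t.
Proof.
move=> h1 h2 h3; apply: derive_ge0_le' => // x /andP[x1 x2].
exists (2 * half_dmass x); first exact: derive_mass.
by rewrite mulr_ge0// half_dmass_ge0// (le_trans h1 x1) (le_trans x2 h3).
Qed.

Lemma half_dmass_step s : s0 <= s -> s + 1 <= s1 -> 2 * half_dmass s <= mass v (s + 1).
Proof.
move=> h1 h2; have ss : s <= s + 1 by rewrite lerDl.
have [x /andP[x1 x2] E] := mvt ss (fun x _ => derive_mass x).
have := mass_ge0 s; have := half_dmass_mono h1 x1 (le_trans x2 h2).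
move: E; rewrite [s + 1 - s]addrC addKr mulr1; lra.
Qed.

(** With B = [half_dmass], B' is at least the integral of v_s^2 + k^2 v^2, and (v_s - k v)^2 >= 0
    turns this into 2 k B. *)
Lemma derive_half_dmass_growth s k : s0 <= s <= s1 ->
  k ^+ 2 * mass v s <= itg 0 pi (fun p => vp (s, p) ^+ 2) ->
  exists d, [/\ is_derive s (1 : R) half_dmass d, 2 * k * half_dmass s <= d & k ^+ 2 * mass v s <= d].
Proof.
move=> ss hk; have [d hd le] := derive_half_dmass ss; exists d.
have c1 := @contP1 R _ s cv; have c2 := @contP1 R _ s cvs.
have h0 : 0 <= itg 0 pi (fun p => vs (s, p) ^+ 2).
  by apply: itg_ge0 => //; [exact: contX|move=> *; exact: sqr_ge0].
have h : 0 <= itg 0 pi (fun p => vs (s, p) ^+ 2 + (k ^+ 2 * v (s, p) ^+ 2 - 2 * k * (v (s, p) * vs (s, p)))).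
  apply: itg_ge0 => //.
    apply: contD; first exact: contX.
    by apply: contB; apply: contM; [exact: contC|exact: contX|exact: contC|exact: contM].
  move=> p _; have -> : vs (s, p) ^+ 2 + (k ^+ 2 * v (s, p) ^+ 2 - 2 * k * (v (s, p) * vs (s, p))) =
    (vs (s, p) - k * v (s, p)) ^+ 2 by ring.
  exact: sqr_ge0.
have d1 : continuous (fun p => k ^+ 2 * v (s, p) ^+ 2) by apply: contM; [exact: contC|exact: contX].
have d2 : continuous (fun p => 2 * k * (v (s, p) * vs (s, p))) by apply: contM; [exact: contC|exact: contM].
have d3 : continuous (fun p => vs (s, p) ^+ 2) by exact: contX.
rewrite (itgD _ _ d3 (contB d1 d2)) (itgB _ _ d1 d2) itgZ in h; last exact: contX.
rewrite itgZ in h; last exact: contM.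
rewrite -/(mass v s) -/(half_dmass s) in h.
by split=> //; [move: h hk le; lra | move: h0 hk le; lra].
Qed.

(** The constant 1/2 is any value below 1, the sharp one for an interval of length pi. It serves
    only to get energy started from mass. *)
Lemma phase_wirtinger s : s0 <= s <= s1 -> 2^-1 ^+ 2 * mass v s <= itg 0 pi (fun p => vp (s, p) ^+ 2).
Proof.
move=> ss; have [e1 e2] := ph_edge ph ss; have pp := @pi_gt0 R.
have H := @wirtinger R (fun p => v (s, p)) (fun p => vp (s, p)) pi 0 2^-1 pi pp.
have := H _ (ph_dp ph s) (contP1 (x := s) cvp).
rewrite e1 e2 => /(_ _ (lexx _) (lexx _) (ltW pp)).
have -> : (fun x => pos_part (v (s, x) - 0) ^+ 2) = (fun p => v (s, p) ^+ 2).
  by apply/funext => x; rewrite subr0 /pos_part max_l// (ph_ge0 ph).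
apply => //.
- by rewrite ltr_pdivrMl// ltr_pMl// ltr1n.
- by move=> a b a0 ab bp _; lra.
Qed.

Lemma half_dmass_start s n : s0 <= s -> s + 1 <= s1 -> n <= mass v s -> n / 4 <= half_dmass (s + 1).
Proof.
move=> h1 h2 h3.
have ss : s <= s + 1 by rewrite lerDl.
have : half_dmass s - n / 4 * s <= half_dmass (s + 1) - n / 4 * (s + 1).
  apply: (derive_ge0_le' (F := fun s => half_dmass s - n / 4 * s)) => // x /andP[x1 x2].
  have xx : s0 <= x <= s1 by rewrite (le_trans h1 x1) (le_trans x2 h2).
  have [d [hd _ hm]] := derive_half_dmass_growth xx (phase_wirtinger xx).
  have hZ : is_derive x (1 : R) (fun s => n / 4 * s) (n / 4 *: 1) by exact: is_deriveZ.
  exists (d - n / 4 *: 1); first exact: is_deriveB.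
  rewrite /GRing.scale /= mulr1 subr_ge0; apply: le_trans hm.
  have := mass_mono h1 x1 (le_trans x2 h2); rewrite expr2; lra.
have : 0 <= half_dmass s by apply: half_dmass_ge0; rewrite h1 (le_trans ss h2).
by lra.
Qed.

End Energy.

(** * The product of the energies of two disjoint phases *)

Section Pair.
Variables (s0 s1 : R) (v1 vs1 vp1 vss1 vpp1 v2 vs2 vp2 vss2 vpp2 : R * R -> R).
Hypothesis ph1 : phase s0 s1 v1 vs1 vp1 vss1 vpp1.
Hypothesis ph2 : phase s0 s1 v2 vs2 vp2 vss2 vpp2.
Hypothesis dis : forall z, 0 < v1 z -> v2 z = 0.

Let B1 := half_dmass v1 vs1.
Let B2 := half_dmass v2 vs2.

Lemma pair_growth s k1 k2 : s0 <= s <= s1 ->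
  k1 ^+ 2 * mass v1 s <= itg 0 pi (fun p => vp1 (s, p) ^+ 2) ->
  k2 ^+ 2 * mass v2 s <= itg 0 pi (fun p => vp2 (s, p) ^+ 2) ->
  exists2 d, is_derive s (1 : R) (fun s => B1 s * B2 s) d & 2 * (k1 + k2) * (B1 s * B2 s) <= d.
Proof.
move=> ss h1 h2.
have [d1 [hd1 g1 _]] := derive_half_dmass_growth ph1 ss h1.
have [d2 [hd2 g2 _]] := derive_half_dmass_growth ph2 ss h2.
have b1 := half_dmass_ge0 ph1 ss; have b2 := half_dmass_ge0 ph2 ss.
eexists; first exact: is_deriveM hd1 hd2.
rewrite /GRing.scale /= -/B1 -/B2.
have := ler_wpM2r b2 g1; have := ler_wpM2r b1 g2; rewrite -/B1 -/B2; lra.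
Qed.

(** Pointwise, (x - m)_+^2 >= (1 - t) x^2 - m^2 / t by Young's inequality, integrated over an
    interval of length pi. *)
Lemma truncated_mass v (m t s : R) : continuous v -> (forall z, 0 <= v z) -> 0 <= m -> 0 < t <= 1 ->
  (1 - t) * mass v s - pi * (m ^+ 2 / t) <= itg 0 pi (fun p => pos_part (v (s, p) - m) ^+ 2).
Proof.
move=> cv v0 m0 /andP[t0 t1].
have c1 := @contP1 R _ s cv.
have c2 : continuous (fun p => (1 - t) * v (s, p) ^+ 2) by apply: contM; [exact: contC|exact: contX].
have -> : (1 - t) * mass v s - pi * (m ^+ 2 / t) = itg 0 pi (fun p => (1 - t) * v (s, p) ^+ 2 - m ^+ 2 / t).
  rewrite itgB//; last exact: contC.
  by rewrite itg_cst itgZ ?subr0 1?[pi * _]mulrC//; exact: contX.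
apply: itg_le; first exact: pi_ge0.
- by apply: contB => //; exact: contC.
- apply: contX; apply: cont1; [exact: cont_pos_part|by apply: contB => //; exact: contC].
move=> p _; have := v0 (s, p); move: (v (s, p)) => x x0.
have mt : m ^+ 2 <= m ^+ 2 / t by rewrite ler_pdivlMr// ler_piMr// sqr_ge0.
rewrite /pos_part; have [xm|xm] := leP (x - m) 0.
  have : x ^+ 2 <= m ^+ 2 by rewrite ler_pXn2r// -subr_le0.
  have := mulr_ge0 (ltW t0) (sqr_ge0 x); rewrite expr0n /=; lra.
have : 0 <= t * (x - m / t) ^+ 2 by rewrite mulr_ge0 ?sqr_ge0// ltW.
have -> : t * (x - m / t) ^+ 2 = t * x ^+ 2 - 2 * x * m + m ^+ 2 / t by field; rewrite gt_eqF.
have := sqr_ge0 m; rewrite sqrrB; lra.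
Qed.

(* Truncating at height [m] confines both supports to [0, pi - th]; the truncation costs a
   factor [1 - (1 + c) t], the shortened interval gains more than [th / (2 pi)]. *)
Lemma pair_growth_trunc s (m th t c : R) : s0 <= s <= s1 -> 0 <= m -> 0 <= th -> 0 < t <= 1 ->
  (forall p, pi - th <= p <= pi -> v1 (s, p) <= m /\ v2 (s, p) <= m) ->
  pi * (m ^+ 2 / t) <= c * t * mass v1 s -> pi * (m ^+ 2 / t) <= c * t * mass v2 s ->
  0 <= 1 - (1 + c) * t <= 1 ->
  forall K, 0 < K -> K * (pi - th) < 4 * pi -> exists2 d, is_derive s (1 : R) (fun s => B1 s * B2 s) d &
    2 * (K * (1 - (1 + c) * t)) * (B1 s * B2 s) <= d.
Proof.
move=> ss m0 th0 t01 edge n1 n2 /andP[r0 r1] K K0 Kd; set r := 1 - (1 + c) * t in r0 r1 *.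
have [e1 _] := ph_edge ph1 ss; have [e2 _] := ph_edge ph2 ss.
have [|||||k1 [k2 [k10 k20 kk w1 w2]]] := wirtinger_pair (m1 := m) (m2 := m) th0 K0 Kd (ph_dp ph1 s)
  (ph_dp ph2 s) (contP1 (x := s) (ph_cp ph1)) (contP1 (x := s) (ph_cp ph2)).
- by rewrite e1.
- by rewrite e2.
- by move=> p /edge[].
- by move=> p /edge[].
- by move=> p mv; rewrite dis// (le_lt_trans m0).
(* The truncated mass is at least r times the mass, hence at least r^2 times it as r <= 1, so that
   truncation replaces the rate k by k r. *)
have step v k (V : R) : continuous v -> (forall z, 0 <= v z) -> 0 < k ->
    pi * (m ^+ 2 / t) <= c * t * mass v s ->
    k ^+ 2 * itg 0 pi (fun p => pos_part (v (s, p) - m) ^+ 2) <= V ->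
    (k * r) ^+ 2 * mass v s <= V.
  move=> cv v0 k0 n w; apply: le_trans w; rewrite exprMn -mulrA; apply: ler_wpM2l; first exact: sqr_ge0.
  apply: le_trans (truncated_mass s cv v0 m0 t01).
  have M0 : 0 <= mass v s by apply: itg_ge0; [exact: pi_ge0|by apply: contX; exact: contP1|move=> *; exact: sqr_ge0].
  apply: (@le_trans _ _ (r * mass v s)); last by rewrite /r; lra.
  by rewrite expr2 -mulrA ler_piMl// mulr_ge0.
have s1' := step _ _ _ (ph_c ph1) (ph_ge0 ph1) k10 n1 w1.
have s2' := step _ _ _ (ph_c ph2) (ph_ge0 ph2) k20 n2 w2.
have [d hd le] := pair_growth ss s1' s2'; exists d => //; apply: le_trans le.
have b1 := half_dmass_ge0 ph1 ss; have b2 := half_dmass_ge0 ph2 ss.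
apply: ler_wpM2r; first exact: mulr_ge0.
by rewrite ler_pM2l// -mulrDl ler_wpM2r.
Qed.

(** With no angle removed [wirtinger_pair] yields every K < 4. The derivative does not depend on K,
    so K may tend to 4. *)
Lemma pair_growth8 s : s0 <= s <= s1 -> exists2 d, is_derive s (1 : R) (fun s => B1 s * B2 s) d &
  8 * (B1 s * B2 s) <= d.
Proof.
move=> ss.
have [e1 e1'] := ph_edge ph1 ss; have [e2 e2'] := ph_edge ph2 ss; have pp := @pi_gt0 R.
have H K : 0 < K -> K < 4 -> exists2 d, is_derive s (1 : R) (fun s => B1 s * B2 s) d &
    2 * K * (B1 s * B2 s) <= d.
  move=> K0 K4; have Kd : K * (pi - 0) < 4 * pi by rewrite subr0 ltr_pM2r.
  have E p : pi - 0 <= p <= pi -> p = pi by rewrite subr0 => h; apply/eqP; rewrite eq_le andbC.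
  have [|||||k1 [k2 [k10 k20 kk w1 w2]]] := wirtinger_pair (m1 := 0) (m2 := 0) (lexx 0) K0 Kd (ph_dp ph1 s)
    (ph_dp ph2 s) (contP1 (x := s) (ph_cp ph1)) (contP1 (x := s) (ph_cp ph2)).
  - by rewrite e1.
  - by rewrite e2.
  - by move=> p /E ->; rewrite e1'.
  - by move=> p /E ->; rewrite e2'.
  - by move=> p mv; rewrite dis.
  have F v : (forall z, 0 <= v z) -> (fun p => pos_part (v (s, p) - 0) ^+ 2) = (fun p => v (s, p) ^+ 2).
    by move=> v0; apply/funext => p; rewrite subr0 /pos_part max_l.
  rewrite (F _ (ph_ge0 ph1)) in w1; rewrite (F _ (ph_ge0 ph2)) in w2.
  have [d hd le] := pair_growth ss w1 w2; exists d => //; apply: le_trans le.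
  have b1 := half_dmass_ge0 ph1 ss; have b2 := half_dmass_ge0 ph2 ss.
  by apply: ler_wpM2r; [exact: mulr_ge0|rewrite ler_pM2l].
have h14 : 1 < 4 :> R by rewrite ltr1n.
have [d hd _] := H 1 ltr01 h14.
exists d => //; set P := B1 s * B2 s.
have P0 : 0 <= P := mulr_ge0 (half_dmass_ge0 ph1 ss) (half_dmass_ge0 ph2 ss).
rewrite leNgt; apply/negP => lt.
pose D := 8 * P - d; have D0 : 0 < D by rewrite subr_gt0.
have q0 : 0 < 4 * P + 1 by rewrite ltr_wpDl// mulr_ge0.
pose e := Num.min 1 (D / (4 * P + 1)).
have e0 : 0 < e by rewrite lt_min ltr01 divr_gt0.
have e1_ : e <= 1 by rewrite ge_min lexx.
have [||d' hd' le'] := H (4 - e); [by lra|by lra|].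
have dd : d' = d by case: hd hd' => _ <- [_ <-].
have : e * (4 * P + 1) <= D by rewrite -ler_pdivlMr// ge_min lexx orbT.
move: le'; rewrite dd -/P /D; lra.
Qed.

End Pair.

End TwoPhase.

(** * Strict monotonicity and the two-phase contradiction *)

Section Monotonicity.
Context {R : realType}.
Implicit Types (v vs vp vss vpp : R * R -> R) (s p : R).

(** Mass is a square, so quadratic growth reads expR (4 * s). All constants are meant to be
    independent of the outer end [s1], while [v] may depend on it. *)
Record far_phase (s0 s1 ss C n0 : R) (S : R -> R) v vs vp vss vpp : Prop := MkFarPhase {
  fp_phase : phase s0 s1 v vs vp vss vpp ;
  fp_start : exists2 t, s0 <= t <= ss & n0 <= mass v t ;
  fp_growth : forall s, ss <= s <= s1 -> mass v s <= C * expR (4 * s) ;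
  fp_edge : forall th s p, 0 < th <= 1 -> S th <= s -> ss <= s <= s1 -> pi - th <= p <= pi ->
    v (s, p) <= C * th ^+ 2 * expR (2 * s) }.

(** Shortening the interval by th allows K = 4 (1 + k th) with k = 1 / (2 P), a gain linear in th.
    The factor 1 - (1 + c) th^2 loses only order th^2, so half of the gain survives when th is
    small. *)
Lemma truncation_parameters (c P : R) : 0 <= c -> 0 < P -> exists th K eta,
  [/\ 0 < th <= 1, 0 < K /\ 0 < eta, 0 <= 1 - (1 + c) * th ^+ 2 <= 1, K * (P - th) < 4 * P &
      8 + eta <= 2 * (K * (1 - (1 + c) * th ^+ 2))].
Proof.
move=> c0 P0; pose k := (2 * P)^-1.
have k0 : 0 < k by rewrite invr_gt0 mulr_gt0.
have kP : k * P = 2^-1 by rewrite /k invfM -mulrA mulVf ?mulr1// gt_eqF.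
have C0 : 0 < 1 + c by rewrite ltr_wpDr.
have D0 : 0 < 2 * (1 + c) * (1 + k) by rewrite !mulr_gt0// addr_gt0.
pose th := k / (2 * (1 + c) * (1 + k)).
have th0 : 0 < th by rewrite divr_gt0.
have E : th * (2 * (1 + c) * (1 + k)) = k by rewrite /th mulfVK// gt_eqF.
clearbody th k.
have ck := mulr_ge0 c0 (ltW k0).
have th1 : th <= 1.
  have : th * (1 + k) <= k.
    by rewrite -[leRHS]E ler_pM2l//; lra.
  move=> h; rewrite leNgt; apply/negP; rewrite -subr_gt0 => h'.
  have := mulr_gt0 h' k0; lra.
have q : (1 + c) * th * (1 + k) = k / 2 by move: E; lra.
have r : (1 + c) * th * (1 + k * th) <= k / 2.
  by rewrite -q ler_pM2l ?mulr_gt0// lerD2l ler_piMr//; exact: ltW.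
have r2 : (1 + c) * th ^+ 2 * (1 + k * th) <= th * (k / 2).
  have -> : (1 + c) * th ^+ 2 * (1 + k * th) = th * ((1 + c) * th * (1 + k * th)) by ring.
  exact: (ler_wpM2l (ltW th0) r).
have kt := mulr_gt0 k0 th0.
have x0 : 0 <= (1 + c) * th ^+ 2 by rewrite mulr_ge0 ?sqr_ge0// ltW.
have x1 : (1 + c) * th ^+ 2 <= 1.
  have : (1 + c) * th ^+ 2 * (1 + k * th) <= 1 + k * th by nra.
  by rewrite -[leRHS]mul1r ler_pM2r// addr_gt0.
exists th, (4 * (1 + k * th)), (4 * (k * th)); split.
- by rewrite th0.
- by split; rewrite mulr_gt0// addr_gt0.
- by apply/andP; split; lra.
- have : k * th * P = th / 2 by rewrite mulrAC kP mulrC.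
  have := mulr_gt0 kt th0; lra.
- by lra.
Qed.

Section Constants.
Variables (s0 ss C n0 : R) (S : R -> R).
Hypotheses (C_gt0 : 0 < C) (n_gt0 : 0 < n0) (s0ss : s0 <= ss).

Section Fixed.
Variables (s1 : R) (v1 vs1 vp1 vss1 vpp1 v2 vs2 vp2 vss2 vpp2 : R * R -> R).
Hypothesis fp1 : far_phase s0 s1 ss C n0 S v1 vs1 vp1 vss1 vpp1.
Hypothesis fp2 : far_phase s0 s1 ss C n0 S v2 vs2 vp2 vss2 vpp2.
Hypothesis dis : forall z, 0 < v1 z -> v2 z = 0.

Let B1 := half_dmass v1 vs1.
Let B2 := half_dmass v2 vs2.
Let ph1 := fp_phase fp1.
Let ph2 := fp_phase fp2.

Lemma far_start v vs vp vss vpp : far_phase s0 s1 ss C n0 S v vs vp vss vpp -> ss + 1 <= s1 ->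
  n0 / 4 <= half_dmass v vs (ss + 1).
Proof.
move=> fp h; apply: (half_dmass_start (fp_phase fp)) => //.
have [t /andP[t0 t1] nt] := fp_start fp.
apply: le_trans nt _; apply: (mass_mono (fp_phase fp)) => //.
by apply: le_trans h; rewrite lerDl.
Qed.

Lemma far_upper v vs vp vss vpp s : far_phase s0 s1 ss C n0 S v vs vp vss vpp -> ss <= s ->
  s + 1 <= s1 -> half_dmass v vs s <= C / 2 * expR (4 * (s + 1)).
Proof.
move=> fp h1 h2.
have a := half_dmass_step (fp_phase fp) (le_trans s0ss h1) h2.
have hs : ss <= s + 1 <= s1 by rewrite h2 andbT; apply: le_trans h1 _; rewrite lerDl.
by have := fp_growth fp hs; lra.
Qed.

Lemma far_prod s : ss + 1 <= s -> s <= s1 ->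
  (n0 / 4) ^+ 2 * expR (8 * (s - (ss + 1))) <= B1 s * B2 s.
Proof.
move=> h1 h2; have n4 : 0 <= n0 / 4 by rewrite divr_ge0// ltW.
apply: le_trans (expR_growth (F := fun s => B1 s * B2 s) (k := 8) h1 _); last first.
  move=> x /andP[x1 x2]; apply: (pair_growth8 ph1 ph2 dis).
  rewrite (le_trans x2 h2) andbT; apply: le_trans s0ss (le_trans _ x1); by rewrite lerDl.
rewrite ler_pM2r ?expR_gt0// expr2.
by apply: ler_pM => //; apply: far_start (le_trans h1 h2); [exact: fp1|exact: fp2].
Qed.

Definition far_const : R :=
  (n0 / 4) ^+ 2 * expR (- 8 * (ss + 1)) / (C / 2 * expR 4) * (2 * expR (- 4)).

Lemma far_const_gt0 : 0 < far_const.
Proof. by rewrite /far_const; rewrite !(mulr_gt0, divr_gt0, exprn_gt0, expR_gt0, invr_gt0). Qed.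

(** The product of the energies is at least of order expR (8 * s) and the other factor at most of
    order expR (4 * s), so this factor is at least of order expR (4 * s). Passing from energy to
    mass shifts s by 1. *)
Lemma far_lower v vs vp vss vpp v' vs' vp' vss' vpp' s : far_phase s0 s1 ss C n0 S v vs vp vss vpp ->
  far_phase s0 s1 ss C n0 S v' vs' vp' vss' vpp' ->
  (forall s, ss + 1 <= s -> s <= s1 ->
     (n0 / 4) ^+ 2 * expR (8 * (s - (ss + 1))) <= half_dmass v vs s * half_dmass v' vs' s) ->
  ss + 2 <= s -> s <= s1 -> far_const * expR (4 * s) <= mass v s.
Proof.
move=> fp fp' H h1 h2.
have s10 : s0 <= s - 1 by have := s0ss; lra.
have e1 : s - 1 + 1 = s by lra.
have := half_dmass_step (fp_phase fp) s10; rewrite e1 => /(_ h2); apply: le_trans.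
have q1 : ss + 1 <= s - 1 by lra.
have q2 : s - 1 <= s1 by lra.
have q3 : ss <= s - 1 by lra.
have b0 : 0 <= half_dmass v vs (s - 1) by apply: (half_dmass_ge0 (fp_phase fp)); rewrite s10.
have := far_upper fp' q3; rewrite e1 => /(_ h2) /(ler_wpM2l b0) /(le_trans (H _ q1 q2)).
have X0 : 0 < C / 2 * expR (4 * s) by rewrite mulr_gt0 ?divr_gt0 ?expR_gt0.
rewrite -ler_pdivrMr// => h; apply: le_trans (ler_wpM2l _ h) => //.
rewrite /far_const le_eqVlt; apply/orP; left; apply/eqP.
have -> : expR (8 * (s - 1 - (ss + 1))) = expR (- 8 * (ss + 1)) * expR (- 4) * expR (- 4) * (expR (4 * s) * expR (4 * s)).
  by rewrite -!expRD; congr expR; lra.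
have -> : expR (- 4) = (expR 4)^-1 :> R by rewrite expRN.
have x1 : expR (4 * s) != 0 by rewrite gt_eqF// expR_gt0.
have x2 : expR 4 != 0 :> R by rewrite gt_eqF// expR_gt0.
have x3 : C != 0 by rewrite gt_eqF.
by field; rewrite ?x1 ?x2 ?x3.
Qed.

Lemma far_growth th K eta s (c := pi * C ^+ 2 / far_const) :
  0 < th <= 1 -> 0 < K -> 0 <= 1 - (1 + c) * th ^+ 2 <= 1 -> K * (pi - th) < 4 * pi ->
  8 + eta <= 2 * (K * (1 - (1 + c) * th ^+ 2)) -> S th <= s -> ss + 2 <= s -> s <= s1 ->
  exists2 d, is_derive s (1 : R) (fun s => B1 s * B2 s) d & (8 + eta) * (B1 s * B2 s) <= d.
Proof.
move=> thI K0 r01 Kth hK Ss h1 h2; have /andP[th0 th1] := thI.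
have sI : ss <= s <= s1 by rewrite h2 andbT; lra.
have s0I : s0 <= s <= s1 by rewrite h2 andbT; have := s0ss; lra.
pose m := C * th ^+ 2 * expR (2 * s).
have m0 : 0 <= m by rewrite !mulr_ge0 ?sqr_ge0 ?expR_ge0// ltW.
have t01 : 0 < th ^+ 2 <= 1 by rewrite exprn_gt0//= exprn_ile1// ltW.
have edge p : pi - th <= p <= pi -> v1 (s, p) <= m /\ v2 (s, p) <= m.
  by move=> hp; split; [exact: (fp_edge fp1)|exact: (fp_edge fp2)].
(* With t = th^2 the truncation error pi m^2 / t equals c th^2 times the guaranteed lower bound of
   the mass, which is what fixes [c]. *)
have mm : pi * (m ^+ 2 / th ^+ 2) = c * th ^+ 2 * (far_const * expR (4 * s)).
  have -> : expR (4 * s) = expR (2 * s) ^+ 2 by rewrite expr2 -expRD; congr expR; lra.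
  by have fc := far_const_gt0; rewrite /m /c; field; rewrite !gt_eqF.
have c0 : 0 <= c := divr_ge0 (mulr_ge0 (pi_ge0 R) (sqr_ge0 C)) (ltW far_const_gt0).
have ct : 0 <= c * th ^+ 2 by rewrite mulr_ge0 ?sqr_ge0.
have [||d hd le] := pair_growth_trunc ph1 ph2 dis s0I m0 (ltW th0) t01 edge (c := c) _ _ r01 K0 Kth.
- rewrite mm; apply: ler_wpM2l => //; apply: (far_lower fp1 fp2) => //; exact: far_prod.
- rewrite mm; apply: ler_wpM2l => //; apply: (far_lower fp2 fp1) => // t t1 t2.
  by rewrite [leRHS]mulrC; exact: far_prod.
exists d => //; apply: le_trans le; apply: ler_wpM2r => //.
by apply: mulr_ge0; [exact: half_dmass_ge0 ph1 _ s0I|exact: half_dmass_ge0 ph2 _ s0I].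
Qed.

Lemma far_bound th K eta S' (c := pi * C ^+ 2 / far_const) :
  0 < th <= 1 -> 0 < K -> 0 <= 1 - (1 + c) * th ^+ 2 <= 1 -> K * (pi - th) < 4 * pi ->
  8 + eta <= 2 * (K * (1 - (1 + c) * th ^+ 2)) -> S th <= S' -> ss + 2 <= S' -> S' + 1 <= s1 ->
  (n0 / 4) ^+ 2 * expR (eta * (s1 - 1 - S') - 8 * (ss + 2)) <= (C / 2) ^+ 2.
Proof.
move=> thI K0 r01 Kth hK Ss h1 h2.
have S1 : S' <= s1 - 1 by lra.
have g := expR_growth (F := fun s => B1 s * B2 s) (k := 8 + eta) S1.
have {g} g : B1 S' * B2 S' * expR ((8 + eta) * (s1 - 1 - S')) <= B1 (s1 - 1) * B2 (s1 - 1).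
  apply: g => x /andP[x1 x2]; apply: (far_growth thI K0 r01 Kth hK);
    [exact: le_trans x1|exact: le_trans x1|by lra].
have l : (n0 / 4) ^+ 2 * expR (8 * (S' - (ss + 1))) <= B1 S' * B2 S'.
  by apply: far_prod; lra.
have e1 : s1 - 1 + 1 = s1 by lra.
have q1 : ss <= s1 - 1 by lra.
have q2 : s0 <= s1 - 1 <= s1 by have := s0ss; move=> h; apply/andP; split; lra.
have u1 := far_upper fp1 q1; have u2 := far_upper fp2 q1; rewrite e1 in u1 u2.
have b1 : 0 <= B1 (s1 - 1) := half_dmass_ge0 ph1 q2.
have b2 : 0 <= B2 (s1 - 1) := half_dmass_ge0 ph2 q2.
have u := ler_pM b1 b2 (u1 (lexx _)) (u2 (lexx _)).
have E0 := @expR_gt0 R ((8 + eta) * (s1 - 1 - S')).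
have := le_trans (ler_wpM2r (ltW E0) l) (le_trans g u).
have -> : C / 2 * expR (4 * s1) * (C / 2 * expR (4 * s1)) = (C / 2) ^+ 2 * expR (8 * s1).
  by rewrite mulrACA -expRD expr2; congr (_ * expR _); lra.
have -> : (n0 / 4) ^+ 2 * expR (8 * (S' - (ss + 1))) * expR ((8 + eta) * (s1 - 1 - S')) =
   (n0 / 4) ^+ 2 * expR (eta * (s1 - 1 - S') - 8 * (ss + 2)) * expR (8 * s1).
  move: ((n0 / 4) ^+ 2) => A; rewrite -!mulrA -!expRD; congr (A * expR _); lra.
by rewrite ler_pM2r// expR_gt0.
Qed.

End Fixed.

(** The angle th and the gain eta depend only on constants shared by all [s1]. They are fixed first,
    and [s1] is then taken so large that growth at rate 8 + eta exceeds the upper bound. *)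
Lemma two_phase_false : (forall s1, ss <= s1 -> exists v1 vs1 vp1 vss1 vpp1 v2 vs2 vp2 vss2 vpp2,
    [/\ far_phase s0 s1 ss C n0 S v1 vs1 vp1 vss1 vpp1, far_phase s0 s1 ss C n0 S v2 vs2 vp2 vss2 vpp2
      & forall z, 0 < v1 z -> v2 z = 0]) -> False.
Proof.
move=> H; pose c := pi * C ^+ 2 / far_const.
have c0 : 0 <= c := divr_ge0 (mulr_ge0 (pi_ge0 R) (sqr_ge0 C)) (ltW far_const_gt0).
have [th [K [eta [thI [K0 eta0] r01 Kth hK]]]] := truncation_parameters c0 (@pi_gt0 R).
pose S' := Num.max (S th) (ss + 2).
have SS : S th <= S' by rewrite le_max lexx.
have S2 : ss + 2 <= S' by rewrite le_max lexx orbT.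
clearbody S'.
(* By expR x >= 1 + x, the second term of [X] multiplied by (n0 / 4)^2 already equals (C / 2)^2, so
   the 1 gives a strict excess. *)
pose X := `|8 * (ss + 2)| + 4 * C ^+ 2 / n0 ^+ 2.
have X0 : 0 <= X.
  by apply: addr_ge0 => //; apply: divr_ge0; [apply: mulr_ge0 => //|]; exact: sqr_ge0.
pose s1 := S' + 1 + X / eta.
have Xe : 0 <= X / eta by rewrite divr_ge0// ltW.
have h1 : S' + 1 <= s1 by rewrite lerDl.
have h2 : ss <= s1 by move: h1 S2; lra.
have [v1 [vs1 [vp1 [vss1 [vpp1 [v2 [vs2 [vp2 [vss2 [vpp2 [fp1 fp2 dis]]]]]]]]]]] := H _ h2.
have := far_bound fp1 fp2 dis thI K0 r01 Kth hK SS S2 h1.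
have -> : eta * (s1 - 1 - S') = X.
  have -> : s1 - 1 - S' = X / eta by rewrite /s1; lra.
  by rewrite mulrC mulfVK// gt_eqF.
have n4 : 0 < (n0 / 4) ^+ 2 by rewrite exprn_gt0// divr_gt0.
have := ler_wpM2l (ltW n4) (expR_ge1Dx (X - 8 * (ss + 2))).
have : (n0 / 4) ^+ 2 * (4 * C ^+ 2 / n0 ^+ 2) = (C / 2) ^+ 2 by field; rewrite gt_eqF.
have h3 : 0 <= (n0 / 4) ^+ 2 * (`|8 * (ss + 2)| - 8 * (ss + 2)).
  by rewrite mulr_ge0 ?(ltW n4)// subr_ge0 ler_norm.
rewrite /X; move: h3 n4; set a := 4 * C ^+ 2 / n0 ^+ 2; set b := (n0 / 4) ^+ 2; set d := (C / 2) ^+ 2.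
set e := `|_|; set f := 8 * _; set g := expR _; move: a b d e f g => a b d e f g; lra.
Qed.

End Constants.

End Monotonicity.

(** * Polar coordinates *)

Section PolarCalculus.
Context {R : realType}.
Implicit Types (F : R * R -> R) (f : R -> R).

Lemma itg_gt0 f (a b x : R) : continuous f -> (forall t, 0 <= f t) -> a < x < b -> 0 < f x ->
  0 < itg a b f.
Proof.
move=> cf f0 /andP[ax xb] fx.
have fx2 : 0 < f x / 2 by rewrite divr_gt0.
have [d d0 Hd] := (cont1P f).1 cf x _ fx2.
pose e := Num.min (Num.min (x - a) (b - x)) d / 2.
have m0 : 0 < Num.min (Num.min (x - a) (b - x)) d by rewrite !lt_min !subr_gt0 ax xb.
have e0 : 0 < e by rewrite divr_gt0.
have em : e < Num.min (Num.min (x - a) (b - x)) d by rewrite ltr_pdivrMr// ltr_pMr// ltr1n.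
move: em; rewrite !lt_min => /andP[/andP[e1 e2] e3].
rewrite -(itg_chasles a (x - e)) -(itg_chasles (x - e) (x + e)).
have h1 : 0 <= itg a (x - e) f by apply: itg_ge0 => //; lra.
have h2 : 0 <= itg (x + e) b f by apply: itg_ge0 => //; lra.
have : itg (x - e) (x + e) (fun=> f x / 2) <= itg (x - e) (x + e) f.
  apply: itg_le => //; [by lra|exact: contC|].
  move=> t /andP[t1 t2]; have : `|t - x| < d by rewrite ltr_norml; apply/andP; split; lra.
  by move=> /Hd; rewrite ltr_norml => /andP[h _]; lra.
rewrite itg_cst; have := mulr_gt0 fx2 e0; move: (itg _ _ _) h1 h2 => A h1 h2.
have -> : x + e - (x - e) = 2 * e by lra.
by lra.
Qed.

Lemma mvt' f df (a b : R) : (forall x, is_derive x (1 : R) f (df x)) ->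
  exists2 c, `|c - a| <= `|b - a| & f b - f a = df c * (b - a).
Proof.
move=> H; have [ab|ba] := leP a b.
  have [c /andP[ac cb] E] := mvt ab (fun x _ => H x); exists c => //.
  by rewrite !ger0_norm ?subr_ge0// lerD2r.
have [c /andP[bc ca] E] := mvt (ltW ba) (fun x _ => H x); exists c.
  by rewrite !ler0_norm ?subr_le0 ?(ltW ba)//; lra.
by move: E; lra.
Qed.

(** Only partial derivatives and the continuity of [F1] are given. The increment of [X] is treated
    by the mean value theorem at the moved value of [Y], that of [Y] by the chain rule in one
    variable. *)
Lemma chain2 F F1 F2 (X Y : R -> R) (dX dY s : R) : continuous F1 ->
  (forall q y, is_derive q (1 : R) (fun t => F (t, y)) (F1 (q, y))) ->
  (forall q y, is_derive y (1 : R) (fun t => F (q, t)) (F2 (q, y))) ->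
  is_derive s (1 : R) X dX -> is_derive s (1 : R) Y dY ->
  is_derive s (1 : R) (fun s => F (X s, Y s)) (F1 (X s, Y s) * dX + F2 (X s, Y s) * dY).
Proof.
move=> cF1 D1 D2 hX hY.
pose G t := F (X t, Y t) - F (X s, Y t).
have hG : is_derive s (1 : R) G (F1 (X s, Y s) * dX).
  have Gs : G s = 0 by rewrite /G subrr.
  apply: is_deriveP => e e0.
  pose A := F1 (X s, Y s); pose L := `|dX| + 1.
  have L0 : 0 < L by rewrite ltr_wpDl.
  have e1 : 0 < e / 2 / L by rewrite !divr_gt0.
  have [d1 d10 H1] := (cont2P F1).1 cF1 (X s, Y s) _ e1.
  have e2 : 0 < Num.min 1 (e / 2 / (`|A| + 1)) by rewrite lt_min ltr01 !divr_gt0// ltr_wpDl.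
  have [d2 d20 H2] := is_derive_bound hX e2.
  have [d3 d30 H3] := is_derive_bound hY ltr01.
  pose LY := `|dY| + 1; have LY0 : 0 < LY by rewrite ltr_wpDl.
  exists (Num.min (Num.min d2 d3) (Num.min (d1 / L) (d1 / LY))).
    by rewrite !lt_min d20 d30 !divr_gt0.
  move=> h; rewrite !lt_min => /andP[/andP[hd2 hd3] /andP[hL hLY]].
  rewrite Gs subr0 /G.
  have [c hc ->] := mvt' (X s) (X (s + h)) (fun q => D1 q (Y (s + h))).
  have bnd (Z : R -> R) dZ k : `|Z (s + h) - Z s - h * dZ| <= k * `|h| -> k <= 1 ->
      `|Z (s + h) - Z s| <= (`|dZ| + 1) * `|h|.
    move=> b k1; rewrite -[Z (s + h) - Z s](subrK (h * dZ)); apply: le_trans (ler_normD _ _) _.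
    rewrite mulrDl mul1r addrC normrM [`|h| * _]mulrC lerD2l; apply: le_trans b _.
    by rewrite ler_piMl.
  have bX := bnd _ _ _ (H2 _ hd2) (ltac:(by rewrite ge_min lexx)).
  have bY := bnd _ _ _ (H3 _ hd3) (lexx _).
  have cX : `|c - X s| < d1 by apply: le_lt_trans hc (le_lt_trans bX _); rewrite mulrC -ltr_pdivlMr.
  have cY : `|Y (s + h) - Y s| < d1 by apply: le_lt_trans bY _; rewrite mulrC -ltr_pdivlMr.
  have a1 := ltW (H1 (c, Y (s + h)) cX cY).
  have a2 : `|A| * `|X (s + h) - X s - h * dX| <= e / 2 * `|h|.
    apply: (@le_trans _ _ (`|A| * (e / 2 / (`|A| + 1) * `|h|))).
      apply: ler_wpM2l => //; apply: le_trans (H2 _ hd2) _; apply: ler_wpM2r => //.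
      by rewrite ge_min lexx orbT.
    rewrite mulrA; apply: ler_wpM2r => //; rewrite mulrCA ler_piMr ?divr_ge0 ?(ltW e0)//.
    by rewrite ler_pdivrMr ?mul1r ?lerDl// ltr_wpDl.
  have a3 : `|F1 (c, Y (s + h)) - A| * `|X (s + h) - X s| <= e / 2 * `|h|.
    apply: le_trans (ler_pM _ _ a1 bX) _ => //.
    by rewrite -/L mulrA divfK// gt_eqF.
  rewrite -/A.
  have -> : F1 (c, Y (s + h)) * (X (s + h) - X s) - h * (A * dX) =
    (F1 (c, Y (s + h)) - A) * (X (s + h) - X s) + A * (X (s + h) - X s - h * dX) by ring.
  apply: le_trans (ler_normD _ _) _; rewrite !normrM.
  by apply: le_trans (lerD a3 a2) _; rewrite -mulrDl -splitr.
have hH : is_derive s (1 : R) (fun t => F (X s, Y t)) (F2 (X s, Y s) * dY).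
  exact: (is_derive1_comp (f := fun t => F (X s, t)) (g := Y)).
have h := is_deriveD hG hH.
have -> : (fun s => F (X s, Y s)) = G + (fun t => F (X s, Y t)).
  by apply/funext => t; rewrite /G /= fctE; lra.
exact: h.
Qed.

(* A C^2 convex nondecreasing substitute for the positive part, with the same linear growth. *)
Definition ramp (t : R) : R := pos_part t ^+ 3 * ((1 + pos_part t)^-1) ^+ 2.
Definition ramp1 (t : R) : R := (pos_part t ^+ 3 + 3 * pos_part t ^+ 2) * ((1 + pos_part t)^-1) ^+ 3.
Definition ramp2 (t : R) : R := 6 * pos_part t * ((1 + pos_part t)^-1) ^+ 4.

Let den (t : R) : 1 <= 1 + pos_part t. Proof. by rewrite lerDl pos_part_ge0. Qed.
Let den_gt0 (t : R) : 0 < 1 + pos_part t. Proof. exact: lt_le_trans ltr01 (den t). Qed.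
Let den_ge0 (t : R) n : 0 <= ((1 + pos_part t)^-1) ^+ n.
Proof. by rewrite exprn_ge0// invr_ge0 ltW. Qed.
Let cpp := @cont_pos_part R.
Let cden n : continuous (fun t : R => ((1 + pos_part t)^-1) ^+ n).
Proof.
apply: contX; apply: contV; first by apply: contD => //; exact: contC.
by move=> t; rewrite gt_eqF.
Qed.

Lemma cont_ramp : continuous ramp.
Proof. by apply: contM => //; exact: contX. Qed.

Lemma cont_ramp1 : continuous ramp1.
Proof.
apply: contM => //; apply: contD; first exact: contX.
by apply: contM; [exact: contC|exact: contX].
Qed.

Lemma cont_ramp2 : continuous ramp2.
Proof. by apply: contM => //; apply: contM => //; exact: contC. Qed.

Lemma ramp_ge0 t : 0 <= ramp t.
Proof. by rewrite mulr_ge0// exprn_ge0// pos_part_ge0. Qed.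

Lemma ramp1_ge0 t : 0 <= ramp1 t.
Proof. by rewrite mulr_ge0// addr_ge0 ?mulr_ge0// ?exprn_ge0// pos_part_ge0. Qed.

Lemma ramp2_ge0 t : 0 <= ramp2 t.
Proof. by rewrite mulr_ge0// mulr_ge0// pos_part_ge0. Qed.

Lemma ramp_le0 t : t <= 0 -> ramp t = 0.
Proof. by move=> t0; rewrite /ramp /pos_part max_r// expr0n mul0r. Qed.

Lemma ramp_gt0 t : 0 < t -> 0 < ramp t.
Proof.
move=> t0; rewrite mulr_gt0 ?exprn_gt0 ?invr_gt0//.
by rewrite /pos_part max_l// ltW.
Qed.

Lemma ramp_le_pos t : ramp t <= pos_part t.
Proof.
rewrite /ramp; have := pos_part_ge0 t; move: (pos_part t) (den_gt0 t) => p d0 p0.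
rewrite exprVn ler_pdivrMr ?exprn_gt0//.
have : 0 <= p * (1 + 2 * p) by rewrite mulr_ge0// addr_ge0// mulr_ge0.
by rewrite !exprS expr0; lra.
Qed.

Lemma derive_near f g df (x : R) : 0 < x -> (forall y, 0 < y -> f y = g y) ->
  is_derive x (1 : R) g df -> is_derive x (1 : R) f df.
Proof.
move=> x0 H hg; apply: (near_eq_is_derive _ hg).
apply: (filterS _ (nbhsx_ballx x _ x0)) => y; rewrite /ball /= => xy.
by apply/esym/H; move: xy; rewrite ltr_norml => /andP[]; lra.
Qed.

Lemma derive_flat f (K x : R) : x <= 0 -> (forall t, `|f t| <= K * pos_part t ^+ 2) ->
  is_derive x (1 : R) f 0.
Proof.
move=> x0 H; have fx : f x = 0.
  by apply/eqP; rewrite -normr_le0; have := H x; rewrite /pos_part max_r// expr0n mulr0.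
have K0 : 0 <= K by have := H 1; rewrite /pos_part max_l// expr1n mulr1; apply: le_trans.
apply: is_deriveP => e e0; exists (e / (K + 1)) => [|h]; first by rewrite divr_gt0// ltr_wpDl.
rewrite ltr_pdivlMr ?ltr_wpDl// => hd; rewrite fx mulr0 !subr0; apply: le_trans (H _) _.
have : pos_part (x + h) ^+ 2 <= `|h| ^+ 2.
  rewrite ler_pXn2r ?nnegrE ?pos_part_ge0// /pos_part ge_max normr_ge0 andbT.
  by have := ler_norm h; lra.
move=> /(ler_wpM2l K0) h1; apply: le_trans h1 _.
rewrite [`|h| ^+ 2]expr2 mulrA; apply: ler_wpM2r => //.
by have := normr_ge0 h; lra.
Qed.

Let dinv n (x : R) : 0 < x -> is_derive x (1 : R) (fun y : R => ((1 + y)^-1) ^+ n)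
  (- n%:R * ((1 + x)^-1) ^+ n.+1).
Proof.
move=> x0; have d0 : 1 + x != 0 by rewrite gt_eqF// addr_gt0.
have h1 : is_derive x (1 : R) (fun y : R => 1 + y) (0 + 1) by exact: is_deriveD.
have h2 := is_deriveV d0 h1.
elim: n => [|n IH].
  by rewrite mulNr mul0r oppr0; exact: is_derive_cst.
have -> : (fun y : R => ((1 + y)^-1) ^+ n.+1) = (fun y : R => (1 + y)^-1) * (fun y => ((1 + y)^-1) ^+ n).
  by apply/funext => y; rewrite exprS.
apply: is_derive_eq (is_deriveM h2 IH) _.
rewrite /GRing.scale /= add0r mulr1 -exprVn -natr1 !exprS expr0.
by move: (n%:R) ((1 + x)^-1) => N i; move: (i ^+ n) => I; ring.
Qed.

Lemma derive_ramp (t : R) : is_derive t (1 : R) ramp (ramp1 t).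
Proof.
have [t0|t0] := leP t 0.
  have -> : ramp1 t = 0 by rewrite /ramp1 /pos_part max_r// !expr0n mulr0 addr0 mul0r.
  apply: (derive_flat (K := 1) t0) => x; rewrite ger0_norm ?ramp_ge0// mul1r /ramp.
  rewrite exprVn ler_pdivrMr ?exprn_gt0// exprSr; apply: ler_wpM2l; first exact: sqr_ge0.
  have := pos_part_ge0 x; move: (pos_part x) => p p0; have := sqr_ge0 p; rewrite !exprS expr0; lra.
apply: (derive_near (g := fun y : R => y ^+ 3 * ((1 + y)^-1) ^+ 2) t0).
  by move=> y y0; rewrite /ramp /pos_part max_l// ltW.
have h1 : is_derive t (1 : R) (fun y : R => y ^+ 3) (3 * t ^+ 2).
  have -> : (fun y : R => y ^+ 3) = (fun y => y) * (fun y => y * y) by apply/funext => y; rewrite exprS expr2.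
  have hid : is_derive t (1 : R) (fun y : R => y) 1 := is_derive_id t (1 : R).
  have h : is_derive t (1 : R) (fun y : R => y * y) (t *: (1 : R) + t *: (1 : R)) := is_deriveM hid hid.
  by apply: is_derive_eq (is_deriveM hid h) _; rewrite /GRing.scale /=; ring.
apply: is_derive_eq (is_deriveM h1 (dinv 2 t0)) _.
rewrite /GRing.scale /= /ramp1 /pos_part max_l ?ltW//; field; rewrite gt_eqF// addr_gt0//.
Qed.

Lemma derive_ramp1 (t : R) : is_derive t (1 : R) ramp1 (ramp2 t).
Proof.
have [t0|t0] := leP t 0.
  have -> : ramp2 t = 0 by rewrite /ramp2 /pos_part max_r// mulr0 mul0r.
  apply: (derive_flat (K := 3) t0) => x; rewrite ger0_norm ?ramp1_ge0// /ramp1.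
  rewrite exprVn ler_pdivrMr ?exprn_gt0//.
  have := pos_part_ge0 x; move: (pos_part x) => p p0.
  have -> : p ^+ 3 + 3 * p ^+ 2 = p ^+ 2 * (p + 3) by ring.
  have -> : 3 * p ^+ 2 * (1 + p) ^+ 3 = p ^+ 2 * (3 * (1 + p) ^+ 3) by ring.
  apply: ler_wpM2l; first exact: sqr_ge0.
  have := exprn_ge0 3 p0; have := exprn_ge0 2 p0; rewrite !exprS expr0; lra.
apply: (derive_near (g := fun y : R => (y ^+ 3 + 3 * y ^+ 2) * ((1 + y)^-1) ^+ 3) t0).
  by move=> y y0; rewrite /ramp1 /pos_part max_l// ltW.
have h1 : is_derive t (1 : R) (fun y : R => y ^+ 3 + 3 * y ^+ 2) (3 * t ^+ 2 + 6 * t).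
  have -> : (fun y : R => y ^+ 3 + 3 * y ^+ 2) = (fun y => y * y) * (fun y => y + 3).
    by apply/funext => y; rewrite /= fctE; ring.
  have hid : is_derive t (1 : R) (fun y : R => y) 1 := is_derive_id t (1 : R).
  have h : is_derive t (1 : R) (fun y : R => y * y) (t *: (1 : R) + t *: (1 : R)) := is_deriveM hid hid.
  have h' : is_derive t (1 : R) (fun y : R => y + 3) (1 + 0) by exact: is_deriveD.
  by apply: is_derive_eq (is_deriveM h h') _; rewrite /GRing.scale /=; ring.
apply: is_derive_eq (is_deriveM h1 (dinv 3 t0)) _.
rewrite /GRing.scale /= /ramp2 /pos_part max_l ?ltW//; field; rewrite gt_eqF// addr_gt0//.
Qed.

Lemma ramp_mono (s t : R) : s <= t -> ramp s <= ramp t.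
Proof.
move=> st; apply: derive_ge0_le' => // x _; exists (ramp1 x); [exact: derive_ramp|exact: ramp1_ge0].
Qed.

Lemma sin_le_id (x : R) : 0 <= x -> sin x <= x.
Proof.
move=> x0; rewrite -subr_ge0.
have : 0 - sin 0 <= x - sin x.
  apply: (derive_ge0_le' (F := fun x => x - sin x) x0) => y _.
  exists (1 - cos y); first exact: is_deriveB.
  by rewrite subr_ge0 cos_le1.
by rewrite sin0 subr0.
Qed.

Lemma cos_ge_half (x : R) : 0 <= x <= 1 -> 2^-1 <= cos x.
Proof.
move=> /andP[x0 x1].
have e : x = x / 2 + x / 2 by rewrite -splitr.
have h0 : 0 <= x / 2 by rewrite divr_ge0.
have h1 := sin_le_id h0.
have h2 : 0 <= sin (x / 2) by apply: sin_ge0_pi; rewrite h0 /=; have := pi_ge2 R; lra.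
have h3 : sin (x / 2) * sin (x / 2) <= x / 2 * (x / 2) by apply: ler_pM.
have h4 : x / 2 * (x / 2) <= 4^-1 by nra.
have h5 := cos2Dsin2 (x / 2); rewrite !expr2 in h5.
by rewrite e cosD; lra.
Qed.

Definition polar (z : R * R) : R * R := (expR z.1 * cos z.2, expR z.1 * sin z.2).

Lemma cont_polar F : continuous F -> continuous (fun z => F (polar z)).
Proof.
move=> cF; apply: cont2 => //; apply: contM; apply: cont1;
  by [exact: continuous_expR|exact: continuous_cos|exact: continuous_sin|exact: contF|exact: contS].
Qed.

Lemma polar_surj (q y : R) : 0 < y -> exists t p, 0 < p < pi /\ polar (t, p) = (q, y).
Proof.
move=> y0; pose r := Num.sqrt (q ^+ 2 + y ^+ 2).
have r0 : 0 < r by rewrite sqrtr_gt0 ltr_wpDl ?sqr_ge0// exprn_gt0.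
have rr : r ^+ 2 = q ^+ 2 + y ^+ 2 by rewrite sqr_sqrtr// addr_ge0// sqr_ge0.
have qr : `|q| < r.
  rewrite -(ltr_pXn2r (n := 2)) ?nnegrE// ?(ltW r0)// rr real_normK ?num_real//.
  by rewrite ltrDl exprn_gt0.
move: qr; rewrite ltr_norml => /andP[q1 q2].
have a1 : -1 < q / r by rewrite ltr_pdivlMr// mulN1r.
have a2 : q / r < 1 by rewrite ltr_pdivrMr// mul1r.
have aI : -1 <= q / r <= 1 by rewrite !ltW.
exists (ln r), (acos (q / r)); split.
  by rewrite acos_gt0 ?acos_ltpi ?a1 ?a2 ?(ltW a1) ?(ltW a2).
rewrite /polar /= lnK ?posrE// acosK ?in_itv//= sin_acos//.
congr pair; first by rewrite mulrC mulfVK// gt_eqF.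
have -> : 1 - (q / r) ^+ 2 = (y / r) ^+ 2.
  have r2 : r ^+ 2 != 0 by rewrite gt_eqF// exprn_gt0.
  rewrite !expr_div_n; apply: (mulIf r2); rewrite mulrBl mul1r !divfK// rr; lra.
by rewrite sqrtr_sqr ger0_norm ?divr_ge0 ?(ltW y0) ?(ltW r0)// mulrC mulfVK// gt_eqF.
Qed.

End PolarCalculus.

(** * Truncated C^2 functions in logarithmic polar coordinates *)

Section PolarPhase.
Context {R : realType}.
Variables (F F1 F2 F11 F12 F21 F22 : R * R -> R).
Hypothesis hF : C2 F F1 F2 F11 F12 F21 F22.

Let X (z : R * R) := (polar z).1.
Let Y (z : R * R) := (polar z).2.

Let cX : continuous X.
Proof.
by apply: contM; apply: cont1; [exact: continuous_expR|exact: contF|exact: continuous_cos|exact: contS].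
Qed.
Let cY : continuous Y.
Proof.
by apply: contM; apply: cont1; [exact: continuous_expR|exact: contF|exact: continuous_sin|exact: contS].
Qed.

Let dXs s p : is_derive s (1 : R) (fun s => X (s, p)) (X (s, p)).
Proof.
have h := is_deriveM (is_derive_expR s) (is_derive_cst (cos p) s (1 : R)).
by apply: is_derive_eq h _; rewrite scaler0 add0r /GRing.scale /= mulrC.
Qed.
Let dYs s p : is_derive s (1 : R) (fun s => Y (s, p)) (Y (s, p)).
Proof.
have h := is_deriveM (is_derive_expR s) (is_derive_cst (sin p) s (1 : R)).
by apply: is_derive_eq h _; rewrite scaler0 add0r /GRing.scale /= mulrC.
Qed.
Let dXp s p : is_derive p (1 : R) (fun p => X (s, p)) (- Y (s, p)).
Proof.
by apply: is_derive_eq (is_deriveZ (expR s) (is_derive_cos p)) _; rewrite /GRing.scale /= mulrN.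
Qed.
Let dYp s p : is_derive p (1 : R) (fun p => Y (s, p)) (X (s, p)).
Proof. exact: (is_deriveZ (expR s) (is_derive_sin p)). Qed.

Let V z := F (polar z).
Let Vs z := F1 (polar z) * X z + F2 (polar z) * Y z.
Let Vp z := F1 (polar z) * - Y z + F2 (polar z) * X z.
Let Vss z := (F1 (polar z) * X z + X z * (F11 (polar z) * X z + F12 (polar z) * Y z)) +
  (F2 (polar z) * Y z + Y z * (F21 (polar z) * X z + F22 (polar z) * Y z)).
Let Vpp z := (F1 (polar z) * - X z + - Y z * (F11 (polar z) * - Y z + F12 (polar z) * X z)) +
  (F2 (polar z) * - Y z + X z * (F21 (polar z) * - Y z + F22 (polar z) * X z)).

Let dVs s p : is_derive s (1 : R) (fun s => V (s, p)) (Vs (s, p)).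
Proof. exact: (chain2 (C2_cont1 hF) (C2_d1 hF) (C2_d2 hF) (dXs s p) (dYs s p)). Qed.
Let dVp s p : is_derive p (1 : R) (fun p => V (s, p)) (Vp (s, p)).
Proof. exact: (chain2 (C2_cont1 hF) (C2_d1 hF) (C2_d2 hF) (dXp s p) (dYp s p)). Qed.
Let dF1s s p := chain2 (C2_cont11 hF) (C2_d11 hF) (C2_d12 hF) (dXs s p) (dYs s p).
Let dF2s s p := chain2 (C2_cont21 hF) (C2_d21 hF) (C2_d22 hF) (dXs s p) (dYs s p).
Let dF1p s p := chain2 (C2_cont11 hF) (C2_d11 hF) (C2_d12 hF) (dXp s p) (dYp s p).
Let dF2p s p := chain2 (C2_cont21 hF) (C2_d21 hF) (C2_d22 hF) (dXp s p) (dYp s p).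
Let dVss s p : is_derive s (1 : R) (fun s => Vs (s, p)) (Vss (s, p)).
Proof. exact: (is_deriveD (is_deriveM (dF1s s p) (dXs s p)) (is_deriveM (dF2s s p) (dYs s p))). Qed.
Let dVpp s p : is_derive p (1 : R) (fun p => Vp (s, p)) (Vpp (s, p)).
Proof.
exact: (is_deriveD (is_deriveM (dF1p s p) (is_deriveN (dYp s p))) (is_deriveM (dF2p s p) (dXp s p))).
Qed.

(** Logarithmic polar coordinates are conformal: the Laplacian is multiplied by r^2, with no
    first-order term left. *)
Let sumV z : Vss z + Vpp z = (F11 (polar z) + F22 (polar z)) * (X z ^+ 2 + Y z ^+ 2).
Proof. by rewrite /Vss /Vpp; ring. Qed.

Let cV : continuous V. Proof. exact: cont_polar (C2_cont hF). Qed.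
Let cG (G : R * R -> R) : continuous G -> continuous (fun z => G (polar z)). Proof. exact: cont_polar. Qed.
Let c1 := cG (C2_cont1 hF).
Let c2 := cG (C2_cont2 hF).
Let c11 := cG (C2_cont11 hF).
Let c12 := cG (C2_cont12 hF).
Let c21 := cG (C2_cont21 hF).
Let c22 := cG (C2_cont22 hF).

Let cVs : continuous Vs. Proof. by apply: contD; exact: contM. Qed.
Let cVp : continuous Vp. Proof. by apply: contD; apply: contM => //; exact: contN. Qed.
Let cVss : continuous Vss.
Proof. by do 2 apply: contD; apply: contM => //; apply: contD; exact: contM. Qed.
Let cVpp : continuous Vpp.
Proof.
have cNX := contN cX; have cNY := contN cY.
by do 2 apply: contD; apply: contM => //; apply: contD; exact: contM.
Qed.

Let comp_ramp (f : R -> R) df e t : is_derive t (1 : R) f df ->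
  is_derive t (1 : R) (fun t => ramp (f t - e)) (ramp1 (f t - e) * df).
Proof.
move=> h; have h1 : is_derive t (1 : R) (fun t => f t - e) (df - 0) by exact: is_deriveB.
rewrite subr0 in h1; have := derive_ramp (f t - e) => h2.
exact: (is_derive1_comp (f := ramp) (g := fun t => f t - e)).
Qed.

Let comp_ramp1 (f df : R -> R) ddf e t : is_derive t (1 : R) f (df t) -> is_derive t (1 : R) df ddf ->
  is_derive t (1 : R) (fun t => ramp1 (f t - e) * df t)
    (ramp2 (f t - e) * df t ^+ 2 + ramp1 (f t - e) * ddf).
Proof.
move=> h h'; have h1 : is_derive t (1 : R) (fun t => f t - e) (df t - 0) by exact: is_deriveB.
rewrite subr0 in h1; have := derive_ramp1 (f t - e) => h2.
have h3 : is_derive t (1 : R) (fun t => ramp1 (f t - e)) (ramp2 (f t - e) * df t).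
  exact: (is_derive1_comp (f := ramp1) (g := fun t => f t - e)).
by apply: is_derive_eq (is_deriveM h3 h') _; rewrite /GRing.scale /=; ring.
Qed.

(** Where F > e, the Laplacian of the truncation is [ramp2] times a squared gradient plus [ramp1]
    times that of F, both nonnegative. Elsewhere the factor [ramp] vanishes. *)
Lemma polar_phase (s0 s1 e : R) :
  (forall p, F (polar (s0, p)) <= e) ->
  (forall s, s0 <= s <= s1 -> F (polar (s, 0)) <= e /\ F (polar (s, pi)) <= e) ->
  (forall s p, s0 <= s <= s1 -> 0 <= p <= pi -> e < F (polar (s, p)) ->
     0 <= F11 (polar (s, p)) + F22 (polar (s, p))) ->
  exists vs vp vss vpp, phase s0 s1 (fun z => ramp (F (polar z) - e)) vs vp vss vpp.
Proof.
move=> Hi He Hs.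
have cU : continuous (fun z => V z - e) by apply: contB => //; exact: contC.
have r0 := cont1 (@cont_ramp R) cU; have r1 := cont1 (@cont_ramp1 R) cU; have r2 := cont1 (@cont_ramp2 R) cU.
exists (fun z => ramp1 (V z - e) * Vs z), (fun z => ramp1 (V z - e) * Vp z).
exists (fun z => ramp2 (V z - e) * Vs z ^+ 2 + ramp1 (V z - e) * Vss z).
exists (fun z => ramp2 (V z - e) * Vp z ^+ 2 + ramp1 (V z - e) * Vpp z).
split => //.
- exact: contM.
- exact: contM.
- by apply: contD; apply: contM => //; exact: contX.
- by apply: contD; apply: contM => //; exact: contX.
- by move=> s p; exact: comp_ramp (dVs s p).
- by move=> s p; exact: comp_ramp (dVp s p).
- by move=> s p; exact: comp_ramp1 (dVs s p) (dVss s p).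
- by move=> s p; exact: comp_ramp1 (dVp s p) (dVpp s p).
- by move=> z; exact: ramp_ge0.
- by move=> p; rewrite ramp_le0// subr_le0.
- by move=> s /He[h1 h2]; rewrite !ramp_le0// subr_le0.
move=> s p hs hp; have [h|h] := leP (F (polar (s, p))) e.
  by rewrite ramp_le0 ?mul0r// subr_le0.
have h1 := Hs s p hs hp h; apply: mulr_ge0; first exact: ramp_ge0.
rewrite addrACA -!mulrDr sumV; apply: addr_ge0; apply: mulr_ge0.
- exact: ramp2_ge0.
- by rewrite addr_ge0// sqr_ge0.
- exact: ramp1_ge0.
- by rewrite mulr_ge0// addr_ge0// sqr_ge0.
Qed.

End PolarPhase.

(** * Total ordering of the solutions *)

Section Ordering.
Context {R : realType}.
Implicit Types (g : R * R -> R) (c : R).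

Definition gap g1 g2 : R * R -> R := fun z => g1 z - g2 z.

(** Where g1 > g2 >= 0 the function g1 is positive, so [frc g1] is harmonic there while [frc g2] is
    superharmonic; the parabola cancels in the difference. *)
Lemma lap_gap_ge0 c g1 g2 a q y : gsol c g1 -> gsol c g2 -> 0 < a -> 0 < y ->
  (forall P Y, q <= P <= q + 2 * a -> y <= Y <= y + 2 * a -> 0 < gap g1 g2 (P, Y)) ->
  0 <= lap a (gap g1 g2) (q, y).
Proof.
move=> gs1 gs2 a0 y0 H.
have -> : gap g1 g2 = fun z => frc g1 z - frc g2 z.
  by apply/funext => z; rewrite /gap /frc; lra.
rewrite lapB; [|exact: cont_frc (g_cont gs1)|exact: cont_frc (g_cont gs2)].
have h2 := lap_frc_le0 gs2 q a0 y0.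
have h1 : 0 <= lap a (frc g1) (q, y).
  apply: (lap_frc_ge0 gs1 a0 y0) => P Y hP hY; have := H P Y hP hY; have := g_ge0 gs2 (P, Y).
  by rewrite /gap; lra.
by rewrite subr_ge0; apply: le_trans h1.
Qed.

Lemma polar_bound (s p M : R) : expR s <= M -> `|(polar (s, p)).1| <= M /\ `|(polar (s, p)).2| <= M.
Proof.
move=> sM; have e0 := @expR_ge0 R s.
rewrite /polar /= !normrM (ger0_norm e0); split; apply: le_trans sM; apply: ler_piMr => //.
  by rewrite ler_norml cos_geN1 cos_le1.
by rewrite ler_norml sin_geN1 sin_le1.
Qed.

Lemma polar_norm2 (s p : R) : (polar (s, p)).1 ^+ 2 + (polar (s, p)).2 ^+ 2 = expR (2 * s).
Proof.
have -> : expR (2 * s) = expR s ^+ 2 by rewrite expr2 -expRD; congr expR; lra.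
by rewrite /polar /= !exprMn -mulrDr cos2Dsin2 mulr1.
Qed.

(** * The positive part of the difference of two solutions as a phase *)

Section FarPhase.
Variables (c C0 e s0 ss t : R) (g1 g2 : R * R -> R).
Hypotheses (gs1 : gsol c g1) (gs2 : gsol c g2) (C0_gt0 : 0 < C0) (e0 : 0 < e) (ss0 : 0 <= ss).
Hypothesis t_itv : s0 <= t <= ss.
Hypothesis growth : forall q y, 0 <= y -> g1 (q, y) <= C0 * (1 + q ^+ 2 + y ^+ 2).
Hypothesis left : forall q y, q <= - C0 -> 0 <= y -> g1 (q, y) <= y ^+ 2 / 2 + C0 * (1 + y).
Hypothesis small : forall p, gap g1 g2 (polar (s0, p)) <= e / 2.

Let w := gap g1 g2.
Let cw : continuous w. Proof. exact: contB (g_cont gs1) (g_cont gs2). Qed.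

Let w_le q y : w (q, y) <= g1 (q, y).
Proof. by rewrite /w /gap gerBl; exact: g_ge0 gs2 _. Qed.

Let w_low q y : y <= 0 -> w (q, y) = 0.
Proof. by move=> y0; rewrite /w /gap (g_low gs1)// (g_low gs2)// subrr. Qed.

(** Near the angle pi one has q <= - r / 2 <= - C0 and y <= th r, so the bound for negative q gives
    th^2 r^2 / 2 + C0 (1 + y). From r >= th^-2 on, 1 + y is also at most 2 th^2 r^2. *)
Lemma gap_edge th s p : 0 < th <= 1 -> (th ^+ 2)^-1 + 2 * C0 <= s -> pi - th <= p <= pi ->
  w (polar (s, p)) <= (1 + 2 * C0) * th ^+ 2 * expR (2 * s).
Proof.
move=> /andP[th0 th1] hs /andP[p1 p2].
have q0 : 0 <= pi - p by lra.
have qt : pi - p <= th by lra.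
have [ec es] : cos p = - cos (pi - p) /\ sin p = sin (pi - p).
  by rewrite cosB sinB cospi sinpi; split; lra.
have E0 := @expR_gt0 R s.
have Es : (th ^+ 2)^-1 + 2 * C0 <= expR s.
  by apply: le_trans hs _; apply: le_trans (expR_ge1Dx s); rewrite lerDr.
have t2 : 0 < th ^+ 2 by rewrite exprn_gt0.
have t2i : 1 <= (th ^+ 2)^-1 by rewrite invf_ge1// exprn_ile1// ltW.
have hc : 2^-1 <= cos (pi - p) by apply: cos_ge_half; rewrite q0 /=; lra.
have hsn : 0 <= sin (pi - p) <= th.
  rewrite sin_ge0_pi ?(le_trans (sin_le_id q0))// q0 /=.
  by apply: le_trans qt (le_trans th1 _); have := pi_ge2 R; lra.
have hq : (polar (s, p)).1 <= - C0.
  rewrite /polar /= ec mulrN lerN2.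
  have := ler_wpM2l (ltW E0) hc; lra.
have /andP[hs1 hs2] := hsn.
have hy0 : 0 <= (polar (s, p)).2 by rewrite /polar /= es mulr_ge0// ltW.
have hy : (polar (s, p)).2 <= expR s * th by rewrite /polar /= es ler_pM2l.
rewrite [polar _]surjective_pairing; apply: le_trans (w_le _ _) _.
apply: le_trans (left hq hy0) _.
have -> : expR (2 * s) = expR s ^+ 2 by rewrite expr2 -expRD; congr expR; lra.
have C0_ge0 := ltW C0_gt0.
have te : 1 <= th ^+ 2 * expR s.
  by rewrite -ler_pdivrMl// mulr1; apply: le_trans Es; rewrite lerDl mulr_ge0.
have E1 : 1 <= expR s.
  by apply: le_trans Es; apply: le_trans t2i _; rewrite lerDl mulr_ge0.
have b1 : (polar (s, p)).2 ^+ 2 <= th ^+ 2 * expR s ^+ 2.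
  by rewrite -exprMn [th * _]mulrC ler_pXn2r// nnegrE mulr_ge0// ltW.
have b2 : expR s <= th ^+ 2 * expR s ^+ 2.
  by rewrite expr2 mulrA -[leLHS]mul1r ler_pM2r.
have b3 : (polar (s, p)).2 <= expR s.
  by apply: le_trans hy _; rewrite ler_piMr// ltW.
have b4 : 1 + (polar (s, p)).2 <= 2 * (th ^+ 2 * expR s ^+ 2) by lra.
have := ler_wpM2l C0_ge0 b4; have := mulr_gt0 t2 (exprn_gt0 2 E0); rewrite -mulrA.
by move: (th ^+ 2 * expR s ^+ 2) b1 => A b1; lra.
Qed.

Lemma gap_growth s p : 0 <= s -> 0 <= p <= pi -> w (polar (s, p)) <= 2 * C0 * expR (2 * s).
Proof.
move=> s_ge0 hp; have hy : 0 <= (polar (s, p)).2.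
  by rewrite /polar /= mulr_ge0 ?expR_ge0// sin_ge0_pi.
have := growth (polar (s, p)).1 hy; have := w_le (polar (s, p)).1 (polar (s, p)).2.
rewrite -surjective_pairing -addrA polar_norm2 => h1 h2; apply: le_trans h1 (le_trans h2 _).
have : 1 <= expR (2 * s) by rewrite -expR0 ler_expR mulr_ge0.
by move=> /(ler_wpM2l (ltW C0_gt0)); lra.
Qed.

Definition far_C : R := 4 * pi * C0 ^+ 2 + (1 + 2 * C0).

(** The smoothing error is at most e / 2 for radii up to expR s1, so truncation at e kills the inner
    circle and the edges. Where the smoothed gap exceeds e, the gap exceeds e / 2 and stays positive
    on the whole averaging box, so that [lap_gap_ge0] applies. The level 2 e in the initial mass
    leaves room for the smoothing error. *)
Lemma gap_far_phase s1 n0 : ss <= s1 ->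
  n0 <= itg 0 pi (fun p => ramp (w (polar (t, p)) - 2 * e) ^+ 2) ->
  exists2 d, 0 < d & forall a, 0 < a < d -> exists vs vp vss vpp,
    far_phase s0 s1 ss far_C n0 (fun th => (th ^+ 2)^-1 + 2 * C0)
      (fun z => ramp (smooth a w (polar z) - e)) vs vp vss vpp.
Proof.
move=> ss1 hn.
have e20 : 0 < e / 2 by rewrite divr_gt0.
have [d1 d10 H1] := smooth_near (expR s1) cw e20.
have [d2 d20 H2] := unif2 (expR s1) cw e20.
have /andP[s0t tss] := t_itv.
exists (Num.min d1 (d2 / 2)) => [|a]; first by rewrite lt_min d10 divr_gt0.
rewrite lt_min => /andP[a0 /andP[ad1 ad2]].
have near s p : s <= s1 -> `|smooth a w (polar (s, p)) - w (polar (s, p))| <= e / 2.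
  move=> hs; have [b1 b2] := @polar_bound s p (expR s1) (ltac:(by rewrite ler_expR)).
  by apply: H1 => //; rewrite a0.
have near1 s p : s <= s1 -> smooth a w (polar (s, p)) <= w (polar (s, p)) + e / 2.
  by move=> /near -/(_ p); rewrite ler_norml => /andP[_]; lra.
have near2 s p : s <= s1 -> w (polar (s, p)) - e / 2 <= smooth a w (polar (s, p)).
  by move=> /near -/(_ p); rewrite ler_norml => /andP[]; lra.
have [F1 [F2 [F11 [F12 [F21 [F22 [hF hlap]]]]]]] := smooth_C2 a0 cw.
have [|||vs [vp [vss [vpp ph]]]] := @polar_phase R _ _ _ _ _ _ _ hF s0 s1 e.
- move=> p; apply: le_trans (near1 _ _ _) _; first by rewrite (le_trans s0t)// (le_trans tss).
  by have := small p; rewrite /w; lra.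
- move=> s /andP[_ hs]; split; apply: le_trans (near1 _ _ hs) _.
    by rewrite /polar /= sin0 mulr0 w_low// add0r; lra.
  by rewrite /polar /= sinpi mulr0 w_low// add0r; lra.
- move=> s p /andP[_ hs] hp he; rewrite hlap.
  have hw : e / 2 < w (polar (s, p)) by have := near1 s p hs; lra.
  have [b1 b2] := @polar_bound s p (expR s1) (ltac:(by rewrite ler_expR)).
  have y0 : 0 < (polar (s, p)).2.
    rewrite ltNge; apply/negP => /w_low h; move: hw.
    by rewrite [polar _]surjective_pairing h; lra.
  rewrite [polar _]surjective_pairing; apply: (lap_gap_ge0 gs1 gs2) => // P Y /andP[P1 P2] /andP[Y1 Y2].
  have h1 : `|P - (polar (s, p)).1| < d2 by rewrite ltr_norml; apply/andP; split; lra.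
  have h2 : `|Y - (polar (s, p)).2| < d2 by rewrite ltr_norml; apply/andP; split; lra.
  have := H2 (polar (s, p)) (P, Y) b1 b2 h1 h2; rewrite ltr_norml.
  move=> /andP[hPY _]; change (0 < w (P, Y)).
  by move: (w (P, Y)) (w (polar (s, p))) hPY hw => A B; lra.
exists vs, vp, vss, vpp; split => //.
- exists t; first by rewrite s0t tss.
  apply: le_trans hn _; apply: itg_le; first exact: pi_ge0.
  + apply: contX; apply: cont1; first exact: cont_ramp.
    apply: contB; last exact: contC.
    by apply: (@contP1 _ (fun z => w (polar z))); exact: cont_polar.
  + by apply: contX; apply: (contP1 (x := t) (ph_c ph)).
  move=> p _; rewrite ler_pXn2r ?nnegrE ?ramp_ge0//; apply: ramp_mono.
  by have := near2 t p (le_trans tss ss1); lra.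
- move=> s /andP[hs hs1].
  have bnd p : 0 <= p <= pi -> ramp (smooth a w (polar (s, p)) - e) ^+ 2 <= 4 * C0 ^+ 2 * expR (4 * s).
    move=> hp; have -> : 4 * C0 ^+ 2 * expR (4 * s) = (2 * C0 * expR (2 * s)) ^+ 2.
      have -> : expR (4 * s) = expR (2 * s) ^+ 2 by rewrite expr2 -expRD; congr expR; lra.
      by ring.
    have B0 : 0 <= 2 * C0 * expR (2 * s) by rewrite !mulr_ge0 ?expR_ge0// ltW.
    rewrite ler_pXn2r ?nnegrE ?ramp_ge0//; apply: le_trans (ramp_le_pos _) _.
    rewrite /pos_part ge_max B0 andbT.
    by have := gap_growth (le_trans ss0 hs) hp; have := near1 s p hs1; have := e0; lra.
  have h : mass (fun z => ramp (smooth a w (polar z) - e)) s <= itg 0 pi (fun=> 4 * C0 ^+ 2 * expR (4 * s)).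
    apply: itg_le bnd; [exact: pi_ge0|by apply: contX; apply: (contP1 (x := s) (ph_c ph))|exact: contC].
  apply: le_trans h _; rewrite itg_cst subr0 mulrAC; apply: ler_wpM2r; first exact: expR_ge0.
  by rewrite /far_C; have := C0_gt0; lra.
- move=> th s p hth hS /andP[hs hs1] hp; have B := gap_edge hth hS hp.
  have X0 : 0 <= th ^+ 2 * expR (2 * s) by rewrite mulr_ge0 ?sqr_ge0 ?expR_ge0.
  have CC : (1 + 2 * C0) * th ^+ 2 * expR (2 * s) <= far_C * th ^+ 2 * expR (2 * s).
    rewrite -(mulrA (1 + 2 * C0)) -(mulrA far_C); apply: ler_wpM2r => //.
    by rewrite /far_C lerDr; apply: mulr_ge0; [rewrite mulr_ge0 ?pi_ge0|exact: sqr_ge0].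
  apply: le_trans (ramp_le_pos _) _; apply: le_trans CC.
  have Y0 : 0 <= (1 + 2 * C0) * th ^+ 2 * expR (2 * s).
    by rewrite -(mulrA (1 + 2 * C0)) mulr_ge0// addr_ge0// mulr_ge0// ltW.
  rewrite /pos_part ge_max Y0 andbT.
  by have := near1 s p hs1; have := e0; lra.
Qed.

End FarPhase.

Lemma ramp_disjoint (e X : R) : 0 < e -> 0 < ramp (X - e) -> forall Y, Y = - X -> ramp (Y - e) = 0.
Proof.
move=> e0 h Y ->; apply: ramp_le0; rewrite leNgt; apply/negP => h'.
have eX : X - e <= 0 by lra.
by move: h; rewrite ramp_le0// ltxx.
Qed.

Lemma ordering c g1 g2 : gsol c g1 -> gsol c g2 ->
  (forall z, g1 z <= g2 z) \/ (forall z, g2 z <= g1 z).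
Proof.
move=> gs1 gs2; apply: contrapT => /not_orP[/existsNP[z1 /negP n1] /existsNP[z2 /negP n2]].
rewrite -ltNge in n1; rewrite -ltNge in n2.
have key : forall ga gb z, gsol c ga -> gsol c gb -> gb z < ga z -> exists t p, 0 < p < pi /\ polar (t, p) = z.
  move=> ga gb [q y] gsa gsb h; apply: polar_surj; rewrite ltNge; apply/negP => y0.
  by move: h; rewrite (g_low gsa)// (g_low gsb)// ltxx.
have [t1 [p1 [p1I E1]]] := key _ _ _ gs1 gs2 n1.
have [t2 [p2 [p2I E2]]] := key _ _ _ gs2 gs1 n2.
have bounds g : gsol c g -> exists C, forall C', C <= C' -> 0 < C' /\
   (forall q y, 0 <= y -> g (q, y) <= C' * (1 + q ^+ 2 + y ^+ 2)) /\
   (forall q y, q <= - C' -> 0 <= y -> g (q, y) <= y ^+ 2 / 2 + C' * (1 + y)).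
  move=> gs; have [C C_gt0 H] := gsol_growth gs; have [D D_gt0 H'] := g_left gs.
  exists (Num.max C D) => C'; rewrite ge_max => /andP[CC DC].
  split; first exact: lt_le_trans CC.
  split=> q y h1 => [|h2].
    by apply: le_trans (H q y h1) _; apply: ler_wpM2r => //; rewrite !addr_ge0// sqr_ge0.
  have qD : q <= - D by apply: le_trans h1 _; rewrite lerN2.
  by apply: le_trans (H' q y qD h2) _; rewrite lerD2l ler_wpM2r// addr_ge0.
have [Ca Ha] := bounds g1 gs1; have [Cb Hb] := bounds g2 gs2.
pose C0 := Num.max Ca Cb.
have [C0_gt0 [gr1 lf1]] := Ha C0 (ltac:(by rewrite le_max lexx)).
have [_ [gr2 lf2]] := Hb C0 (ltac:(by rewrite le_max lexx orbT)).
pose m := Num.min (g1 z1 - g2 z1) (g2 z2 - g1 z2).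
have m0 : 0 < m by rewrite lt_min !subr_gt0 n1 n2.
(* At [z1] and [z2] the gap is at least 3 e, above the level 2 e of the initial mass. *)
pose e := m / 3; have e0 : 0 < e by rewrite divr_gt0.
have m1 : 3 * e <= gap g1 g2 z1 by rewrite /e mulrC divfK// ge_min lexx.
have m2 : 3 * e <= gap g2 g1 z2 by rewrite /e mulrC divfK// ge_min lexx orbT.
have cw : continuous (gap g1 g2) := contB (g_cont gs1) (g_cont gs2).
have e20 : 0 < e / 2 by rewrite divr_gt0.
have [d d0 Hd] := (cont2P (gap g1 g2)).1 cw (0, 0) _ e20.
pose s0 := Num.min (ln (d / 2)) (Num.min t1 t2).
pose ss := Num.max 0 (Num.max t1 t2).
have d20 : 0 < d / 2 by rewrite divr_gt0.
have small p : `|gap g1 g2 (polar (s0, p))| <= e / 2.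
  have es : expR s0 <= d / 2.
    by rewrite -[leRHS]lnK ?posrE// ler_expR ge_min lexx.
  have [b1 b2] := polar_bound p es.
  have dd : d / 2 < d by rewrite ltr_pdivrMr// ltr_pMr// ltr1n.
  have := Hd (polar (s0, p)); rewrite !subr0 => /(_ (le_lt_trans b1 dd) (le_lt_trans b2 dd)).
  have -> : gap g1 g2 (0, 0) = 0.
    by rewrite /gap (g_low gs1 0 (lexx 0)) (g_low gs2 0 (lexx 0)) subrr.
  by rewrite subr0 => /ltW.
have small1 p : gap g1 g2 (polar (s0, p)) <= e / 2 by apply: le_trans (ler_norm _) (small p).
have small2 p : gap g2 g1 (polar (s0, p)) <= e / 2.
  by apply: le_trans (small p); rewrite -normrN; apply: le_trans (ler_norm _); rewrite /gap; lra.
have ss0 : 0 <= ss by rewrite le_max lexx.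
have t1I : s0 <= t1 <= ss by rewrite ge_min ge_min lexx orbT le_max le_max lexx /= orbT.
have t2I : s0 <= t2 <= ss by rewrite ge_min ge_min lexx !orbT le_max le_max lexx !orbT.
pose N ga gb t := itg 0 pi (fun p => ramp (gap ga gb (polar (t, p)) - 2 * e) ^+ 2).
have N0 ga gb t p z : continuous ga -> continuous gb -> 0 < p < pi -> polar (t, p) = z ->
    3 * e <= gap ga gb z -> 0 < N ga gb t.
  move=> ca cb hp E h; apply: (itg_gt0 (x := p)) => //.
  - apply: contX; apply: cont1; first exact: cont_ramp.
    apply: contB; last exact: contC.
    by apply: (@contP1 _ (fun z => gap ga gb (polar z))); apply: cont_polar; exact: contB.
  - by move=> x; exact: sqr_ge0.
  - by rewrite exprn_gt0// ramp_gt0// E; move: e0 h; lra.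
have h1 := N0 _ _ _ _ _ (g_cont gs1) (g_cont gs2) p1I E1 m1.
have h2 := N0 _ _ _ _ _ (g_cont gs2) (g_cont gs1) p2I E2 m2.
pose n0 := Num.min (N g1 g2 t1) (N g2 g1 t2).
have n0_gt0 : 0 < n0 by rewrite lt_min h1 h2.
have FC0 : 0 < far_C C0.
  rewrite /far_C ltr_wpDl//; first by apply: mulr_ge0; [rewrite mulr_ge0 ?pi_ge0|exact: sqr_ge0].
  by have := C0_gt0; lra.
have s0ss : s0 <= ss by case/andP: t1I => a b; exact: le_trans b.
apply: (two_phase_false FC0 n0_gt0 s0ss (S := fun th => (th ^+ 2)^-1 + 2 * C0)) => s1 hs1.
have [da da0 HA] := gap_far_phase gs1 gs2 C0_gt0 e0 ss0 t1I gr1 lf1 small1 hs1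
  (ltac:(by rewrite ge_min lexx) : n0 <= N g1 g2 t1).
have [db db0 HB] := gap_far_phase gs2 gs1 C0_gt0 e0 ss0 t2I gr2 lf2 small2 hs1
  (ltac:(by rewrite ge_min lexx orbT) : n0 <= N g2 g1 t2).
pose a := Num.min da db / 2.
have mm : 0 < Num.min da db by rewrite lt_min da0.
have a0 : 0 < a by rewrite divr_gt0.
have am : a < Num.min da db by rewrite ltr_pdivrMr// ltr_pMr// ltr1n.
move: am; rewrite lt_min => /andP[ada adb].
have [vs [vp [vss [vpp ph1]]]] := HA a (introT andP (conj a0 ada)).
have [vs' [vp' [vss' [vpp' ph2]]]] := HB a (introT andP (conj a0 adb)).
do 10 eexists; split; [exact: ph1|exact: ph2|].
move=> z /(ramp_disjoint e0); apply.
have E : gap g2 g1 = fun z => - gap g1 g2 z by apply/funext => x; rewrite /gap opprB.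
by rewrite E; exact: (congr1 (fun h => h (polar z)) (smoothN a cw)).
Qed.

End Ordering.

(** * Scaling, directed limits and homogeneous solutions *)

Section Scaling.
Context {R : realType}.
Implicit Types (g : R * R -> R) (c l : R).

(** The variables q, x and y all scale by the same factor, so this formula rescales both [u] and its
    transform. *)
Definition gs l g : R * R -> R := fun z => l ^+ 2 * g (z.1 / l, z.2 / l).

Lemma gs1 g : gs 1 g = g.
Proof. by apply/funext => -[q y]; rewrite /gs /= expr1n mul1r !divr1. Qed.

Lemma gsM l m g : gs l (gs m g) = gs (l * m) g.
Proof. by apply/funext => -[q y]; rewrite /gs /= exprMn mulrA invfM !mulrA. Qed.

Lemma gsK l g : 0 < l -> gs l^-1 (gs l g) = g.
Proof. by move=> l0; rewrite gsM mulVf ?gs1// gt_eqF. Qed.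

Lemma gsVK l g : 0 < l -> gs l (gs l^-1 g) = g.
Proof. by move=> l0; rewrite gsM mulfV ?gs1// gt_eqF. Qed.

Lemma gs_le l g g' : (forall z, g z <= g' z) -> forall z, gs l g z <= gs l g' z.
Proof. by move=> H z; rewrite /gs ler_wpM2l// sqr_ge0. Qed.

Lemma cont_gs l g : continuous g -> continuous (gs l g).
Proof.
move=> cg; apply: contM; first exact: contC.
by apply: cont2 => //; apply: contM; by [exact: contF|exact: contS|exact: contC].
Qed.

Lemma frc_gs l g z : 0 < l -> frc (gs l g) z = l ^+ 2 * frc g (z.1 / l, z.2 / l).
Proof. by move=> l0; rewrite /frc /parab /gs /=; field; rewrite gt_eqF. Qed.

Lemma itg_gs (f : R -> R) (a b h l : R) : 0 < l -> 0 < h -> continuous f ->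
  h^-1 * itg a b (fun x => l ^+ 2 * f (x / l)) = l ^+ 2 * ((h / l)^-1 * itg (a / l) (b / l) f).
Proof.
move=> l0 h0 cf.
have cf' : continuous (fun x => f (l^-1 * x)) by apply: cont1 => //; apply: contM; [exact: contC|exact: contI].
have -> : (fun x => l ^+ 2 * f (x / l)) = (fun x => l ^+ 2 * f (l^-1 * x)).
  by apply/funext => x; rewrite mulrC [x / l]mulrC mulrC.
rewrite itgZ// [a / l]mulrC [b / l]mulrC -(itg_scale a b l^-1 cf) invfM invrK.
by field; rewrite !gt_eqF.
Qed.

Lemma gsol_gs c l g : 0 < l -> gsol c g -> gsol c (gs l g).
Proof.
move=> l0 gg; have l2 : 0 <= l ^+ 2 by exact: sqr_ge0.
have li : 0 < l^-1 by rewrite invr_gt0.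
have cg := g_cont gg.
have lin (t x x' : R) : ((1 - t) * x + t * x') / l = (1 - t) * (x / l) + t * (x' / l) by rewrite mulrDl !mulrA.
split.
- exact: cont_gs.
- move=> q y y0; rewrite /gs /= (g_low gg) ?mulr_le0_ge0 ?(ltW li)//.
  have -> : Num.max (q / l) 0 = Num.max q 0 / l.
    by rewrite maxr_pMl ?(ltW li)// mul0r.
  by field; rewrite gt_eqF.
- by move=> z; rewrite /gs mulr_ge0// (g_ge0 gg).
- by move=> q q' y qq; rewrite /gs /= ler_wpM2l// (g_mono gg)// ler_pM2r.
- move=> y q q' t t01; rewrite /gs /= lin.
  have := ler_wpM2l l2 (g_conv gg (y / l) (q / l) (q' / l) t01); lra.
- move=> q y y' t y0 y0' t01; rewrite !frc_gs//= lin.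
  have := ler_wpM2l l2 (g_conc gg (q / l) (divr_ge0 y0 (ltW l0)) (divr_ge0 y0' (ltW l0)) t01); lra.
- have [C C0 H] := g_left gg; exists (C * (l + l ^+ 2)).
    by rewrite mulr_gt0// addr_gt0// exprn_gt0.
  move=> q y hq hy; rewrite /gs /=.
  have h1 : q / l <= - C.
    rewrite ler_pdivrMr//; apply: le_trans hq _; rewrite mulNr lerN2 ler_pM2l// lerDl//.
  have := ler_wpM2l l2 (H _ _ h1 (divr_ge0 hy (ltW l0))).
  have -> : l ^+ 2 * ((y / l) ^+ 2 / 2 + C * (1 + y / l)) = y ^+ 2 / 2 + C * (l ^+ 2 + l * y).
    by field; rewrite gt_eqF.
  move=> h; apply: le_trans h _; rewrite lerD2l -mulrA ler_pM2l//.
  have := mulr_ge0 l2 hy; have := l0; move: (l ^+ 2) l2 => L; nra.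
- move=> q0 q1 y0 y1 h k h0 k0 ky yy qq.
  have c1 q : continuous (fun y => g (q, y)) by exact: contP1.
  have c2 y : continuous (fun q => frc g (q, y)) by apply: contP2; exact: cont_frc.
  pose F y := g (q1 / l, y) - g (q1 / l - h / l, y) - (g (q0 / l + h / l, y) - g (q0 / l, y)).
  pose F' q := frc g (q, y0 / l) - frc g (q, y0 / l - k / l) - (frc g (q, y1 / l + k / l) - frc g (q, y1 / l)).
  have cF : continuous F by apply: contB; apply: contB; exact: c1.
  have cF' : continuous F' by apply: contB; apply: contB; exact: c2.
  have -> : (fun y => gs l g (q1, y) - gs l g (q1 - h, y) - (gs l g (q0 + h, y) - gs l g (q0, y))) =
    (fun y => l ^+ 2 * F (y / l)).
    by apply/funext => y; rewrite /F /gs /= !mulrDl !mulNr; ring.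
  have -> : (fun q => frc (gs l g) (q, y0) - frc (gs l g) (q, y0 - k) - (frc (gs l g) (q, y1 + k) - frc (gs l g) (q, y1))) =
    (fun q => l ^+ 2 * F' (q / l)).
    by apply/funext => q; rewrite /F' !frc_gs//= !mulrDl !mulNr; ring.
  rewrite (itg_gs _ _ l0 h0 cF) (itg_gs _ _ l0 k0 cF').
  by apply: ler_wpM2l => //; apply: (g_flux_le gg); rewrite ?divr_gt0// ler_pM2r.
- move=> q0 q1 y0 y1 h k h0 k0 y00 ky qq pos.
  have c1 q : continuous (fun y => g (q, y)) by exact: contP1.
  have c2 y : continuous (fun q => frc g (q, y)) by apply: contP2; exact: cont_frc.
  pose F y := g (q1 / l + h / l, y) - g (q1 / l, y) - (g (q0 / l, y) - g (q0 / l - h / l, y)).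
  pose F' q := frc g (q, y0 / l + k / l) - frc g (q, y0 / l) - (frc g (q, y1 / l) - frc g (q, y1 / l - k / l)).
  have cF : continuous F by apply: contB; apply: contB; exact: c1.
  have cF' : continuous F' by apply: contB; apply: contB; exact: c2.
  have -> : (fun y => gs l g (q1 + h, y) - gs l g (q1, y) - (gs l g (q0, y) - gs l g (q0 - h, y))) =
    (fun y => l ^+ 2 * F (y / l)).
    by apply/funext => y; rewrite /F /gs /= !mulrDl !mulNr; ring.
  have -> : (fun q => frc (gs l g) (q, y0 + k) - frc (gs l g) (q, y0) - (frc (gs l g) (q, y1) - frc (gs l g) (q, y1 - k))) =
    (fun q => l ^+ 2 * F' (q / l)).
    by apply/funext => q; rewrite /F' !frc_gs//= !mulrDl !mulNr; ring.
  rewrite (itg_gs _ _ l0 h0 cF) (itg_gs _ _ l0 k0 cF').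
  apply: ler_wpM2l => //; apply: (g_flux_ge gg); rewrite ?divr_gt0// -?mulrDl ?ler_pM2r//.
  move=> y /andP[ya yb].
  have ya' : y0 <= y * l by rewrite -ler_pdivrMr.
  have yb' : y * l <= y1 by rewrite -ler_pdivlMr.
  have := pos (y * l) (introT andP (conj ya' yb')).
  by rewrite /gs /= mulfK ?gt_eqF// pmulr_rgt0// exprn_gt0.
Qed.

End Scaling.

(** * Continuity from convexity and concavity *)

Section Limits.
Context {R : realType}.
Implicit Types (g G H : R * R -> R) (c : R).

Lemma conv_lip (K : R -> R) (B : R) :
  (forall x x' t, -1 <= x <= 1 -> -1 <= x' <= 1 -> 0 <= t <= 1 ->
     K ((1 - t) * x + t * x') <= (1 - t) * K x + t * K x') ->
  (forall x, -1 <= x <= 1 -> 0 <= K x <= B) -> forall t, `|t| <= 1 -> `|K t - K 0| <= B * `|t|.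
Proof.
move=> cK bK.
have one (e t : R) : e = 1 \/ e = -1 -> 0 <= t <= 1 -> `|K (t * e) - K 0| <= B * t.
  move=> he /andP[t0 t1].
  have eI : -1 <= e <= 1 by case: he => ->; rewrite !lexx ?andbT /=; lra.
  have eI' : -1 <= - e <= 1 by move: eI => /andP[]; rewrite lerN2 => ? ?; apply/andP; split; lra.
  have z1 : -1 <= (0 : R) <= 1 by rewrite lerN10 ler01.
  have tI : -1 <= t * e <= 1 by case: he => ->; apply/andP; split; lra.
  have /andP[b0 _] := bK 0 z1; have /andP[_ be] := bK e eI; have /andP[_ be'] := bK (- e) eI'.
  have h1 := cK 0 e t z1 eI (introT andP (conj t0 t1)); rewrite mulr0 add0r in h1.
  (* The weight [u] writes 0 as a convex combination of t e and - e, which yields the lower bound on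
     K (t e). *)
  pose u := t / (1 + t).
  have d0 : 0 < 1 + t by lra.
  have ud : u * (1 + t) = t by rewrite /u divfK// gt_eqF.
  have u0 : 0 <= u by rewrite divr_ge0// ltW.
  have u1 : u <= 1 by rewrite ler_pdivrMr//; lra.
  have h2 := cK (t * e) (- e) u tI eI' (introT andP (conj u0 u1)).
  have e0 : (1 - u) * (t * e) + u * - e = 0.
    have -> : (1 - u) * (t * e) + u * - e = e * (t - u * (1 + t)) by ring.
    by rewrite ud subrr mulr0.
  rewrite e0 in h2.
  have tB : t * K e <= t * B by exact: ler_wpM2l.
  have tK : 0 <= t * K 0 by exact: mulr_ge0.
  have h3 : K 0 * (1 + t) <= K (t * e) + t * B.
    have := ler_wpM2r (ltW d0) h2; have uB : u * K (- e) <= u * B by exact: ler_wpM2l.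
    have -> : ((1 - u) * K (t * e) + u * K (- e)) * (1 + t) = K (t * e) * (1 + t - u * (1 + t)) + u * K (- e) * (1 + t) by ring.
    rewrite ud; have := ler_wpM2r (ltW d0) uB.
    have -> : u * B * (1 + t) = t * B by rewrite mulrAC ud.
    by lra.
  by rewrite ler_norml; apply/andP; split; lra.
move=> t; have [t0|t0] := leP 0 t.
  by rewrite ger0_norm// => t1; rewrite -{1}[t]mulr1; apply: one; [left|rewrite t0].
rewrite ltr0_norm// => t1.
have tI : 0 <= - t <= 1 by rewrite t1 andbT oppr_ge0 ltW.
by have := one (-1) (- t) (or_intror erefl) tI; rewrite mulrNN mulr1.
Qed.

(** The conditions that pass to pointwise limits. They already force continuity, which upgrades the
    approximation to a locally uniform one, and only then do the flux conditions pass to the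
    limit. *)
Definition pre_gsol c H G : Prop :=
  [/\ (forall q y, y <= 0 -> G (q, y) = c * (Num.max q 0) ^+ 2 / 2),
      (forall z, 0 <= G z <= H z),
      (forall y q q' t, 0 <= t <= 1 -> G ((1 - t) * q + t * q', y) <= (1 - t) * G (q, y) + t * G (q', y)) &
      (forall q y y' t, 0 <= y -> 0 <= y' -> 0 <= t <= 1 ->
         (1 - t) * frc G (q, y) + t * frc G (q, y') <= frc G (q, (1 - t) * y + t * y'))].

Lemma cont_low c : continuous (fun q : R => c * (Num.max q 0) ^+ 2 / 2).
Proof.
by apply: contM; [apply: contM; [exact: contC|apply: contX; exact: cont_pos_part]|exact: contC].
Qed.

(** At a point with y0 > 0, convexity in q, uniformly for nearby y, and concavity of [frc G] in y
    turn the bound by [H] into Lipschitz estimates in each variable. *)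
Lemma pre_gsol_cont c H G : gsol c H -> pre_gsol c H G -> continuous G.
Proof.
move=> sH [low bnd conv conc]; apply/cont2P => -[q0 y0] e e0.
have cH := g_cont sH; have cl := @cont_low c.
have e40 : 0 < e / 4 by rewrite divr_gt0.
have [y0n|y0p] := leP y0 0; last first.
  have [B0 HB0] := bound2 (`|q0| + y0 * 2 + 1) cH.
  pose B := `|B0| + 2 * y0 ^+ 2 + 1.
  have B_gt0 : 0 < B.
    by rewrite /B; have := normr_ge0 B0; have := sqr_ge0 y0; lra.
  have GB q y : `|q - q0| <= 1 -> 0 <= y <= 2 * y0 -> 0 <= G (q, y) <= `|B0|.
    move=> hq /andP[hy1 hy2]; have /andP[-> h] := bnd (q, y); apply: le_trans h _.
    apply: le_trans (ler_norm _) _; apply: le_trans (ler_norm B0); apply: HB0 => /=.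
      rewrite -[q](subrK q0); apply: le_trans (ler_normD _ _) _; lra.
    by rewrite ger0_norm//; have := normr_ge0 q0; lra.
  have L1 q y : `|q - q0| <= 1 -> 0 <= y <= 2 * y0 -> `|G (q, y) - G (q0, y)| <= B * `|q - q0|.
    move=> hq hy; have := @conv_lip (fun t => G (q0 + t, y)) B _ _ (q - q0) hq.
    rewrite /= addr0 [q0 + (q - q0)]addrC subrK; apply=> [x x' t _ _ tI|x xI].
      have -> : q0 + ((1 - t) * x + t * x') = (1 - t) * (q0 + x) + t * (q0 + x') by ring.
      exact: conv.
    have /andP[-> h] : 0 <= G (q0 + x, y) <= `|B0|.
      by apply: GB => //; rewrite addrC addKr ler_norml.
    by apply: le_trans h _; rewrite /B; have := sqr_ge0 y0; lra.
  have L2 y : `|y - y0| <= y0 -> `|frc G (q0, y) - frc G (q0, y0)| <= B * (`|y - y0| / y0).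
    move=> hy; have hy' : `|(y - y0) / y0| <= 1.
      by rewrite normrM normfV (gtr0_norm y0p) ler_pdivrMr// mul1r.
    have := @conv_lip (fun t => `|B0| - frc G (q0, y0 + y0 * t)) B _ _ _ hy'.
    have -> : y0 + y0 * ((y - y0) / y0) = y by field; rewrite gt_eqF.
    rewrite mulr0 addr0 normrM normfV (gtr0_norm y0p).
    have -> : `|B0| - frc G (q0, y) - (`|B0| - frc G (q0, y0)) = - (frc G (q0, y) - frc G (q0, y0)) by ring.
    rewrite normrN; apply=> [x x' t /andP[x1 _] /andP[x1' _] tI|x /andP[x1 x2]].
      have p1 : 0 <= y0 + y0 * x by have := ler_wpM2l (ltW y0p) x1; lra.
      have p2 : 0 <= y0 + y0 * x' by have := ler_wpM2l (ltW y0p) x1'; lra.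
      have -> : y0 + y0 * ((1 - t) * x + t * x') = (1 - t) * (y0 + y0 * x) + t * (y0 + y0 * x') by ring.
      by have := conc q0 _ _ t p1 p2 tI; lra.
    have p1 : 0 <= y0 + y0 * x <= 2 * y0.
      by have := ler_wpM2l (ltW y0p) x1; have := ler_wpM2l (ltW y0p) x2; move=> *; apply/andP; split; lra.
    have /andP[b1 b2] := GB q0 _ (ltac:(by rewrite subrr normr0)) p1.
    rewrite /frc /parab /= /B; have := sqr_ge0 (y0 + y0 * x).
    have : (y0 + y0 * x) ^+ 2 <= (2 * y0) ^+ 2.
      by case/andP: p1 => p1 p2; rewrite ler_pXn2r// nnegrE// (le_trans p1).
    rewrite exprMn; have : (2 : R) ^+ 2 = 4 by ring.
    move=> -> s1 s2; apply/andP; split; lra.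
  have d1 : 0 < e / 4 / B by rewrite divr_gt0.
  have cX : continuous (fun y : R => y ^+ 2) by apply: contX; exact: contI.
  have [d2 d20 H2] := (cont1P (fun y : R => y ^+ 2)).1 cX y0 _ e40.
  exists (Num.min (Num.min 1 y0) (Num.min (Num.min (e / 4 / B) (y0 * (e / 4 / B))) d2)).
    by rewrite !lt_min ltr01 y0p d1 d20 mulr_gt0.
  move=> [q y] /=; rewrite !lt_min => /andP[/andP[q1 q2] /andP[/andP[q3 q4] q5]] /andP[/andP[y1 y2] /andP[/andP[y3 y4] y5]].
  have yI : 0 <= y <= 2 * y0 by move: y2; rewrite ltr_norml => /andP[? ?]; apply/andP; split; lra.
  have a1 := L1 q y (ltW q1) yI; have a2 := L2 y (ltW y2); have a3 := ltW (H2 y y5).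
  have a1' : `|G (q, y) - G (q0, y)| <= e / 4.
    by apply: le_trans a1 _; rewrite mulrC -ler_pdivlMr// ltW.
  have a2' : `|frc G (q0, y) - frc G (q0, y0)| <= e / 4.
    by apply: le_trans a2 _; rewrite mulrC -ler_pdivlMr// ler_pdivrMr// mulrC ltW.
  have -> : G (q, y) - G (q0, y0) = (G (q, y) - G (q0, y)) + ((frc G (q0, y) - frc G (q0, y0)) + (y ^+ 2 - y0 ^+ 2) / 2).
    by rewrite /frc /parab /=; ring.
  apply: le_lt_trans (ler_normD _ _) _.
  have := ler_normD (frc G (q0, y) - frc G (q0, y0)) ((y ^+ 2 - y0 ^+ 2) / 2).
  have -> : `|(y ^+ 2 - y0 ^+ 2) / 2| = `|y ^+ 2 - y0 ^+ 2| / 2 by rewrite normrM [`|2^-1|]ger0_norm// invr_ge0.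
  move: a1' a2' a3 (normr_ge0 (y ^+ 2 - y0 ^+ 2)) e0.
  move: (`|G (q, y) - G (q0, y)|) (`|frc G (q0, y) - frc G (q0, y0)|) (`|y ^+ 2 - y0 ^+ 2|) => x1 x2 x3.
  move: (`|frc G (q0, y) - frc G (q0, y0) + _|) => x4; lra.
(* At the boundary both bounds are continuous with the right value. *)
pose lo z := (1 - Num.max z.2 (0 : R)) * (c * (Num.max z.1 (0 : R)) ^+ 2 / 2) - Num.max z.2 (0 : R) / 2.
have clo : continuous lo.
  have m2 : continuous (fun z : R * R => Num.max z.2 (0 : R)) by apply: (cont1 (h := @pos_part R)); [exact: cont_pos_part|exact: contS].
  apply: contB; last by apply: contM => //; exact: contC.
  apply: contM; first by apply: contB => //; exact: contC.
  by apply: (cont1 (f := fun z : R * R => z.1) cl); exact: contF.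
have G0 : G (q0, y0) = c * (Num.max q0 (0 : R)) ^+ 2 / 2 by exact: low.
have H0 : H (q0, y0) = G (q0, y0) by rewrite G0 (g_low sH).
have lo0 : lo (q0, y0) = G (q0, y0) by rewrite /lo /= max_r// subr0 mul1r mul0r subr0 G0.
have lole q y : y < 1 -> lo (q, y) <= G (q, y).
  move=> y1; rewrite /lo /=; have [yn|yp] := leP y 0.
    by rewrite subr0 mul1r mul0r subr0 low.
  have := conc q 0 1 y (lexx 0) ler01 (introT andP (conj (ltW yp) (ltW y1))).
  rewrite mulr0 add0r mulr1 /frc /parab /= low// expr0n /= mul0r subr0 expr1n.
  have /andP[+ _] := bnd (q, 1); move=> /(mulr_ge0 (ltW yp)).
  by have := sqr_ge0 y; lra.
have [d1 d10 H1] := (cont2P H).1 cH (q0, y0) _ e0.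
have [d2 d20 H2] := (cont2P lo).1 clo (q0, y0) _ e0.
exists (Num.min 1 (Num.min d1 d2)); first by rewrite !lt_min ltr01 d10.
move=> [q y] /=; rewrite !lt_min => /andP[q1 /andP[q2 q3]] /andP[y1 /andP[y2 y3]].
have := H1 (q, y) q2 y2; have := H2 (q, y) q3 y3; rewrite H0 lo0 !ltr_norml.
have yy : y < 1 by move: y1; rewrite ltr_norml => /andP[_]; lra.
have := lole q y yy; have /andP[_] := bnd (q, y).
move: (H (q, y)) (G (q, y)) (lo (q, y)) (G (q0, y0)) => h g l g0 h1 h2 /andP[h3 h4] /andP[h5 h6].
by apply/andP; split; lra.
Qed.

End Limits.

(** * Limits of directed families of solutions and the extremal rescalings *)

Section DirectedLimits.
Context {R : realType}.
Implicit Types (g G H : R * R -> R) (c : R).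

Lemma segment_bound (a b h : R) : 0 <= h -> exists M0, forall M x, M0 <= M -> a <= x <= b ->
  [/\ `|x| <= M, `|x + h| <= M & `|x - h| <= M].
Proof.
move=> h0; exists (`|a| + `|b| + h) => M x MM /andP[ax xb].
have hx : `|x| <= `|a| + `|b|.
  have := ler_norm b; have := ler_norm (- a); rewrite normrN => a1 b1.
  by have := normr_ge0 a; have := normr_ge0 b; rewrite ler_norml => *; apply/andP; split; lra.
have hp := ler_normD x h; have hm := ler_normB x h; rewrite (ger0_norm h0) in hp hm.
by split; lra.
Qed.

Section Family.
Variables (c : R) (D : set (R * R -> R)) (G H : R * R -> R).
Hypotheses (sH : gsol c H) (sD : forall g, D g -> gsol c g) (DH : forall g z, D g -> g z <= H z).
Hypothesis dir : forall g g', D g -> D g' -> exists2 k, D k &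
  forall z, `|k z - G z| <= `|g z - G z| /\ `|k z - G z| <= `|g' z - G z|.
Hypothesis approx : forall z e, 0 < e -> exists2 g, D g & `|g z - G z| < e.

Let approx3 (z1 z2 z3 : R * R) e : 0 < e -> exists g, [/\ gsol c g, D g,
  `|g z1 - G z1| < e, `|g z2 - G z2| < e & `|g z3 - G z3| < e].
Proof.
move=> e0; have [g1 D1 h1] := approx z1 e0; have [g2 D2 h2] := approx z2 e0.
have [g3 D3 h3] := approx z3 e0; have [g4 D4 h4] := dir D1 D2; have [g5 D5 h5] := dir D4 D3.
exists g5; split=> //; first exact: sD.
- by have [a _] := h5 z1; have [b _] := h4 z1; apply: le_lt_trans a (le_lt_trans b h1).
- by have [a _] := h5 z2; have [_ b] := h4 z2; apply: le_lt_trans a (le_lt_trans b h2).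
- by have [_ a] := h5 z3; apply: le_lt_trans a h3.
Qed.

Let bracket (x y e : R) : `|x - y| < e -> y - e <= x <= y + e.
Proof. by rewrite ltr_norml => /andP[? ?]; apply/andP; split; lra. Qed.

Let frcB g z : frc g z - frc G z = g z - G z.
Proof. by rewrite /frc; lra. Qed.

Let convex_bound (t a b e : R) : 0 <= t <= 1 -> 0 < e ->
  (1 - t) * (a + e) + t * (b + e) = (1 - t) * a + t * b + e.
Proof. by move=> _ _; ring. Qed.

Lemma limit_pre_gsol : pre_gsol c H G.
Proof.
split.
- move=> q y y0; apply/eqP; rewrite eq_le.
  by apply/andP; split; apply/ler_addgt0Pr => e e0;
    have [g [sg _ /bracket/andP[a b] _ _]] := @approx3 (q, y) (q, y) (q, y) e e0;
    rewrite (g_low sg) in a b => //; lra.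
- move=> z; apply/andP; split; apply/ler_addgt0Pr => e e0;
    have [g [sg Dg /bracket/andP[a b] _ _]] := @approx3 z z z e e0.
    by have := g_ge0 sg z; lra.
  by have := DH z Dg; lra.
- move=> y q q' t tI; apply/ler_addgt0Pr => e e0.
  have e20 : 0 < e / 2 by rewrite divr_gt0.
  have [g [sg _ /bracket/andP[a _] /bracket/andP[_ b] /bracket/andP[_ d]]] :=
    @approx3 ((1 - t) * q + t * q', y) (q, y) (q', y) _ e20.
  have := g_conv sg y q q' tI; have := convex_bound (G (q, y)) (G (q', y)) tI e20.
  move: tI => /andP[t0 t1]; have t1' : 0 <= 1 - t by rewrite subr_ge0.
  have := ler_wpM2l t0 d; have := ler_wpM2l t1' b; lra.
- move=> q y y' t y0 y0' tI; apply/ler_addgt0Pr => e e0.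
  have e20 : 0 < e / 2 by rewrite divr_gt0.
  have [g [sg _]] := @approx3 (q, (1 - t) * y + t * y') (q, y) (q, y') _ e20.
  rewrite -!frcB => /bracket/andP[_ a] /bracket/andP[b _] /bracket/andP[d _].
  have := g_conc sg q y0 y0' tI; have := convex_bound (frc g (q, y)) (frc g (q, y')) tI e20.
  move: tI => /andP[t0 t1]; have t1' : 0 <= 1 - t by rewrite subr_ge0.
  have b' : frc G (q, y) <= frc g (q, y) + e / 2 by lra.
  have d' : frc G (q, y') <= frc g (q, y') + e / 2 by lra.
  have := ler_wpM2l t0 d'; have := ler_wpM2l t1' b'; lra.
Qed.

Lemma limit_cont : continuous G.
Proof. exact: pre_gsol_cont sH limit_pre_gsol. Qed.

(* The members at least as good as a given one form a filter base. *)
Let better : set_system (R * R -> R) := [set A | exists2 k, D k &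
  forall g, D g -> (forall z, `|g z - G z| <= `|k z - G z|) -> A g].

Let better_filter : Filter better.
Proof.
split.
- by have [g Dg _] := approx (0, 0) ltr01; exists g.
- move=> A B [k Dk Ak] [k' Dk' Bk]; have [m Dm Hm] := dir Dk Dk'; exists m => // g Dg gm; split.
    by apply: Ak => // z; have [h _] := Hm z; apply: le_trans (gm z) h.
  by apply: Bk => // z; have [_ h] := Hm z; apply: le_trans (gm z) h.
- by move=> A B AB [k Dk Ak]; exists k => // g Dg gk; apply: AB; exact: Ak.
Qed.

(** A member close to [G] at a point is close on a neighbourhood, and every better member inherits
    this there. Compactness, in its near-covering form for the filter [better], selects one member
    for the whole square. *)
Lemma dini (M e : R) : 0 < e ->
  exists2 g, D g & forall z : R * R, `|z.1| <= M -> `|z.2| <= M -> `|g z - G z| <= e.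
Proof.
move=> e0; have cG := limit_cont.
have cK : compact (`[- M, M]%classic `*` `[- M, M]%classic : set (R * R)).
  by apply: compact_setX; exact: segment_compact.
pose P (g : R * R -> R) (z : R * R) := `|g z - G z| <= e.
have := (compact_near_coveringP _).1 cK _ better P better_filter.
have loc : forall x : R * R, (`[- M, M]%classic `*` `[- M, M]%classic) x ->
    \forall x' \near x & g \near better, P g x'.
  move=> x _; have [k Dk kx] := approx x e0.
  have cd : continuous (fun z => `|k z - G z|).
    by apply: (cont1 (h := fun x : R => `|x|)); [exact: norm_continuous|exact: contB (g_cont (sD Dk)) cG].
  have e1 : 0 < e - `|k x - G x| by rewrite subr_gt0.
  have [d d0 Hd] := (cont2P _).1 cd x _ e1.
  exists (ball x d, [set g | D g /\ forall z, `|g z - G z| <= `|k z - G z|]) => /=.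
    by split; [exact: nbhsx_ballx|exists k].
  move=> [z g] /= [[z1 z2] [Dg gk]].
  rewrite /ball /= in z1 z2; rewrite distrC in z1; rewrite distrC in z2.
  have := Hd z z1 z2; rewrite ltr_norml => /andP[_ h].
  by apply: le_trans (gk z) _; lra.
move=> /(_ loc) [k Dk Hk]; exists k => // z z1 z2.
by apply: (Hk k Dk (fun z => lexx _)); split => /=; rewrite in_itv /= -ler_norml.
Qed.

Let comb4 (a1 a2 a3 a4 b1 b2 b3 b4 e : R) : `|a1 - b1| <= e -> `|a2 - b2| <= e ->
  `|a3 - b3| <= e -> `|a4 - b4| <= e ->
  `|a1 - a2 - (a3 - a4) - (b1 - b2 - (b3 - b4))| <= 4 * e.
Proof.
rewrite !ler_norml => /andP[? ?] /andP[? ?] /andP[? ?] /andP[? ?].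
by apply/andP; split; lra.
Qed.

Let itg_near (f f' : R -> R) (a b e : R) : a <= b -> continuous f -> continuous f' ->
  (forall x, a <= x <= b -> `|f x - f' x| <= e) ->
  itg a b f' - e * (b - a) <= itg a b f <= itg a b f' + e * (b - a).
Proof.
move=> ab cf cf' h; have := itg_norm_le ab (contB cf cf') h.
by rewrite itgB// ler_norml => /andP[? ?]; apply/andP; split; lra.
Qed.

Let le_of_near (h k I I' J J' a b e : R) : 0 < h -> 0 < k -> 0 <= a -> 0 <= b -> 0 < e ->
  (forall d, 0 < d -> d <= e -> exists i j, [/\ h^-1 * i <= k^-1 * j, I <= i + d * a & j <= J + d * b]) ->
  h^-1 * I <= k^-1 * J.
Proof.
move=> h0 k0 a0 b0 e0 H0; apply/ler_addgt0Pr => x x0.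
have hi : 0 < h^-1 by rewrite invr_gt0.
have ki : 0 < k^-1 by rewrite invr_gt0.
pose S := h^-1 * a + k^-1 * b + 1.
have S0 : 0 < S by rewrite ltr_wpDl// addr_ge0// mulr_ge0// ltW.
have [d d0 [de dS]] : exists2 d, 0 < d & d <= e /\ d * S <= x.
  exists (Num.min e (x / S)); first by rewrite lt_min e0 divr_gt0.
  by split; [rewrite ge_min lexx|rewrite -ler_pdivlMr// ge_min lexx orbT].
have [i [j [ij Ii jJ]]] := H0 d d0 de.
have := ler_wpM2l (ltW hi) Ii; have := ler_wpM2l (ltW ki) jJ.
rewrite /S in dS; move: ij dS; move: (h^-1) (k^-1) => p q; lra.
Qed.

Lemma limit_gsol : gsol c G.
Proof.
have [low bnd conv conc] := limit_pre_gsol; have cG := limit_cont.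
have cfG := cont_frc cG.
have c1 g q : continuous g -> continuous (fun y => g (q, y)) by move=> cg; exact: contP1.
have c2 g y : continuous g -> continuous (fun q => frc g (q, y)).
  by move=> cg; apply: contP2; exact: cont_frc.
split => //.
- by move=> z; have /andP[] := bnd z.
- move=> q q' y qq; apply/ler_addgt0Pr => e e0.
  have e20 : 0 < e / 2 by rewrite divr_gt0.
  have [g [sg _ /bracket/andP[a b] /bracket/andP[a' b'] _]] := @approx3 (q, y) (q', y) (q, y) _ e20.
  by have := g_mono sg y qq; lra.
- have [C C0 h] := g_left sH; exists C => // q y hq hy.
  by have /andP[_ b] := bnd (q, y); apply: le_trans b (h _ _ hq hy).
- move=> q0 q1 y0 y1 h k h0 k0 ky yy qq.
  have [M1 HM1] := segment_bound q0 q1 (ltW h0); have [M2 HM2] := segment_bound y0 y1 (ltW k0).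
  pose M := Num.max M1 M2.
  have hq x : q0 <= x <= q1 -> [/\ `|x| <= M, `|x + h| <= M & `|x - h| <= M].
    by apply: HM1; rewrite le_max lexx.
  have hy x : y0 <= x <= y1 -> [/\ `|x| <= M, `|x + k| <= M & `|x - k| <= M].
    by apply: HM2; rewrite le_max lexx orbT.
  have yM y : y0 <= y <= y1 -> `|y| <= M by case/hy.
  have qM q : q0 <= q <= q1 -> `|q| <= M by case/hq.
  have [p1 _ p2] := hq q1 (introT andP (conj qq (lexx _))).
  have [p4 p3 _] := hq q0 (introT andP (conj (lexx _) qq)).
  have [r1 _ r2] := hy y0 (introT andP (conj (lexx _) yy)).
  have [r4 r3 _] := hy y1 (introT andP (conj yy (lexx _))).
  apply: (@le_of_near h k _ 0 _ 0 (4 * (y1 - y0)) (4 * (q1 - q0)) 1 h0 k0) => //.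
  + by rewrite mulr_ge0// subr_ge0.
  + by rewrite mulr_ge0// subr_ge0.
  move=> d d0 _; have [g Dg Hg] := dini M d0; have sg := sD Dg; have cg := g_cont sg.
  have HG z : `|z.1| <= M -> `|z.2| <= M -> `|G z - g z| <= d by rewrite distrC; exact: Hg.
  have Hf z : `|z.1| <= M -> `|z.2| <= M -> `|frc g z - frc G z| <= d by rewrite frcB; exact: Hg.
  eexists; eexists; split; first exact: (g_flux_le sg h0 k0 ky yy qq).
  + have /andP[_] := @itg_near (fun y => G (q1, y) - G (q1 - h, y) - (G (q0 + h, y) - G (q0, y)))
      (fun y => g (q1, y) - g (q1 - h, y) - (g (q0 + h, y) - g (q0, y))) y0 y1 (4 * d) yy
      (contB (contB (c1 _ _ cG) (c1 _ _ cG)) (contB (c1 _ _ cG) (c1 _ _ cG)))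
      (contB (contB (c1 _ _ cg) (c1 _ _ cg)) (contB (c1 _ _ cg) (c1 _ _ cg)))
      (fun y hy => comb4 (HG (q1, y) p1 (yM y hy)) (HG (q1 - h, y) p2 (yM y hy))
         (HG (q0 + h, y) p3 (yM y hy)) (HG (q0, y) p4 (yM y hy))).
    by rewrite mulrA [d * 4]mulrC.
  + have /andP[_] := @itg_near
      (fun q => frc g (q, y0) - frc g (q, y0 - k) - (frc g (q, y1 + k) - frc g (q, y1)))
      (fun q => frc G (q, y0) - frc G (q, y0 - k) - (frc G (q, y1 + k) - frc G (q, y1))) q0 q1 (4 * d) qq
      (contB (contB (c2 _ _ cg) (c2 _ _ cg)) (contB (c2 _ _ cg) (c2 _ _ cg)))
      (contB (contB (c2 _ _ cG) (c2 _ _ cG)) (contB (c2 _ _ cG) (c2 _ _ cG)))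
      (fun q hq => comb4 (Hf (q, y0) (qM q hq) r1) (Hf (q, y0 - k) (qM q hq) r2)
         (Hf (q, y1 + k) (qM q hq) r3) (Hf (q, y1) (qM q hq) r4)).
    by rewrite mulrA [d * 4]mulrC.
- move=> q0 q1 y0 y1 h k h0 k0 y00 ky qq pos.
  have yy : y0 <= y1 by apply: le_trans ky; rewrite lerDl ltW.
  have [M1 HM1] := segment_bound q0 q1 (ltW h0); have [M2 HM2] := segment_bound y0 y1 (ltW k0).
  pose M := Num.max M1 M2.
  have hq x : q0 <= x <= q1 -> [/\ `|x| <= M, `|x + h| <= M & `|x - h| <= M].
    by apply: HM1; rewrite le_max lexx.
  have hy x : y0 <= x <= y1 -> [/\ `|x| <= M, `|x + k| <= M & `|x - k| <= M].
    by apply: HM2; rewrite le_max lexx orbT.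
  have yM y : y0 <= y <= y1 -> `|y| <= M by case/hy.
  have qM q : q0 <= q <= q1 -> `|q| <= M by case/hq.
  have [p2 p1 _] := hq q1 (introT andP (conj qq (lexx _))).
  have [p3 _ p4] := hq q0 (introT andP (conj (lexx _) qq)).
  have [r2 r1 _] := hy y0 (introT andP (conj (lexx _) yy)).
  have [r3 _ r4] := hy y1 (introT andP (conj yy (lexx _))).
  (* Positivity of [G] on the compact side q = q0 leaves a margin: approximants within [mu] are
     positive there too. *)
  have [ym ymI Hym] := EVT_min yy (continuous_subspaceT (c1 G q0 cG)).
  rewrite in_itv /= in ymI; pose mu := G (q0, ym) / 2.
  have mu0 : 0 < mu by rewrite divr_gt0// pos.
  apply: (@le_of_near k h _ 0 _ 0 (4 * (q1 - q0)) (4 * (y1 - y0)) mu k0 h0) => //.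
  + by rewrite mulr_ge0// subr_ge0.
  + by rewrite mulr_ge0// subr_ge0.
  move=> d d0 dmu; have [g Dg Hg] := dini M d0; have sg := sD Dg; have cg := g_cont sg.
  have HG z : `|z.1| <= M -> `|z.2| <= M -> `|frc G z - frc g z| <= d.
    by rewrite -opprB normrN frcB; exact: Hg.
  have pos' y : y0 <= y <= y1 -> 0 < g (q0, y).
    move=> yI; have := Hg (q0, y) p3 (yM y yI); rewrite ler_norml => /andP[h1 _].
    have h2 : G (q0, ym) <= G (q0, y) by apply: Hym; rewrite in_itv.
    by rewrite /mu in mu0 dmu; lra.
  eexists; eexists; split; first exact: (g_flux_ge sg h0 k0 y00 ky qq pos').
  + have /andP[_] := @itg_near
      (fun q => frc G (q, y0 + k) - frc G (q, y0) - (frc G (q, y1) - frc G (q, y1 - k)))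
      (fun q => frc g (q, y0 + k) - frc g (q, y0) - (frc g (q, y1) - frc g (q, y1 - k))) q0 q1 (4 * d) qq
      (contB (contB (c2 _ _ cG) (c2 _ _ cG)) (contB (c2 _ _ cG) (c2 _ _ cG)))
      (contB (contB (c2 _ _ cg) (c2 _ _ cg)) (contB (c2 _ _ cg) (c2 _ _ cg)))
      (fun q hq => comb4 (HG (q, y0 + k) (qM q hq) r1) (HG (q, y0) (qM q hq) r2)
         (HG (q, y1) (qM q hq) r3) (HG (q, y1 - k) (qM q hq) r4)).
    by rewrite mulrA [d * 4]mulrC.
  + have /andP[_] := @itg_near (fun y => g (q1 + h, y) - g (q1, y) - (g (q0, y) - g (q0 - h, y)))
      (fun y => G (q1 + h, y) - G (q1, y) - (G (q0, y) - G (q0 - h, y))) y0 y1 (4 * d) yy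
      (contB (contB (c1 _ _ cg) (c1 _ _ cg)) (contB (c1 _ _ cg) (c1 _ _ cg)))
      (contB (contB (c1 _ _ cG) (c1 _ _ cG)) (contB (c1 _ _ cG) (c1 _ _ cG)))
      (fun y hy => comb4 (Hg (q1 + h, y) p1 (yM y hy)) (Hg (q1, y) p2 (yM y hy))
         (Hg (q0, y) p3 (yM y hy)) (Hg (q0 - h, y) p4 (yM y hy))).
    by rewrite mulrA [d * 4]mulrC.
Qed.

End Family.

Definition homogeneous G := forall l z, 0 < l -> gs l G z = G z.

Lemma homogeneous_of_le G : (forall l z, 0 < l -> G z <= gs l G z) -> homogeneous G.
Proof.
move=> h l z l0; apply/eqP; rewrite eq_le h// andbT.
have li : 0 < l^-1 by rewrite invr_gt0.
have := gs_le l (fun z => h l^-1 z li) z; by rewrite gsVK.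
Qed.

Lemma homogeneous_of_ge G : (forall l z, 0 < l -> gs l G z <= G z) -> homogeneous G.
Proof.
move=> h l z l0; apply/eqP; rewrite eq_le h//=.
have li : 0 < l^-1 by rewrite invr_gt0.
have := gs_le l (fun z => h l^-1 z li) z; by rewrite gsVK.
Qed.

Lemma inf_scaling c g : gsol c g -> exists G, [/\ gsol c G, homogeneous G,
  forall l z, 0 < l -> G z <= gs l g z &
  forall L : R * R -> R, (forall l z, 0 < l -> L z <= gs l g z) -> forall z, L z <= G z].
Proof.
move=> sg; pose E z := [set r | exists2 l, 0 < l & r = gs l g z]; pose G z := inf (E z).
have hE z : has_inf (E z).
  split; first by exists (gs 1 g z), 1.
  by exists 0 => r [l l0 ->]; exact: g_ge0 (gsol_gs l0 sg) z.
have Gle l z : 0 < l -> G z <= gs l g z by move=> l0; apply: ge_inf; [have [] := hE z|exists l].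
have leG (L : R * R -> R) : (forall l z, 0 < l -> L z <= gs l g z) -> forall z, L z <= G z.
  by move=> h z; apply: lb_le_inf; [have [] := hE z|move=> r [l l0 ->]; exact: h].
exists G; split => //; last first.
  apply: homogeneous_of_le => m z m0.
  have prem l x : 0 < l -> gs m^-1 G x <= gs l g x.
    move=> l0; have ml : 0 < m * l by rewrite mulr_gt0.
    have := gs_le m^-1 (fun z => Gle (m * l) z ml) x.
    by rewrite gsM mulrA mulVf ?gt_eqF// mul1r.
  have := leG _ prem (z.1 / m, z.2 / m).
  have -> : gs m^-1 G (z.1 / m, z.2 / m) = m^-1 ^+ 2 * G z.
    by rewrite /gs /= !invrK !divfK ?gt_eqF// -surjective_pairing.
  rewrite exprVn /gs; have m2 : 0 < m ^+ 2 by rewrite exprn_gt0.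
  by rewrite ler_pdivrMl.
(* Keeping only the rescalings below [g] provides the upper bound H = g. The infimum is the same, as
   by [ordering] the other rescalings lie above [g]. *)
pose D := [set k | exists2 l, 0 < l & k = gs l g /\ forall z, k z <= g z].
have GD k z : D k -> G z <= k z by move=> [l l0 [-> _]]; exact: Gle.
apply: (@limit_gsol c D G g sg).
- by move=> k [l l0 [-> _]]; exact: gsol_gs.
- by move=> k z [l l0 [_ h]].
- move=> k k' Dk Dk'; have [l l0 [ek _]] := Dk; have [l' l0' [ek' _]] := Dk'.
  have sk : gsol c k by rewrite ek; exact: gsol_gs.
  have sk' : gsol c k' by rewrite ek'; exact: gsol_gs.
  case: (ordering sk sk') => kk; [exists k => //|exists k' => //] => z;
    by rewrite !ger0_norm ?subr_ge0 ?GD// !lerD2r; split.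
- move=> z e e0; have [r [l l0 er] rl] := inf_adherent e0 (hE z).
  have D1 : D g by exists 1 => //; rewrite gs1.
  case: (ordering sg (gsol_gs l0 sg)) => h.
    exists g => //; rewrite ger0_norm ?subr_ge0 ?GD//.
    by rewrite ltrBlDl; apply: le_lt_trans (h z) _; rewrite -er.
  have Dl : D (gs l g) by exists l.
  by exists (gs l g) => //; rewrite ger0_norm ?subr_ge0 ?GD// ltrBlDl -er.
Qed.

Lemma sup_scaling c g H : gsol c g -> gsol c H -> (forall l z, 0 < l -> gs l g z <= H z) ->
  exists G, [/\ gsol c G, homogeneous G, forall z, g z <= G z & forall z, G z <= H z].
Proof.
move=> sg sH gH; pose E z := [set r | exists2 l, 0 < l & r = gs l g z]; pose G z := sup (E z).
have hE z : has_sup (E z).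
  split; first by exists (gs 1 g z), 1.
  by exists (H z) => r [l l0 ->]; exact: gH.
have Gge l z : 0 < l -> gs l g z <= G z by move=> l0; apply: sup_upper_bound => //; exists l.
have geG (L : R * R -> R) : (forall l z, 0 < l -> gs l g z <= L z) -> forall z, G z <= L z.
  by move=> h z; apply: sup_le_ub; [have [] := hE z|move=> r [l l0 ->]; exact: h].
exists G; split; last exact: geG.
- pose D := [set k | exists2 l, 0 < l & k = gs l g].
  have GD k z : D k -> k z <= G z by move=> [l l0 ->]; exact: Gge.
  apply: (@limit_gsol c D G H sH).
  + by move=> k [l l0 ->]; exact: gsol_gs.
  + by move=> k z [l l0 ->]; exact: gH.
  + move=> k k' Dk Dk'; have [l l0 ek] := Dk; have [l' l0' ek'] := Dk'.
    have sk : gsol c k by rewrite ek; exact: gsol_gs.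
    have sk' : gsol c k' by rewrite ek'; exact: gsol_gs.
    case: (ordering sk sk') => kk; [exists k' => //|exists k => //] => z;
      by rewrite !ler0_norm ?subr_le0 ?GD// !lerN2 !lerD2r; split.
  + move=> z e e0; have [r [l l0 er] rl] := sup_adherent e0 (hE z).
    have Dl : D (gs l g) by exists l.
    exists (gs l g) => //; rewrite ler0_norm ?subr_le0 ?GD// opprB -er.
    by rewrite ltrBlDr -ltrBlDl.
- apply: homogeneous_of_ge => m z m0.
  have prem l x : 0 < l -> gs l g x <= gs m^-1 G x.
    move=> l0; have ml : 0 < m * l by rewrite mulr_gt0.
    have := gs_le m^-1 (fun z => Gge (m * l) z ml) x.
    by rewrite gsM mulrA mulVf ?gt_eqF// mul1r.
  have := geG _ prem (z.1 / m, z.2 / m).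
  have -> : gs m^-1 G (z.1 / m, z.2 / m) = m^-1 ^+ 2 * G z.
    by rewrite /gs /= !invrK !divfK ?gt_eqF// -surjective_pairing.
  rewrite exprVn /gs; have m2 : 0 < m ^+ 2 by rewrite exprn_gt0.
  by rewrite ler_pdivlMl.
- by move=> z; rewrite -{1}(gs1 g); exact: Gge.
Qed.

End DirectedLimits.

(** * Classification of the homogeneous solutions *)

Section Quadratics.
Context {R : realType}.
Implicit Types (F g G : R * R -> R).

Definition quad (A B D E E' G0 : R) (z : R * R) : R :=
  A * z.1 ^+ 2 + B * z.1 * z.2 + D * z.2 ^+ 2 + E * z.1 + E' * z.2 + G0.

Lemma cont_quad (A B D E E' G0 : R) : continuous (quad A B D E E' G0).
Proof.
have c1 := @contF R; have c2 := @contS R.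
have k x : continuous (fun z : R * R => x : R) by exact: contC.
apply: contD => //; apply: contD; last exact: contM.
apply: contD; last exact: contM.
apply: contD; last by apply: contM => //; exact: contX.
apply: contD; first by apply: contM => //; exact: contX.
by apply: contM => //; exact: contM.
Qed.

Lemma itg_quad (al be ga a b : R) : itg a b (fun t => al * t ^+ 2 + be * t + ga) =
  al * (b ^+ 3 - a ^+ 3) / 3 + be * (b ^+ 2 - a ^+ 2) / 2 + ga * (b - a).
Proof.
have hid t : is_derive t (1 : R) (fun y : R => y) 1 := is_derive_id t (1 : R).
have h2 t : is_derive t (1 : R) (fun y : R => y * y) (t *: (1 : R) + t *: (1 : R)) := is_deriveM (hid t) (hid t).
have H t : is_derive t (1 : R) (fun y : R => al / 3 * (y * (y * y)) + be / 2 * (y * y) + ga * y) (al * t ^+ 2 + be * t + ga).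
  have h3 : is_derive t (1 : R) (fun y : R => y * (y * y)) _ := is_deriveM (hid t) (h2 t).
  have a3 := is_deriveZ (al / 3) h3; have a2 := is_deriveZ (be / 2) (h2 t); have a1 := is_deriveZ ga (hid t).
  apply: is_derive_eq (is_deriveD (is_deriveD a3 a2) a1) _; rewrite /GRing.scale /=; lra.
rewrite (itgE _ _ H); first by lra.
have ci := @contI R.
apply: contD; last exact: contC.
by apply: contD; apply: contM => //; [exact: contC|exact: contX|exact: contC].
Qed.

Lemma avg2_quad a (A B D E E' G0 : R) : 0 < a -> avg2 a (quad A B D E E' G0) =
  quad A B D (E + B * a / 2) (E' + D * a) (G0 + E' * a / 2 + D * a ^+ 2 / 3).
Proof.
move=> a0; apply/funext => -[q y]; rewrite /avg2 /quad /=.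
rewrite (_ : (fun t => _) = (fun t => D * t ^+ 2 + (B * q + E') * t + (A * q ^+ 2 + E * q + G0))).
  by rewrite itg_quad; field; rewrite gt_eqF.
by apply/funext => t; ring.
Qed.

Lemma avg1_quad a (A B D E E' G0 : R) : 0 < a -> avg1 a (quad A B D E E' G0) =
  quad A B D (E + A * a) (E' + B * a / 2) (G0 + E * a / 2 + A * a ^+ 2 / 3).
Proof.
move=> a0; apply/funext => -[q y]; rewrite /avg1 /quad /=.
rewrite (_ : (fun t => _) = (fun t => A * t ^+ 2 + (B * y + E) * t + (D * y ^+ 2 + E' * y + G0))).
  by rewrite itg_quad; field; rewrite gt_eqF.
by apply/funext => t; ring.
Qed.

Lemma lap_quad a (A B D E E' G0 : R) z : 0 < a -> lap a (quad A B D E E' G0) z = 2 * A + 2 * D.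
Proof.
move=> a0; rewrite /lap !avg2_quad// !avg1_quad// /dif1 /dif2 /quad /=.
by field; rewrite gt_eqF.
Qed.

Lemma second_derivative_le0 (f df : R -> R) (ddf x r : R) : 0 < r ->
  (forall t, is_derive t (1 : R) f (df t)) -> is_derive x (1 : R) df ddf ->
  (forall t, `|t - x| < r -> f t <= f x) -> ddf <= 0.
Proof.
move=> r0 D1 D2 H; rewrite leNgt; apply/negP => k0.
have k4 : 0 < ddf / 4 by rewrite divr_gt0.
have [d d0 Hd] := is_derive_bound D2 k4.
pose h := Num.min d r / 2.
have m0 : 0 < Num.min d r by rewrite lt_min d0.
have h0 : 0 < h by rewrite divr_gt0.
have hm : h < Num.min d r by rewrite ltr_pdivrMr// ltr_pMr// ltr1n.
move: hm; rewrite lt_min => /andP[hd hr].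
(* If ddf > 0, the first-order expansion of [df] makes [psi] nondecreasing on [0, h], which
   contradicts the maximum at x. *)
pose psi t := f (x + t) + f (x - t) - ddf / 2 * (t * t).
have h1 : f (x + h) <= f x by apply: H; rewrite addrC addKr gtr0_norm.
have h2 : f (x - h) <= f x by apply: H; rewrite addrC addKr normrN gtr0_norm.
have : psi 0 <= psi h.
  apply: (derive_ge0_le' (F := psi) (ltW h0)) => t /andP[t0 th].
  have hid : is_derive t (1 : R) (fun y : R => y) 1 := is_derive_id t (1 : R).
  have s1 : is_derive t (1 : R) (fun y : R => x + y) (0 + 1) by exact: is_deriveD.
  have s2 : is_derive t (1 : R) (fun y : R => x - y) (0 - 1) by exact: is_deriveB.
  have e1 : is_derive t (1 : R) (fun y => f (x + y)) (df (x + t) * (0 + 1)).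
    by have := D1 (x + t) => ?; exact: (is_derive1_comp (f := f) (g := fun y => x + y)).
  have e2 : is_derive t (1 : R) (fun y => f (x - y)) (df (x - t) * (0 - 1)).
    by have := D1 (x - t) => ?; exact: (is_derive1_comp (f := f) (g := fun y => x - y)).
  have e3 := is_deriveZ (ddf / 2) (is_deriveM hid hid).
  eexists; first exact: (is_deriveB (is_deriveD e1 e2) e3).
  rewrite /GRing.scale /=.
  have td : `|t| < d by rewrite ger0_norm//; exact: le_lt_trans hd.
  have := Hd t td; rewrite (ger0_norm t0) ler_norml => /andP[b1 _].
  have := Hd (- t); rewrite normrN => /(_ td); rewrite (ger0_norm t0) ler_norml => /andP[_ b2].
  have k2 := mulr_ge0 (ltW k4) t0.
  by move: b1 b2 k2; move: (df (x + t)) (df (x - t)) (df x) => p q u; lra.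
rewrite /psi addr0 subr0 mulr0 mulr0 subr0.
by have := mulr_gt0 k4 (mulr_gt0 h0 h0); lra.
Qed.

Lemma box_max F (P : R * R) (r : R) : 0 < r -> continuous F ->
  exists z : R * R, [/\ `|z.1 - P.1| <= r, `|z.2 - P.2| <= r &
    forall y : R * R, `|y.1 - P.1| <= r -> `|y.2 - P.2| <= r -> F y <= F z].
Proof.
move=> r0 cF.
pose K : set (R * R) := `[P.1 - r, P.1 + r]%classic `*` `[P.2 - r, P.2 + r]%classic.
have cK : compact K by apply: compact_setX; exact: segment_compact.
have KE (z : R * R) : K z <-> `|z.1 - P.1| <= r /\ `|z.2 - P.2| <= r.
  by rewrite /K /= !in_itv /= !ler_distl.
have K0 : K !=set0 by exists P; apply/KE; rewrite !subrr normr0 ltW.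
have [z zK Hz] := compact_EVT_max K0 cK (continuous_subspaceT cF).
move/set_mem/KE : zK => [z1 z2]; exists z; split => // y y1 y2.
by apply: Hz; apply/mem_set/KE.
Qed.

(** A maximum principle for a continuous function: its value at P beats the boundary by [rho], so
    after a smoothing with error rho / 3 the maximum over the box is still interior, and there the
    Laplacian of the smoothed function is nonpositive. *)
Lemma weak_max F (P : R * R) (r rho : R) : continuous F -> 0 < r -> 0 < rho ->
  (forall z : R * R, `|z.1 - P.1| <= r -> `|z.2 - P.2| <= r ->
     `|z.1 - P.1| = r \/ `|z.2 - P.2| = r -> F z <= F P - rho) ->
  exists2 d, 0 < d & forall a, 0 < a < d -> exists z : R * R,
    [/\ `|z.1 - P.1| < r, `|z.2 - P.2| < r & lap a F z <= 0].
Proof.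
move=> cF r0 rho0 H.
pose M := `|P.1| + `|P.2| + r; have r30 : 0 < rho / 3 by rewrite divr_gt0.
have [d d0 Hd] := smooth_near M cF r30.
exists d => // a aI; have /andP[a0 _] := aI.
have inM (z : R * R) : `|z.1 - P.1| <= r -> `|z.2 - P.2| <= r -> `|z.1| <= M /\ `|z.2| <= M.
  move=> z1 z2; have n1 := normr_ge0 P.1; have n2 := normr_ge0 P.2; split.
    by rewrite -[z.1](subrK P.1); apply: le_trans (ler_normD _ _) _; rewrite /M; lra.
  by rewrite -[z.2](subrK P.2); apply: le_trans (ler_normD _ _) _; rewrite /M; lra.
have near (z : R * R) : `|z.1 - P.1| <= r -> `|z.2 - P.2| <= r ->
    F z - rho / 3 <= smooth a F z <= F z + rho / 3.
  move=> z1 z2; have [m1 m2] := inM z z1 z2; have := Hd a z aI m1 m2.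
  by rewrite ler_norml => /andP[? ?]; apply/andP; split; lra.
have [F1 [F2 [F11 [F12 [F21 [F22 [hF hlap]]]]]]] := smooth_C2 a0 cF.
have [z [z1 z2 Hz]] := box_max P r0 (C2_cont hF).
have PI : `|P.1 - P.1| <= r /\ `|P.2 - P.2| <= r by rewrite !subrr normr0 ltW.
have top : F P - rho / 3 <= smooth a F z.
  have /andP[h _] := near P PI.1 PI.2; apply: le_trans h (Hz P PI.1 PI.2).
have interior : ~ (`|z.1 - P.1| = r \/ `|z.2 - P.2| = r).
  by move=> /(H z z1 z2); have /andP[_] := near z z1 z2; lra.
have z1' : `|z.1 - P.1| < r by rewrite lt_neqAle z1 andbT; apply/eqP => E; apply: interior; left.
have z2' : `|z.2 - P.2| < r by rewrite lt_neqAle z2 andbT; apply/eqP => E; apply: interior; right.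
exists z; split => //; rewrite -hlap.
have zE : z = (z.1, z.2) by rewrite -surjective_pairing.
have h1 : F11 (z.1, z.2) <= 0.
  have e0 : 0 < r - `|z.1 - P.1| by rewrite subr_gt0.
  apply: (second_derivative_le0 e0 (fun t => C2_d1 hF t z.2) (C2_d11 hF z.1 z.2)) => t ht.
  rewrite -zE; apply: Hz => //=; rewrite -[t](subrK z.1) -addrA.
  by apply: le_trans (ler_normD _ _) _; lra.
have h2 : F22 (z.1, z.2) <= 0.
  have e0 : 0 < r - `|z.2 - P.2| by rewrite subr_gt0.
  apply: (second_derivative_le0 e0 (fun t => C2_d2 hF z.1 t) (C2_d22 hF z.1 z.2)) => t ht.
  rewrite -zE; apply: Hz => //=; rewrite -[t](subrK z.2) -addrA.
  by apply: le_trans (ler_normD _ _) _; lra.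
by rewrite zE; lra.
Qed.

Lemma dist_shift (p x y r a : R) : - r < x - p < r -> x <= y <= x + 2 * a -> 2 * a < r ->
  `|y - p| <= 2 * r.
Proof.
by move=> /andP[? ?] /andP[? ?] ?; rewrite ler_norml; apply/andP; split; lra.
Qed.

(* Comparison with the multiple of the superharmonic barrier y^2 - 2 (q - tm y)^2 that touches
   from above along a ray. *)
Lemma sector_le0 F (t1 t2 : R) : continuous F -> t1 < t2 -> t2 - t1 <= 1 / 2 ->
  (forall q y, 0 < y -> F (q, y) = y ^+ 2 * F (q / y, 1)) ->
  (forall a q y, 0 < a -> 0 < y ->
     (forall P Y, q <= P <= q + 2 * a -> y <= Y <= y + 2 * a -> t1 * Y < P < t2 * Y) ->
     lap a F (q, y) = 0) ->
  F (t1, 1) = 0 -> F (t2, 1) = 0 -> forall t, t1 <= t <= t2 -> F (t, 1) <= 0.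
Proof.
move=> cF t12 len hom Hlap F1 F2 t tI; rewrite leNgt; apply/negP => Ft.
(* [b] is the barrier on the line y = 1; the width at most 1 / 2 keeps it positive. *)
pose tm := (t1 + t2) / 2; pose b (t : R) := 1 - 2 * (t - tm) ^+ 2.
have b_lb x : t1 <= x <= t2 -> 2^-1 <= b x.
  move=> /andP[x1 x2]; have : (x - tm) ^+ 2 <= 4^-1 ^+ 2.
    have d1 : 0 <= 4^-1 - (x - tm) by rewrite /tm; lra.
    have d2 : 0 <= 4^-1 + (x - tm) by rewrite /tm; lra.
    by have := mulr_ge0 d1 d2; rewrite -subr_sqr subr_ge0.
  by rewrite /b [4^-1 ^+ 2]expr2; lra.
have b_gt0 x : t1 <= x <= t2 -> 0 < b x by move=> /b_lb; apply: lt_le_trans.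
have cb : {within `[t1, t2], continuous (fun x => F (x, 1) / b x)}.
  apply: continuous_in_subspaceT => x /set_mem; rewrite /= in_itv /= => xI.
  have cbb : continuous b.
    apply: contB; first exact: contC.
    by apply: contM; [exact: contC|apply: contX; apply: contB; [exact: contI|exact: contC]].
  have cK : continuous (fun x => F (x, 1)) by exact: contP2.
  have ci : {for x, continuous (fun x => (b x)^-1)}.
    by apply: continuousV; [rewrite gt_eqF// b_gt0|exact: cbb].
  exact: (continuousM (cK x) ci).
have [ts tsI Hts] := EVT_max (ltW t12) cb; rewrite in_itv /= in tsI.
pose mu := F (ts, 1) / b ts.
have mu_max x : t1 <= x <= t2 -> F (x, 1) <= mu * b x.
  move=> xI; rewrite -ler_pdivrMr ?b_gt0//; apply: Hts; by rewrite in_itv.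
have mu0 : 0 < mu.
  have := mu_max t tI; have := b_gt0 t tI => bt h; have := lt_le_trans Ft h.
  by rewrite pmulr_lgt0.
have Fts : F (ts, 1) = mu * b ts by rewrite /mu divfK// gt_eqF// b_gt0.
have pts : 0 < F (ts, 1) by rewrite Fts mulr_gt0// b_gt0.
have /andP[l1 l2] := tsI.
have s1 : t1 < ts.
  by rewrite lt_neqAle l1 andbT; apply/eqP => E; move: pts; rewrite -E F1 ltxx.
have s2 : ts < t2.
  by rewrite lt_neqAle l2 andbT; apply/eqP => E; move: pts; rewrite E F2 ltxx.
(* The barrier has Laplacian - 2 - 4 tm^2. The term with [eta], which makes the contact strict, has
   Laplacian 4 eta, so with eta = mu / 4 the total stays negative. *)
pose eta := mu / 4; have eta0 : 0 < eta by rewrite divr_gt0.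
pose W := quad (- 2 * mu + eta) (4 * tm * mu) (mu * (1 - 2 * tm ^+ 2) + eta)
  (- 2 * eta * ts) (- 2 * eta) (eta * (ts ^+ 2 + 1)).
have WE q y : W (q, y) = mu * (y ^+ 2 - 2 * (q - tm * y) ^+ 2) + eta * ((q - ts) ^+ 2 + (y - 1) ^+ 2).
  by rewrite /W /quad /=; ring.
pose F' z := F z - W z.
have cF' : continuous F' by apply: contB => //; exact: cont_quad.
have F'0 : F' (ts, 1) = 0.
  by rewrite /F' WE Fts /b; ring.
have F'le q y : 0 < y -> t1 * y <= q <= t2 * y -> F' (q, y) <= - (eta * ((q - ts) ^+ 2 + (y - 1) ^+ 2)).
  move=> y0 /andP[q1 q2]; rewrite /F' WE hom//.
  have qI : t1 <= q / y <= t2 by rewrite ler_pdivlMr// ler_pdivrMr// q1 q2.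
  have := ler_wpM2l (sqr_ge0 y) (mu_max _ qI).
  have -> : y ^+ 2 * (mu * b (q / y)) = mu * (y ^+ 2 - 2 * (q - tm * y) ^+ 2).
    by rewrite /b; field; rewrite gt_eqF.
  by lra.
pose m := Num.min 1 (Num.min (ts - t1) (t2 - ts)).
have m0 : 0 < m by rewrite !lt_min ltr01 !subr_gt0 s1.
(* [L] makes the box of half-side 2 r around (ts, 1) fit into the sector; the factor 2 leaves room
   for the averaging boxes. *)
pose L := 2 * (`|t1| + `|t2| + 1).
have L2 : 2 <= L.
  by rewrite /L; move: (`|t1|) (`|t2|) (normr_ge0 t1) (normr_ge0 t2) => x y x0 y0; lra.
have L00 : 0 < L by exact: lt_le_trans L2.
pose r := m / (2 * L); have r0 : 0 < r by rewrite divr_gt0// mulr_gt0.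
have rL : 2 * r * L = m by rewrite /r; field; rewrite gt_eqF.
have m1 : m <= 1 by rewrite ge_min lexx.
have m2 : m <= ts - t1 by rewrite !ge_min lexx orbT.
have m3 : m <= t2 - ts by rewrite !ge_min lexx !orbT.
have r1 : 2 * r <= 1 / 2.
  have r20 : 0 <= 2 * r by rewrite mulr_ge0// ltW.
  by have := ler_wpM2l r20 L2; rewrite rL; lra.
have sector q y : `|q - ts| <= 2 * r -> `|y - 1| <= 2 * r -> 0 < y /\ t1 * y < q < t2 * y.
  rewrite !ler_norml => /andP[q1 q2] /andP[y1 y2].
  have y0 : 0 < y by lra.
  have bt (u : R) : `|u * (y - 1)| <= `|u| * (2 * r).
    by rewrite normrM ler_wpM2l// ler_norml y1.
  have := bt t1; have := bt t2; rewrite !ler_norml => /andP[u1 u2] /andP[u3 u4].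
  have e1 : 2 * r * (2 * (`|t1| + `|t2| + 1)) <= ts - t1 by rewrite -/L rL.
  have e2 : 2 * r * (2 * (`|t1| + `|t2| + 1)) <= t2 - ts by rewrite -/L rL.
  have n1 := mulr_ge0 (ltW r0) (normr_ge0 t1); have n2 := mulr_ge0 (ltW r0) (normr_ge0 t2).
  by split=> //; apply/andP; split; lra.
have rr : r <= 2 * r by lra.
have er : 0 < eta * r ^+ 2 by rewrite mulr_gt0// exprn_gt0.
pose P0 : R * R := (ts, 1).
have bdry (z : R * R) : `|z.1 - P0.1| <= r -> `|z.2 - P0.2| <= r ->
     `|z.1 - P0.1| = r \/ `|z.2 - P0.2| = r -> F' z <= F' P0 - eta * r ^+ 2.
  rewrite /P0; case: z => q y /= q1 y1 hb; have [y0 /andP[a1 a2]] := sector q y (le_trans q1 rr) (le_trans y1 rr).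
  rewrite F'0 sub0r; apply: le_trans (F'le q y y0 _) _; first by rewrite !ltW.
  rewrite lerN2 ler_pM2l//.
  case: hb => E; first by rewrite -E real_normK ?num_real// lerDl sqr_ge0.
  by rewrite -[r]E real_normK ?num_real// lerDr sqr_ge0.
have [d d0 Hd] := weak_max cF' r0 er bdry.
pose a := Num.min d r / 2 / 2.
have mdr : 0 < Num.min d r by rewrite lt_min d0.
have a0 : 0 < a by rewrite !divr_gt0.
have am : 2 * a < Num.min d r by rewrite /a; lra.
move: am; rewrite lt_min => /andP[ad ar].
have aI : 0 < a < d by rewrite a0; lra.
have [[q y] [/= q1 y1]] := Hd a aI.
rewrite /F' (lapB a cF (@cont_quad _ _ _ _ _ _)) lap_quad//.
move: q1 y1; rewrite !ltr_norml => hq hy.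
rewrite Hlap//.
- rewrite sub0r oppr_le0 leNgt => /negP; apply.
  have := mulr_ge0 (ltW mu0) (sqr_ge0 tm); rewrite /eta; lra.
- by have /andP[y1 _] := hy; lra.
move=> P Y hP hY.
by have [_ ->] := sector P Y (dist_shift hq hP ar) (dist_shift hy hY ar).
Qed.

End Quadratics.

(** * The profile of a homogeneous solution on the line y = 1 *)

Section HomogeneousSolutions.
Context {R : realType}.
Variables (c : R) (G : R * R -> R).
Hypotheses (c01 : 0 < c < 1) (sG : gsol c G) (hG : homogeneous G).

Let c0 : 0 < c. Proof. by case/andP: c01. Qed.

Let K (t : R) : R := G (t, 1).

Let cG : continuous G := g_cont sG.
Let cK : continuous K. Proof. exact: contP2. Qed.

Let GK q y : 0 < y -> G (q, y) = y ^+ 2 * K (q / y).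
Proof. by move=> y0; rewrite -(hG (q, y) y0) /gs /= divff ?gt_eqF. Qed.

Let K_ge0 t : 0 <= K t. Proof. exact: g_ge0 sG _. Qed.
Let K_mono t t' : t <= t' -> K t <= K t'. Proof. by move=> h; exact: (g_mono sG). Qed.

(** The trace on y = 1 of y^2 / 2 + A (q^2 - y^2) + B q y, the parabola plus a general homogeneous
    harmonic quadratic. *)
Let prof (A B t : R) : R := 2^-1 + A * (t ^+ 2 - 1) + B * t.

Let cont_prof A B : continuous (prof A B).
Proof.
have ci := @contI R; have k x : continuous (fun _ : R => x : R) by exact: contC.
apply: contD; last exact: contM.
apply: contD => //; apply: contM => //; apply: contB => //; exact: contX.
Qed.

(** Where K > 0 the function [frc G] is harmonic. Subtracting the harmonic quadratic with the same
    values on the two rays leaves a function to which [sector_le0] applies with either sign. *)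
Let on_sector t1 t2 : t1 < t2 -> t2 - t1 <= 1 / 2 -> 0 < K t1 ->
  exists A B, forall t, t1 <= t <= t2 -> K t = prof A B t.
Proof.
move=> t12 len Kt.
(* Up to sign, (t2 - t1) (1 + t1 t2) is the determinant of the interpolation problem; a narrow
   sector keeps the second factor positive, as 4 t1 t2 >= - (t2 - t1)^2. *)
have det : 1 + t1 * t2 != 0.
  rewrite gt_eqF//; have h1 : 0 <= (t1 + t2) ^+ 2 by exact: sqr_ge0.
  have h2 : (t2 - t1) ^+ 2 <= (1 / 2) ^+ 2.
    by rewrite ler_pXn2r// ?nnegrE ?subr_ge0 ?(ltW t12).
  by rewrite !expr2 in h1 h2; lra.
have dt : t2 - t1 != 0 by rewrite gt_eqF// subr_gt0.
pose k1 := K t1 - 2^-1; pose k2 := K t2 - 2^-1.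
pose A := (k2 * t1 - k1 * t2) / ((t2 - t1) * (1 + t1 * t2)).
pose B := (k1 * (t2 ^+ 2 - 1) - k2 * (t1 ^+ 2 - 1)) / ((t2 - t1) * (1 + t1 * t2)).
have P1 : prof A B t1 = K t1 by rewrite /prof /A /B /k1 /k2; field; rewrite dt det.
have P2 : prof A B t2 = K t2 by rewrite /prof /A /B /k1 /k2; field; rewrite dt det.
exists A, B.
pose F z := frc G z - quad A B (- A) 0 0 0 z.
have cF : continuous F by apply: contB; [exact: cont_frc|exact: cont_quad].
have FE t : F (t, 1) = K t - prof A B t by rewrite /F /frc /parab /quad /prof /K /=; field.
have Fhom q y : 0 < y -> F (q, y) = y ^+ 2 * F (q / y, 1).
  move=> y0; rewrite FE /F /frc /parab /= GK// /quad /prof /=; field; exact: lt0r_neq0.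
have Flap a q y : 0 < a -> 0 < y ->
    (forall P Y, q <= P <= q + 2 * a -> y <= Y <= y + 2 * a -> t1 * Y < P < t2 * Y) ->
    lap a F (q, y) = 0.
  move=> a0 y0 H; rewrite /F (lapB a (cont_frc cG) (@cont_quad _ _ _ _ _ _ _)) lap_quad//.
  have h1 := lap_frc_le0 sG q a0 y0.
  have h2 : 0 <= lap a (frc G) (q, y).
    apply: (lap_frc_ge0 sG a0 y0) => P Y hP hY; have /andP[l _] := H P Y hP hY.
    have Y0 : 0 < Y by case/andP: hY => hY _; exact: lt_le_trans hY.
    rewrite GK// mulr_gt0 ?exprn_gt0//; apply: lt_le_trans Kt (K_mono _).
    by rewrite ler_pdivlMr// ltW.
  by move: (lap a (frc G) (q, y)) h1 h2 => X h1 h2; lra.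
have F1 : F (t1, 1) = 0 by rewrite FE P1 subrr.
have F2 : F (t2, 1) = 0 by rewrite FE P2 subrr.
have le1 := sector_le0 cF t12 len Fhom Flap F1 F2.
have cNF : continuous (fun z => - F z) := contN cF.
have NFhom q y : 0 < y -> - F (q, y) = y ^+ 2 * - F (q / y, 1) by move=> y0; rewrite mulrN -Fhom.
have NFlap a q y : 0 < a -> 0 < y ->
    (forall P Y, q <= P <= q + 2 * a -> y <= Y <= y + 2 * a -> t1 * Y < P < t2 * Y) ->
    lap a (fun z => - F z) (q, y) = 0.
  by move=> a0 y0 H; rewrite (lapN a cF) (Flap _ _ _ a0 y0 H) oppr0.
have NF1 : - F (t1, 1) = 0 by rewrite F1 oppr0.
have NF2 : - F (t2, 1) = 0 by rewrite F2 oppr0.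
have le2 := sector_le0 cNF t12 len NFhom NFlap NF1 NF2.
move=> t tI; have := le1 t tI; have := le2 t tI; rewrite FE; lra.
Qed.

Let prof_inj A B A' B' x d : 0 < d -> (forall t, x <= t <= x + 2 * d -> prof A B t = prof A' B' t) ->
  A = A' /\ B = B'.
Proof.
move=> d0 H.
have e0 : prof A B x = prof A' B' x by apply: H; apply/andP; split; lra.
have e1 : prof A B (x + d) = prof A' B' (x + d) by apply: H; apply/andP; split; lra.
have e2 : prof A B (x + 2 * d) = prof A' B' (x + 2 * d) by apply: H; apply/andP; split; lra.
have eA : A = A'.
  have d2 : 2 * d ^+ 2 != 0 by rewrite gt_eqF// mulr_gt0// exprn_gt0.
  apply: (mulIf d2).
  have : forall a b, a * (2 * d ^+ 2) = prof a b (x + 2 * d) - 2 * prof a b (x + d) + prof a b x.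
    by move=> a b; rewrite /prof; ring.
  by move=> h; rewrite (h A B) (h A' B') e0 e1 e2.
split=> //; apply: (mulIf (lt0r_neq0 d0)).
have : forall b, b * d = prof A b (x + d) - prof A b x - A * (2 * x * d + d ^+ 2).
  by move=> b; rewrite /prof; ring.
by move=> h; rewrite (h B) (h B') e0 e1 eA.
Qed.

Let on_ray T : 0 < K T -> exists A B, forall t, T <= t -> K t = prof A B t.
Proof.
move=> KT; have [||A [B HAB]] := @on_sector T (T + 1 / 2) _ _ KT; [by lra|by lra|].
exists A, B.
(* Sectors of width 1 / 2 advance by 1 / 4, and [prof_inj] identifies the coefficients on the
   overlaps. *)
have H n : forall t, T <= t <= T + 1 / 2 + n%:R / 4 -> K t = prof A B t.
  elim: n => [|n IH] t; first by rewrite mul0r addr0; exact: HAB.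
  have n0 : 0 <= n%:R / 4 :> R by rewrite divr_ge0.
  rewrite -[n.+1%:R]natr1; pose a := T + n%:R / 4 + 1 / 4; move=> /andP[t1 t2].
  have [h|h] := leP t (T + 1 / 2 + n%:R / 4); first by apply: IH; rewrite t1.
  have Ka : 0 < K a by apply: lt_le_trans KT (K_mono _); rewrite /a; lra.
  have [||A' [B' HAB']] := @on_sector a (a + 1 / 2) _ _ Ka; [by lra|by lra|].
  have [] : A = A' /\ B = B'.
    apply: (@prof_inj _ _ _ _ a (1 / 8)) => [|x /andP[x1 x2]]; first by lra.
    rewrite -IH; last by rewrite /a in x1 x2; apply/andP; split; lra.
    by apply: HAB'; rewrite x1 /=; lra.
  by move=> -> ->; apply: HAB'; rewrite /a; apply/andP; split; lra.
move=> t tT; pose n := Num.bound (4 * (t - T)); apply: (H n); rewrite tT /=.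
have x0 : 0 <= 4 * (t - T) by rewrite mulr_ge0// subr_ge0.
by have := archi_boundP x0; rewrite -/n; lra.
Qed.

(** By homogeneity G (1, 1 / t) = K t / t^2 tends to A, while continuity at the boundary point (1,
    0) makes the limit c / 2. *)
Let lead A B T : (forall t, T <= t -> K t = prof A B t) -> A = c / 2.
Proof.
move=> H; apply/eqP; rewrite -subr_eq0 -normr_eq0; apply/negPn/negP => ne.
pose D := `|A - c / 2|; have D0 : 0 < D by rewrite lt_neqAle eq_sym ne normr_ge0.
have D3 : 0 < D / 3 by rewrite divr_gt0.
have [d d0 Hd] := (cont2P G).1 cG (1, 0) _ D3.
pose S := `|2^-1 - A| + `|B|.
have S0 : 0 <= S by rewrite addr_ge0.
pose t := Num.max (Num.max T 1) (Num.max (2 / d) (3 * S / D)).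
have tT : T <= t by rewrite !le_max lexx.
have t1 : 1 <= t by rewrite !le_max lexx orbT.
have td : 2 / d <= t by rewrite !le_max lexx !orbT.
have tS : 3 * S / D <= t by rewrite !le_max lexx !orbT.
have t0 : 0 < t by exact: lt_le_trans t1.
have G1 : G (1, t^-1) = t^-1 ^+ 2 * prof A B t by rewrite GK ?invr_gt0// invrK mul1r H.
have Gc : G (1, 0) = c / 2 by rewrite (g_low sG)// max_l// expr1n mulr1.
have := Hd (1, t^-1); rewrite /= subrr normr0 subr0 => /(_ d0).
have -> : `|t^-1| < d.
  rewrite gtr0_norm ?invr_gt0// invf_plt ?posrE//; apply: lt_le_trans td.
  by rewrite -[ltLHS]mul1r ltr_pM2r ?invr_gt0// ltr1n.
move=> /(_ isT); rewrite Gc G1.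
have -> : t^-1 ^+ 2 * prof A B t = A + ((2^-1 - A) * t^-1 ^+ 2 + B * t^-1).
  by rewrite /prof; field; rewrite gt_eqF.
have ti : 0 < t^-1 by rewrite invr_gt0.
have ti1 : t^-1 <= 1 by rewrite invf_le1.
have b1 : `|(2^-1 - A) * t^-1 ^+ 2 + B * t^-1| <= S * t^-1.
  apply: le_trans (ler_normD _ _) _; rewrite !normrM /S mulrDl.
  rewrite (ger0_norm (ltW ti)) lerD2r; apply: ler_wpM2l => //.
  by rewrite ler_piMl// ltW.
have b2 : S * t^-1 <= D / 3.
  by rewrite ler_pdivrMr//; move: tS; rewrite ler_pdivrMr//; lra.
have h := ler_normD (A - c / 2 + ((2^-1 - A) * t^-1 ^+ 2 + B * t^-1)) (- ((2^-1 - A) * t^-1 ^+ 2 + B * t^-1)).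
rewrite addrK normrN -/D in h.
have -> : A + ((2^-1 - A) * t^-1 ^+ 2 + B * t^-1) - c / 2 = A - c / 2 + ((2^-1 - A) * t^-1 ^+ 2 + B * t^-1) by ring.
move: h b1 b2 D0; move: (`|A - c / 2 + _|) (`|_ + B * t^-1|) (S * t^-1) => x y z; lra.
Qed.

Let K_pos : exists T, 0 < K T.
Proof.
have Gc : G (1, 0) = c / 2 by rewrite (g_low sG)// max_l// expr1n mulr1.
have c2 : 0 < c / 2 by rewrite divr_gt0.
have [d d0 Hd] := (cont2P G).1 cG (1, 0) _ c2.
have y0 : 0 < d / 2 by rewrite divr_gt0.
exists (1 / (d / 2)); rewrite -(pmulr_rgt0 _ (exprn_gt0 2 y0)) -GK//.
have := Hd (1, d / 2); rewrite /= subrr normr0 subr0 => /(_ d0).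
rewrite gtr0_norm// Gc => /(_ (ltac:(by rewrite ltr_pdivrMr// ltr_pMr// ltr1n))).
by rewrite ltr_norml => /andP[h _]; lra.
Qed.

Let K_prof : exists B, forall t, 0 < K t -> K t = prof (c / 2) B t.
Proof.
have [T KT] := K_pos; have [A [B HB]] := on_ray KT; exists B => t Kt.
have [A' [B' HB']] := on_ray Kt.
have eA := lead HB; have eA' := lead HB'; subst A A'.
have [_ ->] : c / 2 = c / 2 /\ B = B'.
  apply: (@prof_inj _ _ _ _ (Num.max T t) 1 ltr01) => x /andP[+ _]; rewrite ge_max => /andP[x1 x2].
  by rewrite -HB// HB'.
exact: HB'.
Qed.

Let kink : exists t0, [/\ K t0 = 0, forall t, t0 < t -> 0 < K t & forall t, t <= t0 -> K t = 0].
Proof.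
have [T KT] := K_pos; have [B HB] := K_prof; have [C C0 HC] := g_left sG.
pose E := [set t | 0 < K t].
have lbE : has_lbound E.
  apply: contrapT => nb.
  have all_pos t : 0 < K t.
    have [//|Kt] := ltP 0 (K t); exfalso; apply: nb; exists t => s Es.
    by rewrite leNgt; apply/negP => st; move: Es; rewrite /E /= ltNge (le_trans (K_mono (ltW st)) Kt).
  (* At - X the quadratic with leading coefficient c / 2 exceeds 1 / 2 + 2 C, the bound that
     [g_left] gives on y = 1. *)
  pose X := C + 2 * (`|B| + 1) / c + 4 * C + 4.
  have cB : 0 < 2 * (`|B| + 1) / c by rewrite divr_gt0// mulr_gt0// ltr_wpDl.
  have X0 : C <= X by rewrite /X; lra.
  have h1 : K (- X) <= 1 ^+ 2 / 2 + C * (1 + 1) by apply: HC => //; rewrite lerN2.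
  have h2 := HB (- X) (all_pos _).
  have cX : 2 * (`|B| + 1) <= c * X.
    have : c * (2 * (`|B| + 1) / c) <= c * X by rewrite ler_pM2l// /X; lra.
    by rewrite mulrC divfK// gt_eqF.
  have X1 : 0 <= X by apply: le_trans X0; exact: ltW.
  have h3 := ler_wpM2r X1 cX; have h4 : B * X <= `|B| * X by rewrite ler_wpM2r// ler_norm.
  have cc : c < 1 by case/andP: c01.
  have X4 : 4 * C + 4 <= X by rewrite /X; lra.
  move: h1; rewrite h2 /prof sqrrN expr2 expr1n mulrN.
  clearbody X; move: (`|B|) h3 h4 X4 C0 cc => u; lra.
have hE : has_inf E by split=> //; exists T.
pose t0 := inf E.
have pos t : t0 < t -> 0 < K t.
  move=> tt; have e0 : 0 < t - t0 by rewrite subr_gt0.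
  have [s Es st] := inf_adherent e0 hE; apply: lt_le_trans Es (K_mono _).
  by rewrite ltW//; move: st; rewrite -/t0 addrC subrK.
have zero_lt t : t < t0 -> K t = 0.
  move=> tt; apply/eqP; rewrite eq_le K_ge0 andbT leNgt; apply/negP => Kt.
  by have := ge_inf lbE Kt; rewrite -/t0 leNgt tt.
have zero0 : K t0 = 0.
  apply/eqP; rewrite eq_le K_ge0 andbT leNgt; apply/negP => Kt.
  have [d d0 Hd] := (cont1P K).1 cK t0 _ Kt.
  have d20 : 0 < d / 2 by rewrite divr_gt0.
  have := Hd (t0 - d / 2); rewrite zero_lt; last by lra.
  rewrite addrC addKr normrN gtr0_norm// => /(_ (ltac:(lra))).
  by rewrite sub0r normrN gtr0_norm// ltxx.
exists t0; split=> // t; rewrite le_eqVlt => /orP[/eqP -> //|]; exact: zero_lt.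
Qed.

(* A slope jump of K at t0 would violate the concavity of G - y^2/2 along the line q = t0. *)
Let profile : exists t0, c * t0 ^+ 2 = 1 - c /\ forall t, K t = c / 2 * pos_part (t - t0) ^+ 2.
Proof.
have [B HB] := K_prof; have [t0 [K0 pos zero]] := kink.
have cc : c < 1 by case/andP: c01.
pose ka := c * t0 + B.
(* The quadratic is known only where K > 0, to the right of [t0]; continuity transfers its value to
   [t0]. *)
have P0 : prof (c / 2) B t0 = 0.
  apply/eqP; apply/negPn/negP => ne.
  have n0 : 0 < `|prof (c / 2) B t0| by rewrite normr_gt0.
  have n2 : 0 < `|prof (c / 2) B t0| / 2 by rewrite divr_gt0.
  have [d d0 Hd] := (cont1P _).1 (@cont_prof (c / 2) B) t0 _ n2.
  have [d' d0' Hd'] := (cont1P K).1 cK t0 _ n2.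
  pose h := Num.min d d' / 2; have m0 : 0 < Num.min d d' by rewrite lt_min d0.
  have h0 : 0 < h by rewrite divr_gt0.
  have hm : h < Num.min d d' by rewrite ltr_pdivrMr// ltr_pMr// ltr1n.
  move: hm; rewrite lt_min => /andP[hd hd'].
  have tt : t0 < t0 + h by rewrite ltrDl.
  have := Hd (t0 + h); rewrite addrC addKr gtr0_norm// => /(_ hd).
  have := Hd' (t0 + h); rewrite addrC addKr gtr0_norm// => /(_ hd').
  rewrite K0 subr0 (HB _ (pos _ tt)); move: (prof _ _ (t0 + h)) (prof _ _ t0) => x y a b.
  have := ler_normD (y - x) x; rewrite subrK distrC; move: a b n0; lra.
have KE t : t0 < t -> K t = ka * (t - t0) + c / 2 * (t - t0) ^+ 2.
  by move=> tt; rewrite HB ?pos//; move: P0; rewrite /prof /ka; lra.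
have ka0 : 0 <= ka.
  rewrite leNgt; apply/negP => kn.
  have tt : t0 < t0 - ka / c by rewrite ltrDl oppr_gt0 pmulr_llt0 ?invr_gt0.
  have := K_ge0 (t0 - ka / c); rewrite KE//.
  have -> : ka * (t0 - ka / c - t0) + c / 2 * (t0 - ka / c - t0) ^+ 2 = - (ka ^+ 2 / (2 * c)).
    by field; rewrite gt_eqF.
  have k2 : 0 < ka ^+ 2 by rewrite exprn_even_gt0//= lt_eqF.
  by rewrite oppr_ge0 leNgt divr_gt0// mulr_gt0.
have Klb t : t0 < t -> ka * (t - t0) <= K t.
  by move=> tt; rewrite KE// lerDl mulr_ge0 ?sqr_ge0// divr_ge0// ltW.
(* Midpoint concavity of [frc G] at (t0, 1), where G vanishes: what remains of the parabola is
   exactly d^2. *)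
have edge d : `|d| < 1 -> 0 <= d \/ d <= 0 -> G (t0, 1 + d) + G (t0, 1 - d) <= d ^+ 2.
  rewrite ltr_norml => /andP[d1 d2] _.
  have p1 : 0 <= 1 + d by lra.
  have p2 : 0 <= 1 - d by lra.
  have hh : 0 <= (2^-1 : R) <= 1 by rewrite invr_ge0 ler0n /=; lra.
  have := g_conc sG t0 p1 p2 hh; rewrite /frc /parab /=.
  have -> : (1 - 2^-1) * (1 + d) + 2^-1 * (1 - d) = 1 by lra.
  by rewrite -/(K t0) K0 expr1n; lra.
have small (x : R) : 0 <= x -> (forall d : R, 0 < d -> d <= 1 / 2 -> x * d <= 2 * d ^+ 2) -> x = 0.
  move=> x0 H; apply/eqP; rewrite eq_le x0 andbT leNgt; apply/negP => xp.
  pose d := Num.min (1 / 2) (x / 4).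
  have d0 : 0 < d by rewrite lt_min !divr_gt0.
  have dx : d <= x / 4 by rewrite ge_min lexx orbT.
  have := H d d0 (ltac:(by rewrite ge_min lexx)).
  by rewrite expr2 mulrA ler_pM2r//; lra.
have t0_neq : t0 != 0.
  apply/eqP => E; move: P0; rewrite E /prof expr0n /= mulr0 addr0 => h; lra.
(* Of the points (t0, 1 + d) and (t0, 1 - d), the sign of t0 decides which has q / y > t0. There G
   is at least of order ka |t0| d, against d^2 in [edge]. *)
have kat : ka * `|t0| = 0.
  apply: small; first exact: mulr_ge0.
  move=> d d0 d1; have dn : `|d| < 1 by rewrite gtr0_norm//; lra.
  have [tp|tn] := ltP 0 t0.
    have := edge d dn (or_introl (ltW d0)).
    have y0 : 0 < 1 - d by lra.
    have tt : t0 < t0 / (1 - d).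
      by rewrite ltr_pdivlMr//; have := mulr_gt0 tp d0; lra.
    rewrite [G (t0, 1 - d)]GK//.
    have := ler_wpM2l (sqr_ge0 (1 - d)) (Klb _ tt).
    have -> : (1 - d) ^+ 2 * (ka * (t0 / (1 - d) - t0)) = (1 - d) * (ka * t0 * d).
      by field; rewrite gt_eqF.
    have := g_ge0 sG (t0, 1 + d); rewrite gtr0_norm//.
    have : 0 <= ka * t0 * d by rewrite !mulr_ge0// ltW.
    move: (ka * t0 * d) ((1 - d) ^+ 2 * K (t0 / (1 - d))) (G _) => x y z x0 z0 h1 h2.
    by have := ler_wpM2r x0 d1; move: (d ^+ 2) h2 => w; lra.
  have tn' : t0 < 0 by rewrite lt_neqAle t0_neq.
  have := edge d dn (or_introl (ltW d0)).
  have y0 : 0 < 1 + d by lra.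
  have tt : t0 < t0 / (1 + d).
    by rewrite ltr_pdivlMr//; have tq : 0 < - t0 * d by [rewrite mulr_gt0// oppr_gt0]; lra.
  rewrite [G (t0, 1 + d)]GK//.
  have := ler_wpM2l (sqr_ge0 (1 + d)) (Klb _ tt).
  have -> : (1 + d) ^+ 2 * (ka * (t0 / (1 + d) - t0)) = (1 + d) * (ka * - t0 * d).
    by field; rewrite gt_eqF.
  have := g_ge0 sG (t0, 1 - d); rewrite ltr0_norm//.
  have : 0 <= ka * - t0 * d by rewrite !mulr_ge0 ?(ltW d0)// oppr_ge0.
  move: (ka * - t0 * d) ((1 + d) ^+ 2 * K (t0 / (1 + d))) (G _) => x y z x0 z0 h1 h2.
  by have := mulr_ge0 x0 (ltW d0); move: (d ^+ 2) h2 => w; lra.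
have {}ka0 : ka = 0.
  by move/eqP: kat; rewrite mulf_eq0 normr_eq0 (negbTE t0_neq) orbF => /eqP.
exists t0; split.
  have Bt : B = - (c * t0) by move: ka0; rewrite /ka; lra.
  by move: P0; rewrite /prof Bt; lra.
move=> t; rewrite /pos_part; have [h|h] := leP (t - t0) 0.
  have tt : t <= t0 by rewrite -subr_le0.
  by rewrite (zero _ tt) expr0n mulr0.
have tt : t0 < t by rewrite -subr_gt0.
by rewrite (KE _ tt) ka0 mul0r add0r.
Qed.

Lemma homogeneous_gsol (s := Num.sqrt (1 - c)) (r := Num.sqrt c) :
  (forall q y, 0 <= y -> G (q, y) = pos_part (r * q - s * y) ^+ 2 / 2) \/
  (forall q y, 0 <= y -> G (q, y) = pos_part (r * q + s * y) ^+ 2 / 2).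
Proof.
have [t0 [ct Kt]] := profile.
have cc : 0 <= 1 - c by case/andP: c01 => _ h; rewrite subr_ge0 ltW.
have r0 : 0 < r by rewrite sqrtr_gt0.
have rr : r ^+ 2 = c by rewrite sqr_sqrtr// ltW.
have key q y : 0 <= y -> G (q, y) = pos_part (r * q - r * t0 * y) ^+ 2 / 2.
  move=> y0; have pM (x k : R) : 0 <= k -> pos_part (k * x) = k * pos_part x.
    by move=> k0; rewrite /pos_part maxr_pMr// mulr0.
  have [yp|yn] := ltP 0 y; last first.
    have -> : y = 0 by apply/eqP; rewrite eq_le yn.
    by rewrite (g_low sG q (lexx 0)) mulr0 subr0 (pM _ _ (ltW r0)) exprMn rr.
  have -> : r * q - r * t0 * y = r * (y * (q / y - t0)) by field; rewrite gt_eqF.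
  by rewrite GK// Kt !pM ?(ltW r0)// !exprMn rr; ring.
have ss : s ^+ 2 = 1 - c by rewrite sqr_sqrtr.
have /eqP : (r * t0) ^+ 2 = s ^+ 2 by rewrite exprMn rr ss.
rewrite eqf_sqr => /orP[/eqP E|/eqP E]; [left|right] => q y y0; rewrite key// E//.
by rewrite mulNr opprK.
Qed.

End HomogeneousSolutions.

(** * Classification of the solutions *)

Section Comparison.
Context {R : realType}.
Implicit Types (u v : R * R -> R) (g : R * R -> R).

(* [quad_leg c sg] is the transform of [quad_sol sg]; P^+ and P^- are the cases
   [sg = Num.sqrt (1 - c)] and [sg = - Num.sqrt (1 - c)]. *)
Definition quad_leg (c sg : R) (z : R * R) : R := pos_part (Num.sqrt c * z.1 - sg * z.2) ^+ 2 / 2.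
Definition quad_sol (sg x y : R) : R := x ^+ 2 / 2 + y ^+ 2 / 2 + sg * (x * y).

Lemma pos_part_mono (x y : R) : x <= y -> pos_part x <= pos_part y.
Proof. by move=> xy; rewrite /pos_part ge_max !le_max xy lexx orbT. Qed.

Lemma quad_leg_anti (c s t : R) (z : R * R) : s <= t -> 0 <= z.2 -> quad_leg c t z <= quad_leg c s z.
Proof.
move=> st z0; rewrite /quad_leg ler_pM2r ?invr_gt0// ler_pXn2r ?nnegrE ?pos_part_ge0//.
by apply: pos_part_mono; rewrite lerD2l lerN2 ler_wpM2r.
Qed.

Section OneSolution.
Variables (c : R) (u : R * R -> R).
Hypotheses (hc : 0 < c < 1) (hu : convex_solution c u).
Let rc0 := sqrtc_gt0 hc.

Lemma sol_le_quad sg x y : (forall q y, 0 <= y -> quad_leg c sg (q, y) <= gof c u (q, y)) ->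
  0 < x -> 0 <= y -> u (x, y) <= quad_sol sg x y.
Proof.
move=> H x0 y0.
apply: (le_of_leg hc hu (v := fun z => quad_sol sg z.1 z.2)
  (lv := fun q y => quad_leg c sg (q, y) - y ^+ 2 / 2) x0 y0) => q.
  rewrite /quad_sol /quad_leg /=; set a := Num.sqrt c * q - sg * y.
  (* Young's inequality: x a <= x a_+ <= x^2 / 2 + a_+^2 / 2. *)
  have h1 : x * a <= x * pos_part a by rewrite ler_pM2l// /pos_part le_max lexx.
  have -> : Num.sqrt c * q * x = x * a + sg * (x * y) by rewrite /a; ring.
  have := sqr_ge0 (x - pos_part a); rewrite sqrrB.
  by move: h1; move: (pos_part a) => p; rewrite mulr2n; lra.
by rewrite lerBlDr -gofE//; exact: H.
Qed.

Lemma sol_ge_quad sg x y : (forall q y, 0 <= y -> gof c u (q, y) <= quad_leg c sg (q, y)) ->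
  0 <= x -> 0 <= y -> quad_sol sg x y <= u (x, y).
Proof.
(* This choice makes rc q the x-derivative of [quad_sol], the case of equality in Young's
   inequality. *)
move=> H x0 y0; pose q := (x + sg * y) / Num.sqrt c.
have rq : Num.sqrt c * q = x + sg * y by rewrite /q mulrC divfK// gt_eqF.
have := H q y y0; rewrite gofE// /quad_leg /= rq addrK /pos_part max_l// => h.
have := leg_ge hc hu q y0 x0; rewrite /legf rq /quad_sol => h'.
by move: h h'; move: (leg c u q y) (u (x, y)) => l w; lra.
Qed.

End OneSolution.

Lemma sol_le_scaled c u v l x y : 0 < c < 1 -> convex_solution c u -> convex_solution c v -> 0 < l ->
  (forall z, gs l (gof c v) z <= gof c u z) -> 0 < x -> 0 <= y ->
  u (x, y) <= l ^+ 2 * v (x / l, y / l).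
Proof.
move=> hc hu hv l0 H x0 y0.
apply: (le_of_leg hc hu (v := fun z => l ^+ 2 * v (z.1 / l, z.2 / l)) (lv := leg c u) x0 y0) => // q /=.
have xl : 0 <= x / l by rewrite divr_ge0// ltW.
have yl : 0 <= y / l by rewrite divr_ge0// ltW.
have := H (q, y); rewrite /gs /= !gofE// => h.
have := ler_wpM2l (sqr_ge0 l) (leg_ge hc hv (q / l) yl xl); rewrite /legf mulrBr.
have -> : l ^+ 2 * (Num.sqrt c * (q / l) * (x / l)) = Num.sqrt c * q * x by field; rewrite gt_eqF.
move: h; rewrite mulrDr.
have -> : l ^+ 2 * ((y / l) ^+ 2 / 2) = y ^+ 2 / 2 by field; rewrite gt_eqF.
by rewrite lerD2r => h h'; exact: le_trans h' h.
Qed.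

Lemma sol_eq_scaled c u v l x y : 0 < c < 1 -> convex_solution c u -> convex_solution c v -> 0 < l ->
  (forall z, gof c u z = gs l (gof c v) z) -> 0 <= x -> 0 <= y ->
  u (x, y) = l ^+ 2 * v (l^-1 * x, l^-1 * y).
Proof.
move=> hc hu hv l0 H x0 y0; have li : 0 < l^-1 by rewrite invr_gt0.
rewrite [l^-1 * x]mulrC [l^-1 * y]mulrC.
have yl : 0 <= y / l by rewrite divr_ge0// ltW.
have [xp|xn] := ltP 0 x; last first.
  have -> : x = 0 by apply/eqP; rewrite eq_le xn.
  by rewrite mul0r (sol_axis2 hu y0) (sol_axis2 hv yl); field; rewrite gt_eqF.
have xl : 0 < x / l by rewrite divr_gt0.
apply/eqP; rewrite eq_le; apply/andP; split.
  by apply: (sol_le_scaled hc hu hv l0) => // z; rewrite H.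
have h : forall z, gs l^-1 (gof c u) z <= gof c v z.
  by move=> z; have -> : gof c u = gs l (gof c v) by [apply/funext]; rewrite gsK.
have := sol_le_scaled hc hv hu li h xl yl; rewrite !invrK !divfK ?gt_eqF// exprVn => h'.
by rewrite -ler_pdivlMl ?exprn_gt0.
Qed.

(** Connectedness of an interval covered by two closed sets: the supremum of the points satisfying P
    belongs to both. Closedness concerns only limits of points x >= a, as the scales must stay away
    from 0. *)
Lemma closed_cover_meet (P Q : R -> Prop) (a b : R) : a <= b ->
  (forall m, (forall e, 0 < e -> exists x, [/\ a <= x, `|x - m| < e & P x]) -> a <= m -> P m) ->
  (forall m, (forall e, 0 < e -> exists x, [/\ a <= x, `|x - m| < e & Q x]) -> a <= m -> Q m) ->
  (forall x, a <= x -> P x \/ Q x) -> P a -> Q b -> exists m, [/\ a <= m, P m & Q m].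
Proof.
move=> ab cP cQ cov Pa Qb.
pose E := [set x | a <= x <= b /\ P x].
have hE : has_sup E.
  by split; [exists a; rewrite /E /= lexx ab|exists b => x [/andP[]]].
pose m := sup E.
have am : a <= m by apply: sup_upper_bound => //; split; rewrite ?lexx.
have mb : m <= b by apply: sup_le_ub; [have [] := hE|move=> x [/andP[]]].
have Pm : P m.
  apply: cP => // e e0; have [x [/andP[x1 x2] Px] mx] := sup_adherent e0 hE.
  exists x; split => //; have xm : x <= m by apply: sup_upper_bound => //; split; rewrite ?x1.
  by rewrite distrC ger0_norm ?subr_ge0//; move: mx; rewrite -/m; lra.
exists m; split => //; have [<-//|mb'] := eqVneq b m.
have mb'' : m < b by rewrite lt_neqAle eq_sym mb' mb.
apply: cQ => // e e0; pose x := Num.min (m + e / 2) b.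
have mx : m < x by rewrite lt_min mb'' andbT ltrDl divr_gt0.
have xb : x <= b by rewrite ge_min lexx orbT.
have xe : x <= m + e / 2 by rewrite ge_min lexx.
have ax : a <= x by apply: le_trans am (ltW mx).
exists x; split => //; first by rewrite ger0_norm ?subr_ge0 ?(ltW mx)//; lra.
have [Px|//] := cov x ax.
have : x <= m by apply: sup_upper_bound => //; split; rewrite ?ax.
by rewrite leNgt mx.
Qed.

(** The maximum with [a] keeps the scale away from 0, where division by it is not continuous. *)
Lemma cont_gs_scale g (a : R) z : 0 < a -> continuous g -> continuous (fun l => gs (Num.max l a) g z).
Proof.
move=> a0 cg; have cm : continuous (fun l => Num.max l a).
  by move=> l; apply: continuous_max; [exact: cvg_id|exact: cvg_cst].
have ci : continuous (fun l => (Num.max l a)^-1).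
  by apply: contV => // l; rewrite gt_eqF// lt_max a0 orbT.
apply: contM; first exact: contX.
by apply: cont2 => //; apply: contM => //; exact: contC.
Qed.

Lemma crossing c g gu : gsol c g -> gsol c gu ->
  (exists2 l, 0 < l & forall z, gs l g z <= gu z) ->
  (exists2 l, 0 < l & forall z, gu z <= gs l g z) ->
  exists2 l, 0 < l & forall z, gu z = gs l g z.
Proof.
move=> sg su [l1 l10 h1] [l2 l20 h2].
have closed_le (a m : R) : 0 < a -> a <= m ->
    (forall e, 0 < e -> exists x, [/\ a <= x, `|x - m| < e & forall z, gs x g z <= gu z]) ->
    forall z, gs m g z <= gu z.
  move=> a0 am H z; rewrite leNgt; apply/negP; rewrite -subr_gt0 => h.
  have [d d0 Hd] := (cont1P _).1 (cont_gs_scale (z := z) a0 (g_cont sg)) m _ h.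
  have [x [ax xm hx]] := H d d0; have := Hd x xm; rewrite !max_l// ltr_norml => /andP[+ _].
  by have := hx z; lra.
have closed_ge (a m : R) : 0 < a -> a <= m ->
    (forall e, 0 < e -> exists x, [/\ a <= x, `|x - m| < e & forall z, gu z <= gs x g z]) ->
    forall z, gu z <= gs m g z.
  move=> a0 am H z; rewrite leNgt; apply/negP; rewrite -subr_gt0 => h.
  have [d d0 Hd] := (cont1P _).1 (cont_gs_scale (z := z) a0 (g_cont sg)) m _ h.
  have [x [ax xm hx]] := H d d0; have := Hd x xm; rewrite !max_l// ltr_norml => /andP[_].
  by have := hx z; lra.
have cov l : 0 < l -> (forall z, gs l g z <= gu z) \/ (forall z, gu z <= gs l g z).
  by move=> l0; exact: ordering (gsol_gs l0 sg) su.
have done_ (m : R) : 0 < m -> (forall z, gs m g z <= gu z) -> (forall z, gu z <= gs m g z) ->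
    exists2 l, 0 < l & forall z, gu z = gs l g z.
  by move=> m0 a b; exists m => // z; apply/eqP; rewrite eq_le a b.
have [l12|l21] := leP l1 l2.
  have [||x xl|m [lm Pm Qm]] := @closed_cover_meet (fun l => forall z, gs l g z <= gu z)
    (fun l => forall z, gu z <= gs l g z) l1 l2 l12 _ _ _ h1 h2.
  - by move=> m H lm; exact: closed_le l10 lm H.
  - by move=> m H lm; exact: closed_ge l10 lm H.
  - by apply: cov; exact: lt_le_trans xl.
  - exact: done_ (lt_le_trans l10 lm) Pm Qm.
have [||x xl|m [lm Pm Qm]] := @closed_cover_meet (fun l => forall z, gu z <= gs l g z)
  (fun l => forall z, gs l g z <= gu z) l2 l1 (ltW l21) _ _ _ h2 h1.
- by move=> m H lm; exact: closed_ge l20 lm H.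
- by move=> m H lm; exact: closed_le l20 lm H.
- by case: (cov x (lt_le_trans l20 xl)); [right|left].
- exact: done_ (lt_le_trans l20 lm) Qm Pm.
Qed.

Lemma crossing_cases c g gu : gsol c g -> gsol c gu ->
  [\/ exists2 l, 0 < l & forall z, gu z = gs l g z,
      forall l z, 0 < l -> gs l g z <= gu z | forall l z, 0 < l -> gu z <= gs l g z].
Proof.
move=> sg su.
have [h1|n1] := pselect (exists2 l, 0 < l & forall z, gs l g z <= gu z); last first.
  apply: Or33 => l z l0; have [h|//] := ordering (gsol_gs l0 sg) su.
  by exfalso; apply: n1; exists l.
have [h2|n2] := pselect (exists2 l, 0 < l & forall z, gu z <= gs l g z); last first.
  apply: Or32 => l z l0; have [//|h] := ordering (gsol_gs l0 sg) su.
  by exfalso; apply: n2; exists l.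
by apply: Or31; exact: crossing sg su h1 h2.
Qed.

Lemma homogeneous_cases c G : 0 < c < 1 -> gsol c G -> homogeneous G ->
  exists2 sg, sg = Num.sqrt (1 - c) \/ sg = - Num.sqrt (1 - c) &
    forall q y, 0 <= y -> G (q, y) = quad_leg c sg (q, y).
Proof.
move=> hc sG hG; have [h|h] := homogeneous_gsol hc sG hG.
  by exists (Num.sqrt (1 - c)); [left|move=> q y y0; rewrite h].
by exists (- Num.sqrt (1 - c)); [right|move=> q y y0; rewrite h// /quad_leg /= mulNr opprK].
Qed.

Lemma P_plusE c x y : P_plus c (x, y) = quad_sol (Num.sqrt (1 - c)) x y.
Proof. by []. Qed.

Lemma P_minusE c x y : P_minus c (x, y) = quad_sol (- Num.sqrt (1 - c)) x y.
Proof. by rewrite /P_minus /quad_sol /= mulNr. Qed.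

Lemma sol_eq_quad c u sg : 0 < c < 1 -> convex_solution c u ->
  (forall q y, 0 <= y -> gof c u (q, y) = quad_leg c sg (q, y)) ->
  forall x y, 0 <= x -> 0 <= y -> u (x, y) = quad_sol sg x y.
Proof.
move=> hc hu H x y x0 y0; apply/eqP; rewrite eq_le; apply/andP; split; last first.
  by apply: (sol_ge_quad hc hu) => // q t t0; rewrite H.
have [xp|xn] := ltP 0 x.
  by apply: (sol_le_quad hc hu) => // q t t0; rewrite H.
have -> : x = 0 by apply/eqP; rewrite eq_le xn.
by rewrite (sol_axis2 hu y0) /quad_sol mul0r mulr0 addr0 expr0n mul0r add0r.
Qed.

End Comparison.

(** * Comparison with the rescalings of the two particular solutions *)

Section Classification.
Context {R : realType}.
Variables (c : R) (Pbar Punder u : R * R -> R).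
Hypotheses (hc : 0 < c < 1) (hPbar : is_P_bar c Pbar) (hPunder : is_P_underline c Punder).
Hypothesis hu : convex_solution c u.

Let s := Num.sqrt (1 - c).
Let s0 : 0 <= s. Proof. exact: sqrtr_ge0. Qed.
Let ss : - s <= s. Proof. by rewrite (le_trans _ s0)// oppr_le0. Qed.
Let su := gsol_gof hc hu.
Let sb := gsol_gof hc (P_bar_sol hPbar).
Let sn := gsol_gof hc (P_underline_sol hPunder).

Let one_quadrant : quadrant ((1, 1) : R * R). Proof. by split => /=. Qed.

Let bar_not_above : ~ (forall q y, 0 <= y -> quad_leg c (- s) (q, y) <= gof c Pbar (q, y)).
Proof.
move=> H; have := sol_le_quad hc (P_bar_sol hPbar) H ltr01 ler01.
have /andP[] := P_bar_between hPbar one_quadrant.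
by rewrite P_minusE => h _; rewrite leNgt h.
Qed.

Let bar_not_below : ~ (forall q y, 0 <= y -> gof c Pbar (q, y) <= quad_leg c s (q, y)).
Proof.
move=> H; have := sol_ge_quad hc (P_bar_sol hPbar) H ler01 ler01.
have /andP[_] := P_bar_between hPbar one_quadrant.
by rewrite P_plusE => h; rewrite leNgt h.
Qed.

Let under_not_below : ~ (forall q y, 0 <= y -> gof c Punder (q, y) <= quad_leg c (- s) (q, y)).
Proof.
move=> H; have := sol_ge_quad hc (P_underline_sol hPunder) H ler01 ler01.
have := P_underline_below hPunder one_quadrant.
by rewrite P_minusE => h; rewrite leNgt h.
Qed.

Let gs1E g (z : R * R) : gs 1 g z = g z. Proof. by rewrite gs1. Qed.

(** Two homogeneous infima enclose the transform of [u]. That of the rescalings of [Pbar] cannot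
    come from P^-, or [Pbar] would lie below P^-; that of the rescalings of [u] itself is at least
    the smaller of the two possible transforms, the one of P^+. *)
Let all_ge_bar : (forall l z, 0 < l -> gof c u z <= gs l (gof c Pbar) z) ->
  forall q y, 0 <= y -> gof c u (q, y) = quad_leg c s (q, y).
Proof.
move=> H q y y0; apply/eqP; rewrite eq_le; apply/andP; split.
  have [G [sG hG Gle Gglb]] := inf_scaling sb.
  apply: le_trans (Gglb _ H (q, y)) _.
  have [sg [->|E] HG] := homogeneous_cases hc sG hG; first by rewrite HG.
  exfalso; apply: bar_not_above => q' y' y0'.
  by rewrite /s -E -HG// -[leRHS]gs1E Gle.
have [G [sG hG Gle _]] := inf_scaling su.
rewrite -[leRHS]gs1E; apply: le_trans (Gle 1 (q, y) ltr01).
have [sg E HG] := homogeneous_cases hc sG hG; rewrite HG//.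
by apply: quad_leg_anti => //; case: E => ->.
Qed.

Let all_le_bar : (forall l z, 0 < l -> gs l (gof c Pbar) z <= gof c u z) ->
  forall q y, 0 <= y -> quad_leg c (- s) (q, y) <= gof c u (q, y).
Proof.
move=> H q y y0; have [G [sG hG Gge Gle]] := sup_scaling sb su H.
apply: le_trans (Gle (q, y)).
have [sg [E|->] HG] := homogeneous_cases hc sG hG; last by rewrite HG.
exfalso; apply: bar_not_below => q' y' y0'.
by rewrite /s -E -HG.
Qed.

Let all_ge_under : (forall l z, 0 < l -> gof c u z <= gs l (gof c Punder) z) ->
  forall q y, 0 <= y -> gof c u (q, y) <= quad_leg c (- s) (q, y).
Proof.
move=> H q y y0; have [G [sG hG Gle Gglb]] := inf_scaling sn.
apply: le_trans (Gglb _ H (q, y)) _.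
have [sg E HG] := homogeneous_cases hc sG hG; rewrite HG//.
by apply: quad_leg_anti => //; case: E => ->.
Qed.

(** The transform of [u] would bound the rescalings of [Punder]. Their supremum, being homogeneous,
    is at most the transform of P^-, which would put [Punder] above P^-. *)
Let not_all_le_under : ~ (forall l z, 0 < l -> gs l (gof c Punder) z <= gof c u z).
Proof.
move=> H; have [G [sG hG Gge Gle]] := sup_scaling sn su H.
apply: under_not_below => q y y0; apply: le_trans (Gge (q, y)) _.
have [sg E HG] := homogeneous_cases hc sG hG; rewrite HG//.
by apply: quad_leg_anti => //; case: E => ->.
Qed.

Lemma solution_cases :
  [\/ forall x y, 0 <= x -> 0 <= y -> u (x, y) = P_plus c (x, y),
      forall x y, 0 <= x -> 0 <= y -> u (x, y) = P_minus c (x, y),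
      exists2 l, 0 < l & forall x y, 0 <= x -> 0 <= y -> u (x, y) = l ^+ 2 * Pbar (l^-1 * x, l^-1 * y)
    | exists2 l, 0 < l & forall x y, 0 <= x -> 0 <= y -> u (x, y) = l ^+ 2 * Punder (l^-1 * x, l^-1 * y)].
Proof.
have [[l l0 H]|H|H] := crossing_cases sb su.
- apply: Or43; exists l => // x y x0 y0; exact: sol_eq_scaled hc hu (P_bar_sol hPbar) l0 H x0 y0.
- have h1 := all_le_bar H; have [[l l0 H']|H'|H'] := crossing_cases sn su.
  + apply: Or44; exists l => // x y x0 y0.
    exact: sol_eq_scaled hc hu (P_underline_sol hPunder) l0 H' x0 y0.
  + by exfalso; exact: not_all_le_under H'.
  + have h2 := all_ge_under H'; apply: Or42 => x y x0 y0; rewrite P_minusE.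
    apply: (sol_eq_quad hc hu) => // q t t0; apply/eqP; rewrite eq_le h2//; exact: h1.
- apply: Or41 => x y x0 y0; rewrite P_plusE.
  by apply: (sol_eq_quad hc hu) => // q t t0; exact: all_ge_bar.
Qed.

End Classification.

Theorem proposition4p6 (R : realType) (c : R) (Pbar Punder u : R * R -> R)
    (hc : 0 < c < 1)
    (hPbar : is_P_bar c Pbar) (hPunder : is_P_underline c Punder)
    (hu : convex_solution c u) :
  [\/ {in closure quadrant, forall x, u x = P_plus c x},
      {in closure quadrant, forall x, u x = P_minus c x},
      exists lambda : R, 0 < lambda /\
        {in closure quadrant, forall x,
           u x = lambda ^+ 2 * Pbar (lambda^-1 *: x)}
    | exists lambda : R, 0 < lambda /\
        {in closure quadrant, forall x,
           u x = lambda ^+ 2 * Punder (lambda^-1 *: x)}].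
Proof.
have [H|H|[l l0 H]|[l l0 H]] := solution_cases hc hPbar hPunder hu.
- by apply: Or41 => -[x y] /set_mem/closure_quadrant[x0 y0]; exact: H.
- by apply: Or42 => -[x y] /set_mem/closure_quadrant[x0 y0]; exact: H.
- by apply: Or43; exists l; split=> // -[x y] /set_mem/closure_quadrant[x0 y0]; exact: H.
- by apply: Or44; exists l; split=> // -[x y] /set_mem/closure_quadrant[x0 y0]; exact: H.
Qed.
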